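(* Let $n\geq 1$, $m\geq 1$, $k\geq 0$ be integers such that $m$ and $n$ have no common factors, and let $$P(z)=z^{n}-\frac{2n}{n-m}z^{n-m}+\frac{n}{n-2m}z^{n-2m}+c,$$ where $c$ is a complex number with $|c|\neq\frac{2m^2}{(n-m)(n-2m)}$, $c\neq 0$ and $c\neq-\frac{1}{2}\left(1-\frac{2n}{n-m}+\frac{n}{n-2m}\right)$. Let $S=\{z: P(z)=0\}$. Let $f$ and $g$ be two non-constant meromorphic functions on $\mathbb{C}$ with $E_{f^{(k)}}(S,l)=E_{g^{(k)}}(S,l)$. If one of the following holds: (1) $l\geq 2$ and $n>\max\{2m+4+\frac{4}{k+1},\,4m+1\}$; (2) $l=1$ and $n>\max\{2m+4.5+\frac{4.5}{k+1},\,4m+1\}$; (3) $l=0$ and $n>\max\{2m+7+\frac{7}{k+1},\,4m+1\}$, then $f^{(k)}\equiv g^{(k)}$.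
   Context: For a non-constant meromorphic function $h$, $a\in\mathbb{C}\cup\{\infty\}$ and $k$ a nonnegative integer or $\infty$, $E_k(a;h)$ denotes the set of all $a$-points of $h$, where an $a$-point of multiplicity $p$ is counted $p$ times if $p\leq k$ and $k+1$ times if $p>k$. For a set $S\subset\mathbb{C}\cup\{\infty\}$ of distinct elements, $E_h(S,k)=\bigcup_{a\in S}E_k(a;h)$. The condition $E_f(S,k)=E_g(S,k)$ means $f,g$ share $S$ with weight $k$ (weight $0$ = ignoring multiplicities, weight $\infty$ = counting multiplicities). $f^{(k)}$ denotes the $k$-th derivative ($f^{(0)}=f$). *)

(* Defs.v *)
From Stdlib Require Import Reals ClassicalEpsilon.
From Coquelicot Require Import Coquelicot.

Open Scope R_scope.

Definition Cis_deriv (f : C -> C) (z l : C) : Prop :=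
  is_derive (K := C_AbsRing) (V := C_NormedModule) f z l.

Definition holo_at (f : C -> C) (z : C) : Prop :=
  exists eps : R, 0 < eps /\
    forall w : C, Cmod (w - z)%C < eps -> exists l : C, Cis_deriv f w l.

(* f is meromorphic on C: holomorphic off a closed discrete set D of
   poles, and |f(w)| -> +oo as w -> z for every z in D.
   (Values of f at poles are irrelevant junk.) *)
Definition meromorphic (f : C -> C) : Prop :=
  exists D : C -> Prop,
    (forall z : C, exists eps : R, 0 < eps /\
        forall w : C, Cmod (w - z)%C < eps -> D w -> w = z) /\
    (forall z : C, ~ D z -> exists l : C, Cis_deriv f z l) /\
    (forall z : C, D z ->
        forall M : R, exists eps : R, 0 < eps /\
          forall w : C, w <> z -> Cmod (w - z)%C < eps -> M < Cmod (f w)).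

(* the complex derivative as a total function (junk where it does not exist) *)
Definition Cderive (f : C -> C) (z : C) : C :=
  epsilon (inhabits (RtoC 0)) (fun l => Cis_deriv f z l).

Definition Cderive_n (k : nat) (f : C -> C) : C -> C :=
  Nat.iter k Cderive f.

(* non-constant as a meromorphic function (values at poles ignored) *)
Definition nonconstant (f : C -> C) : Prop :=
  ~ (exists c : C, forall z : C, holo_at f z -> f z = c).

Definition a_point_mult (h : C -> C) (a z : C) (p : nat) : Prop :=
  (1 <= p)%nat /\ holo_at h z /\ h z = a /\
  exists g : C -> C, holo_at g z /\ g z <> RtoC 0 /\
    exists eps : R, 0 < eps /\
      forall w : C, Cmod (w - z)%C < eps -> (h w - a = (w - z) ^ p * g w)%C.

(* weights: None = infinity, Some l = l *)
Definition weight_count (l : option nat) (p : nat) : nat :=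
  match l with None => p | Some l0 => Nat.min p (S l0) end.

(* z occurs in E_h(S,l) with count q (q >= 1); points with no such q have count 0 *)
Definition E_pt (h : C -> C) (S : C -> Prop) (l : option nat) (z : C) (q : nat) : Prop :=
  exists a p, S a /\ a_point_mult h a z p /\ q = weight_count l p.

Definition share_set (f g : C -> C) (S : C -> Prop) (l : option nat) : Prop :=
  forall z q, E_pt f S l z q <-> E_pt g S l z q.

Definition Ppoly (n m : nat) (c z : C) : C :=
  (z ^ n - RtoC (2 * INR n / (INR n - INR m)) * z ^ (n - m)
   + RtoC (INR n / (INR n - 2 * INR m)) * z ^ (n - 2 * m) + c)%C.

Definition weight_ge (l : option nat) (j : nat) : Prop :=
  match l with None => True | Some l0 => (j <= l0)%nat end.

(* Main.v *)
(* Write u = f^(k), v = g^(k), U = P(u), V = P(v).  With the characteristic T = mean of ln(1 + |f|) over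
   |z| = r plus the counting function of the poles, Jensen's formula gives the first main theorem, and the
   lemma on the logarithmic derivative holds on an unbounded set of radii.  Put W = (1/U)' / (1/V)' and
   suppose first that W is not constant, with H = W'/W.  At every point the orders of H, of u'/R(u) and
   v'/R(v), where R(w) = P(w) w (w^m - 1), and of u'/u and v'/v satisfy a linear inequality against the
   zeros of U, V, u, v, u^m - 1, v^m - 1 and the poles of u, v; this uses the sharing hypothesis and the
   fact that H vanishes at common simple zeros of U and V.  Summed over the disc it contradicts the lower
   bound on n.  If W is constant, then 1/U = A/V + B, and a second main theorem for F(u), with
   F = P - const, excludes everything but U = V.  Finally, if u <> v and U = V, the discriminant of a
   quadratic equation for v^m shows that a polynomial psi in h = u/v is a constant times a square, against
   the second main theorem for psi(h). *)
Require Import Defs.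
From Stdlib Require Import Reals Lra Lia Psatz ZArith List ClassicalEpsilon Classical Permutation.
From Coquelicot Require Import Coquelicot.
Import ListNotations.
Open Scope R_scope.

(** * Complex differentiability *)

(** Integration is only over rectangles: the exponential turns an annulus into one, which yields
    mean values, Cauchy's formula and local factorisations. The second main theorem rests on one
    pointwise inequality: if F has degree q and E, of degree e, absorbs the multiple roots of F,
    then |E(w)| (1 + |w|)^(q-e-1) <= A (|F(w)/w| + |F'(w)|). So u' E(u) / F(u) is controlled by
    logarithmic derivatives, and Jensen's formula counts its orders. Poles of f^(k) have order at
    least k + 1, whence the terms with 1/(k+1). In the main inequality u'/u and v'/v enter with
    weight theta = 0, 1/4, 3/2 for l >= 2, l = 1, l = 0: they pay for common zeros of U and V of
    different multiplicities, and the bound on n becomes 2m + (4 + 2 theta)(1 + 1/(k+1)). The bound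
    n > 4m + 1 gives 2m/n < 1/2, which settles the case 1/U = A/V + B with B <> 0. *)

Definition near (z : C) (P : C -> Prop) : Prop :=
  exists eps, 0 < eps /\ forall w, Cmod (w - z)%C < eps -> P w.
Definition pnear (z : C) (P : C -> Prop) : Prop :=
  exists eps, 0 < eps /\ forall w, w <> z -> Cmod (w - z)%C < eps -> P w.
Lemma near_and z P Q : near z P -> near z Q -> near z (fun w => P w /\ Q w).
Proof.
  intros [e [He H]] [d [Hd K]]; exists (Rmin e d); split.
  - now apply Rmin_glb_lt.
  - intros w Hw; split; [apply H | apply K]; eapply Rlt_le_trans; eauto;
      [apply Rmin_l | apply Rmin_r].
Qed.
Lemma pnear_and z P Q : pnear z P -> pnear z Q -> pnear z (fun w => P w /\ Q w).
Proof.
  intros [e [He H]] [d [Hd K]]; exists (Rmin e d); split.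
  - now apply Rmin_glb_lt.
  - intros w Hn Hw; split; [apply H | apply K]; auto; eapply Rlt_le_trans; eauto;
      [apply Rmin_l | apply Rmin_r].
Qed.
Lemma near_imp z (P Q : C -> Prop) : (forall w, P w -> Q w) -> near z P -> near z Q.
Proof. intros H [e [He K]]; exists e; split; auto. Qed.
Lemma pnear_imp z (P Q : C -> Prop) :
  (forall w, w <> z -> P w -> Q w) -> pnear z P -> pnear z Q.
Proof. intros H [e [He K]]; exists e; split; auto. Qed.
Lemma near_pnear z P : near z P -> pnear z P.
Proof. intros [e [He K]]; exists e; split; auto. Qed.
Lemma near_all z (P : C -> Prop) : (forall w, P w) -> near z P.
Proof. intros H; exists 1; split; auto; lra. Qed.
Lemma Cmod_pos (z : C) : z <> RtoC 0 -> 0 < Cmod z.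
Proof. intros H; apply Cmod_gt_0; exact H. Qed.
Lemma Cmod_pos_neq (z : C) : 0 < Cmod z -> z <> RtoC 0.
Proof. intros H; apply Cmod_gt_0; exact H. Qed.
Lemma Cmod_self z : Cmod (z - z)%C = 0.
Proof. replace (z - z)%C with (RtoC 0) by ring; apply Cmod_0. Qed.
Lemma near_pt z (P : C -> Prop) : near z P -> P z.
Proof. intros [e [He K]]; apply K; now rewrite Cmod_self. Qed.
Lemma Cmod_sym w z : Cmod (w - z)%C = Cmod (z - w)%C.
Proof. rewrite <- Cmod_opp; f_equal; ring. Qed.
Lemma Cmod_tri3 x y z : Cmod (x - z)%C <= Cmod (x - y)%C + Cmod (y - z)%C.
Proof. replace (x - z)%C with ((x - y) + (y - z))%C by ring; apply Cmod_triangle. Qed.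
Lemma Cmod_tri_sub x y : Cmod x - Cmod y <= Cmod (x - y)%C.
Proof.
  assert (H := Cmod_triangle (x - y)%C y).
  replace (x - y + y)%C with x in H by ring; lra.
Qed.
Lemma Cmod_tri_minus x y : Cmod (x - y)%C <= Cmod x + Cmod y.
Proof.
  unfold Cminus; assert (H := Cmod_triangle x (- y)%C); rewrite Cmod_opp in H; lra.
Qed.
Lemma near_near z (P : C -> Prop) : near z P -> near z (fun w => near w P).
Proof.
  intros [e [He K]]; exists e; split; auto; intros w Hw.
  exists (e - Cmod (w - z)%C); split; [lra|]; intros x Hx; apply K.
  assert (T := Cmod_tri3 x w z); lra.
Qed.
(** Needed to differentiate identities that hold off [z] only: at each [w] the identity must hold
    near [w]. *)
Lemma pnear_near z (P : C -> Prop) : pnear z P -> pnear z (fun w => near w P).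
Proof.
  intros [e [He K]]; exists e; split; auto; intros w Hn Hw.
  assert (Hp : 0 < Cmod (w - z)%C).
  { apply Cmod_gt_0; intro E; apply Hn.
    replace w with ((w - z) + z)%C by ring; rewrite E; ring. }
  exists (Rmin (e - Cmod (w - z)%C) (Cmod (w - z)%C)); split.
  - apply Rmin_glb_lt; lra.
  - intros x Hx.
    assert (H1 := Rlt_le_trans _ _ _ Hx (Rmin_l _ _)).
    assert (H2 := Rlt_le_trans _ _ _ Hx (Rmin_r _ _)).
    apply K.
    + intros ->; rewrite Cmod_sym in H2; lra.
    + assert (T := Cmod_tri3 x w z); lra.
Qed.
Lemma near_of_pnear z (P : C -> Prop) : P z -> pnear z P -> near z P.
Proof.
  intros Hz [e [He K]]; exists e; split; auto; intros w Hw.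
  destruct (excluded_middle_informative (w = z)) as [->|]; auto.
Qed.
Lemma pnear_ex z (P : C -> Prop) eps : 0 < eps -> pnear z P ->
  exists w, w <> z /\ Cmod (w - z)%C < eps /\ P w.
Proof.
  intros Hp [e [He K]].
  set (d := Rmin e eps / 2).
  assert (Hm : 0 < Rmin e eps) by now apply Rmin_glb_lt.
  assert (L1 := Rmin_l e eps); assert (L2 := Rmin_r e eps).
  assert (Hd : Cmod (z + RtoC d - z)%C = d).
  { replace (z + RtoC d - z)%C with (RtoC d) by ring.
    rewrite Cmod_R, Rabs_pos_eq; unfold d; lra. }
  exists (z + RtoC d)%C; repeat split.
  - intro E; rewrite E, Cmod_self in Hd; unfold d in Hd; lra.
  - rewrite Hd; unfold d; lra.
  - apply K; [|rewrite Hd; unfold d; lra].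
    intro E; rewrite E, Cmod_self in Hd; unfold d in Hd; lra.
Qed.
Lemma near_ball z r w : Cmod (w - z)%C < r -> near w (fun x => Cmod (x - z)%C < r).
Proof.
  intro H; exists (r - Cmod (w - z)%C); split; [lra|]; intros x Hx.
  assert (T := Cmod_tri3 x w z); lra.
Qed.
Lemma near_lt r w : Cmod w < r -> near w (fun x => Cmod x < r).
Proof.
  intro H; replace w with (w - 0)%C in H by ring.
  apply near_ball in H; revert H; apply near_imp; intros x Hx.
  replace x with (x - 0)%C by ring; exact Hx.
Qed.
Lemma near_neq z a : z <> a -> near z (fun w => w <> a).
Proof.
  intro H; exists (Cmod (z - a)%C); split.
  - apply Cmod_gt_0; intro E; apply H; replace z with ((z - a) + a)%C by ring; rewrite E; ring.
  - intros w Hw ->; rewrite Cmod_sym in Hw; lra.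
Qed.
Lemma Csub_neq z a : z <> a -> (z - a)%C <> RtoC 0.
Proof. intros H E; apply H; replace z with ((z - a) + a)%C by ring; rewrite E; ring. Qed.
Lemma Cmult_integral (a b : C) : (a * b)%C = RtoC 0 -> a = RtoC 0 \/ b = RtoC 0.
Proof.
  intros H; destruct (excluded_middle_informative (a = RtoC 0)) as [|n]; auto; right.
  apply NNPP; intro n2; now apply (Cmult_neq_0 a b n n2).
Qed.
Lemma Csub_eq z a : (z - a)%C = RtoC 0 -> z = a.
Proof. intros E; replace z with ((z - a) + a)%C by ring; rewrite E; ring. Qed.
(** A remainder bound instead of a difference quotient: nothing is divided, and w = z needs no
    exception. *)
Definition D (f : C -> C) (z l : C) : Prop :=
  forall eps, 0 < eps ->
  near z (fun w => Cmod (f w - f z - (w - z) * l)%C <= eps * Cmod (w - z)%C).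
Lemma Cis_deriv_D f z l : Cis_deriv f z l <-> D f z l.
Proof.
  unfold Cis_deriv; split.
  - intros [_ H] eps Heps.
    specialize (H z (fun P HP => HP) (mkposreal eps Heps)).
    destruct H as [d Hd]; exists d; split; [apply cond_pos|].
    intros w Hw; specialize (Hd w Hw).
    exact Hd.
  - intros H; split.
    + apply (is_linear_scal_l (K := C_AbsRing) (V := C_NormedModule) l).
    + intros x Hx.
      apply (is_filter_lim_locally_unique (V := AbsRing_NormedModule C_AbsRing)) in Hx; subst x.
      intros eps; destruct (H eps (cond_pos eps)) as [d [Hd K]].
      exists (mkposreal d Hd); intros w Hw; apply (K w Hw).
Qed.
Lemma D_ext f g z l : near z (fun w => f w = g w) -> D f z l -> D g z l.
Proof.
  intros He H eps Heps.
  assert (E := near_pt _ _ He); simpl in E.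
  generalize (near_and _ _ _ He (H eps Heps)); apply near_imp.
  intros w [E1 E2]; rewrite <- E, <- E1; exact E2.
Qed.
Lemma D_bound f z l : D f z l ->
  near z (fun w => Cmod (f w - f z)%C <= (Cmod l + 1) * Cmod (w - z)%C).
Proof.
  intros H; generalize (H 1 Rlt_0_1); apply near_imp; intros w Hw.
  assert (T := Cmod_triangle (f w - f z - (w - z) * l)%C ((w - z) * l)%C).
  replace (f w - f z - (w - z) * l + (w - z) * l)%C with (f w - f z)%C in T by ring.
  rewrite Cmod_mult in T; lra.
Qed.
Definition ccont (f : C -> C) (z : C) : Prop :=
  forall eps, 0 < eps -> near z (fun w => Cmod (f w - f z)%C < eps).
Lemma near_dist z k e : 0 <= k -> 0 < e -> near z (fun w => k * Cmod (w - z)%C < e).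
Proof.
  intros Hk He; exists (e / (k + 1)); split; [apply Rdiv_lt_0_compat; lra|].
  intros w Hw; assert (Hc := Cmod_ge_0 (w - z)%C).
  apply Rle_lt_trans with ((k + 1) * Cmod (w - z)%C); [nra|].
  apply Rmult_lt_reg_l with (/ (k + 1)); [apply Rinv_0_lt_compat; lra|].
  rewrite <- Rmult_assoc, Rinv_l, Rmult_1_l by lra.
  unfold Rdiv in Hw; lra.
Qed.
Lemma D_cont f z l : D f z l -> ccont f z.
Proof.
  intros H eps He.
  generalize (near_and _ _ _ (D_bound _ _ _ H)
    (near_dist z (Cmod l + 1) eps ltac:(generalize (Cmod_ge_0 l); lra) He)).
  apply near_imp; intros w [H1 H2]; lra.
Qed.
Lemma D_const (c z : C) : D (fun _ => c) z 0.
Proof.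
  intros e He; apply near_all; intros w.
  replace (c - c - (w - z) * 0)%C with (RtoC 0) by ring.
  rewrite Cmod_0; apply Rmult_le_pos; [lra | apply Cmod_ge_0].
Qed.
Lemma D_id z : D (fun w => w) z 1.
Proof.
  intros e He; apply near_all; intros w.
  replace (w - z - (w - z) * 1)%C with (RtoC 0) by ring.
  rewrite Cmod_0; apply Rmult_le_pos; [lra | apply Cmod_ge_0].
Qed.
Lemma D_plus f g z l m : D f z l -> D g z m -> D (fun w => f w + g w)%C z (l + m).
Proof.
  intros H K e He.
  generalize (near_and _ _ _ (H (e/2) ltac:(lra)) (K (e/2) ltac:(lra))); apply near_imp.
  intros w [H1 H2].
  replace (f w + g w - (f z + g z) - (w - z) * (l + m))%C with
    ((f w - f z - (w - z) * l) + (g w - g z - (w - z) * m))%C by ring.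
  eapply Rle_trans; [apply Cmod_triangle | lra].
Qed.
Lemma D_comp f g z l m : D g z l -> D f (g z) m -> D (fun w => f (g w)) z (l * m).
Proof.
  intros Hg Hf e He.
  set (k := Cmod l + 1).
  assert (Hk : 0 < k) by (unfold k; generalize (Cmod_ge_0 l); lra).
  assert (Hm := Cmod_ge_0 m).
  set (e1 := e / (2 * k)).
  assert (He1 : 0 < e1) by (unfold e1; apply Rdiv_lt_0_compat; lra).
  set (e2 := e / (2 * (Cmod m + 1))).
  assert (He2 : 0 < e2) by (unfold e2; apply Rdiv_lt_0_compat; lra).
  destruct (Hf e1 He1) as [d [Hd Kd]].
  generalize (near_and _ _ _ (near_and _ _ _ (Hg e2 He2) (D_bound _ _ _ Hg))
     (D_cont _ _ _ Hg d Hd)); apply near_imp; intros w [[H1 H2] H3].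
  specialize (Kd _ H3).
  replace (f (g w) - f (g z) - (w - z) * (l * m))%C with
   ((f (g w) - f (g z) - (g w - g z) * m) + (g w - g z - (w - z) * l) * m)%C by ring.
  eapply Rle_trans; [apply Cmod_triangle|]; rewrite Cmod_mult.
  fold k in H2.
  assert (Hw := Cmod_ge_0 (w - z)%C).
  apply Rle_trans with (e1 * (k * Cmod (w - z)%C) + e2 * Cmod (w - z)%C * Cmod m).
  - apply Rplus_le_compat.
    + eapply Rle_trans; [apply Kd|]; apply Rmult_le_compat_l; lra.
    + apply Rmult_le_compat_r; lra.
  - replace (e1 * (k * Cmod (w - z)%C)) with (e / 2 * Cmod (w - z)%C)
      by (unfold e1; field; lra).
    assert (e2 * Cmod m <= e / 2).
    { unfold e2; apply Rle_trans with (e / (2 * (Cmod m + 1)) * (Cmod m + 1)).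
      - apply Rmult_le_compat_l; [fold e2; lra | lra].
      - right; field; lra. }
    nra.
Qed.
Lemma D_scal c f z l : D f z l -> D (fun w => c * f w)%C z (c * l).
Proof.
  intros H; assert (K : D (fun w => c * w)%C (f z) c).
  { intros e He; apply near_all; intros w.
    replace (c * w - c * f z - (w - f z) * c)%C with (RtoC 0) by ring.
    rewrite Cmod_0; apply Rmult_le_pos; [lra | apply Cmod_ge_0]. }
  rewrite Cmult_comm; exact (D_comp (fun w => c * w)%C f z l c H K).
Qed.
Lemma D_sq z : D (fun w => w * w)%C z (2 * z).
Proof.
  intros e He; exists e; split; auto; intros w Hw.
  replace (w * w - z * z - (w - z) * (2 * z))%C with ((w - z) * (w - z))%C by ring.
  rewrite Cmod_mult; apply Rmult_le_compat_r; [apply Cmod_ge_0 | lra].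
Qed.
Lemma D_eq f z (l m : C) : D f z l -> l = m -> D f z m.
Proof. intros H <-; exact H. Qed.
(* Polarisation reduces products to squares. *)
Lemma D_mult f g z l m : D f z l -> D g z m -> D (fun w => f w * g w)%C z (l * g z + f z * m).
Proof.
  intros H K.
  assert (H1 := D_comp _ _ _ _ _ (D_plus _ _ _ _ _ H K) (D_sq _)).
  assert (H2 := D_comp _ _ _ _ _ (D_plus _ _ _ _ _ H (D_scal (-(1)) _ _ _ K)) (D_sq _)).
  assert (H3 := D_scal (/4) _ _ _ (D_plus _ _ _ _ _ H1 (D_scal (-(1)) _ _ _ H2))).
  simpl in H3; eapply D_ext; [|eapply D_eq; [exact H3|]].
  - apply near_all; intros w; field; intro E; apply RtoC_inj in E; lra.
  - field; intro E; apply RtoC_inj in E; lra.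
Qed.
Lemma D_opp f z l : D f z l -> D (fun w => - f w)%C z (- l).
Proof.
  intros H; apply (D_ext (fun w => -(1) * f w)%C); [apply near_all; intros; ring|].
  replace (- l)%C with (-(1) * l)%C by ring; now apply D_scal.
Qed.
Lemma D_minus f g z l m : D f z l -> D g z m -> D (fun w => f w - g w)%C z (l - m).
Proof. intros H K; apply D_plus; [exact H | now apply D_opp]. Qed.
Lemma D_Cinv (z : C) : z <> RtoC 0 -> D (fun w => / w)%C z (- / (z * z)).
Proof.
  intros Hz e He.
  assert (Hm : 0 < Cmod z) by (apply Cmod_pos; assumption).
  (* The remainder is exactly (w - z)^2 / (w z^2), and [k] bounds |w| |z|^2 from below once |w| >
     |z| / 2. *)
  set (k := Cmod z * Cmod z * Cmod z / 2).
  assert (Hk : 0 < k) by (unfold k; apply Rdiv_lt_0_compat; [|lra]; repeat apply Rmult_lt_0_compat; auto).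
  exists (Rmin (Cmod z / 2) (e * k)); split.
  { apply Rmin_glb_lt; [lra | now apply Rmult_lt_0_compat]. }
  intros w Hw.
  assert (H1 := Rlt_le_trans _ _ _ Hw (Rmin_l _ _)).
  assert (H2 := Rlt_le_trans _ _ _ Hw (Rmin_r _ _)).
  assert (Hwm : Cmod z / 2 < Cmod w).
  { assert (T := Cmod_tri_sub z w); rewrite Cmod_sym in T; lra. }
  assert (Hw0 : w <> RtoC 0) by (apply Cmod_pos_neq; lra).
  replace (/ w - / z - (w - z) * - / (z * z))%C with
    ((w - z) * ((w - z) * / (w * z * z)))%C by (field; auto).
  rewrite Cmod_mult, (Rmult_comm e).
  apply Rmult_le_compat_l; [apply Cmod_ge_0|].
  rewrite Cmod_mult, Cmod_inv by (repeat apply Cmult_neq_0; auto).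
  rewrite !Cmod_mult.
  assert (Hk2 : k < Cmod w * Cmod z * Cmod z).
  { unfold k; assert (0 < Cmod z * Cmod z) by now apply Rmult_lt_0_compat. nra. }
  apply Rmult_le_reg_r with (Cmod w * Cmod z * Cmod z); [lra|].
  rewrite Rmult_assoc, Rinv_l, Rmult_1_r by lra.
  nra.
Qed.
Lemma D_inv (f : C -> C) z l : f z <> RtoC 0 -> D f z l -> D (fun w => / f w)%C z (- l / (f z * f z)).
Proof.
  intros Hz H; assert (K := D_comp (fun w => / w)%C f z l _ H (D_Cinv _ Hz)).
  replace (- l / (f z * f z))%C with (l * - / (f z * f z))%C; [exact K|].
  field; auto.
Qed.
Lemma D_div (f g : C -> C) z l m : g z <> RtoC 0 -> D f z l -> D g z m ->
  D (fun w => f w / g w)%C z ((l * g z - f z * m) / (g z * g z)).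
Proof.
  intros Hz H K; assert (M := D_mult _ _ _ _ _ H (D_inv _ _ _ Hz K)); simpl in M.
  replace ((l * g z - f z * m) / (g z * g z))%C
    with (l * / g z + f z * (- m / (g z * g z)))%C; [exact M|field; auto].
Qed.
Lemma D_pow f z l n : D f z l -> D (fun w => f w ^ n)%C z (INR n * f z ^ pred n * l).
Proof.
  intros H; induction n as [|n IH].
  - simpl; replace (0 * 1 * l)%C with (RtoC 0) by ring; apply D_const.
  - assert (M := D_mult _ _ _ _ _ H IH).
    eapply D_eq; [exact M|].
    rewrite S_INR, RtoC_plus; destruct n as [|n]; [simpl; ring|].
    simpl pred; rewrite (Cpow_S (f z) n); ring.
Qed.
Lemma D_unique f z l m : D f z l -> D f z m -> l = m.
Proof.
  intros H K; apply NNPP; intro Hn.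
  assert (Hp : 0 < Cmod (l - m)%C) by (apply Cmod_gt_0, Csub_neq; auto).
  destruct (pnear_ex z _ 1 Rlt_0_1 (near_pnear _ _ (near_and _ _ _
     (H (Cmod (l - m)%C / 4) ltac:(lra)) (K (Cmod (l - m)%C / 4) ltac:(lra)))))
    as [w [Hw [_ [H1 H2]]]].
  assert (Hq : 0 < Cmod (w - z)%C) by (apply Cmod_gt_0, Csub_neq; auto).
  assert (T := Cmod_tri_minus (f w - f z - (w - z) * m)%C (f w - f z - (w - z) * l)%C).
  replace (f w - f z - (w - z) * m - (f w - f z - (w - z) * l))%C
    with ((w - z) * (l - m))%C in T by ring.
  rewrite Cmod_mult in T; nra.
Qed.
Lemma Cderive_D f z l : D f z l -> Cderive f z = l.
Proof.
  intros H; unfold Cderive.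
  assert (E := epsilon_spec (inhabits (RtoC 0)) (fun l => Cis_deriv f z l)
    (ex_intro _ l (proj2 (Cis_deriv_D _ _ _) H))).
  apply (D_unique f z); auto; now apply Cis_deriv_D.
Qed.
Definition df (f : C -> C) z : Prop := exists l, D f z l.
Lemma df_D f z : df f z -> D f z (Cderive f z).
Proof. intros [l H]; now rewrite (Cderive_D _ _ _ H). Qed.
Lemma holo_df f z : holo_at f z <-> near z (df f).
Proof.
  split; intros [e [He H]]; exists e; split; auto; intros w Hw; destruct (H w Hw) as [l Hl];
    exists l; now apply Cis_deriv_D.
Qed.
Lemma holo_D f z : holo_at f z -> D f z (Cderive f z).
Proof. intro H; apply df_D, (near_pt _ _ (proj1 (holo_df _ _) H)). Qed.
Lemma holo_cont f z : holo_at f z -> ccont f z.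
Proof. intro H; eapply D_cont, holo_D, H. Qed.
Lemma df_ext f g z : near z (fun w => f w = g w) -> df f z -> df g z.
Proof. intros H [l Hl]; exists l; eapply D_ext; eauto. Qed.
Lemma near_eq_sym z (f g : C -> C) : near z (fun w => f w = g w) -> near z (fun w => g w = f w).
Proof. apply near_imp; auto. Qed.
Lemma holo_ext f g z : near z (fun w => f w = g w) -> holo_at f z -> holo_at g z.
Proof.
  rewrite !holo_df; intros He H.
  generalize (near_and _ _ _ (near_near _ _ He) H); apply near_imp.
  intros w [H1 H2]; eapply df_ext; eauto.
Qed.
Lemma holo_near f z : holo_at f z -> near z (holo_at f).
Proof. rewrite holo_df; intros H; apply near_near in H; revert H; apply near_imp; intros; now apply holo_df. Qed.
Lemma holo_const c z : holo_at (fun _ => c) z.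
Proof. apply holo_df, near_all; intros w; eexists; apply D_const. Qed.
Lemma holo_id z : holo_at (fun w => w) z.
Proof. apply holo_df, near_all; intros w; eexists; apply D_id. Qed.
Lemma holo_lift2 (op : C -> C -> C) f g z :
  (forall w, df f w -> df g w -> df (fun x => op (f x) (g x)) w) ->
  holo_at f z -> holo_at g z -> holo_at (fun w => op (f w) (g w)) z.
Proof.
  intros Hop H K; apply holo_df in H; apply holo_df in K; apply holo_df.
  generalize (near_and _ _ _ H K); apply near_imp; intros w [H1 H2]; auto.
Qed.
Lemma holo_plus f g z : holo_at f z -> holo_at g z -> holo_at (fun w => f w + g w)%C z.
Proof. apply (holo_lift2 Cplus); intros w [l H] [m K]; eexists; eapply D_plus; eauto. Qed.
Lemma holo_minus f g z : holo_at f z -> holo_at g z -> holo_at (fun w => f w - g w)%C z.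
Proof. apply (holo_lift2 Cminus); intros w [l H] [m K]; eexists; eapply D_minus; eauto. Qed.
Lemma holo_mult f g z : holo_at f z -> holo_at g z -> holo_at (fun w => f w * g w)%C z.
Proof. apply (holo_lift2 Cmult); intros w [l H] [m K]; eexists; eapply D_mult; eauto. Qed.
Lemma holo_pow f z n : holo_at f z -> holo_at (fun w => f w ^ n)%C z.
Proof. intros H; rewrite holo_df in *; revert H; apply near_imp; intros w [l H]; eexists; eapply D_pow; eauto. Qed.
Lemma ccont_near_neq (f : C -> C) z : ccont f z -> f z <> RtoC 0 -> near z (fun w => f w <> RtoC 0).
Proof.
  intros H K; assert (Hp : 0 < Cmod (f z)) by (apply Cmod_pos; assumption).
  generalize (H _ Hp); apply near_imp; intros w Hw E.
  rewrite E, Cmod_sym in Hw; replace (f z - 0)%C with (f z) in Hw by ring; lra.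
Qed.
Lemma holo_inv f z : holo_at f z -> f z <> RtoC 0 -> holo_at (fun w => / f w)%C z.
Proof.
  intros H K; assert (N := ccont_near_neq _ _ (holo_cont _ _ H) K).
  rewrite holo_df in *; generalize (near_and _ _ _ H N); apply near_imp.
  intros w [[l Hl] Hn]; eexists; eapply D_inv; eauto.
Qed.
Lemma holo_div f g z : holo_at f z -> holo_at g z -> g z <> RtoC 0 -> holo_at (fun w => f w / g w)%C z.
Proof. intros; apply holo_mult; auto; now apply holo_inv. Qed.
Lemma near_comp g z (P : C -> Prop) : ccont g z -> near (g z) P -> near z (fun w => P (g w)).
Proof.
  intros H [e [He K]]; generalize (H e He); apply near_imp; intros w Hw; now apply K.
Qed.
Lemma holo_comp f g z : holo_at g z -> holo_at f (g z) -> holo_at (fun w => f (g w)) z.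
Proof.
  intros H K; assert (N := near_comp _ _ _ (holo_cont _ _ H) (proj1 (holo_df _ _) K)).
  rewrite holo_df in *; generalize (near_and _ _ _ H N); apply near_imp.
  intros w [[l Hl] [m Hm]]; eexists; eapply D_comp; eauto.
Qed.
Lemma ccont_comp f g z : ccont g z -> ccont f (g z) -> ccont (fun w => f (g w)) z.
Proof. intros H K e He; exact (near_comp _ _ _ H (K e He)). Qed.
Lemma ccont_ext f g z : near z (fun w => f w = g w) -> ccont f z -> ccont g z.
Proof.
  intros He H e Hp; assert (E := near_pt _ _ He); simpl in E.
  generalize (near_and _ _ _ He (H e Hp)); apply near_imp; intros w [E1 E2].
  rewrite <- E, <- E1; exact E2.
Qed.
Lemma ccont_plus f g z : ccont f z -> ccont g z -> ccont (fun w => f w + g w)%C z.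
Proof.
  intros H K e He; generalize (near_and _ _ _ (H (e/2) ltac:(lra)) (K (e/2) ltac:(lra))).
  apply near_imp; intros w [H1 H2].
  replace (f w + g w - (f z + g z))%C with ((f w - f z) + (g w - g z))%C by ring.
  eapply Rle_lt_trans; [apply Cmod_triangle | lra].
Qed.
Lemma ccont_scal c f z : ccont f z -> ccont (fun w => c * f w)%C z.
Proof. intros H; apply (ccont_comp (fun w => c * w)%C f z H).
  eapply D_cont, D_scal, D_id. Qed.
Lemma ccont_inv f z : ccont f z -> f z <> RtoC 0 -> ccont (fun w => / f w)%C z.
Proof. intros H K; apply (ccont_comp (fun w => / w)%C f z H); eapply D_cont, D_Cinv, K. Qed.

(** * The Cauchy-Goursat theorem *)

Lemma Cmod_le_sum (z : C) : Cmod z <= Rabs (fst z) + Rabs (snd z).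
Proof.
  replace z with (RtoC (fst z) + Ci * RtoC (snd z))%C at 1
    by (destruct z; unfold Ci, RtoC, Cmult, Cplus; simpl; f_equal; ring).
  eapply Rle_trans; [apply Cmod_triangle|].
  rewrite Cmod_mult, Cmod_Ci, !Cmod_R; lra.
Qed.
Lemma fst_le_Cmod (z : C) : Rabs (fst z) <= Cmod z.
Proof. eapply Rle_trans; [apply Rmax_l | apply Rmax_Cmod]. Qed.
Lemma snd_le_Cmod (z : C) : Rabs (snd z) <= Cmod z.
Proof. eapply Rle_trans; [apply Rmax_r | apply Rmax_Cmod]. Qed.
(** Paths are handled coordinate by coordinate, so that the real integral calculus applies to them
    directly. *)
Definition pcont (g : R -> C) (t : R) : Prop :=
  continuous (fun s => fst (g s)) t /\ continuous (fun s => snd (g s)) t.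
Definition PD (g : R -> C) (t : R) (m : C) : Prop :=
  is_derive (fun s => fst (g s)) t (fst m) /\ is_derive (fun s => snd (g s)) t (snd m).
Lemma cont_eps (f : R -> R) t : continuous f t <->
  forall eps, 0 < eps -> exists d, 0 < d /\ forall s, Rabs (s - t) < d -> Rabs (f s - f t) < eps.
Proof.
  split.
  - intros H eps He.
    destruct (proj1 (filterlim_locally _ _) H (mkposreal eps He)) as [d Hd].
    exists d; split; [apply cond_pos|]; intros s Hs; apply (Hd s Hs).
  - intros H; apply filterlim_locally; intros eps.
    destruct (H eps (cond_pos eps)) as [d [Hd K]].
    exists (mkposreal d Hd); intros s Hs; apply (K s Hs).
Qed.
Lemma pcont_eps (g : R -> C) t : pcont g t <->
  forall eps, 0 < eps -> exists d, 0 < d /\ forall s, Rabs (s - t) < d -> Cmod (g s - g t)%C < eps.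
Proof.
  unfold pcont; rewrite !cont_eps; split.
  - intros [H1 H2] eps He.
    destruct (H1 (eps/2) ltac:(lra)) as [d1 [Hd1 K1]].
    destruct (H2 (eps/2) ltac:(lra)) as [d2 [Hd2 K2]].
    exists (Rmin d1 d2); split; [now apply Rmin_glb_lt|].
    intros s Hs; eapply Rle_lt_trans; [apply Cmod_le_sum|].
    assert (A1 := K1 s (Rlt_le_trans _ _ _ Hs (Rmin_l _ _))).
    assert (A2 := K2 s (Rlt_le_trans _ _ _ Hs (Rmin_r _ _))).
    unfold Cminus, Cplus, Copp; simpl; unfold Rminus in *; lra.
  - intros H; split; intros eps He; destruct (H eps He) as [d [Hd K]]; exists d; split; auto;
      intros s Hs; (eapply Rle_lt_trans; [|apply (K s Hs)]).
    + apply (fst_le_Cmod (g s - g t)%C).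
    + apply (snd_le_Cmod (g s - g t)%C).
Qed.
Lemma pcont_comp f g t : pcont g t -> ccont f (g t) -> pcont (fun s => f (g s)) t.
Proof.
  rewrite !pcont_eps; intros H K eps He; destruct (K eps He) as [d [Hd Kd]].
  destruct (H d Hd) as [e [Hee Ke]]; exists e; split; auto.
Qed.
Lemma pcont_const c t : pcont (fun _ => c) t.
Proof. split; apply continuous_const. Qed.
Lemma pcont_plus f g t : pcont f t -> pcont g t -> pcont (fun s => f s + g s)%C t.
Proof. intros [H1 H2] [K1 K2]; split; simpl; apply (continuous_plus (V := R_NormedModule)); auto. Qed.
Lemma pcont_mult f g t : pcont f t -> pcont g t -> pcont (fun s => f s * g s)%C t.
Proof.
  intros [H1 H2] [K1 K2]; split; simpl.
  - apply (continuous_minus (V := R_NormedModule)); apply (continuous_mult (K := R_AbsRing)); auto.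
  - apply (continuous_plus (V := R_NormedModule)); apply (continuous_mult (K := R_AbsRing)); auto.
Qed.
Lemma pcont_opp f t : pcont f t -> pcont (fun s => - f s)%C t.
Proof. intros [H1 H2]; split; simpl; apply (continuous_opp (V := R_NormedModule)); auto. Qed.
Lemma pcont_minus f g t : pcont f t -> pcont g t -> pcont (fun s => f s - g s)%C t.
Proof. intros; apply pcont_plus; auto; now apply pcont_opp. Qed.
Lemma pcont_Cmod g t : pcont g t -> continuous (fun s => Cmod (g s)) t.
Proof.
  rewrite pcont_eps, cont_eps; intros H eps He; destruct (H eps He) as [d [Hd K]].
  exists d; split; auto; intros s Hs; eapply Rle_lt_trans; [|apply (K s Hs)].
  apply Rabs_le; split.
  - assert (T := Cmod_tri_sub (g t) (g s)); rewrite Cmod_sym in T; lra.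
  - apply Cmod_tri_sub.
Qed.
Lemma pcont_RtoC f t : continuous f t -> pcont (fun s => RtoC (f s)) t.
Proof. intros H; split; simpl; auto; apply continuous_const. Qed.
Lemma deriv_eps (f : R -> R) t l : is_derive f t l <->
  forall eps, 0 < eps -> exists d, 0 < d /\ forall s, Rabs (s - t) < d ->
    Rabs (f s - f t - (s - t) * l) <= eps * Rabs (s - t).
Proof.
  split.
  - intros [_ H] eps He.
    specialize (H t (fun P HP => HP) (mkposreal eps He)).
    destruct H as [d Hd]; exists d; split; [apply cond_pos|].
    intros s Hs; apply (Hd s Hs).
  - intros H; split; [apply (is_linear_scal_l (K := R_AbsRing) (V := R_NormedModule))|].
    intros x Hx; apply (is_filter_lim_locally_unique (V := AbsRing_NormedModule R_AbsRing)) in Hx; subst x.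
    intros eps; destruct (H eps (cond_pos eps)) as [d [Hd K]].
    exists (mkposreal d Hd); intros s Hs; apply (K s Hs).
Qed.
Lemma PD_eps g t m : PD g t m <->
  forall eps, 0 < eps -> exists d, 0 < d /\ forall s, Rabs (s - t) < d ->
    Cmod (g s - g t - RtoC (s - t) * m)%C <= eps * Rabs (s - t).
Proof.
  unfold PD; rewrite !deriv_eps; split.
  - intros [H1 H2] eps He.
    destruct (H1 (eps/2) ltac:(lra)) as [d1 [Hd1 K1]].
    destruct (H2 (eps/2) ltac:(lra)) as [d2 [Hd2 K2]].
    exists (Rmin d1 d2); split; [now apply Rmin_glb_lt|].
    intros s Hs; eapply Rle_trans; [apply Cmod_le_sum|].
    assert (A1 := K1 s (Rlt_le_trans _ _ _ Hs (Rmin_l _ _))).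
    assert (A2 := K2 s (Rlt_le_trans _ _ _ Hs (Rmin_r _ _))).
    simpl; ring_simplify (fst (g s) + - fst (g t) + - ((s - t) * fst m - 0 * snd m)).
    ring_simplify (snd (g s) + - snd (g t) + - ((s - t) * snd m + 0 * fst m)).
    ring_simplify (fst (g s) - fst (g t) - (s - t) * fst m) in A1.
    ring_simplify (snd (g s) - snd (g t) - (s - t) * snd m) in A2.
    lra.
  - intros H; split; intros eps He; destruct (H eps He) as [d [Hd K]]; exists d; split; auto;
      intros s Hs; (eapply Rle_trans; [|apply (K s Hs)]).
    + eapply Rle_trans; [|apply fst_le_Cmod]; right; f_equal; simpl; ring.
    + eapply Rle_trans; [|apply snd_le_Cmod]; right; f_equal; simpl; ring.
Qed.
Lemma PD_pcont g t m : PD g t m -> pcont g t.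
Proof.
  intros [H1 H2]; split; apply (ex_derive_continuous (K := R_AbsRing) (V := R_NormedModule)); eexists; eauto.
Qed.
Lemma PD_comp (f : C -> C) (g : R -> C) t (l m : C) : PD g t m -> D f (g t) l -> PD (fun s => f (g s)) t (m * l)%C.
Proof.
  intros Hg Hf; assert (Hc := proj1 (pcont_eps _ _) (PD_pcont _ _ _ Hg)).
  rewrite PD_eps in *; intros eps He.
  assert (Hm := Cmod_ge_0 m); assert (Hl := Cmod_ge_0 l).
  set (k := Cmod m + 1).
  set (e1 := eps / (2 * k)).
  assert (He1 : 0 < e1) by (unfold e1, k; apply Rdiv_lt_0_compat; lra).
  set (e2 := eps / (2 * (Cmod l + 1))).
  assert (He2 : 0 < e2) by (unfold e2; apply Rdiv_lt_0_compat; lra).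
  destruct (Hf e1 He1) as [d [Hd Kd]].
  destruct (Hc d Hd) as [d1 [Hd1 K1]].
  destruct (Hg e2 He2) as [d2 [Hd2 K2]].
  destruct (Hg 1 Rlt_0_1) as [d3 [Hd3 K3]].
  exists (Rmin d1 (Rmin d2 d3)); split; [repeat apply Rmin_glb_lt; auto|].
  intros s Hs.
  assert (S1 := Rlt_le_trans _ _ _ Hs (Rmin_l _ _)).
  assert (S23 := Rlt_le_trans _ _ _ Hs (Rmin_r _ _)).
  assert (S2 := Rlt_le_trans _ _ _ S23 (Rmin_l _ _)).
  assert (S3 := Rlt_le_trans _ _ _ S23 (Rmin_r _ _)).
  specialize (Kd _ (K1 s S1)); specialize (K2 s S2); specialize (K3 s S3).
  replace (f (g s) - f (g t) - RtoC (s - t) * (m * l))%C with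
   ((f (g s) - f (g t) - (g s - g t) * l) + (g s - g t - RtoC (s - t) * m) * l)%C by ring.
  eapply Rle_trans; [apply Cmod_triangle|]; rewrite Cmod_mult.
  assert (Hs0 := Rabs_pos (s - t)).
  assert (Hg3 : Cmod (g s - g t)%C <= k * Rabs (s - t)).
  { assert (T := Cmod_triangle (g s - g t - RtoC (s - t) * m)%C (RtoC (s - t) * m)%C).
    replace (g s - g t - RtoC (s - t) * m + RtoC (s - t) * m)%C with (g s - g t)%C in T by ring.
    rewrite Cmod_mult, Cmod_R in T; unfold k; lra. }
  apply Rle_trans with (e1 * (k * Rabs (s - t)) + e2 * Rabs (s - t) * Cmod l).
  - apply Rplus_le_compat.
    + eapply Rle_trans; [apply Kd|]; apply Rmult_le_compat_l; lra.
    + apply Rmult_le_compat_r; lra.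
  - replace (e1 * (k * Rabs (s - t))) with (eps / 2 * Rabs (s - t))
      by (unfold e1, k; field; lra).
    assert (e2 * Cmod l <= eps / 2).
    { unfold e2; apply Rle_trans with (eps / (2 * (Cmod l + 1)) * (Cmod l + 1)).
      - apply Rmult_le_compat_l; [fold e2; lra | lra].
      - right; field; lra. }
    nra.
Qed.
Definition CI (g : R -> C) (a b : R) : C :=
  (RInt (fun t => fst (g t)) a b, RInt (fun t => snd (g t)) a b).
Definition Pc (g : R -> C) a b := forall t, a <= t <= b -> pcont g t.
Lemma ex_RInt_c (f : R -> R) a b : a <= b -> (forall t, a <= t <= b -> continuous f t) -> ex_RInt f a b.
Proof.
  intros Hab H; apply (ex_RInt_continuous (V := R_CompleteNormedModule)).
  rewrite Rmin_left, Rmax_right by auto; auto.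
Qed.
Lemma Pc_ex1 g a b : a <= b -> Pc g a b -> ex_RInt (fun t => fst (g t)) a b.
Proof. intros Hab H; apply ex_RInt_c; auto; intros t Ht; apply (H t Ht). Qed.
Lemma Pc_ex2 g a b : a <= b -> Pc g a b -> ex_RInt (fun t => snd (g t)) a b.
Proof. intros Hab H; apply ex_RInt_c; auto; intros t Ht; apply (H t Ht). Qed.
Lemma CI_ext f g a b : a <= b -> (forall t, a <= t <= b -> f t = g t) -> CI f a b = CI g a b.
Proof.
  intros Hab H; unfold CI; f_equal; apply RInt_ext; rewrite Rmin_left, Rmax_right by auto;
    intros x Hx; rewrite H; auto; lra.
Qed.
Lemma CI_plus f g a b : a <= b -> Pc f a b -> Pc g a b ->
  CI (fun t => f t + g t)%C a b = (CI f a b + CI g a b)%C.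
Proof.
  intros Hab Hf Hg; unfold CI, Cplus; simpl; f_equal;
    apply (RInt_plus (V := R_CompleteNormedModule)); auto using Pc_ex1, Pc_ex2.
Qed.
Lemma RInt_eq (f g : R -> R) a b : (forall t, f t = g t) -> RInt f a b = RInt g a b.
Proof. intros H; apply RInt_ext; intros; apply H. Qed.
Lemma RInt_lin (f g : R -> R) k m a b : ex_RInt f a b -> ex_RInt g a b ->
  RInt (fun t => k * f t + m * g t) a b = k * RInt f a b + m * RInt g a b.
Proof.
  intros Hf Hg; apply is_RInt_unique.
  apply (is_RInt_plus (V := R_NormedModule)); apply (is_RInt_scal (V := R_NormedModule));
    now apply (RInt_correct (V := R_CompleteNormedModule)).
Qed.
Lemma CI_scal c g a b : a <= b -> Pc g a b ->
  CI (fun t => c * g t)%C a b = (c * CI g a b)%C.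
Proof.
  intros Hab Hg; assert (E1 := Pc_ex1 _ _ _ Hab Hg); assert (E2 := Pc_ex2 _ _ _ Hab Hg).
  unfold CI, Cmult; simpl; f_equal.
  - rewrite (RInt_eq _ (fun t => fst c * fst (g t) + - snd c * snd (g t))) by (intros; ring).
    rewrite RInt_lin by auto; match goal with |- ?a = ?b => change (@eq R a b) end; ring.
  - now apply RInt_lin.
Qed.
Lemma Pc_scal c g a b : Pc g a b -> Pc (fun t => c * g t)%C a b.
Proof. intros H t Ht; apply pcont_mult; [apply pcont_const | auto]. Qed.
Lemma CI_minus f g a b : a <= b -> Pc f a b -> Pc g a b ->
  CI (fun t => f t - g t)%C a b = (CI f a b - CI g a b)%C.
Proof.
  intros Hab Hf Hg.
  rewrite (CI_ext _ (fun t => f t + -(1) * g t)%C) by (auto; intros; ring).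
  rewrite CI_plus, CI_scal by (auto using Pc_scal); ring.
Qed.
Lemma CI_Chasles g a b c : a <= b <= c -> Pc g a c -> CI g a c = (CI g a b + CI g b c)%C.
Proof.
  intros Hab H.
  assert (H1 : Pc g a b) by (intros t Ht; apply H; lra).
  assert (H2 : Pc g b c) by (intros t Ht; apply H; lra).
  unfold CI, Cplus; simpl; f_equal; symmetry.
  - apply (RInt_Chasles (V := R_CompleteNormedModule) (fun t => fst (g t)));
      apply Pc_ex1; auto; apply Hab.
  - apply (RInt_Chasles (V := R_CompleteNormedModule) (fun t => snd (g t)));
      apply Pc_ex2; auto; apply Hab.
Qed.
(** The factor 2 comes from bounding the two coordinates separately. *)
Lemma CI_bound g a b M : a <= b -> Pc g a b -> (forall t, a <= t <= b -> Cmod (g t) <= M) ->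
  Cmod (CI g a b) <= 2 * M * (b - a).
Proof.
  intros Hab H HM; eapply Rle_trans; [apply Cmod_le_sum|]; unfold CI; simpl.
  assert (B1 := abs_RInt_le_const _ a b M Hab (Pc_ex1 _ _ _ Hab H)
    (fun t Ht => Rle_trans _ _ _ (fst_le_Cmod _) (HM t Ht))).
  assert (B2 := abs_RInt_le_const _ a b M Hab (Pc_ex2 _ _ _ Hab H)
    (fun t Ht => Rle_trans _ _ _ (snd_le_Cmod _) (HM t Ht))).
  lra.
Qed.
Lemma RInt_FTC (F f : R -> R) a b : a <= b -> (forall t, a <= t <= b -> is_derive F t (f t)) ->
  (forall t, a <= t <= b -> continuous f t) -> RInt f a b = F b - F a.
Proof.
  intros Hab HF Hf; apply is_RInt_unique, (is_RInt_derive (V := R_CompleteNormedModule) F f);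
    rewrite Rmin_left, Rmax_right by auto; auto.
Qed.
Lemma CI_FTC F g a b : a <= b -> Pc g a b -> (forall t, a <= t <= b -> PD F t (g t)) ->
  CI g a b = (F b - F a)%C.
Proof.
  intros Hab Hg HF; unfold CI, Cminus, Cplus, Copp; simpl; f_equal.
  - apply (RInt_FTC (fun t => fst (F t)) (fun t => fst (g t))); auto; intros t Ht; [apply (HF t Ht) | apply (Hg t Ht)].
  - apply (RInt_FTC (fun t => snd (F t)) (fun t => snd (g t))); auto; intros t Ht; [apply (HF t Ht) | apply (Hg t Ht)].
Qed.
Lemma PD_hor c x : PD (fun s => (s, c) : C) x (RtoC 1).
Proof. split; simpl; [apply (is_derive_id (K := R_AbsRing)) | apply (is_derive_const (K := R_AbsRing) (V := R_NormedModule))]. Qed.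
Lemma PD_ver c y : PD (fun s => (c, s) : C) y Ci.
Proof. split; simpl; [apply (is_derive_const (K := R_AbsRing) (V := R_NormedModule)) | apply (is_derive_id (K := R_AbsRing))]. Qed.
(** The contour integral of [g] along the positively oriented boundary of [a, b] x [c, d]. *)
Definition bdry (g : C -> C) a b c d : C :=
  (CI (fun x => g (x, c)) a b + Ci * CI (fun y => g (b, y)) c d
   - CI (fun x => g (x, d)) a b - Ci * CI (fun y => g (a, y)) c d)%C.
Definition on_rect (P : C -> Prop) a b c d : Prop :=
  forall x y, a <= x <= b -> c <= y <= d -> P (x, y).
Lemma Pc_hor g a b c : (forall x, a <= x <= b -> ccont g (x, c)) -> Pc (fun x => g (x, c)) a b.
Proof. intros H t Ht; apply (pcont_comp g (fun x => (x, c) : C)); [eapply PD_pcont, PD_hor | auto]. Qed.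
Lemma Pc_ver g a b c : (forall y, a <= y <= b -> ccont g (c, y)) -> Pc (fun y => g (c, y)) a b.
Proof. intros H t Ht; apply (pcont_comp g (fun y => (c, y) : C)); [eapply PD_pcont, PD_ver | auto]. Qed.
Lemma bdry_split_x g a p b c d : a <= p <= b -> c <= d -> on_rect (ccont g) a b c d ->
  bdry g a b c d = (bdry g a p c d + bdry g p b c d)%C.
Proof.
  intros Hp Hcd H; unfold bdry.
  rewrite (CI_Chasles (fun x => g (x, c)) a p b), (CI_Chasles (fun x => g (x, d)) a p b);
    try lra; try (apply Pc_hor; intros; apply H; lra).
  ring.
Qed.
Lemma bdry_split_y g a b c q d : c <= q <= d -> a <= b -> on_rect (ccont g) a b c d ->
  bdry g a b c d = (bdry g a b c q + bdry g a b q d)%C.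
Proof.
  intros Hp Hcd H; unfold bdry.
  rewrite (CI_Chasles (fun y => g (a, y)) c q d), (CI_Chasles (fun y => g (b, y)) c q d);
    try lra; try (apply Pc_ver; intros; apply H; lra).
  ring.
Qed.
Lemma bdry_primitive F g a b c d : a <= b -> c <= d -> (forall w, D F w (g w)) -> (forall w, ccont g w) ->
  bdry g a b c d = RtoC 0.
Proof.
  intros Hab Hcd HF Hg; unfold bdry.
  assert (Hh : forall y, CI (fun x => g (x, y)) a b = (F (b, y) - F (a, y))%C).
  { intros y; apply (CI_FTC (fun x => F (x, y))); auto; [apply Pc_hor; auto|].
    intros t _; replace (g (t, y)) with (RtoC 1 * g (t, y))%C by ring.
    apply (PD_comp F (fun x => (x, y) : C)); auto; apply PD_hor. }
  assert (Hv : forall x, (Ci * CI (fun y => g (x, y)) c d = F (x, d) - F (x, c))%C).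
  { intros x; rewrite <- CI_scal by (auto; apply Pc_ver; auto).
    apply (CI_FTC (fun y => F (x, y))); auto; [apply Pc_scal, Pc_ver; auto|].
    intros t _; apply (PD_comp F (fun y => (x, y) : C)); auto; apply PD_ver. }
  rewrite !Hh, !Hv; ring.
Qed.
Lemma bdry_minus f g a b c d : a <= b -> c <= d -> on_rect (ccont f) a b c d ->
  on_rect (ccont g) a b c d ->
  bdry (fun w => f w - g w)%C a b c d = (bdry f a b c d - bdry g a b c d)%C.
Proof.
  intros Hab Hcd Hf Hg; unfold bdry.
  rewrite !CI_minus; auto; try ring;
   try (apply Pc_hor; intros; (apply Hf || apply Hg); lra);
   try (apply Pc_ver; intros; (apply Hf || apply Hg); lra).
Qed.
Lemma bdry_bound g a b c d M : a <= b -> c <= d -> on_rect (ccont g) a b c d ->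
  on_rect (fun w => Cmod (g w) <= M) a b c d ->
  Cmod (bdry g a b c d) <= 4 * M * ((b - a) + (d - c)).
Proof.
  intros Hab Hcd Hg HM; unfold bdry.
  assert (H1 := CI_bound (fun x => g (x, c)) a b M Hab
     ltac:(apply Pc_hor; intros; apply Hg; lra) ltac:(intros; apply HM; lra)).
  assert (H2 := CI_bound (fun x => g (x, d)) a b M Hab
     ltac:(apply Pc_hor; intros; apply Hg; lra) ltac:(intros; apply HM; lra)).
  assert (H3 := CI_bound (fun y => g (b, y)) c d M Hcd
     ltac:(apply Pc_ver; intros; apply Hg; lra) ltac:(intros; apply HM; lra)).
  assert (H4 := CI_bound (fun y => g (a, y)) c d M Hcd
     ltac:(apply Pc_ver; intros; apply Hg; lra) ltac:(intros; apply HM; lra)).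
  eapply Rle_trans; [apply Cmod_tri_minus|].
  eapply Rle_trans; [apply Rplus_le_compat_r, Cmod_tri_minus|].
  eapply Rle_trans; [apply Rplus_le_compat_r, Rplus_le_compat_r, Cmod_triangle|].
  rewrite !Cmod_mult, Cmod_Ci; lra.
Qed.
Lemma nested_point (u v : nat -> R) :
  (forall n, u n <= u (S n)) -> (forall n, v (S n) <= v n) -> (forall n, u n <= v n) ->
  exists x, forall n, u n <= x <= v n.
Proof.
  intros Hu Hv Huv.
  assert (Mu : forall k n, u n <= u (k + n)%nat).
  { induction k; intros n; simpl; [lra|]; eapply Rle_trans; [apply IHk | apply Hu]. }
  assert (Mv : forall k n, v (k + n)%nat <= v n).
  { induction k; intros n; simpl; [lra|]; eapply Rle_trans; [apply Hv | apply IHk]. }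
  assert (X : forall n m, u n <= v m).
  { intros n m; eapply Rle_trans; [apply (Mu m n)|]; rewrite Nat.add_comm.
    eapply Rle_trans; [apply Huv | apply Mv]. }
  destruct (completeness (fun x => exists n, x = u n)) as [x [H1 H2]].
  - exists (v 0%nat); intros y [n ->]; auto.
  - exists (u 0%nat), 0%nat; auto.
  - exists x; intros n; split; [apply H1; now exists n|].
    apply H2; intros y [m ->]; auto.
Qed.
Record rect := mkrect { rx0 : R; rx1 : R; ry0 : R; ry1 : R }.
(** Quadrisection: if the integral exceeded [kap] times the area, one quarter would inherit this at
    every stage. At the limit point the affine part of [g] integrates to 0, and the remainder is too
    small for the excess. *)
Lemma goursat g a b c d : a < b -> c < d -> on_rect (df g) a b c d -> bdry g a b c d = RtoC 0.
Proof.
  intros Hab Hcd Hdf.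
  assert (Hcc : on_rect (ccont g) a b c d).
  { intros x y Hx Hy; destruct (Hdf x y Hx Hy) as [l Hl]; eapply D_cont; eauto. }
  (* In the end [kap] is half the ratio of the integral to the area, which is absurd unless the
     integral is 0. *)
  assert (key : forall kap, 0 < kap -> Cmod (bdry g a b c d) <= kap * ((b - a) * (d - c))).
  { intros kap Hk; apply Rnot_lt_le; intro Hbad.
    set (bad := fun n r => a <= rx0 r /\ rx1 r <= b /\ c <= ry0 r /\ ry1 r <= d /\
      rx1 r - rx0 r = (b - a) / 2 ^ n /\ ry1 r - ry0 r = (d - c) / 2 ^ n /\
      kap * ((rx1 r - rx0 r) * (ry1 r - ry0 r)) < Cmod (bdry g (rx0 r) (rx1 r) (ry0 r) (ry1 r))).
    assert (step : forall n r, bad n r -> exists r', bad (S n) r' /\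
       rx0 r <= rx0 r' /\ rx1 r' <= rx1 r /\ ry0 r <= ry0 r' /\ ry1 r' <= ry1 r).
    { intros n [a1 b1 c1 d1] (H1 & H2 & H3 & H4 & H5 & H6 & H7); simpl in *.
      assert (Hpn : 0 < 2 ^ n) by (apply pow_lt; lra).
      assert (P1 : 0 < (b - a) / 2 ^ n) by (apply Rdiv_lt_0_compat; lra).
      assert (P2 : 0 < (d - c) / 2 ^ n) by (apply Rdiv_lt_0_compat; lra).
      set (p := (a1 + b1) / 2); set (q := (c1 + d1) / 2).
      assert (Hp : a1 <= p <= b1) by (unfold p; lra).
      assert (Hq : c1 <= q <= d1) by (unfold q; lra).
      assert (O : forall a2 b2 c2 d2, a1 <= a2 -> b2 <= b1 -> c1 <= c2 -> d2 <= d1 -> on_rect (ccont g) a2 b2 c2 d2).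
      { intros a2 b2 c2 d2 A1 A2 A3 A4 x y Hx Hy; apply Hcc; lra. }
      rewrite (bdry_split_x g a1 p b1) in H7 by (try apply O; lra).
      rewrite (bdry_split_y g a1 p c1 q), (bdry_split_y g p b1 c1 q) in H7 by (try apply O; lra).
      assert (E1 : (b - a) / (2 * 2 ^ n) = (b1 - a1) / 2) by (rewrite H5; field; lra).
      assert (E2 : (d - c) / (2 * 2 ^ n) = (d1 - c1) / 2) by (rewrite H6; field; lra).
      assert (Q : forall a2 b2 c2 d2, a1 <= a2 -> b2 <= b1 -> c1 <= c2 -> d2 <= d1 ->
         b2 - a2 = (b1 - a1) / 2 -> d2 - c2 = (d1 - c1) / 2 ->
         kap * ((b2 - a2) * (d2 - c2)) < Cmod (bdry g a2 b2 c2 d2) ->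
         exists r', bad (S n) r' /\ a1 <= rx0 r' /\ rx1 r' <= b1 /\ c1 <= ry0 r' /\ ry1 r' <= d1).
      { intros a2 b2 c2 d2 A1 A2 A3 A4 A5 A6 A7; exists (mkrect a2 b2 c2 d2).
        unfold bad; simpl; rewrite E1, E2; repeat split; lra. }
      destruct (Rlt_dec (kap * ((p - a1) * (q - c1))) (Cmod (bdry g a1 p c1 q))) as [F1|F1];
        [apply (Q a1 p c1 q); try (unfold p, q in *; lra)|].
      destruct (Rlt_dec (kap * ((p - a1) * (d1 - q))) (Cmod (bdry g a1 p q d1))) as [F2|F2];
        [apply (Q a1 p q d1); try (unfold p, q in *; lra)|].
      destruct (Rlt_dec (kap * ((b1 - p) * (q - c1))) (Cmod (bdry g p b1 c1 q))) as [F3|F3];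
        [apply (Q p b1 c1 q); try (unfold p, q in *; lra)|].
      destruct (Rlt_dec (kap * ((b1 - p) * (d1 - q))) (Cmod (bdry g p b1 q d1))) as [F4|F4];
        [apply (Q p b1 q d1); try (unfold p, q in *; lra)|].
      exfalso; revert H7; apply Rle_not_lt.
      eapply Rle_trans; [apply Cmod_triangle|].
      eapply Rle_trans; [apply Rplus_le_compat; apply Cmod_triangle|].
      replace (kap * ((b1 - a1) * (d1 - c1))) with
        (kap * ((p - a1) * (q - c1)) + kap * ((p - a1) * (d1 - q)) +
         (kap * ((b1 - p) * (q - c1)) + kap * ((b1 - p) * (d1 - q)))) by (unfold p, q; field).
      lra. }
    set (nxt := fun n r => epsilon (inhabits r) (fun r' => bad (S n) r' /\
       rx0 r <= rx0 r' /\ rx1 r' <= rx1 r /\ ry0 r <= ry0 r' /\ ry1 r' <= ry1 r)).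
    set (sq := fix sq n := match n with O => mkrect a b c d | S n => nxt n (sq n) end).
    assert (B0 : bad 0%nat (sq 0%nat)).
    { unfold bad; simpl; repeat split; try lra; field. }
    assert (Bn : forall n, bad n (sq n)).
    { induction n; auto; simpl.
      apply (epsilon_spec (inhabits (sq n)) _ (step n _ IHn)). }
    assert (Sn : forall n, rx0 (sq n) <= rx0 (sq (S n)) /\ rx1 (sq (S n)) <= rx1 (sq n) /\
        ry0 (sq n) <= ry0 (sq (S n)) /\ ry1 (sq (S n)) <= ry1 (sq n)).
    { intros n; apply (epsilon_spec (inhabits (sq n)) _ (step n _ (Bn n))). }
    assert (Hpn : forall n, 0 < 2 ^ n) by (intro; apply pow_lt; lra).
    destruct (nested_point (fun n => rx0 (sq n)) (fun n => rx1 (sq n))) as [x Hx];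
      [intro; apply Sn | intro; apply Sn | |].
    { intro n; destruct (Bn n) as (_ & _ & _ & _ & E & _).
      assert (0 < (b - a) / 2 ^ n) by (apply Rdiv_lt_0_compat; [lra|auto]); lra. }
    destruct (nested_point (fun n => ry0 (sq n)) (fun n => ry1 (sq n))) as [y Hy];
      [intro; apply Sn | intro; apply Sn | |].
    { intro n; destruct (Bn n) as (_ & _ & _ & _ & _ & E & _).
      assert (0 < (d - c) / 2 ^ n) by (apply Rdiv_lt_0_compat; [lra|auto]); lra. }
    assert (Hx0 := Hx 0%nat); assert (Hy0 := Hy 0%nat); simpl in Hx0, Hy0.
    destruct (Hdf x y Hx0 Hy0) as [l Hl].
    set (h := b - a); set (k := d - c).
    assert (Hh : 0 < h) by (unfold h; lra).
    assert (Hkk : 0 < k) by (unfold k; lra).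
    (* Chosen so that [bdry_bound] on the n-th rectangle gives exactly [kap] times its area. *)
    set (eps := kap * (h * k) / (4 * ((h + k) * (h + k)))).
    assert (Hhk : 0 < h * k) by nra.
    assert (Heps : 0 < eps) by (unfold eps; apply Rdiv_lt_0_compat; nra).
    destruct (Hl eps Heps) as [dl [Hdl Kdl]].
    assert (Hn : exists n, (h + k) / 2 ^ n < dl).
    { destruct (pow_lt_1_zero (/2) ltac:(rewrite Rabs_pos_eq; lra) (dl / (h + k))
        ltac:(apply Rdiv_lt_0_compat; lra)) as [N HN].
      exists N; specialize (HN N (le_n N)).
      rewrite pow_inv in HN.
      rewrite Rabs_pos_eq in HN by (left; apply Rinv_0_lt_compat; auto).
      apply Rmult_lt_compat_r with (r := h + k) in HN; [|lra].
      replace (dl / (h + k) * (h + k)) with dl in HN by (field; lra).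
      unfold Rdiv; lra. }
    destruct Hn as [n Hn].
    destruct (Bn n) as (H1 & H2 & H3 & H4 & H5 & H6 & H7).
    specialize (Hx n); specialize (Hy n); simpl in Hx, Hy.
    destruct (sq n) as [a1 b1 c1 d1]; simpl in *.
    fold h in H5; fold k in H6.
    assert (Hq : 0 < 2 ^ n) by auto.
    assert (Hsum : h / 2 ^ n + k / 2 ^ n = (h + k) / 2 ^ n) by (field; lra).
    assert (P1 : 0 < h / 2 ^ n) by (apply Rdiv_lt_0_compat; lra).
    assert (P2 : 0 < k / 2 ^ n) by (apply Rdiv_lt_0_compat; lra).
    set (t := (x, y) : C) in *.
    (* The first-order part of [g] at the limit point; it has a quadratic primitive. *)
    set (af := fun w => (g t + (w - t) * l)%C).
    assert (Daf : forall w, D (fun w => g t * w + / 2 * l * ((w - t) * (w - t)))%C w (af w)).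
    { intros w; eapply D_eq; [apply D_plus; [apply D_scal, D_id|apply D_scal]|].
      - apply (D_comp (fun w => w * w)%C (fun w => w - t)%C); [apply D_minus; [apply D_id|apply D_const]|apply D_sq].
      - unfold af; simpl; field; intro E; apply RtoC_inj in E; lra. }
    assert (Caf : forall w, ccont af w).
    { intros w; eapply D_cont; unfold af; eapply D_plus; [apply D_const|].
      eapply D_mult; [apply D_minus; [apply D_id | apply D_const] | apply D_const]. }
    assert (Cr : on_rect (ccont g) a1 b1 c1 d1) by (intros x1 y1 ? ?; apply Hcc; lra).
    assert (Cd : on_rect (ccont (fun w => g w - af w)%C) a1 b1 c1 d1).
    { intros x1 y1 ? ?; apply ccont_ext with (fun w => g w + -(1) * af w)%C.
      - apply near_all; intros; ring.
      - apply ccont_plus; [apply Cr; auto | apply ccont_scal, Caf]. }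
    assert (Ee : bdry g a1 b1 c1 d1 = bdry (fun w => g w - af w)%C a1 b1 c1 d1).
    { rewrite bdry_minus by (auto; try lra; intros x1 y1 _ _; apply Caf).
      rewrite (bdry_primitive _ af) by (auto; try lra; eexact Daf).
      ring. }
    rewrite Ee in H7; revert H7; apply Rle_not_lt.
    set (M := eps * ((h + k) / 2 ^ n)).
    eapply Rle_trans; [apply (bdry_bound _ _ _ _ _ M); try lra; auto|].
    - intros x1 y1 Hx1 Hy1.
      assert (Hd : Cmod ((x1, y1) - t)%C <= (h + k) / 2 ^ n).
      { eapply Rle_trans; [apply Cmod_le_sum|]; unfold t; simpl.
        assert (Rabs (x1 + - x) <= h / 2 ^ n) by (apply Rabs_le; lra).
        assert (Rabs (y1 + - y) <= k / 2 ^ n) by (apply Rabs_le; lra).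
        lra. }
      specialize (Kdl (x1, y1) ltac:(lra)).
      unfold af; replace (g (x1, y1) - (g t + ((x1, y1) - t) * l))%C
        with (g (x1, y1) - g t - ((x1, y1) - t) * l)%C by ring.
      eapply Rle_trans; [apply Kdl|]; unfold M; apply Rmult_le_compat_l; lra.
    - rewrite H5, H6, Hsum; unfold M, eps; right; field; split; lra. }
  apply Cmod_eq_0; apply Rle_antisym; [|apply Cmod_ge_0].
  apply Rnot_lt_le; intro Hp.
  assert (Ha : 0 < (b - a) * (d - c)) by nra.
  specialize (key (Cmod (bdry g a b c d) / (2 * ((b - a) * (d - c)))) ltac:(apply Rdiv_lt_0_compat; lra)).
  replace (Cmod (bdry g a b c d) / (2 * ((b - a) * (d - c))) * ((b - a) * (d - c)))
    with (Cmod (bdry g a b c d) / 2) in key by (field; lra).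
  lra.
Qed.

(** * Circle means *)

Definition circ (r t : R) : C := (r * cos t, r * sin t).
Definition avg (r : R) (F : C -> R) : R := RInt (fun t => F (circ r t)) 0 (2 * PI) / (2 * PI).
Definition avgC (r : R) (f : C -> C) : C := (avg r (fun z => fst (f z)), avg r (fun z => snd (f z))).
(** Continuity along the circle only, so that functions with poles elsewhere qualify. *)
Definition rc (r : R) (F : C -> R) : Prop := forall t, continuous (fun s => F (circ r s)) t.
Definition cc (r : R) (f : C -> C) : Prop := forall t, pcont (fun s => f (circ r s)) t.
Lemma Cmod_circ r t : 0 <= r -> Cmod (circ r t) = r.
Proof.
  intros Hr; unfold Cmod, circ; simpl.
  replace (r * cos t * (r * cos t * 1) + r * sin t * (r * sin t * 1)) with
    (r ^ 2 * ((sin t)² + (cos t)²)) by (unfold Rsqr; ring).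
  rewrite sin2_cos2, Rmult_1_r; now apply sqrt_pow2.
Qed.
Lemma twoPI_pos : 0 < 2 * PI.
Proof. generalize PI_RGT_0; lra. Qed.
Lemma PD_circ r t : PD (circ r) t (Ci * circ r t)%C.
Proof.
  split; unfold circ; simpl; auto_derive; auto; ring.
Qed.
Lemma cc_ccont r f : 0 <= r -> (forall z, Cmod z = r -> ccont f z) -> cc r f.
Proof.
  intros Hr H t; apply (pcont_comp f (circ r)); [eapply PD_pcont, PD_circ|].
  apply H, Cmod_circ, Hr.
Qed.
Lemma ex_circ r F : rc r F -> ex_RInt (fun t => F (circ r t)) 0 (2 * PI).
Proof. intros H; apply ex_RInt_c; [generalize twoPI_pos; lra | intros; apply H]. Qed.
Lemma avg_ext r F G : 0 <= r -> (forall z, Cmod z = r -> F z = G z) -> avg r F = avg r G.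
Proof.
  intros Hr H; unfold avg; f_equal; apply RInt_eq; intros t; apply H, Cmod_circ, Hr.
Qed.
Lemma avg_lin r F G k m : rc r F -> rc r G ->
  avg r (fun z => k * F z + m * G z) = k * avg r F + m * avg r G.
Proof.
  intros HF HG; unfold avg.
  rewrite (RInt_lin (fun t => F (circ r t)) (fun t => G (circ r t))) by (apply ex_circ; auto).
  field; generalize twoPI_pos; lra.
Qed.
Lemma avg_const r k : avg r (fun _ => k) = k.
Proof.
  unfold avg; assert (E : RInt (fun _ => k) 0 (2 * PI) = (2 * PI - 0) * k)
    by exact (RInt_const (V := R_CompleteNormedModule) 0 (2 * PI) k).
  rewrite E; field; generalize PI_RGT_0; lra.
Qed.
Lemma avg_plus r F G : rc r F -> rc r G -> avg r (fun z => F z + G z) = avg r F + avg r G.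
Proof.
  intros HF HG; replace (avg r F + avg r G) with (1 * avg r F + 1 * avg r G) by ring.
  rewrite <- avg_lin by auto; unfold avg; f_equal; apply RInt_eq; intros; ring.
Qed.
Lemma avg_scal r F k : rc r F -> avg r (fun z => k * F z) = k * avg r F.
Proof.
  intros HF; replace (k * avg r F) with (k * avg r F + 0 * avg r F) by ring.
  rewrite <- avg_lin by auto; unfold avg; f_equal; apply RInt_eq; intros; ring.
Qed.
Lemma avg_le r F G : 0 <= r -> rc r F -> rc r G -> (forall z, Cmod z = r -> F z <= G z) ->
  avg r F <= avg r G.
Proof.
  intros Hr HF HG H; unfold avg, Rdiv; apply Rmult_le_compat_r.
  - left; apply Rinv_0_lt_compat, twoPI_pos.
  - apply RInt_le; try apply ex_circ; auto; [generalize twoPI_pos; lra|].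
    intros t _; apply H, Cmod_circ, Hr.
Qed.
Lemma rc_const r k : rc r (fun _ => k).
Proof. intros t; apply continuous_const. Qed.
Lemma rc_plus r F G : rc r F -> rc r G -> rc r (fun z => F z + G z).
Proof. intros H K t; apply (continuous_plus (V := R_NormedModule)); [apply H | apply K]. Qed.
Lemma rc_mult r F G : rc r F -> rc r G -> rc r (fun z => F z * G z).
Proof. intros H K t; apply (continuous_mult (K := R_AbsRing)); [apply H | apply K]. Qed.
Lemma rc_scal r F k : rc r F -> rc r (fun z => k * F z).
Proof. intros H; apply rc_mult; auto; apply rc_const. Qed.
Lemma rc_comp r F (h : R -> R) : rc r F -> (forall z, Cmod z = r -> continuous h (F z)) -> 0 <= r ->
  rc r (fun z => h (F z)).
Proof.
  intros H K Hr t; apply (continuous_comp (fun s => F (circ r s)) h); [apply H|].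
  apply K, Cmod_circ, Hr.
Qed.
Lemma rc_Cmod r f : cc r f -> rc r (fun z => Cmod (f z)).
Proof. intros H t; apply (pcont_Cmod (fun s => f (circ r s))), H. Qed.
Lemma rc_fst r f : cc r f -> rc r (fun z => fst (f z)).
Proof. intros H t; apply (H t). Qed.
Lemma rc_snd r f : cc r f -> rc r (fun z => snd (f z)).
Proof. intros H t; apply (H t). Qed.
Lemma cc_const r c : cc r (fun _ => c).
Proof. intros t; apply pcont_const. Qed.
Lemma cc_minus r f g : cc r f -> cc r g -> cc r (fun z => f z - g z)%C.
Proof. intros H K t; apply (pcont_minus (fun s => f (circ r s)) (fun s => g (circ r s))); auto. Qed.
Lemma cc_mult r f g : cc r f -> cc r g -> cc r (fun z => f z * g z)%C.
Proof. intros H K t; apply (pcont_mult (fun s => f (circ r s)) (fun s => g (circ r s))); auto. Qed.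
Lemma cc_RtoC r F : rc r F -> cc r (fun z => RtoC (F z)).
Proof. intros H t; apply (pcont_RtoC (fun s => F (circ r s))), H. Qed.
Lemma avgC_CI r f : cc r f -> CI (fun t => f (circ r t)) 0 (2 * PI) = (RtoC (2 * PI) * avgC r f)%C.
Proof.
  intros H; unfold CI, avgC, avg, Cmult, RtoC; simpl; generalize twoPI_pos; intros.
  f_equal; symmetry; match goal with |- ?a = ?b => change (@eq R a b) end; field; lra.
Qed.
Lemma avgC_ext r f g : 0 <= r -> (forall z, Cmod z = r -> f z = g z) -> avgC r f = avgC r g.
Proof. intros Hr H; unfold avgC; f_equal; apply avg_ext; auto; intros; rewrite H; auto. Qed.
Lemma avgC_const r c : avgC r (fun _ => c) = c.
Proof. unfold avgC; rewrite !avg_const; now destruct c. Qed.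
Lemma avgC_plus r f g : cc r f -> cc r g -> avgC r (fun z => f z + g z)%C = (avgC r f + avgC r g)%C.
Proof.
  intros H K; unfold avgC, Cplus; simpl; f_equal; apply avg_plus; first [apply rc_fst|apply rc_snd]; auto.
Qed.
Lemma avgC_scal r c f : cc r f -> avgC r (fun z => c * f z)%C = (c * avgC r f)%C.
Proof.
  intros H; unfold avgC, Cmult; simpl; f_equal.
  - replace (fst c * avg r (fun z => fst (f z)) - snd c * avg r (fun z => snd (f z))) with
      (fst c * avg r (fun z => fst (f z)) + - snd c * avg r (fun z => snd (f z))) by ring.
    rewrite <- avg_lin by (try apply rc_fst; try apply rc_snd; auto).
    unfold avg; f_equal; apply RInt_eq; intros; ring.
  - apply avg_lin; try apply rc_fst; try apply rc_snd; auto.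
Qed.
Lemma avgC_minus r f g : cc r f -> cc r g -> avgC r (fun z => f z - g z)%C = (avgC r f - avgC r g)%C.
Proof.
  intros H K; transitivity (avgC r (fun z => f z + (-(1)) * g z)%C).
  - unfold avgC, avg; f_equal; f_equal; apply RInt_eq; intros; simpl; ring.
  - rewrite avgC_plus, avgC_scal; auto; [ring|]. apply cc_mult; auto; apply cc_const.
Qed.
Lemma Cmod_avgC_le r f : 0 <= r -> cc r f -> Cmod (avgC r f) <= avg r (fun z => Cmod (f z)).
Proof.
  intros Hr H; set (a := avgC r f).
  destruct (Req_dec (Cmod a) 0) as [E|E].
  - rewrite E, <- (avg_const r 0); apply avg_le; auto; [apply rc_const | now apply rc_Cmod|].
    intros; apply Cmod_ge_0.
  - assert (Hp : 0 < Cmod a) by (generalize (Cmod_ge_0 a); lra).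
    (* multiply by the conjugate of the mean to make it real *)
    assert (E1 : Cmod a ^ 2 = avg r (fun z => fst (Cconj a * f z)%C)).
    { transitivity (fst (avgC r (fun z => Cconj a * f z)%C)); [|reflexivity].
      rewrite avgC_scal by auto; fold a; rewrite Cmult_comm, <- Cmod2_conj; reflexivity. }
    assert (E2 : Cmod a ^ 2 <= Cmod a * avg r (fun z => Cmod (f z))).
    { rewrite E1, <- avg_scal by now apply rc_Cmod.
      apply avg_le; auto.
      - apply (rc_fst r (fun z => Cconj a * f z)%C), cc_mult; auto; apply cc_const.
      - apply rc_scal; now apply rc_Cmod.
      - intros z _; eapply Rle_trans; [apply Rle_abs|].
        eapply Rle_trans; [apply fst_le_Cmod|]; rewrite Cmod_mult, Cmod_conj; lra. }
    simpl in E2; rewrite Rmult_1_r in E2; now apply Rmult_le_reg_l with (Cmod a).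
Qed.
Lemma avgC_conj r f : cc r f -> avgC r (fun z => Cconj (f z)) = Cconj (avgC r f).
Proof.
  intros H; unfold avgC, Cconj; simpl; f_equal.
  replace (- avg r (fun z => snd (f z))) with (-1 * avg r (fun z => snd (f z))) by ring.
  rewrite <- avg_scal by now apply rc_snd.
  unfold avg; f_equal; apply RInt_eq; intros; ring.
Qed.
Lemma cc_conj r f : cc r f -> cc r (fun z => Cconj (f z)).
Proof.
  intros H t; destruct (H t) as [H1 H2]; split; simpl; auto.
  apply (continuous_opp (V := R_NormedModule)); auto.
Qed.

(** * The complex exponential and mean values over circles *)

Definition cexp (w : C) : C := (exp (fst w) * cos (snd w), exp (fst w) * sin (snd w)).
Lemma cexp_plus a b : cexp (a + b)%C = (cexp a * cexp b)%C.
Proof.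
  unfold cexp, Cmult; simpl; rewrite exp_plus, cos_plus, sin_plus; f_equal; ring.
Qed.
(** Only the point 0 is estimated by hand, from the real derivatives of exp, cos and sin; the
    functional equation carries the result to every other point. *)
Lemma D_cexp0 : D cexp 0 1.
Proof.
  intros eps He.
  assert (X : forall (f : R -> R) l, is_derive f 0 l -> forall e, 0 < e -> exists d, 0 < d /\
     forall s, Rabs s < d -> Rabs (f s - f 0 - s * l) <= e * Rabs s).
  { intros f l H e Hpe; destruct (proj1 (deriv_eps f 0 l) H e Hpe) as [d [Hd K]].
    exists d; split; auto; intros s Hs; specialize (K s); rewrite Rminus_0_r in K; auto. }
  set (e := Rmin (eps / 8) 1).
  assert (Hpe : 0 < e) by (unfold e; apply Rmin_glb_lt; lra).
  assert (e <= eps / 8) by apply Rmin_l.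
  assert (e <= 1) by apply Rmin_r.
  destruct (X exp 1 ltac:(auto_derive; auto; rewrite exp_0; ring) e Hpe) as [d1 [Hd1 K1]].
  destruct (X cos 0 ltac:(auto_derive; auto; rewrite sin_0; ring) e Hpe) as [d2 [Hd2 K2]].
  destruct (X sin 1 ltac:(auto_derive; auto; rewrite cos_0; ring) e Hpe) as [d3 [Hd3 K3]].
  rewrite exp_0 in K1; rewrite cos_0 in K2; rewrite sin_0 in K3.
  exists (Rmin (e / 4) (Rmin d1 (Rmin d2 d3))); split; [repeat apply Rmin_glb_lt; lra|].
  intros w Hw; replace (w - 0)%C with w in * by ring.
  assert (S0 := Rlt_le_trans _ _ _ Hw (Rmin_l _ _)).
  assert (S' := Rlt_le_trans _ _ _ Hw (Rmin_r _ _)).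
  assert (S1 := Rlt_le_trans _ _ _ S' (Rmin_l _ _)).
  assert (S'' := Rlt_le_trans _ _ _ S' (Rmin_r _ _)).
  assert (S2 := Rlt_le_trans _ _ _ S'' (Rmin_l _ _)).
  assert (S3 := Rlt_le_trans _ _ _ S'' (Rmin_r _ _)).
  destruct w as [x y].
  assert (Bx := fst_le_Cmod (x, y)); assert (By := snd_le_Cmod (x, y)); simpl in Bx, By.
  specialize (K1 x ltac:(lra)); specialize (K2 y ltac:(lra)); specialize (K3 y ltac:(lra)).
  set (m := Cmod (x, y)) in *.
  assert (Ex : Rabs (exp x - 1) <= 2 * m).
  { replace (exp x - 1) with ((exp x - 1 - x * 1) + x) by ring.
    eapply Rle_trans; [apply Rabs_triang|]; assert (0 <= Rabs x) by apply Rabs_pos; nra. }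
  assert (Em : Rabs (exp x) <= 2).
  { replace (exp x) with ((exp x - 1) + 1) by ring.
    eapply Rle_trans; [apply Rabs_triang|]; rewrite (Rabs_pos_eq 1) by lra; lra. }
  eapply Rle_trans; [apply Cmod_le_sum|]; unfold cexp; simpl.
  rewrite exp_0, cos_0, sin_0.
  assert (Hm : 0 <= m) by apply Cmod_ge_0.
  assert (Z1 : Rabs (exp x * cos y + - (1 * 1) + - (x * 1 - y * 0)) <= 3 * e * m).
  { replace (exp x * cos y + - (1 * 1) + - (x * 1 - y * 0)) with
      ((exp x - 1 - x * 1) + exp x * (cos y - 1 - y * 0)) by ring.
    eapply Rle_trans; [apply Rabs_triang|]; rewrite Rabs_mult.
    assert (Rabs (exp x) * Rabs (cos y - 1 - y * 0) <= 2 * (e * Rabs y))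
      by (apply Rmult_le_compat; auto using Rabs_pos).
    nra. }
  assert (Z2 : Rabs (exp x * sin y + - (1 * 0) + - (x * 0 + y * 1)) <= 3 * e * m).
  { replace (exp x * sin y + - (1 * 0) + - (x * 0 + y * 1)) with
      ((exp x - 1) * y + exp x * (sin y - 0 - y * 1)) by ring.
    eapply Rle_trans; [apply Rabs_triang|]; rewrite !Rabs_mult.
    assert (Rabs (exp x) * Rabs (sin y - 0 - y * 1) <= 2 * (e * Rabs y))
      by (apply Rmult_le_compat; auto using Rabs_pos).
    assert (Rabs (exp x - 1) * Rabs y <= (2 * m) * m)
      by (apply Rmult_le_compat; auto using Rabs_pos).
    nra. }
  nra.
Qed.
Lemma D_cexp w : D cexp w (cexp w).
Proof.
  apply (D_ext (fun x => cexp w * cexp (x - w))%C).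
  - apply near_all; intros x; rewrite <- cexp_plus; f_equal; ring.
  - eapply D_eq; [apply D_scal, (D_comp cexp (fun x => x - w)%C);
      [apply D_minus; [apply D_id | apply D_const]|]|].
    + replace (w - w)%C with (RtoC 0) by ring; apply D_cexp0.
    + ring.
Qed.
Lemma cexp_circ r t : 0 < r -> cexp (ln r, t) = circ r t.
Proof. intros; unfold cexp, circ; simpl; now rewrite exp_ln. Qed.
Lemma Cmod_cexp w : Cmod (cexp w) = exp (fst w).
Proof.
  destruct w as [x y]; rewrite <- (ln_exp x) at 1; rewrite cexp_circ by apply exp_pos.
  rewrite Cmod_circ; [reflexivity | left; apply exp_pos].
Qed.
(** Pulled back by the exponential, the annulus is the rectangle [ln r0, ln r1] x [0, 2 pi]. Its
    horizontal sides cancel by periodicity and its vertical sides are the two means. *)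
Lemma mvp_annulus f r0 r1 : 0 < r0 -> r0 < r1 -> (forall z, r0 <= Cmod z <= r1 -> df f z) ->
  avgC r0 f = avgC r1 f.
Proof.
  intros H0 H1 H.
  assert (HC : forall r, r0 <= r <= r1 -> cc r f).
  { intros r Hr; apply cc_ccont; [lra|]; intros z Hz.
    destruct (H z ltac:(lra)) as [l Hl]; eapply D_cont; eauto. }
  assert (G : bdry (fun w => f (cexp w)) (ln r0) (ln r1) 0 (2 * PI) = RtoC 0).
  { apply goursat; [now apply ln_increasing | apply twoPI_pos|].
    intros x y [Hx1 Hx2] Hy.
    destruct (H (cexp (x, y))) as [l Hl].
    - rewrite Cmod_cexp; simpl; split.
      + rewrite <- (exp_ln r0) by auto.
        destruct Hx1 as [Hx1|Hx1]; [left; now apply exp_increasing | right; now rewrite Hx1].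
      + rewrite <- (exp_ln r1) by lra.
        destruct Hx2 as [Hx2|Hx2]; [left; now apply exp_increasing | right; now rewrite Hx2].
    - eexists; apply (D_comp f cexp); [apply D_cexp | exact Hl]. }
  unfold bdry in G.
  assert (E : forall r, r0 <= r <= r1 -> CI (fun y => f (cexp (ln r, y))) 0 (2 * PI) = (RtoC (2 * PI) * avgC r f)%C).
  { intros r Hr; rewrite <- avgC_CI by auto; apply CI_ext; [generalize twoPI_pos; lra|].
    intros t _; rewrite cexp_circ; auto; lra. }
  rewrite (E r0), (E r1) in G by lra.
  rewrite (CI_ext (fun x => f (cexp (x, 2 * PI))) (fun x => f (cexp (x, 0)))) in G.
  - assert (Hpi : RtoC (2 * PI) <> RtoC 0) by (intro X; apply RtoC_inj in X; generalize twoPI_pos; lra).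
    assert (HCi : Ci <> RtoC 0) by (intro X; apply (f_equal snd) in X; simpl in X; lra).
    assert (X : (Ci * RtoC (2 * PI) * (avgC r1 f - avgC r0 f))%C = RtoC 0) by (rewrite <- G; ring).
    apply Cmult_integral in X; destruct X as [X|X].
    + apply Cmult_integral in X; destruct X; contradiction.
    + symmetry; now apply Csub_eq.
  - left; now apply ln_increasing.
  - intros t _; f_equal; unfold cexp; simpl; rewrite cos_2PI, sin_2PI, cos_0, sin_0; f_equal; ring.
Qed.
Lemma avgC_near_const r f c e : 0 <= r -> cc r f -> (forall z, Cmod z = r -> Cmod (f z - c)%C <= e) ->
  Cmod (avgC r f - c)%C <= e.
Proof.
  intros Hr Hf He.
  replace (avgC r f - c)%C with (avgC r (fun z => f z - c)%C)
    by (rewrite avgC_minus, avgC_const by (auto; apply cc_const); ring).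
  assert (cc r (fun z => f z - c)%C) by (apply cc_minus; auto; apply cc_const).
  eapply Rle_trans; [now apply Cmod_avgC_le|].
  rewrite <- (avg_const r e); apply avg_le; auto; [now apply rc_Cmod | apply rc_const].
Qed.
Lemma C_eq_eps (a b : C) : (forall e, 0 < e -> Cmod (a - b)%C <= e) -> a = b.
Proof.
  intros H; apply Csub_eq, Cmod_eq_0; apply Rle_antisym; [|apply Cmod_ge_0].
  apply le_epsilon; intros e He; rewrite Rplus_0_l; auto.
Qed.
(** The inner circle of the annulus shrinks to 0, so continuity suffices at the centre. *)
Lemma mvp_center f R0 : 0 < R0 -> (forall z, z <> RtoC 0 -> Cmod z <= R0 -> df f z) -> ccont f 0 ->
  avgC R0 f = f 0.
Proof.
  intros HR Hd Hc; apply C_eq_eps; intros e He.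
  destruct (Hc e He) as [d [Hdp K]].
  set (r := Rmin (d / 2) (R0 / 2)).
  assert (Hr : 0 < r) by (unfold r; apply Rmin_glb_lt; lra).
  assert (L1 : r <= d / 2) by apply Rmin_l; assert (L2 : r <= R0 / 2) by apply Rmin_r.
  assert (Hdz : forall z, r <= Cmod z <= R0 -> df f z).
  { intros z Hz; apply Hd; [apply Cmod_pos_neq|]; lra. }
  rewrite <- (mvp_annulus f r R0) by (auto; lra).
  apply avgC_near_const; [lra| |].
  - apply cc_ccont; [lra|]; intros z Hz; destruct (Hdz z ltac:(lra)) as [l Hl]; eapply D_cont; eauto.
  - intros z Hz; left; apply K; replace (z - 0)%C with z by ring; lra.
Qed.
(** Polar coordinates prepare the uniform continuity in the angle that [mvp_exc] uses. *)
Lemma ccont_2d f r0 t0 : ccont f (circ r0 t0) -> 0 <= r0 ->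
  continuity_2d_pt (fun r t => fst (f (circ r t))) r0 t0 /\
  continuity_2d_pt (fun r t => snd (f (circ r t))) r0 t0.
Proof.
  intros H Hr.
  assert (X : forall eps, 0 < eps -> locally_2d (fun r t => Cmod (f (circ r t) - f (circ r0 t0))%C < eps) r0 t0).
  { intros eps He; destruct (H eps He) as [d [Hd K]].
    assert (C1 : continuity_2d_pt (fun r t => r * cos t) r0 t0).
    { apply continuity_2d_pt_mult; [apply continuity_2d_pt_id1|].
      apply (continuity_1d_2d_pt_comp cos); [apply continuity_cos | apply continuity_2d_pt_id2]. }
    assert (C2 : continuity_2d_pt (fun r t => r * sin t) r0 t0).
    { apply continuity_2d_pt_mult; [apply continuity_2d_pt_id1|].
      apply (continuity_1d_2d_pt_comp sin); [apply continuity_sin | apply continuity_2d_pt_id2]. }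
    assert (Hd2 : 0 < d / 2) by lra.
    generalize (locally_2d_and _ _ _ _ (C1 (mkposreal _ Hd2)) (C2 (mkposreal _ Hd2))).
    apply locally_2d_impl, locally_2d_forall; intros r t [A1 A2]; simpl in A1, A2.
    apply K; eapply Rle_lt_trans; [apply Cmod_le_sum|]; unfold circ; simpl; unfold Rminus in *; lra. }
  split; intros eps; generalize (X eps (cond_pos eps)); apply locally_2d_impl, locally_2d_forall;
    intros r t A; (eapply Rle_lt_trans; [|exact A]).
  - apply (fst_le_Cmod (f (circ r t) - f (circ r0 t0))%C).
  - apply (snd_le_Cmod (f (circ r t) - f (circ r0 t0))%C).
Qed.
(** The exceptional point is where the difference quotient in Cauchy's formula is merely continuous.
    The means are constant inside and outside the circle through [z0], and uniform continuity across
    that circle joins the two constants. *)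
Lemma mvp_exc f R0 z0 : 0 < R0 -> (forall z, z <> z0 -> Cmod z <= R0 -> df f z) -> ccont f z0 ->
  Cmod z0 < R0 -> avgC R0 f = f 0.
Proof.
  intros HR Hd Hc Hz.
  assert (Hcc : forall z, Cmod z <= R0 -> ccont f z).
  { intros z Hzz; destruct (excluded_middle_informative (z = z0)) as [->|n]; auto.
    destruct (Hd z n Hzz) as [l Hl]; eapply D_cont; eauto. }
  destruct (excluded_middle_informative (z0 = RtoC 0)) as [->|Hn]; [now apply mvp_center|].
  assert (Hrho : 0 < Cmod z0) by now apply Cmod_pos.
  set (rho := Cmod z0) in *.
  apply C_eq_eps; intros e He.
  assert (U : exists d, 0 < d /\ forall r t, 0 <= t <= 2 * PI -> Rabs (r - rho) <= d ->
     Cmod (f (circ r t) - f (circ rho t))%C <= e / 4).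
  { assert (He4 : 0 < e / 8) by lra.
    destruct (uniform_continuity_2d_1d' (fun r t => fst (f (circ r t))) 0 (2 * PI) rho) with (eps := mkposreal _ He4) as [d1 K1].
    { intros t _; apply ccont_2d; [|lra]; apply Hcc; rewrite Cmod_circ; lra. }
    destruct (uniform_continuity_2d_1d' (fun r t => snd (f (circ r t))) 0 (2 * PI) rho) with (eps := mkposreal _ He4) as [d2 K2].
    { intros t _; apply ccont_2d; [|lra]; apply Hcc; rewrite Cmod_circ; lra. }
    assert (P1 := cond_pos d1); assert (P2 := cond_pos d2).
    exists (Rmin d1 d2); split; [now apply Rmin_glb_lt|].
    intros r t Ht Hrr; assert (L1 := Rmin_l d1 d2); assert (L2 := Rmin_r d1 d2).
    apply Rabs_le_between in Hrr.
    specialize (K1 t rho t r Ht ltac:(lra) Ht ltac:(lra) ltac:(unfold Rminus; rewrite Rplus_opp_r, Rabs_R0; lra)).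
    specialize (K2 t rho t r Ht ltac:(lra) Ht ltac:(lra) ltac:(unfold Rminus; rewrite Rplus_opp_r, Rabs_R0; lra)).
    eapply Rle_trans; [apply Cmod_le_sum|]; simpl in *; unfold Rminus in *; lra. }
  destruct U as [d [Hdp U]].
  (* Small enough that rho - h and rho + h lie strictly between 0 and R0 and within reach of [U]. *)
  set (h := Rmin (d / 2) (Rmin (rho / 2) ((R0 - rho) / 2))).
  assert (Hh : 0 < h) by (unfold h; repeat apply Rmin_glb_lt; lra).
  assert (L1 : h <= d / 2) by apply Rmin_l.
  assert (L2 : h <= rho / 2) by (eapply Rle_trans; [apply Rmin_r | apply Rmin_l]).
  assert (L3 : h <= (R0 - rho) / 2) by (eapply Rle_trans; [apply Rmin_r | apply Rmin_r]).
  rewrite <- (mvp_annulus f (rho + h) R0); [|lra|lra|].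
  2:{ intros z Hzz; apply Hd; [intros ->; fold rho in Hzz; lra | lra]. }
  rewrite <- (mvp_center f (rho - h)); [|lra| |apply Hcc; rewrite Cmod_0; lra].
  2:{ intros z _ Hzz; apply Hd; [intros ->; fold rho in Hzz; lra | lra]. }
  assert (HCc : forall r, 0 <= r <= R0 -> cc r f) by (intros r Hrr; apply cc_ccont; [lra|]; intros; apply Hcc; lra).
  assert (key : forall r, 0 <= r <= R0 -> Rabs (r - rho) <= d -> Cmod (avgC r f - avgC rho f)%C <= e / 2).
  { intros r Hr Hrr.
    set (F := fun z : C => (f (circ r (fst z)) - f (circ rho (fst z)))%C).
    assert (PF : Pc (fun t => f (circ r t) - f (circ rho t))%C 0 (2 * PI)).
    { intros t _; apply pcont_minus; apply HCc; lra. }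
    assert (I : (RtoC (2 * PI) * (avgC r f - avgC rho f))%C = CI (fun t => f (circ r t) - f (circ rho t))%C 0 (2 * PI)).
    { rewrite CI_minus, !avgC_CI by (first [generalize twoPI_pos; lra | apply HCc; lra | intros t _; apply HCc; lra]).
      ring. }
    assert (B : Cmod (avgC r f - avgC rho f)%C <= 2 * (e / 4)).
    { apply Rmult_le_reg_l with (2 * PI); [apply twoPI_pos|].
      rewrite <- (Rabs_pos_eq (2 * PI)) at 1 by (generalize twoPI_pos; lra).
      rewrite <- Cmod_R, <- Cmod_mult, I.
      eapply Rle_trans; [apply (CI_bound _ 0 (2 * PI) (e / 4)); [generalize twoPI_pos; lra | exact PF |]|right; ring].
      intros t Ht; apply U; auto. }
    lra. }
  replace (avgC (rho + h) f - avgC (rho - h) f)%C with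
    ((avgC (rho + h) f - avgC rho f) - (avgC (rho - h) f - avgC rho f))%C by ring.
  eapply Rle_trans; [apply Cmod_tri_minus|].
  assert (K1 := key (rho + h) ltac:(lra) ltac:(apply Rabs_le; lra)).
  assert (K2 := key (rho - h) ltac:(lra) ltac:(apply Rabs_le; lra)).
  lra.
Qed.

(** * The Cauchy integral formula *)

(** The Cauchy kernel with respect to the normalised angle on a circle; [k2] and [k3] are its first
    two derivatives in [w]. *)
Definition k1 (w x : C) : C := (x / (x - w))%C.
Definition k2 (w x : C) : C := (x / ((x - w) * (x - w)))%C.
Definition k3 (w x : C) : C := (2 * x / ((x - w) * (x - w) * (x - w)))%C.
Lemma ccont_id z : ccont (fun x => x) z.
Proof. eapply D_cont, D_id. Qed.
Lemma circ_neq r x w : Cmod x = r -> Cmod w < r -> (x - w)%C <> RtoC 0.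
Proof. intros H K; apply Csub_neq; intros ->; lra. Qed.
Lemma cc_k r w n : 0 < r -> Cmod w < r -> cc r (fun x => / (x - w) ^ n)%C.
Proof.
  intros Hr Hw; apply cc_ccont; [lra|]; intros z Hz.
  assert (Hn := circ_neq _ _ _ Hz Hw).
  apply (ccont_inv (fun x => (x - w) ^ n)%C); [|now apply Cpow_nz].
  eapply D_cont, D_pow, D_minus; [apply D_id | apply D_const].
Qed.
Lemma cc_id r : 0 <= r -> cc r (fun x => x).
Proof. intros; apply cc_ccont; auto; intros; apply ccont_id. Qed.
Lemma cc_ext r f g : 0 <= r -> (forall z, Cmod z = r -> f z = g z) -> cc r f -> cc r g.
Proof.
  intros Hr E H t; destruct (H t) as [H1 H2]; split;
    [apply (continuous_ext (fun s => fst (f (circ r s)))) | apply (continuous_ext (fun s => snd (f (circ r s))))];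
    auto; intros x; now rewrite E by now apply Cmod_circ.
Qed.
Lemma cc_k1 r w : 0 < r -> Cmod w < r -> cc r (k1 w).
Proof.
  intros Hr Hw; apply (cc_ext r (fun x => x * / (x - w) ^ 1)%C); [lra| |].
  - intros z Hz; unfold k1; simpl; field; eapply circ_neq; eauto.
  - apply cc_mult; [apply cc_id; lra | now apply cc_k].
Qed.
Lemma cc_k2 r w : 0 < r -> Cmod w < r -> cc r (k2 w).
Proof.
  intros Hr Hw; apply (cc_ext r (fun x => x * / (x - w) ^ 2)%C); [lra| |].
  - intros z Hz; unfold k2; simpl; field; eapply circ_neq; eauto.
  - apply cc_mult; [apply cc_id; lra | now apply cc_k].
Qed.
Lemma cc_k3 r w : 0 < r -> Cmod w < r -> cc r (k3 w).
Proof.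
  intros Hr Hw; apply (cc_ext r (fun x => (2 * x) * / (x - w) ^ 3)%C); [lra| |].
  - intros z Hz; unfold k3; simpl; field; eapply circ_neq; eauto.
  - apply cc_mult; [apply cc_mult; [apply cc_const | apply cc_id; lra] | now apply cc_k].
Qed.
Lemma kern_D r phi (k k' : C -> C -> C) z : 0 < r -> Cmod z < r -> cc r phi ->
  (forall w, Cmod w < r -> cc r (k w)) -> cc r (k' z) ->
  (exists M, near z (fun w => forall x, Cmod x = r ->
     Cmod (k w x - k z x - (w - z) * k' z x)%C <= M * (Cmod (w - z)%C * Cmod (w - z)%C))) ->
  D (fun w => avgC r (fun x => phi x * k w x)%C) z (avgC r (fun x => phi x * k' z x)%C).
(* Differentiation under the mean: the quadratic Taylor bound of the kernel is uniform on the
   circle, so it survives integration against |phi|. *)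
Proof.
  intros Hr Hz Hphi Hk Hk' [M HM] eps He.
  set (A := avg r (fun x => Cmod (phi x))).
  assert (HA : 0 <= A).
  { unfold A; rewrite <- (avg_const r 0); apply avg_le; [lra|apply rc_const|now apply rc_Cmod|].
    intros; apply Cmod_ge_0. }
  generalize (near_and _ _ _ (near_and _ _ _ HM (near_lt _ _ Hz))
    (near_dist z (A * Rabs M) eps ltac:(apply Rmult_le_pos; auto using Rabs_pos) He)).
  apply near_imp; intros w [[H1 H2] H3].
  assert (C1 : cc r (fun x => phi x * k w x)%C) by (apply cc_mult; auto).
  assert (C2 : cc r (fun x => phi x * k z x)%C) by (apply cc_mult; auto).
  assert (C3 : cc r (fun x => phi x * k' z x)%C) by (apply cc_mult; auto).
  assert (C4 : cc r (fun x => (w - z) * (phi x * k' z x))%C) by (apply cc_mult; auto; apply cc_const).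
  assert (C5 : cc r (fun x => phi x * k w x - phi x * k z x)%C) by (apply cc_minus; assumption).
  assert (C6 : cc r (fun x => phi x * k w x - phi x * k z x - (w - z) * (phi x * k' z x))%C) by (apply cc_minus; assumption).
  rewrite <- avgC_scal, <- !avgC_minus by assumption.
  set (d := Cmod (w - z)%C) in *.
  assert (Hd : 0 <= d) by apply Cmod_ge_0.
  eapply Rle_trans; [apply Cmod_avgC_le; [lra|exact C6]|].
  apply Rle_trans with (avg r (fun x => (Rabs M * (d * d)) * Cmod (phi x))).
  - apply avg_le; [lra|apply rc_Cmod; exact C6|apply rc_scal; now apply rc_Cmod|].
    intros x Hx.
    replace (phi x * k w x - phi x * k z x - (w - z) * (phi x * k' z x))%C with
      (phi x * (k w x - k z x - (w - z) * k' z x))%C by ring.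
    rewrite Cmod_mult, Rmult_comm; apply Rmult_le_compat_r; [apply Cmod_ge_0|].
    eapply Rle_trans; [now apply H1|]; apply Rmult_le_compat_r; [nra | apply Rle_abs].
  - rewrite avg_scal by now apply rc_Cmod.
    fold A. replace (Rabs M * (d * d) * A) with ((A * Rabs M * d) * d) by ring.
    apply Rmult_le_compat_r; lra.
Qed.
Lemma circ_dist r x w e : Cmod x = r -> Cmod w <= r - e -> e <= Cmod (x - w)%C.
Proof. intros; assert (T := Cmod_tri_sub x w); lra. Qed.
Lemma mul3_le e a b c : 0 < e -> e <= a -> e <= b -> e <= c -> e * e * e <= a * b * c.
Proof.
  intros; apply Rmult_le_compat; try lra; [nra|]; apply Rmult_le_compat; lra.
Qed.
Lemma k1_taylor r z : 0 < r -> Cmod z < r -> exists M, near z (fun w => forall x, Cmod x = r ->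
   Cmod (k1 w x - k1 z x - (w - z) * k2 z x)%C <= M * (Cmod (w - z)%C * Cmod (w - z)%C)).
Proof.
  intros Hr Hz; set (e := (r - Cmod z) / 2); assert (He : 0 < e) by (unfold e; lra).
  exists (r / (e * e * e)), e; split; auto; intros w Hw x Hx.
  assert (Hwz : Cmod w <= r - e).
  { assert (T := Cmod_tri_sub w z); unfold e in *; lra. }
  assert (Ha := circ_dist _ _ z e Hx ltac:(unfold e in *; lra)).
  assert (Hb := circ_dist _ _ w e Hx Hwz).
  assert (N1 : (x - z)%C <> RtoC 0) by (apply Cmod_pos_neq; lra).
  assert (N2 : (x - w)%C <> RtoC 0) by (apply Cmod_pos_neq; lra).
  replace (k1 w x - k1 z x - (w - z) * k2 z x)%C with
    (x / ((x - w) * (x - z) * (x - z)) * ((w - z) * (w - z)))%C by (unfold k1, k2; field; auto).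
  rewrite !Cmod_mult; apply Rmult_le_compat_r.
  - apply Rmult_le_pos; apply Cmod_ge_0.
  - rewrite Cmod_div by (repeat apply Cmult_neq_0; auto).
    rewrite !Cmod_mult, Hx; unfold Rdiv; apply Rmult_le_compat_l; [lra|].
    apply Rinv_le_contravar; [repeat (apply Rmult_lt_0_compat; [|exact He]); exact He|].
    now apply mul3_le.
Qed.
Lemma k2_taylor r z : 0 < r -> Cmod z < r -> exists M, near z (fun w => forall x, Cmod x = r ->
   Cmod (k2 w x - k2 z x - (w - z) * k3 z x)%C <= M * (Cmod (w - z)%C * Cmod (w - z)%C)).
Proof.
  intros Hr Hz; set (e := (r - Cmod z) / 2); assert (He : 0 < e) by (unfold e; lra).
  exists ((r * (8 * r)) / (e * e * e * e * e)), e; split; auto; intros w Hw x Hx.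
  assert (Hwz : Cmod w <= r - e).
  { assert (T := Cmod_tri_sub w z); unfold e in *; lra. }
  assert (Ha := circ_dist _ _ z e Hx ltac:(unfold e in *; lra)).
  assert (Hb := circ_dist _ _ w e Hx Hwz).
  assert (N1 : (x - z)%C <> RtoC 0) by (apply Cmod_pos_neq; lra).
  assert (N2 : (x - w)%C <> RtoC 0) by (apply Cmod_pos_neq; lra).
  replace (k2 w x - k2 z x - (w - z) * k3 z x)%C with
    (x * (3 * (x - w) + (w - z)) / ((x - w) * (x - w) * (x - z) * (x - z) * (x - z)) * ((w - z) * (w - z)))%C
    by (unfold k2, k3; field; auto).
  rewrite !Cmod_mult; apply Rmult_le_compat_r.
  - apply Rmult_le_pos; apply Cmod_ge_0.
  - rewrite Cmod_div by (repeat apply Cmult_neq_0; auto).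
    rewrite !Cmod_mult, Hx; unfold Rdiv; apply Rmult_le_compat.
    + apply Rmult_le_pos; [lra | apply Cmod_ge_0].
    + left; apply Rinv_0_lt_compat; repeat apply Rmult_lt_0_compat; lra.
    + apply Rmult_le_compat_l; [lra|].
      eapply Rle_trans; [apply Cmod_triangle|]; rewrite Cmod_mult, Cmod_R, Rabs_pos_eq by lra.
      assert (T := Cmod_tri_minus x w); unfold e in *; assert (0 <= Cmod z) by apply Cmod_ge_0; lra.
    + apply Rinv_le_contravar; [repeat (apply Rmult_lt_0_compat; [|exact He]); exact He|].
      apply Rmult_le_compat; [|lra| |exact Ha].
      { repeat apply Rmult_le_pos; lra. }
      apply Rmult_le_compat; [|lra|apply mul3_le; auto|exact Ha].
      repeat apply Rmult_le_pos; lra.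
Qed.
Lemma K1_D r phi z : 0 < r -> Cmod z < r -> cc r phi ->
  D (fun w => avgC r (fun x => phi x * k1 w x)%C) z (avgC r (fun x => phi x * k2 z x)%C).
Proof.
  intros Hr Hz Hphi; apply (kern_D r phi k1 k2); auto; [|now apply cc_k2|now apply k1_taylor].
  intros; now apply cc_k1.
Qed.
Lemma K2_D r phi z : 0 < r -> Cmod z < r -> cc r phi ->
  D (fun w => avgC r (fun x => phi x * k2 w x)%C) z (avgC r (fun x => phi x * k3 z x)%C).
Proof.
  intros Hr Hz Hphi; apply (kern_D r phi k2 k3); auto; [|now apply cc_k3|now apply k2_taylor].
  intros; now apply cc_k2.
Qed.
Lemma df_ccont f z : df f z -> ccont f z.
Proof. intros [l H]; eapply D_cont; eauto. Qed.
Lemma Cconj_mult_R r x : 0 < r -> Cmod x = r -> Cconj x = (RtoC (r * r) / x)%C.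
Proof.
  intros Hr Hx; assert (x <> RtoC 0) by (apply Cmod_pos_neq; lra).
  assert (E := Cmod2_conj x); rewrite Hx in E.
  replace (r * r) with (r ^ 2) by ring; rewrite E; field; auto.
Qed.
(* On |x| = r the conjugate of x is r^2 / x, so the conjugate of the kernel extends holomorphically. *)
Lemma avg_k1 r z : 0 < r -> Cmod z < r -> avgC r (k1 z) = RtoC 1.
Proof.
  intros Hr Hz; assert (Hc := cc_k1 r z Hr Hz).
  assert (E : avgC r (fun x => Cconj (k1 z x)) = RtoC 1).
  { assert (N : forall x, Cmod x <= r -> (RtoC (r * r) - Cconj z * x)%C <> RtoC 0).
    { intros x Hx; apply Csub_neq; intro E; apply (f_equal Cmod) in E.
      rewrite Cmod_R, Cmod_mult, Cmod_conj, Rabs_pos_eq in E by nra.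
      assert (0 <= Cmod z) by apply Cmod_ge_0; assert (0 <= Cmod x) by apply Cmod_ge_0; nra. }
    transitivity (avgC r (fun x => RtoC (r * r) / (RtoC (r * r) - Cconj z * x))%C).
    - apply avgC_ext; [lra|]; intros x Hx; unfold k1, Cdiv.
      assert (x <> RtoC 0) by (apply Cmod_pos_neq; lra).
      assert (Hn := circ_neq _ _ _ Hx Hz).
      rewrite Cmult_conj, Cinv_conj, Cminus_conj, (Cconj_mult_R r x Hr Hx) by auto.
      field; split; [apply N; lra | auto].
    - assert (Dk : forall x, Cmod x <= r -> df (fun x => RtoC (r * r) / (RtoC (r * r) - Cconj z * x))%C x).
      { intros x Hx; eexists; apply D_div; [now apply N|apply D_const|].
        apply D_minus; [apply D_const|apply D_scal, D_id]. }
      rewrite (mvp_center _ r Hr); [|intros; now apply Dk|apply df_ccont, Dk; rewrite Cmod_0; lra].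
      assert (Hrr : RtoC (r * r) <> RtoC 0) by (intro E; apply RtoC_inj in E; nra).
      field; replace (RtoC (r * r) - Cconj z * 0)%C with (RtoC (r * r)) by ring; exact Hrr. }
  rewrite avgC_conj in E by auto.
  apply (f_equal Cconj) in E; rewrite Cconj_conj in E; rewrite E.
  unfold Cconj, RtoC; simpl; f_equal; ring.
Qed.
(** The function x (f x - f z) / (x - z), continued by z l at z, vanishes at 0, so its mean is 0. On
    the circle it is (f x - f z) times the kernel, whose mean is 1. *)
Lemma cauchy f r z : 0 < r -> (forall w, Cmod w <= r -> df f w) -> Cmod z < r ->
  f z = avgC r (fun x => f x * k1 z x)%C.
Proof.
  intros Hr Hf Hz.
  assert (Hcf : cc r f) by (apply cc_ccont; [lra|]; intros w Hw; apply df_ccont, Hf; lra).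
  assert (Hck := cc_k1 r z Hr Hz).
  destruct (Hf z ltac:(lra)) as [l Hl].
  set (Phi := fun x => if excluded_middle_informative (x = z) then (z * l)%C
                 else (x * (f x - f z) / (x - z))%C).
  assert (P0 : Phi 0 = RtoC 0).
  { unfold Phi; destruct (excluded_middle_informative (RtoC 0 = z)) as [e|n].
    - rewrite <- e; ring.
    - unfold Cdiv; ring. }
  assert (M : avgC r Phi = Phi 0).
  { apply (mvp_exc Phi r z); auto.
    - intros w Hw Hwr.
      destruct (Hf w Hwr) as [m Hm].
      apply (df_ext (fun x => x * (f x - f z) / (x - z))%C).
      + generalize (near_neq _ _ Hw); apply near_imp; intros x Hx; unfold Phi.
        destruct (excluded_middle_informative (x = z)); [contradiction|reflexivity].
      + eexists; apply D_div; [now apply Csub_neq| |apply D_minus; [apply D_id|apply D_const]].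
        apply D_mult; [apply D_id | apply D_minus; [exact Hm | apply D_const]].
    - intros e He.
      assert (Hmz := Cmod_ge_0 z).
      set (e1 := Rmin 1 (e / (2 * (Cmod z + 2)))).
      assert (He1 : 0 < e1) by (unfold e1; apply Rmin_glb_lt; [lra|apply Rdiv_lt_0_compat; lra]).
      generalize (near_and _ _ _ (near_and _ _ _ (Hl e1 He1) (near_ball z 1 z ltac:(rewrite Cmod_self; lra)))
        (near_dist z (Cmod l) (e/2) (Cmod_ge_0 l) ltac:(lra))); apply near_imp; intros x [[H1 H2] H3].
      unfold Phi at 2; destruct (excluded_middle_informative (z = z)); [|congruence].
      unfold Phi; destruct (excluded_middle_informative (x = z)) as [->|n].
      + rewrite Cmod_self; lra.
      + assert (Hx := Csub_neq _ _ n).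
        replace (x * (f x - f z) / (x - z) - z * l)%C with
          (x * ((f x - f z - (x - z) * l) / (x - z)) + (x - z) * l)%C by (field; auto).
        eapply Rle_lt_trans; [apply Cmod_triangle|].
        rewrite !Cmod_mult.
        assert (Hq : Cmod ((f x - f z - (x - z) * l) / (x - z))%C <= e1).
        { rewrite Cmod_div by auto.
          apply Rmult_le_reg_r with (Cmod (x - z)%C); [now apply Cmod_pos|].
          unfold Rdiv; rewrite Rmult_assoc, Rinv_l, Rmult_1_r; [exact H1|].
          apply Rgt_not_eq; now apply Cmod_pos. }
        assert (Hxm : Cmod x <= Cmod z + 1).
        { assert (T := Cmod_tri_sub x z); lra. }
        assert (Cmod x * Cmod ((f x - f z - (x - z) * l) / (x - z))%C <= (Cmod z + 2) * (e / (2 * (Cmod z + 2)))).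
        { apply Rmult_le_compat; try apply Cmod_ge_0; [lra|]. eapply Rle_trans; [exact Hq|apply Rmin_r]. }
        replace ((Cmod z + 2) * (e / (2 * (Cmod z + 2)))) with (e / 2) in * by (field; lra).
        lra. }
  rewrite P0 in M.
  assert (E : avgC r Phi = (avgC r (fun x => f x * k1 z x) - f z * avgC r (k1 z))%C).
  { assert (Cx1 : cc r (fun x => f x * k1 z x)%C) by (apply cc_mult; assumption).
    assert (Cx2 : cc r (fun x => f z * k1 z x)%C) by (apply cc_mult; [apply cc_const|assumption]).
    rewrite <- avgC_scal, <- avgC_minus by assumption.
    apply avgC_ext; [lra|]; intros x Hx; unfold Phi.
    destruct (excluded_middle_informative (x = z)) as [->|n]; [lra|].
    unfold k1; field; now apply Csub_neq. }
  rewrite M, avg_k1 in E by auto.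
  symmetry; apply Csub_eq; rewrite E at 1; ring.
Qed.
Lemma cauchy_deriv f r z : 0 < r -> (forall w, Cmod w <= r -> df f w) -> Cmod z < r ->
  Cderive f z = avgC r (fun x => f x * k2 z x)%C.
Proof.
  intros Hr Hf Hz; apply Cderive_D.
  apply (D_ext (fun w => avgC r (fun x => f x * k1 w x)%C)).
  - generalize (near_lt _ _ Hz); apply near_imp; intros w Hw; symmetry; now apply cauchy.
  - apply K1_D; auto; apply cc_ccont; [lra|]; intros w Hw; apply df_ccont, Hf; lra.
Qed.
Lemma df_shift f c w : df f (c + w)%C -> df (fun x => f (c + x)%C) w.
Proof.
  intros [l H]; eexists; apply (D_comp f (fun x => c + x)%C); [|exact H].
  apply D_plus; [apply D_const | apply D_id].
Qed.
Lemma Cderive_shift f c w : df f (c + w)%C -> Cderive (fun x => f (c + x)%C) w = Cderive f (c + w)%C.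
Proof.
  intros H; apply Cderive_D; apply df_D in H.
  eapply D_eq; [apply (D_comp f (fun x => c + x)%C); [|exact H];
    apply D_plus; [apply D_const | apply D_id]|ring].
Qed.
Lemma holo_shift f c : holo_at f c -> exists r, 0 < r /\ forall w, Cmod w <= r -> df (fun x => f (c + x)%C) w.
Proof.
  intros H; apply holo_df in H; destruct H as [e [He K]]; exists (e / 2); split; [lra|].
  intros w Hw; apply df_shift, K; replace (c + w - c)%C with w by ring; lra.
Qed.
(** Cauchy's formula is differentiated twice under the mean. *)
Lemma holo_Cderive f c : holo_at f c -> holo_at (Cderive f) c.
Proof.
  intros H; destruct (holo_shift _ _ H) as [r [Hr Hf]].
  set (F := fun x => f (c + x)%C) in *.
  assert (HcF : cc r F) by (apply cc_ccont; [lra|]; intros w Hw; apply df_ccont, Hf; lra).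
  apply (holo_ext (fun w => avgC r (fun x => F x * k2 (w - c) x)%C)).
  - apply holo_df in H.
    generalize (near_and _ _ _ H (near_ball c r c ltac:(rewrite Cmod_self; lra))); apply near_imp.
    intros w [H1 H2]; rewrite <- (cauchy_deriv F) by auto.
    unfold F; rewrite Cderive_shift; [f_equal; ring|].
    replace (c + (w - c))%C with w by ring; exact H1.
  - apply holo_df; generalize (near_ball c r c ltac:(rewrite Cmod_self; lra)); apply near_imp.
    intros w Hw; eexists.
    apply (D_comp (fun w => avgC r (fun x => F x * k2 w x)%C) (fun w => w - c)%C);
      [apply D_minus; [apply D_id | apply D_const] | now apply K2_D].
Qed.
(** The numbers F n 0 are the Taylor coefficients, and F n is what remains of f after subtracting
    the first n terms and dividing by w^n. The first nonzero coefficient gives the factorisation; if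
    there is none, |f z| is bounded by a constant times (|z|/r)^n for every n. *)
Lemma holo_factor0 f r : 0 < r -> (forall w, Cmod w <= r -> df f w) ->
  (forall w, Cmod w < r -> f w = RtoC 0) \/
  exists (p : nat) g, (forall w, Cmod w < r -> df g w) /\ g 0 <> RtoC 0 /\
    forall w, Cmod w < r -> f w = (w ^ p * g w)%C.
Proof.
  intros Hr Hf.
  assert (Hcf : cc r f) by (apply cc_ccont; [lra|]; intros w Hw; apply df_ccont, Hf; lra).
  set (ph := fun n x => (f x * / x ^ n)%C).
  assert (Hph : forall n, cc r (ph n)).
  { intros n; unfold ph; apply cc_mult; auto.
    apply (cc_ext r (fun x => / (x - 0) ^ n)%C); [lra| |apply cc_k; auto; rewrite Cmod_0; lra].
    intros z Hz; do 2 f_equal; ring. }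
  set (F := fun n z => avgC r (fun x => ph n x * k1 z x)%C).
  assert (Hc : forall n z, Cmod z < r -> cc r (fun x => ph n x * k1 z x)%C).
  { intros; apply cc_mult; auto; now apply cc_k1. }
  assert (H0r : Cmod 0 < r) by (rewrite Cmod_0; lra).
  assert (St : forall n z, Cmod z < r -> F n z = (F n 0 + z * F (S n) z)%C).
  { intros n z Hz; unfold F.
    assert (Cx1 := Hc n 0 H0r); assert (Cx2 := Hc (S n) z Hz).
    assert (Cx3 : cc r (fun x => z * (ph (S n) x * k1 z x))%C) by (apply cc_mult; [apply cc_const|assumption]).
    rewrite <- avgC_scal, <- avgC_plus by assumption.
    apply avgC_ext; [lra|]; intros x Hx; unfold ph, k1.
    assert (x <> RtoC 0) by (apply Cmod_pos_neq; lra).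
    assert (Hn := circ_neq _ _ _ Hx Hz).
    rewrite Cpow_S; field; auto using Cpow_nz. }
  assert (F0 : forall z, Cmod z < r -> f z = F 0%nat z).
  { intros z Hz; rewrite (cauchy f r z Hr Hf Hz) at 1; unfold F, ph; apply avgC_ext; [lra|].
    intros x Hx; simpl; field; auto. }
  assert (Fn : forall n, (forall j, (j < n)%nat -> F j 0 = RtoC 0) ->
     forall z, Cmod z < r -> f z = (z ^ n * F n z)%C).
  { induction n as [|n IH]; intros Hz0 z Hz.
    - simpl; rewrite F0 by auto; ring.
    - rewrite IH by (auto; intros; apply Hz0; lia).
      rewrite (St n z Hz), Hz0 by lia; rewrite Cpow_S; ring. }
  destruct (classic (exists n, F n 0 <> RtoC 0)) as [[n Hn]|Hno].
  - right.
    destruct (dec_inh_nat_subset_has_unique_least_element (fun n => F n 0 <> RtoC 0)) as [p [[Hp1 Hp2] _]].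
    + intros k; apply classic.
    + now exists n.
    + exists p, (F p); repeat split; auto.
      * intros w Hw; eexists; now apply K1_D.
      * apply Fn; intros j Hj; apply NNPP; intro X; specialize (Hp2 j X); lia.
  - left; intros z Hz.
    assert (HF : forall n, f z = (z ^ n * F n z)%C).
    { intros n; apply Fn; auto; intros j _; apply NNPP; intro X; apply Hno; eauto. }
    set (A := avg r (fun x => Cmod (f x))).
    set (q := Cmod z / r).
    assert (Hmz := Cmod_ge_0 z).
    assert (Hq : 0 <= q < 1).
    { unfold q; split; [apply Rmult_le_pos; [lra|left; now apply Rinv_0_lt_compat]|].
      apply Rmult_lt_reg_r with r; auto; unfold Rdiv; rewrite Rmult_assoc, Rinv_l; lra. }
    assert (B : forall n, Cmod (f z) <= q ^ n * (A * (r / (r - Cmod z)))).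
    { intros n; rewrite (HF n), Cmod_mult, Cmod_pow.
      assert (Bn : Cmod (F n z) <= (/ r ^ n * (r / (r - Cmod z))) * A).
      { unfold F; eapply Rle_trans; [apply Cmod_avgC_le; [lra|auto]|].
        unfold A; rewrite <- avg_scal by now apply rc_Cmod.
        apply avg_le; [lra|apply rc_Cmod; auto|apply rc_scal; now apply rc_Cmod|].
        intros x Hx; unfold ph, k1.
        assert (x <> RtoC 0) by (apply Cmod_pos_neq; lra).
        assert (Hn := circ_neq _ _ _ Hx Hz).
        rewrite !Cmod_mult, Cmod_div, Cmod_inv, Cmod_pow, Hx by (auto; now apply Cpow_nz).
        rewrite (Rmult_comm (Cmod (f x))), !Rmult_assoc.
        apply Rmult_le_compat_l; [left; apply Rinv_0_lt_compat, pow_lt; lra|].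
        rewrite Rmult_comm; apply Rmult_le_compat_r; [apply Cmod_ge_0|].
        apply Rmult_le_compat_l; [lra|]; apply Rinv_le_contravar; [lra|].
        apply (circ_dist r); lra. }
      unfold q; unfold Rdiv at 1; rewrite Rpow_mult_distr, pow_inv.
      apply Rle_trans with (Cmod z ^ n * (/ r ^ n * (r / (r - Cmod z)) * A)).
      - apply Rmult_le_compat_l; auto; now apply pow_le.
      - right; field; split; [lra|]; apply pow_nonzero; lra. }
    set (K := A * (r / (r - Cmod z))) in *.
    apply Cmod_eq_0; apply Rle_antisym; [|apply Cmod_ge_0].
    apply le_epsilon; intros e He; rewrite Rplus_0_l.
    destruct (pow_lt_1_zero q ltac:(rewrite Rabs_pos_eq; lra) (e / (Rabs K + 1))
      ltac:(apply Rdiv_lt_0_compat; [lra|generalize (Rabs_pos K); lra])) as [N HN].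
    specialize (HN N (le_n N)); rewrite Rabs_pos_eq in HN by (apply pow_le; lra).
    eapply Rle_trans; [apply (B N)|].
    assert (HK := Rabs_pos K); assert (HK2 := Rle_abs K).
    assert (Hqn : 0 <= q ^ N) by (apply pow_le; lra).
    apply Rle_trans with (q ^ N * (Rabs K + 1)); [apply Rmult_le_compat_l; lra|].
    apply Rle_trans with (e / (Rabs K + 1) * (Rabs K + 1)); [apply Rmult_le_compat_r; lra|].
    right; field; lra.
Qed.
Lemma holo_factor f c : holo_at f c ->
  near c (fun w => f w = RtoC 0) \/
  exists (p : nat) g, holo_at g c /\ g c <> RtoC 0 /\ near c (fun w => f w = ((w - c) ^ p * g w)%C).
Proof.
  intros H; destruct (holo_shift _ _ H) as [r [Hr Hf]].
  assert (B := near_ball c r c ltac:(rewrite Cmod_self; lra)).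
  destruct (holo_factor0 _ r Hr Hf) as [Z|[p [g [Hg [Hg0 Hgf]]]]].
  - left; revert B; apply near_imp; intros w Hw; rewrite <- (Z _ Hw); f_equal; ring.
  - right; exists p, (fun w => g (w - c)%C); repeat split.
    + apply holo_df; revert B; apply near_imp; intros w Hw.
      destruct (Hg _ Hw) as [l Hl]; eexists; apply (D_comp g (fun w => w - c)%C);
        [apply D_minus; [apply D_id | apply D_const] | exact Hl].
    + replace (c - c)%C with (RtoC 0) by ring; auto.
    + revert B; apply near_imp; intros w Hw; rewrite <- (Hgf _ Hw); f_equal; ring.
Qed.

(** * Mean of the logarithm of a zero-free function *)

Lemma continuous_ln x : 0 < x -> continuous ln x.
Proof.
  intros Hx; apply (ex_derive_continuous (K := R_AbsRing) (V := R_NormedModule)).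
  auto_derive; auto.
Qed.
Lemma rc_ln r F : 0 <= r -> rc r F -> (forall z, Cmod z = r -> 0 < F z) -> rc r (fun z => ln (F z)).
Proof. intros Hr H K; apply rc_comp; auto; intros; apply continuous_ln, K; auto. Qed.
Lemma rc_lnmod r f : 0 <= r -> cc r f -> (forall z, Cmod z = r -> f z <> RtoC 0) ->
  rc r (fun z => ln (Cmod (f z))).
Proof.
  intros Hr H K; apply (rc_ln r (fun z => Cmod (f z))); auto; [now apply rc_Cmod|].
  intros z Hz; apply Cmod_pos, K, Hz.
Qed.
(** The derivative of ln |g| is the real part of g'/g, computed in coordinates without a branch of
    the logarithm. *)
Lemma PD_lnmod g t m : PD g t m -> g t <> RtoC 0 ->
  is_derive (fun s => ln (Cmod (g s))) t (fst (m / g t)%C).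
Proof.
  intros [H1 H2] Hn.
  assert (Hp : 0 < fst (g t) ^ 2 + snd (g t) ^ 2).
  { assert (H := Cmod_pos _ Hn); unfold Cmod in H.
    apply Rnot_le_lt; intro X; rewrite sqrt_neg_0 in H by auto; lra. }
  set (x := fun s => fst (g s)) in *; set (y := fun s => snd (g s)) in *.
  apply (is_derive_ext (fun s => ln (sqrt (x s ^ 2 + y s ^ 2)))); [reflexivity|].
  change (fst (g t)) with (x t) in Hp; change (snd (g t)) with (y t) in Hp.
  assert (E1 : Derive x t = fst m) by now apply is_derive_unique.
  assert (E2 : Derive y t = snd m) by now apply is_derive_unique.
  assert (Hs : 0 < sqrt (x t ^ 2 + y t ^ 2)) by now apply sqrt_lt_R0.
  auto_derive.
  - repeat split; try (eexists; eassumption); simpl in *; rewrite ?Rmult_1_r in *; auto.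
  - change (Derive (fun x0 : R => x x0) t) with (Derive x t); change (Derive (fun x0 : R => y x0) t) with (Derive y t); rewrite E1, E2; unfold Cdiv, Cmult, Cinv; simpl; unfold x, y in *; simpl in *.
    rewrite !Rmult_1_r in *.
    assert (S := sqrt_sqrt _ (Rlt_le _ _ Hp)).
    set (q := sqrt (fst (g t) * fst (g t) + snd (g t) * snd (g t))) in *.
    rewrite <- S; field; lra.
Qed.
Lemma PD_ray z t : PD (fun s => (RtoC s * z)%C) t z.
Proof. split; simpl; auto_derive; auto; ring. Qed.
Definition nvd (g : C -> C) (r : R) : Prop := forall z, Cmod z < r -> holo_at g z /\ g z <> RtoC 0.
Definition logd (g : C -> C) (z : C) : C := (Cderive g z / g z)%C.
Lemma holo_is_df f z : holo_at f z -> df f z.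
Proof. intros H; exists (Cderive f z); now apply holo_D. Qed.
Lemma nvd_logd_df g R1 z : nvd g R1 -> Cmod z < R1 -> df (logd g) z.
Proof.
  intros H Hz; destruct (H z Hz) as [H1 H2].
  apply holo_is_df, holo_div; auto; now apply holo_Cderive.
Qed.
(* Integration by parts over the circle turns ln|g| against k2 into its angular derivative
   Re(i x g'/g) against 1/(x - z); only the holomorphic half contributes. *)
Lemma logd_k2 g R1 r z : nvd g R1 -> 0 < r < R1 -> Cmod z < r ->
  (RtoC 2 * avgC r (fun x => RtoC (ln (Cmod (g x))) * k2 z x))%C = logd g z.
Proof.
  intros Hg [Hr HrR] Hz.
  set (L := logd g).
  assert (HL : forall w, Cmod w <= r -> df L w) by (intros; eapply nvd_logd_df; eauto; lra).
  assert (CL : cc r L) by (apply cc_ccont; [lra|]; intros; apply df_ccont, HL; lra).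
  assert (Cg : cc r g) by (apply cc_ccont; [lra|]; intros w Hw; apply holo_cont, Hg; lra).
  assert (Hgn : forall w, Cmod w = r -> g w <> RtoC 0) by (intros; apply Hg; lra).
  set (l := fun x => ln (Cmod (g x))).
  assert (Cl : rc r l) by (apply rc_lnmod; auto; lra).
  assert (Ck : cc r (fun x => / (x - z))%C).
  { apply (cc_ext r (fun x => / (x - z) ^ 1)%C); [lra| |now apply cc_k].
    intros x Hx; f_equal; simpl; ring. }
  assert (Cid : cc r (fun x => x)) by (apply cc_id; lra).
  set (A := fun x => (Ci * (x * L x))%C).
  assert (CA : cc r A) by (apply cc_mult; [apply cc_const|now apply cc_mult]).
  set (dl := fun x => fst (A x)).
  assert (Cdl : rc r dl) by now apply rc_fst.
  set (B := fun x => (RtoC (dl x) * / (x - z) - RtoC (l x) * (Ci * k2 z x))%C).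
  assert (Cb1 : cc r (fun x => RtoC (dl x) * / (x - z))%C) by (apply cc_mult; auto; now apply cc_RtoC).
  assert (Cb2 : cc r (fun x => RtoC (l x) * k2 z x)%C)
    by (apply cc_mult; [now apply cc_RtoC|now apply cc_k2]).
  assert (Cb3 : cc r (fun x => RtoC (l x) * (Ci * k2 z x))%C)
    by (apply cc_mult; [now apply cc_RtoC|apply cc_mult; [apply cc_const|now apply cc_k2]]).
  assert (CB : cc r B) by (apply cc_minus; assumption).
  assert (Hpi : RtoC (2 * PI) <> RtoC 0) by (intro X; apply RtoC_inj in X; generalize twoPI_pos; lra).
  assert (I0 : avgC r B = RtoC 0).
  { assert (I := avgC_CI r B CB).
    rewrite (CI_FTC (fun t => (RtoC (l (circ r t)) * / (circ r t - z))%C)) in I.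
    - unfold circ in I; rewrite cos_2PI, sin_2PI, cos_0, sin_0 in I.
      assert (X : (RtoC (2 * PI) * avgC r B)%C = RtoC 0) by (rewrite <- I; ring).
      apply Cmult_integral in X; destruct X; [contradiction|assumption].
    - generalize twoPI_pos; lra.
    - intros t _; apply CB.
    - intros t _.
      assert (Hm : Cmod (circ r t) = r) by (apply Cmod_circ; lra).
      assert (Hxz := circ_neq _ _ _ Hm Hz).
      assert (P1 : PD (fun s => g (circ r s)) t (Ci * circ r t * Cderive g (circ r t))%C).
      { apply PD_comp; [apply PD_circ|]; apply holo_D, Hg; lra. }
      assert (P2 : is_derive (fun s => l (circ r s)) t (dl (circ r t))).
      { unfold l; assert (Q := PD_lnmod _ _ _ P1 (Hgn _ Hm)); unfold dl, A, L, logd.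
        replace (Ci * (circ r t * (Cderive g (circ r t) / g (circ r t))))%C with
          (Ci * circ r t * Cderive g (circ r t) / g (circ r t))%C; [exact Q|].
        field; auto. }
      assert (P3 : PD (fun s => / (circ r s - z))%C t (Ci * circ r t * (- / ((circ r t - z) * (circ r t - z))))%C).
      { apply (PD_comp (fun w => / (w - z))%C (circ r)); [apply PD_circ|].
        eapply D_eq; [apply (D_comp (fun w => / w)%C (fun w => w - z)%C);
          [apply D_minus; [apply D_id|apply D_const] | now apply D_Cinv]|]. ring. }
      destruct P3 as [P3 P4].
      unfold B; split; simpl.
      + apply (is_derive_ext (fun s => l (circ r s) * fst (/ (circ r s - z))%C)).
        { intros s; simpl; ring. }
        assert (Q := is_derive_mult (K := R_AbsRing) _ _ _ _ _ P2 P3 Rmult_comm).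
        match goal with |- is_derive _ _ ?a => match type of Q with is_derive _ _ ?b => replace a with b; [exact Q|] end end.
        unfold plus, mult, k2, Cdiv; simpl; ring.
      + apply (is_derive_ext (fun s => l (circ r s) * snd (/ (circ r s - z))%C)).
        { intros s; simpl; ring. }
        assert (Q := is_derive_mult (K := R_AbsRing) _ _ _ _ _ P2 P4 Rmult_comm).
        match goal with |- is_derive _ _ ?a => match type of Q with is_derive _ _ ?b => replace a with b; [exact Q|] end end.
        unfold plus, mult, k2, Cdiv; simpl; ring. }
  assert (I1 : avgC r B = (avgC r (fun x => RtoC (dl x) * / (x - z)) - Ci * avgC r (fun x => RtoC (l x) * k2 z x))%C).
  { unfold B; rewrite avgC_minus by assumption.
    rewrite (avgC_ext r (fun x => RtoC (l x) * (Ci * k2 z x))%C (fun x => Ci * (RtoC (l x) * k2 z x))%C)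
      by (first [lra | intros; ring]).
    rewrite avgC_scal by assumption; reflexivity. }
  set (A' := fun x => (Cconj (A x) * / (x - z))%C).
  assert (CA1 : cc r (fun x => A x * / (x - z))%C) by now apply cc_mult.
  assert (CA' : cc r A') by (apply cc_mult; auto; now apply cc_conj).
  assert (I2 : (RtoC 2 * avgC r (fun x => RtoC (dl x) * / (x - z)))%C =
     (avgC r (fun x => A x * / (x - z)) + avgC r A')%C).
  { rewrite <- avgC_scal, <- avgC_plus by assumption.
    apply avgC_ext; [lra|]; intros x _; unfold A', dl.
    replace (RtoC 2 * (RtoC (fst (A x)) * / (x - z)))%C with ((RtoC 2 * RtoC (fst (A x))) * / (x - z))%C by ring.
    rewrite <- Cmult_plus_distr_r; f_equal.
    unfold Cconj, RtoC, Cmult, Cplus; simpl; f_equal; ring. }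
  assert (I3 : avgC r (fun x => A x * / (x - z))%C = (Ci * L z)%C).
  { rewrite (cauchy L r z Hr HL Hz), <- avgC_scal by (apply cc_mult; [assumption|now apply cc_k1]).
    apply avgC_ext; [lra|]; intros x _; unfold A, k1, Cdiv; ring. }
  assert (I4 : avgC r A' = RtoC 0).
  { assert (N : forall x, Cmod x <= r -> (RtoC (r * r) - Cconj z * x)%C <> RtoC 0).
    { intros x Hx; apply Csub_neq; intro E; apply (f_equal Cmod) in E.
      rewrite Cmod_R, Cmod_mult, Cmod_conj, Rabs_pos_eq in E by nra.
      assert (0 <= Cmod z) by apply Cmod_ge_0; assert (0 <= Cmod x) by apply Cmod_ge_0; nra. }
    assert (Df : forall x, Cmod x <= r -> df (fun x => x * (A x / (RtoC (r * r) - Cconj z * x)))%C x).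
    { intros x Hx; destruct (HL x Hx) as [m Hm]; eexists.
      apply D_mult; [apply D_id|apply D_div; [now apply N| |apply D_minus; [apply D_const|apply D_scal, D_id]]].
      unfold A; apply D_scal, D_mult; [apply D_id|exact Hm]. }
    assert (E : avgC r (fun x => Cconj (A' x)) = RtoC 0).
    { transitivity (avgC r (fun x => x * (A x / (RtoC (r * r) - Cconj z * x)))%C).
      - apply avgC_ext; [lra|]; intros x Hx; unfold A', Cdiv.
        assert (x <> RtoC 0) by (apply Cmod_pos_neq; lra).
        assert (Hxz := circ_neq _ _ _ Hx Hz).
        rewrite Cmult_conj, Cinv_conj, Cminus_conj, Cconj_conj, (Cconj_mult_R r x Hr Hx) by auto.
        field; split; [apply N; lra|auto].
      - rewrite (mvp_center _ r Hr); [ring|intros; now apply Df|apply df_ccont, Df; rewrite Cmod_0; lra]. }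
    rewrite avgC_conj in E by assumption.
    apply (f_equal Cconj) in E; rewrite Cconj_conj in E; rewrite E.
    unfold Cconj, RtoC; simpl; f_equal; ring. }
  rewrite I1 in I0; apply Csub_eq in I0; rewrite I0, I3, I4 in I2.
  assert (HCi : Ci <> RtoC 0) by (intro X; apply (f_equal snd) in X; simpl in X; lra).
  assert (X : (Ci * (RtoC 2 * avgC r (fun x => RtoC (l x) * k2 z x) - L z))%C = RtoC 0).
  { replace (Ci * (RtoC 2 * avgC r (fun x => RtoC (l x) * k2 z x) - L z))%C with
     (RtoC 2 * (Ci * avgC r (fun x => RtoC (l x) * k2 z x)) - Ci * L z)%C by ring.
    rewrite I2; ring. }
  apply Cmult_integral in X; destruct X as [X|X]; [contradiction|now apply Csub_eq].
Qed.
Lemma const_of_deriv0 (f : R -> R) a b : a <= b -> (forall t, a <= t <= b -> is_derive f t 0) -> f b = f a.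
Proof.
  intros Hab H.
  assert (E := RInt_FTC f (fun _ => 0) a b Hab H ltac:(intros; apply continuous_const)).
  assert (E0 : RInt (fun _ => 0) a b = (b - a) * 0) by exact (RInt_const (V := R_CompleteNormedModule) a b 0).
  rewrite E0 in E; lra.
Qed.
(** A holomorphic logarithm is produced as a Cauchy transform: [h] satisfies h' = g'/g, so ln |g| -
    Re h is constant along rays from 0, and the mean value property of [h] finishes. *)
Lemma avg_lnmod g R1 r : nvd g R1 -> 0 < r < R1 -> avg r (fun z => ln (Cmod (g z))) = ln (Cmod (g 0)).
Proof.
  (* The transform is taken over a circle larger than [r], so that [h] is holomorphic on the closed
     disc of radius [r]. *)
  intros Hg Hr; set (s := (r + R1) / 2).
  assert (Hs : r < s < R1) by (unfold s; lra).
  set (l := fun x => RtoC (ln (Cmod (g x)))).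
  assert (Cl : cc s l).
  { apply cc_RtoC, rc_lnmod; [lra| |intros; apply Hg; lra].
    apply cc_ccont; [lra|]; intros; apply holo_cont, Hg; lra. }
  set (h := fun z => (RtoC 2 * avgC s (fun x => l x * k1 z x))%C).
  assert (Dh : forall z, Cmod z < s -> D h z (logd g z)).
  { intros z Hz; rewrite <- (logd_k2 g R1 s z) by (auto; lra).
    apply D_scal; apply K1_D; auto; lra. }
  assert (key : forall z, Cmod z < s -> ln (Cmod (g z)) - fst (h z) = ln (Cmod (g 0)) - fst (h 0)).
  { intros z Hz.
    assert (E := const_of_deriv0 (fun t => ln (Cmod (g (RtoC t * z)%C)) - fst (h (RtoC t * z)%C)) 0 1 ltac:(lra)).
    cbv beta in E; replace (RtoC 1 * z)%C with z in E by ring; replace (RtoC 0 * z)%C with (RtoC 0) in E by ring.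
    apply E; intros t Ht.
    assert (Htz : Cmod (RtoC t * z)%C < s).
    { rewrite Cmod_mult, Cmod_R, Rabs_pos_eq by lra; assert (0 <= Cmod z) by apply Cmod_ge_0; nra. }
    destruct (Hg (RtoC t * z)%C ltac:(lra)) as [Hg1 Hg2].
    assert (P1 := PD_comp g _ t _ _ (PD_ray z t) (holo_D _ _ Hg1)).
    assert (P2 := PD_lnmod _ _ _ P1 Hg2).
    destruct (PD_comp h _ t _ _ (PD_ray z t) (Dh _ Htz)) as [P3 _].
    assert (P := is_derive_minus (K := R_AbsRing) (V := R_NormedModule) _ _ _ _ _ P2 P3).
    match type of P with is_derive _ _ ?b => replace 0 with b; [exact P|] end.
    unfold minus, plus, opp, logd, Cdiv; simpl; ring. }
  assert (Ch : cc r h) by (apply cc_ccont; [lra|]; intros; eapply D_cont, Dh; lra).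
  assert (M : avgC r h = h 0).
  { apply mvp_center; [lra| |eapply D_cont, Dh; rewrite Cmod_0; lra].
    intros z _ Hz; eexists; apply Dh; lra. }
  rewrite (avg_ext r _ (fun z => fst (h z) + (ln (Cmod (g 0)) - fst (h 0)))); [|lra|].
  - rewrite avg_plus, avg_const by (try apply rc_fst; auto; apply rc_const).
    apply (f_equal fst) in M; unfold avgC in M; simpl fst at 1 in M.
    change (avg r (fun z => fst (h z))) with (fst (avgC r h)).
    unfold avgC; simpl fst at 1; rewrite M; ring.
  - intros z Hz; rewrite <- (key z) by lra; ring.
Qed.
(** The free constant [k] will normalise g; it may be subtracted because [k2] has mean 0 against
    constants. *)
Lemma logd_bound g R1 r z k : nvd g R1 -> 0 < r < R1 -> Cmod z < r ->
  Cmod (logd g z) <= 2 * r / ((r - Cmod z) * (r - Cmod z)) * avg r (fun x => Rabs (ln (Cmod (g x)) - k)).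
Proof.
  intros Hg Hr Hz; rewrite <- (logd_k2 g R1 r z) by auto.
  set (l := fun x => ln (Cmod (g x))).
  assert (Cl : rc r l).
  { apply rc_lnmod; [lra| |intros; apply Hg; lra].
    apply cc_ccont; [lra|]; intros; apply holo_cont, Hg; lra. }
  assert (Ck := cc_k2 r z ltac:(lra) Hz).
  (* The mean of [k2] is the derivative of the mean of [k1], which is constantly 1. *)
  assert (K0 : avgC r (fun x => RtoC k * k2 z x)%C = RtoC 0).
  { apply (D_unique (fun w => avgC r (fun x => RtoC k * k1 w x)%C) z).
    - apply (K1_D r (fun _ => RtoC k)); [lra|auto|apply cc_const].
    - apply (D_ext (fun _ => RtoC k)); [|apply D_const].
      generalize (near_lt _ _ Hz); apply near_imp; intros w Hw.
      rewrite avgC_scal, avg_k1 by (try apply cc_k1; auto; lra); ring. }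
  assert (C1 : cc r (fun x => RtoC (l x) * k2 z x)%C) by (apply cc_mult; auto; now apply cc_RtoC).
  assert (C2 : cc r (fun x => RtoC k * k2 z x)%C) by (apply cc_mult; auto; apply cc_const).
  change (avgC r (fun x => RtoC (ln (Cmod (g x))) * k2 z x)%C) with (avgC r (fun x => RtoC (l x) * k2 z x)%C).
  replace (avgC r (fun x => RtoC (l x) * k2 z x)%C) with
    (avgC r (fun x => RtoC (l x) * k2 z x - RtoC k * k2 z x)%C)
    by (rewrite avgC_minus, K0 by assumption; ring).
  assert (C3 : cc r (fun x => RtoC (l x) * k2 z x - RtoC k * k2 z x)%C) by now apply cc_minus.
  rewrite Cmod_mult, Cmod_R, Rabs_pos_eq by lra.
  assert (Ra : rc r (fun x => Rabs (l x - k))).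
  { apply (rc_comp r (fun x => l x - k) Rabs); [|intros; apply continuous_Rabs|lra].
    intros t; apply (continuous_minus (V := R_NormedModule)); [apply Cl|apply continuous_const]. }
  change (avg r (fun x => Rabs (ln (Cmod (g x)) - k))) with (avg r (fun x => Rabs (l x - k))).
  set (q := r / ((r - Cmod z) * (r - Cmod z))).
  replace (2 * r / ((r - Cmod z) * (r - Cmod z)) * avg r (fun x => Rabs (l x - k))) with
    (2 * (q * avg r (fun x => Rabs (l x - k)))) by (unfold q; field; lra).
  apply Rmult_le_compat_l; [lra|].
  eapply Rle_trans; [apply Cmod_avgC_le; [lra|assumption]|].
  rewrite <- avg_scal by assumption.
  apply avg_le; [lra|now apply rc_Cmod|now apply rc_scal|].
  intros x Hx.
  change (Cmod (RtoC (l x) * k2 z x - RtoC k * k2 z x)%C <= q * Rabs (l x - k)).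
  replace (RtoC (l x) * k2 z x - RtoC k * k2 z x)%C with (RtoC (l x - k) * k2 z x)%C
    by (rewrite RtoC_minus; ring).
  rewrite Cmod_mult, Cmod_R, (Rmult_comm q); apply Rmult_le_compat_l; [apply Rabs_pos|].
  assert (Hxz := circ_neq _ _ _ Hx Hz).
  unfold k2; rewrite Cmod_div, Cmod_mult, Hx by now apply Cmult_neq_0.
  assert (Hd : r - Cmod z <= Cmod (x - z)%C) by (apply (circ_dist r); lra).
  unfold q, Rdiv; apply Rmult_le_compat_l; [lra|].
  apply Rinv_le_contravar; [apply Rmult_lt_0_compat; lra|apply Rmult_le_compat; lra].
Qed.

(** * Orders of zeros and poles *)

(** At least one of the two exponents is 0, so only one of the factors ever matters. *)
Definition zp (z : C) (p : Z) : C := (z ^ Z.to_nat p * / z ^ Z.to_nat (- p))%C.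
Lemma C1_neq0 : RtoC 1 <> RtoC 0.
Proof. intro E; apply RtoC_inj in E; lra. Qed.
Lemma zp_nat z n : zp z (Z.of_nat n) = (z ^ n)%C.
Proof.
  unfold zp; rewrite Nat2Z.id; replace (Z.to_nat (- Z.of_nat n)) with 0%nat by lia.
  simpl; field; apply C1_neq0.
Qed.
(** Any way of writing the exponent as a difference of naturals may be used; the laws for integer
    powers reduce to natural ones through it. *)
Lemma zp_frac z a b : z <> RtoC 0 -> zp z (Z.of_nat a - Z.of_nat b) = (z ^ a * / z ^ b)%C.
Proof.
  intros Hz; unfold zp; destruct (le_lt_dec a b) as [H|H].
  - replace (Z.to_nat (Z.of_nat a - Z.of_nat b)) with 0%nat by lia.
    replace (Z.to_nat (- (Z.of_nat a - Z.of_nat b))) with (b - a)%nat by lia.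
    replace b with (a + (b - a))%nat at 2 by lia; rewrite Cpow_add_r; simpl.
    field; split; now apply Cpow_nz.
  - replace (Z.to_nat (Z.of_nat a - Z.of_nat b)) with (a - b)%nat by lia.
    replace (Z.to_nat (- (Z.of_nat a - Z.of_nat b))) with 0%nat by lia.
    replace a with (b + (a - b))%nat at 2 by lia; rewrite Cpow_add_r; simpl.
    field; now apply Cpow_nz.
Qed.
Lemma Z_frac (p : Z) : exists a b : nat, p = (Z.of_nat a - Z.of_nat b)%Z.
Proof. exists (Z.to_nat p), (Z.to_nat (- p)); lia. Qed.
Lemma zp_nz z p : z <> RtoC 0 -> zp z p <> RtoC 0.
Proof.
  intros Hz; destruct (Z_frac p) as [a [b ->]]; rewrite zp_frac by auto.
  apply Cmult_neq_0; [now apply Cpow_nz|].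
  intro E; apply C1_neq0; rewrite <- (Cinv_r (z ^ b)%C) by now apply Cpow_nz.
  rewrite E; ring.
Qed.
Lemma zp_add z p q : z <> RtoC 0 -> zp z (p + q) = (zp z p * zp z q)%C.
Proof.
  intros Hz; destruct (Z_frac p) as [a [b ->]]; destruct (Z_frac q) as [c [d ->]].
  replace (Z.of_nat a - Z.of_nat b + (Z.of_nat c - Z.of_nat d))%Z
    with (Z.of_nat (a + c) - Z.of_nat (b + d))%Z by lia.
  rewrite !zp_frac, !Cpow_add_r by auto; field; split; now apply Cpow_nz.
Qed.
Lemma zp_0 z : zp z 0 = RtoC 1.
Proof. exact (zp_nat z 0). Qed.
Lemma zp_opp z p : z <> RtoC 0 -> zp z (- p) = (/ zp z p)%C.
Proof.
  intros Hz; assert (H := zp_add z p (- p) Hz); rewrite Z.add_opp_diag_r, zp_0 in H.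
  assert (N := zp_nz z p Hz).
  replace (zp z (- p)) with (/ zp z p * (zp z p * zp z (- p)))%C by (field; auto).
  rewrite <- H; ring.
Qed.
Lemma zp_mul z p n : z <> RtoC 0 -> zp z (Z.of_nat n * p) = (zp z p ^ n)%C.
Proof.
  intros Hz; induction n as [|n IH]; [apply zp_0|].
  replace (Z.of_nat (S n) * p)%Z with (p + Z.of_nat n * p)%Z by lia.
  rewrite zp_add, IH by auto; reflexivity.
Qed.
Lemma zp_1 z : zp z 1 = z.
Proof. change 1%Z with (Z.of_nat 1); rewrite zp_nat; simpl; ring. Qed.
Lemma D_zp p w : w <> RtoC 0 -> D (fun x => zp x p) w (RtoC (IZR p) * zp w (p - 1))%C.
Proof.
  intros Hw; destruct (Z_frac p) as [a [b ->]].
  apply (D_ext (fun x => x ^ a * / x ^ b)%C).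
  - generalize (near_neq _ _ Hw); apply near_imp; intros x Hx; now rewrite zp_frac.
  - eapply D_eq; [apply D_mult; [apply D_pow, D_id | apply D_inv; [now apply Cpow_nz | apply D_pow, D_id]]|].
    replace (Z.of_nat a - Z.of_nat b - 1)%Z with (Z.of_nat a - Z.of_nat (S b))%Z by lia.
    rewrite zp_frac, minus_IZR, <- !INR_IZR_INZ, RtoC_minus by auto.
    assert (Ha : (INR a * w ^ pred a)%C = (INR a * w ^ a * / w)%C)
      by (destruct a as [|a]; [simpl; ring|simpl pred; rewrite (Cpow_S w a); field; auto]).
    assert (Hb : (INR b * w ^ pred b)%C = (INR b * w ^ b * / w)%C)
      by (destruct b as [|b]; [simpl; ring|simpl pred; rewrite (Cpow_S w b); field; auto]).
    rewrite Ha, Hb, Cpow_S; field; split; auto using Cpow_nz.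
Qed.
(* Only punctured neighbourhoods matter, because values at poles are junk; [zp x p] is [x^p] for [p : Z]. *)
Definition ord (f : C -> C) (c : C) (p : Z) : Prop :=
  exists g, holo_at g c /\ g c <> RtoC 0 /\ pnear c (fun w => f w = (zp (w - c) p * g w)%C).
(** In contrast to [ord], the cofactor may vanish at [c], which makes the class closed under
    sums. *)
Definition mer_at (f : C -> C) (c : C) : Prop :=
  exists p h, holo_at h c /\ pnear c (fun w => f w = (zp (w - c) p * h w)%C).
Definition lz (f : C -> C) (c : C) : Prop := pnear c (fun w => f w = RtoC 0).
Lemma holo_sub_id c z : holo_at (fun w => w - c)%C z.
Proof. apply holo_minus; [apply holo_id | apply holo_const]. Qed.
Lemma ccont_pnear0 f c : ccont f c -> pnear c (fun w => f w = RtoC 0) -> f c = RtoC 0.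
Proof.
  intros H K; apply NNPP; intro N.
  destruct (pnear_ex c _ 1 Rlt_0_1 (pnear_and _ _ _ K (near_pnear _ _ (ccont_near_neq _ _ H N))))
    as [w [_ [_ [H1 H2]]]]; contradiction.
Qed.
Lemma pnear_neq c : pnear c (fun w => (w - c)%C <> RtoC 0).
Proof. exists 1; split; [lra|]; intros w Hw _; now apply Csub_neq. Qed.
Lemma ord_nz f c p : ord f c p -> pnear c (fun w => f w <> RtoC 0).
Proof.
  intros [g [Hg [Hn H]]].
  generalize (pnear_and _ _ _ H (pnear_and _ _ _ (pnear_neq c)
     (near_pnear _ _ (ccont_near_neq _ _ (holo_cont _ _ Hg) Hn)))).
  apply pnear_imp; intros w _ [-> [H1 H2]]; apply Cmult_neq_0; auto; now apply zp_nz.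
Qed.
Lemma pnear_False c (P : C -> Prop) : (forall w, ~ P w) -> ~ pnear c P.
Proof. intros H K; destruct (pnear_ex c P 1 Rlt_0_1 K) as [w [_ [_ Hw]]]; exact (H w Hw). Qed.
Lemma ord_not_lz f c p : ord f c p -> ~ lz f c.
Proof.
  intros H K; refine (pnear_False c _ _ (pnear_and _ _ _ K (ord_nz _ _ _ H))).
  intros w [H1 H2]; contradiction.
Qed.
Lemma ord_ext f g c p : pnear c (fun w => f w = g w) -> ord f c p -> ord g c p.
Proof.
  intros E [h [H1 [H2 H3]]]; exists h; repeat split; auto.
  generalize (pnear_and _ _ _ E H3); apply pnear_imp; intros w _ [<- ->]; reflexivity.
Qed.
Lemma lz_ext f g c : pnear c (fun w => f w = g w) -> lz f c -> lz g c.
Proof.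
  intros E H; generalize (pnear_and _ _ _ E H); apply pnear_imp; intros w _ [<- ->]; reflexivity.
Qed.
Lemma mer_ext f g c : pnear c (fun w => f w = g w) -> mer_at f c -> mer_at g c.
Proof.
  intros E [p [h [H1 H3]]]; exists p, h; split; auto.
  generalize (pnear_and _ _ _ E H3); apply pnear_imp; intros w _ [<- ->]; reflexivity.
Qed.
Lemma pnear_all c (P : C -> Prop) : (forall w, P w) -> pnear c P.
Proof. intros; now apply near_pnear, near_all. Qed.
(** If p < q, dividing by the smaller power shows that its cofactor vanishes at [c]. *)
Lemma ord_unique f c p q : ord f c p -> ord f c q -> p = q.
Proof.
  assert (X : forall p q, (p < q)%Z -> ord f c p -> ord f c q -> False).
  { clear p q; intros p q Hpq [g [Hg [Gn Gf]]] [h [Hh [Hn Hf]]]; apply Gn.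
    set (n := Z.to_nat (q - p)).
    assert (K : (g c - (c - c) ^ n * h c)%C = RtoC 0).
    { apply (ccont_pnear0 (fun w => g w - (w - c) ^ n * h w)%C).
      - apply holo_cont, holo_minus; auto; apply holo_mult; auto; apply holo_pow, holo_sub_id.
      - generalize (pnear_and _ _ _ (pnear_neq c) (pnear_and _ _ _ Gf Hf)); apply pnear_imp.
        intros w _ [Nw [E1 E2]].
        rewrite E1 in E2; replace q with (p + Z.of_nat n)%Z in E2 by (unfold n; lia).
        rewrite zp_add, zp_nat in E2 by auto.
        assert (Z := zp_nz _ p Nw).
        replace (g w) with (/ zp (w - c) p * (zp (w - c) p * g w))%C by (field; auto).
        rewrite E2; field; auto. }
    replace (c - c)%C with (RtoC 0) in K by ring.
    replace n with (S (pred n)) in K by (unfold n; lia).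
    rewrite Cpow_S in K; rewrite <- K; ring. }
  intros H K; destruct (Z.lt_trichotomy p q) as [L|[L|L]]; auto; exfalso; eauto.
Qed.
Lemma ord_mer f c p : ord f c p -> mer_at f c.
Proof. intros [g [H1 [_ H2]]]; exists p, g; auto. Qed.
Lemma mer_dich f c : mer_at f c -> lz f c \/ exists p, ord f c p.
Proof.
  intros [p [h [Hh Hf]]]; destruct (holo_factor h c Hh) as [Z|[n [g [Hg [Gn Gf]]]]].
  - left; generalize (pnear_and _ _ _ Hf (near_pnear _ _ Z)); apply pnear_imp.
    intros w _ [-> ->]; ring.
  - right; exists (p + Z.of_nat n)%Z, g; repeat split; auto.
    generalize (pnear_and _ _ _ (pnear_neq c) (pnear_and _ _ _ Hf (near_pnear _ _ Gf))); apply pnear_imp.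
    intros w _ [Nw [-> ->]]; rewrite zp_add, zp_nat by auto; ring.
Qed.
Lemma holo_mer f c : holo_at f c -> mer_at f c.
Proof.
  intros H; exists 0%Z, f; split; auto; apply pnear_all; intros w; rewrite zp_0; ring.
Qed.
Lemma holo_ord0 f c : holo_at f c -> f c <> RtoC 0 -> ord f c 0.
Proof.
  intros H N; exists f; repeat split; auto; apply pnear_all; intros w; rewrite zp_0; ring.
Qed.
Lemma holo_ord_nat f c : holo_at f c -> ~ lz f c ->
  exists n : nat, ord f c (Z.of_nat n) /\ (f c = RtoC 0 -> (1 <= n)%nat).
Proof.
  intros H N; destruct (holo_factor f c H) as [Z|[n [g [Hg [Gn Gf]]]]].
  - exfalso; apply N; now apply near_pnear.
  - exists n; split.
    + exists g; repeat split; auto; generalize (near_pnear _ _ Gf); apply pnear_imp; intros w _ ->.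
      now rewrite zp_nat.
    + intros E; destruct n as [|n]; [|lia]; exfalso; apply Gn.
      apply near_pt in Gf; simpl in Gf; rewrite E in Gf; rewrite Gf; ring.
Qed.
Lemma holo_ord_nonneg f c p : holo_at f c -> ord f c p -> (0 <= p)%Z.
Proof.
  intros H K; destruct (holo_ord_nat f c H (ord_not_lz _ _ _ K)) as [n [Hn _]].
  rewrite (ord_unique _ _ _ _ K Hn); lia.
Qed.
Lemma holo_ord_zero f c p : holo_at f c -> ord f c p -> f c = RtoC 0 -> (1 <= p)%Z.
Proof.
  intros H K E; destruct (holo_ord_nat f c H (ord_not_lz _ _ _ K)) as [n [Hn Z]].
  rewrite (ord_unique _ _ _ _ K Hn); specialize (Z E); lia.
Qed.
Lemma ord_const a c : a <> RtoC 0 -> ord (fun _ => a) c 0.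
Proof. intros; apply holo_ord0; auto; apply holo_const. Qed.
Lemma ord_mult f g c p q : ord f c p -> ord g c q -> ord (fun w => f w * g w)%C c (p + q).
Proof.
  intros [f1 [A1 [A2 A3]]] [g1 [B1 [B2 B3]]]; exists (fun w => f1 w * g1 w)%C; repeat split.
  - now apply holo_mult.
  - now apply Cmult_neq_0.
  - generalize (pnear_and _ _ _ (pnear_neq c) (pnear_and _ _ _ A3 B3)); apply pnear_imp.
    intros w _ [N [-> ->]]; rewrite zp_add by auto; ring.
Qed.
Lemma Cinv_nz (z : C) : z <> RtoC 0 -> (/ z)%C <> RtoC 0.
Proof.
  intros Hz E; apply C1_neq0; rewrite <- (Cinv_r z) by auto; rewrite E; ring.
Qed.
Lemma ord_inv f c p : ord f c p -> ord (fun w => / f w)%C c (- p).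
Proof.
  intros [f1 [A1 [A2 A3]]]; exists (fun w => / f1 w)%C; repeat split.
  - now apply holo_inv.
  - now apply Cinv_nz.
  - generalize (pnear_and _ _ _ (pnear_neq c) (pnear_and _ _ _ A3
      (near_pnear _ _ (ccont_near_neq _ _ (holo_cont _ _ A1) A2)))); apply pnear_imp.
    intros w _ [N [-> M]]; rewrite zp_opp by auto; field; split; auto; now apply zp_nz.
Qed.
Lemma ord_div f g c p q : ord f c p -> ord g c q -> ord (fun w => f w / g w)%C c (p - q).
Proof. intros H K; apply (ord_mult f (fun w => / g w)%C); auto; now apply ord_inv. Qed.
Lemma ord_pow f c p n : ord f c p -> ord (fun w => f w ^ n)%C c (Z.of_nat n * p).
Proof.
  intros H; induction n as [|n IH]; [apply (ord_const (RtoC 1)), C1_neq0|].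
  replace (Z.of_nat (S n) * p)%Z with (p + Z.of_nat n * p)%Z by lia.
  now apply (ord_mult f (fun w => f w ^ n)%C).
Qed.
Lemma ord_scal a f c p : a <> RtoC 0 -> ord f c p -> ord (fun w => a * f w)%C c p.
Proof. intros Ha H; apply (ord_mult (fun _ => a) f c 0 p); auto; now apply ord_const. Qed.
Lemma mer_const a c : mer_at (fun _ => a) c.
Proof. apply holo_mer, holo_const. Qed.
Lemma mer_mult f g c : mer_at f c -> mer_at g c -> mer_at (fun w => f w * g w)%C c.
Proof.
  intros [p [f1 [A1 A3]]] [q [g1 [B1 B3]]]; exists (p + q)%Z, (fun w => f1 w * g1 w)%C; split.
  - now apply holo_mult.
  - generalize (pnear_and _ _ _ (pnear_neq c) (pnear_and _ _ _ A3 B3)); apply pnear_imp.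
    intros w _ [N [-> ->]]; rewrite zp_add by auto; ring.
Qed.
Lemma mer_plus f g c : mer_at f c -> mer_at g c -> mer_at (fun w => f w + g w)%C c.
Proof.
  assert (X : forall f g, (exists p q f1 g1, (p <= q)%Z /\ holo_at f1 c /\ holo_at g1 c /\
     pnear c (fun w => f w = (zp (w - c) p * f1 w)%C) /\ pnear c (fun w => g w = (zp (w - c) q * g1 w)%C)) ->
     mer_at (fun w => f w + g w)%C c).
  { clear f g; intros f g [p [q [f1 [g1 [Hpq [A1 [B1 [A3 B3]]]]]]]].
    exists p, (fun w => f1 w + (w - c) ^ Z.to_nat (q - p) * g1 w)%C; split.
    - apply holo_plus; auto; apply holo_mult; auto; apply holo_pow, holo_sub_id.
    - generalize (pnear_and _ _ _ (pnear_neq c) (pnear_and _ _ _ A3 B3)); apply pnear_imp.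
      intros w _ [N [-> ->]].
      replace q with (p + Z.of_nat (Z.to_nat (q - p)))%Z at 1 by lia.
      rewrite zp_add, zp_nat by auto; ring. }
  intros [p [f1 [A1 A3]]] [q [g1 [B1 B3]]]; destruct (Z.le_gt_cases p q) as [L|L].
  - apply X; exists p, q, f1, g1; repeat split; auto.
  - apply (mer_ext (fun w => g w + f w)%C); [apply pnear_all; intros; ring|].
    apply X; exists q, p, g1, f1; repeat split; auto; lia.
Qed.
Lemma mer_scal a f c : mer_at f c -> mer_at (fun w => a * f w)%C c.
Proof. apply (mer_mult (fun _ => a) f), mer_const. Qed.
Lemma mer_minus f g c : mer_at f c -> mer_at g c -> mer_at (fun w => f w - g w)%C c.
Proof.
  intros H K; apply (mer_ext (fun w => f w + -(1) * g w)%C); [apply pnear_all; intros; ring|].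
  apply mer_plus; auto; now apply mer_scal.
Qed.
Lemma mer_pow f c n : mer_at f c -> mer_at (fun w => f w ^ n)%C c.
Proof.
  intros H; induction n; [apply (mer_const (RtoC 1))|]; now apply (mer_mult f (fun w => f w ^ n)%C).
Qed.
Lemma mer_inv f c : mer_at f c -> mer_at (fun w => / f w)%C c.
Proof.
  intros H; destruct (mer_dich f c H) as [Z|[p Hp]].
  - apply (mer_ext (fun _ => / 0)%C); [|apply mer_const].
    revert Z; apply pnear_imp; intros w _ ->; reflexivity.
  - eapply ord_mer, ord_inv, Hp.
Qed.
Lemma Cderive_ext f g z : near z (fun w => f w = g w) -> df f z -> Cderive g z = Cderive f z.
Proof. intros E H; apply Cderive_D; eapply D_ext; eauto; now apply df_D. Qed.
Lemma pnear_deriv f c p h : holo_at h c -> pnear c (fun w => f w = (zp (w - c) p * h w)%C) ->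
  pnear c (fun w => df f w /\
    Cderive f w = (zp (w - c) (p - 1) * (RtoC (IZR p) * h w + (w - c) * Cderive h w))%C).
Proof.
  intros Hh H; apply pnear_near in H.
  generalize (pnear_and _ _ _ (pnear_neq c) (pnear_and _ _ _ H (near_pnear _ _ (holo_near _ _ Hh)))).
  apply pnear_imp; intros w _ [N [E K]].
  assert (Dw : D f w (RtoC (IZR p) * zp (w - c) (p - 1) * h w + zp (w - c) p * Cderive h w)%C).
  { apply (D_ext (fun x => zp (x - c) p * h x)%C); [now apply near_eq_sym|].
    eapply D_eq; [apply D_mult; [apply (D_comp (fun x => zp x p) (fun x => x - c)%C);
      [apply D_minus; [apply D_id|apply D_const]|now apply D_zp]|now apply holo_D]|].
    simpl; ring. }
  split; [eexists; eauto|]; rewrite (Cderive_D _ _ _ Dw).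
  replace p with ((p - 1) + 1)%Z at 3 by lia; rewrite zp_add, zp_1 by auto; ring.
Qed.
Lemma mer_Cderive f c : mer_at f c -> mer_at (Cderive f) c.
Proof.
  intros [p [h [Hh H]]]; exists (p - 1)%Z, (fun w => RtoC (IZR p) * h w + (w - c) * Cderive h w)%C; split.
  - apply holo_plus; [apply holo_mult; auto; apply holo_const|].
    apply holo_mult; [apply holo_sub_id | now apply holo_Cderive].
  - generalize (pnear_deriv _ _ _ _ Hh H); apply pnear_imp; intros w _ [_ E]; exact E.
Qed.
Lemma ord_deriv f c p : ord f c p -> p <> 0%Z -> ord (Cderive f) c (p - 1).
Proof.
  intros [h [Hh [Hn H]]] Hp; exists (fun w => RtoC (IZR p) * h w + (w - c) * Cderive h w)%C; repeat split.
  - apply holo_plus; [apply holo_mult; auto; apply holo_const|].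
    apply holo_mult; [apply holo_sub_id | now apply holo_Cderive].
  - replace (RtoC (IZR p) * h c + (c - c) * Cderive h c)%C with (RtoC (IZR p) * h c)%C by ring.
    apply Cmult_neq_0; auto; intro E; apply RtoC_inj in E; apply Hp; now apply eq_IZR.
  - generalize (pnear_deriv _ _ _ _ Hh H); apply pnear_imp; intros w _ [_ E]; exact E.
Qed.
(** Off [c], f agrees with its holomorphic cofactor, and so do the derivatives. *)
Lemma ord_deriv0 f c q : ord f c 0 -> ord (Cderive f) c q -> (0 <= q)%Z.
Proof.
  intros [h [Hh [Hn H]]] K; apply (holo_ord_nonneg (Cderive h) c); [now apply holo_Cderive|].
  revert K; apply ord_ext.
  assert (E : pnear c (fun w => near w (fun x => h x = f x))).
  { apply pnear_near in H; revert H; apply pnear_imp; intros w _; apply near_imp; intros x ->.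
    rewrite zp_0; ring. }
  generalize (pnear_and _ _ _ E (near_pnear _ _ (holo_near _ _ Hh))); apply pnear_imp.
  intros w _ [E1 E2]; apply Cderive_ext; auto; now apply holo_is_df.
Qed.
Lemma mer_df f c : mer_at f c -> pnear c (holo_at f).
Proof.
  intros [p [h [Hh H]]].
  assert (X := pnear_near _ _ (pnear_deriv _ _ _ _ Hh H)).
  revert X; apply pnear_imp; intros w _ X; apply holo_df; revert X; apply near_imp; intros x [Hx _]; exact Hx.
Qed.
(** Argued by orders: a nonzero f - a vanishing at [c] has some order n >= 1, so its derivative has
    order n - 1 and cannot vanish identically. *)
Lemma df_lz_minus f c : mer_at f c -> lz (Cderive f) c -> exists a, lz (fun w => f w - a)%C c.
Proof.
  intros H K; destruct (mer_dich f c H) as [Z|[p Hp]].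
  { exists 0; revert Z; apply lz_ext, pnear_all; intros; ring. }
  destruct (Z.eq_dec p 0) as [->|Np].
  2:{ exfalso; exact (ord_not_lz _ _ _ (ord_deriv _ _ _ Hp Np) K). }
  destruct Hp as [h [Hh [Hn Hf]]].
  exists (h c).
  assert (E : pnear c (fun w => f w = h w))
    by (revert Hf; apply pnear_imp; intros w _ ->; rewrite zp_0; ring).
  apply (lz_ext (fun w => h w - h c)%C).
  { revert E; apply pnear_imp; intros w _ ->; reflexivity. }
  assert (Hm : holo_at (fun w => h w - h c)%C c) by (apply holo_minus; auto; apply holo_const).
  apply NNPP; intro N; destruct (holo_ord_nat _ _ Hm N) as [n [On Hn1]].
  specialize (Hn1 ltac:(ring)).
  assert (O1 := ord_deriv _ _ _ On ltac:(lia)); apply (ord_not_lz _ _ _ O1).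
  revert K; apply lz_ext.
  apply pnear_near in E; generalize (pnear_and _ _ _ E (near_pnear _ _ (holo_near _ _ Hh))).
  apply pnear_imp; intros w _ [E1 E2].
  transitivity (Cderive h w).
  - apply Cderive_ext; [now apply near_eq_sym|now apply holo_is_df].
  - symmetry; apply Cderive_D; eapply D_eq; [apply D_minus; [now apply holo_D|apply D_const]|ring].
Qed.
(** An order >= 0 would keep f bounded near [c], so it is enough to find any order at all, and 1/f
    leads to it. *)
Lemma pole_ord f c : pnear c (df f) ->
  (forall M, pnear c (fun w => M < Cmod (f w))) -> exists p, (1 <= p)%Z /\ ord f c (- p).
Proof.
  intros Hd Hinf.
  assert (Hnz : pnear c (fun w => f w <> RtoC 0)).
  { generalize (Hinf 0); apply pnear_imp; intros w _ Hw; now apply Cmod_pos_neq. }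
  (* With (w - c)^2 as numerator the extension by 0 is visibly differentiable at [c], with
     derivative 0; this replaces a removable singularity theorem. *)
  set (h := fun w => if excluded_middle_informative (w = c) then RtoC 0 else ((w - c) * (w - c) / f w)%C).
  assert (Hh : holo_at h c).
  { apply holo_df, near_of_pnear.
    - exists (RtoC 0); intros e He.
      apply near_of_pnear.
      + rewrite Cmod_self; replace (h c - h c - 0 * 0)%C with (RtoC 0) by ring.
        replace (h c - h c - (c - c) * 0)%C with (RtoC 0) by ring; rewrite Cmod_0; lra.
      + generalize (pnear_and _ _ _ (Hinf (/ e))
          (near_pnear _ _ (near_ball c 1 c ltac:(rewrite Cmod_self; lra)))); apply pnear_imp.
        intros w Hw [H1 H2]; unfold h.
        destruct (excluded_middle_informative (w = c)); [contradiction|].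
        destruct (excluded_middle_informative (c = c)); [|congruence].
        assert (Hi : 0 < / e) by now apply Rinv_0_lt_compat.
        assert (Hf0 : f w <> RtoC 0) by (apply Cmod_pos_neq; lra).
        replace ((w - c) * (w - c) / f w - 0 - (w - c) * 0)%C with ((w - c) * ((w - c) / f w))%C by (field; auto).
        rewrite Cmod_mult, Cmod_div, (Rmult_comm e) by auto; apply Rmult_le_compat_l; [apply Cmod_ge_0|].
        assert (/ Cmod (f w) <= e) by (rewrite <- (Rinv_inv e); apply Rinv_le_contravar; lra).
        assert (0 < / Cmod (f w)) by (apply Rinv_0_lt_compat; lra).
        assert (0 <= Cmod (w - c)%C) by apply Cmod_ge_0.
        unfold Rdiv; nra.
    - generalize (pnear_and _ _ _ Hd Hnz); apply pnear_imp; intros w Hw [[l Hl] Hn].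
      apply (df_ext (fun x => (x - c) * (x - c) / f x)%C).
      + generalize (near_neq _ _ Hw); apply near_imp; intros x Hx; unfold h.
        destruct (excluded_middle_informative (x = c)); [contradiction|reflexivity].
      + eexists; apply D_div; [exact Hn| |exact Hl].
        apply D_mult; (apply D_minus; [apply D_id|apply D_const]). }
  assert (Nlz : ~ lz h c).
  { intro K; refine (pnear_False c (fun w => False) (fun _ X => X) _).
    generalize (pnear_and _ _ _ K Hnz); apply pnear_imp; intros w Hw [H1 H2]; unfold h in H1.
    destruct (excluded_middle_informative (w = c)); [contradiction|].
    revert H1; apply Cmult_neq_0; [apply Cmult_neq_0; now apply Csub_neq|now apply Cinv_nz]. }
  destruct (holo_ord_nat h c Hh Nlz) as [n [Hn _]].
  assert (Hof : ord f c (2 - Z.of_nat n)).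
  { assert (O2 : ord (fun w => (w - c) ^ 2)%C c 2).
    { exists (fun _ => RtoC 1); repeat split; [apply holo_const|apply C1_neq0|].
      apply pnear_all; intros w; change 2%Z with (Z.of_nat 2); rewrite zp_nat; ring. }
    generalize (ord_div _ _ _ _ _ O2 Hn); apply ord_ext.
    revert Hnz; apply pnear_imp; intros w Hw Hn0; unfold h.
    destruct (excluded_middle_informative (w = c)); [contradiction|].
    assert (X := Csub_neq _ _ Hw); simpl; field; split; auto. }
  destruct (Z.le_gt_cases 1 (Z.of_nat n - 2)) as [L|L].
  - exists (Z.of_nat n - 2)%Z; split; auto.
    replace (- (Z.of_nat n - 2))%Z with (2 - Z.of_nat n)%Z by lia; auto.
  - exfalso; destruct Hof as [g [Hg [_ Hf]]].
    set (k := Z.to_nat (2 - Z.of_nat n)).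
    set (G := fun w => ((w - c) ^ k * g w)%C).
    assert (HG : holo_at G c) by (apply holo_mult; auto; apply holo_pow, holo_sub_id).
    refine (pnear_False c (fun w => False) (fun _ X => X) _).
    generalize (pnear_and _ _ _ (pnear_and _ _ _ Hf (Hinf (Cmod (G c) + 1)))
      (near_pnear _ _ (holo_cont _ _ HG 1 Rlt_0_1))); apply pnear_imp.
    intros w Hw [[E1 E2] E3].
    assert (EG : f w = G w).
    { rewrite E1; unfold G; rewrite <- (zp_nat _ k); do 2 f_equal; unfold k; lia. }
    rewrite EG in E2; assert (T := Cmod_tri_sub (G w) (G c)); lra.
Qed.

(** * Functions meromorphic in the plane and the identity theorem *)

Definition mero (f : C -> C) : Prop := forall z, mer_at f z.
Definition nz (f : C -> C) : Prop := forall z, exists p, ord f z p.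
(** Let [t] be the supremum of the times up to which f vanishes locally along the segment from z0 to
    z1. At time [t] an order would exclude zeros nearby, so f vanishes locally there too, hence a
    little further on. *)
Lemma ident f z0 z1 : mero f -> lz f z0 -> lz f z1.
Proof.
  intros Hm H0.
  set (ga := fun t => (z0 + RtoC t * (z1 - z0))%C).
  set (E := fun t => 0 <= t <= 1 /\ forall s, 0 <= s <= t -> lz f (ga s)).
  assert (g0 : ga 0 = z0) by (unfold ga; ring).
  assert (g1 : ga 1 = z1) by (unfold ga; ring).
  assert (E0 : E 0).
  { split; [lra|]; intros s Hs; replace s with 0 by lra; now rewrite g0. }
  destruct (completeness E) as [t [Ht1 Ht2]].
  - exists 1; intros x [Hx _]; lra.
  - now exists 0.
  - assert (Ht : 0 <= t <= 1).
    { split; [now apply Ht1|]; apply Ht2; intros x [Hx _]; lra. }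
    assert (Hlt : forall s, 0 <= s < t -> lz f (ga s)).
    { intros s Hs; apply NNPP; intro N.
      assert (t <= s); [|lra]; apply Ht2; intros x [Hx Kx].
      apply Rnot_lt_le; intro; apply N, Kx; lra. }
    set (L := Cmod (z1 - z0)%C); assert (HL : 0 <= L) by apply Cmod_ge_0.
    assert (Hdist : forall s u, Cmod (ga s - ga u)%C = Rabs (s - u) * L).
    { intros s u; unfold ga, L; rewrite <- Cmod_R, <- Cmod_mult; f_equal.
      rewrite RtoC_minus; ring. }
    assert (Zt : lz f (ga t)).
    { destruct (mer_dich f (ga t) (Hm _)) as [Z|[p Hp]]; auto.
      destruct (Req_dec t 0) as [->|Nt]; [now rewrite g0|].
      destruct (Req_dec L 0) as [L0|NL].
      { assert (X : ga t = z0).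
        { apply Csub_eq, Cmod_eq_0; rewrite <- g0, Hdist, L0; ring. }
        now rewrite X. }
      exfalso; destruct (ord_nz _ _ _ Hp) as [e [He Ke]].
      set (s := Rmax 0 (t - e / (2 * L))).
      assert (Hs : 0 <= s < t).
      { unfold s; split; [apply Rmax_l|]; apply Rmax_lub_lt; [lra|].
        assert (0 < e / (2 * L)) by (apply Rdiv_lt_0_compat; lra); lra. }
      assert (Hs2 : Rabs (s - t) * L < e).
      { rewrite Rabs_minus_sym, Rabs_pos_eq by lra.
        assert (t - e / (2 * L) <= s) by apply Rmax_r.
        apply Rle_lt_trans with (e / (2 * L) * L); [apply Rmult_le_compat_r; lra|].
        replace (e / (2 * L) * L) with (e / 2) by (field; auto); lra. }
      assert (Ns : ga s <> ga t).
      { intro X; assert (Y := Hdist s t); rewrite X, Cmod_self in Y.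
        symmetry in Y; apply Rmult_integral in Y; destruct Y as [Y|Y]; [|lra].
        revert Y; apply Rabs_no_R0; lra. }
      destruct (pnear_and _ _ _ (Hlt s Hs) (near_pnear _ _ (near_and _ _ _
         (near_ball (ga t) e (ga s) ltac:(rewrite Hdist; auto)) (near_neq _ _ Ns)))) as [d [Hd Kd]].
      destruct (pnear_ex (ga s) (fun w => w <> ga s /\ Cmod (w - ga s)%C < d) d Hd) as [w [_ [_ [W1 W2]]]].
      { exists d; split; auto. }
      destruct (Kd w W1 W2) as [F1 [F2 F3]]; exact (Ke w F3 F2 F1). }
    destruct Zt as [e [He Ke]].
    assert (Zn : forall s, Rabs (s - t) * L < e -> lz f (ga s)).
    { intros s Hs.
      destruct (excluded_middle_informative (ga s = ga t)) as [->|N]; [exists e; auto|].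
      assert (X := near_and _ _ _ (near_ball (ga t) e (ga s) ltac:(rewrite Hdist; auto)) (near_neq _ _ N)).
      generalize (near_pnear _ _ X); apply pnear_imp; intros w _ [X1 X2]; auto. }
    destruct (Req_dec t 1) as [->|N1].
    { rewrite <- g1; apply Zn; unfold Rminus; rewrite Rplus_opp_r, Rabs_R0; lra. }
    exfalso.
    set (u := Rmin 1 (t + e / (2 * (L + 1)))).
    assert (Hp : 0 < e / (2 * (L + 1))) by (apply Rdiv_lt_0_compat; lra).
    assert (Hu : t < u) by (unfold u; apply Rmin_glb_lt; lra).
    assert (u <= t); [|lra]; apply Ht1; split; [split; [lra|apply Rmin_l]|].
    intros s Hs; destruct (Rlt_dec s t) as [|Nst]; [apply Hlt; lra|].
    apply Zn; rewrite Rabs_pos_eq by lra.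
    assert (u <= t + e / (2 * (L + 1))) by apply Rmin_r.
    apply Rle_lt_trans with (e / (2 * (L + 1)) * (L + 1)); [apply Rmult_le_compat; lra|].
    replace (e / (2 * (L + 1)) * (L + 1)) with (e / 2) by (field; lra); lra.
Qed.
Lemma mero_nz f : mero f -> (exists z, ~ lz f z) -> nz f.
Proof.
  intros Hm [z0 H] z; destruct (mer_dich f z (Hm z)) as [Z|]; auto.
  exfalso; apply H; eapply ident; eauto.
Qed.
Lemma nz_mero f : nz f -> mero f.
Proof. intros H z; destruct (H z); eapply ord_mer; eauto. Qed.
Definition ordf (f : C -> C) (z : C) : Z := epsilon (inhabits 0%Z) (ord f z).
Lemma ordf_eq f z p : ord f z p -> ordf f z = p.
Proof.
  intros H; apply (ord_unique f z); auto; unfold ordf; apply epsilon_spec; eauto.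
Qed.
Lemma nz_ordf f z : nz f -> ord f z (ordf f z).
Proof. intros H; destruct (H z) as [p Hp]; now rewrite (ordf_eq _ _ _ Hp). Qed.

(** * Counting functions and Jensen's formula *)

(** [compactness_list] gives the finite cover of a square under a double negation, which classical
    logic removes. Halving delta turns coordinate bounds into a bound on the modulus. *)
Lemma disc_cover (delta : C -> R) K : (forall z, 0 < delta z) ->
  exists l : list C, forall z, Cmod z <= K -> exists t, In t l /\ Cmod (z - t)%C < delta t.
Proof.
  intros Hd.
  assert (Hp : forall t : Compactness.Tn 2 R, 0 < delta (fst t, fst (snd t)) / 2).
  { intros t; specialize (Hd (fst t, fst (snd t))); lra. }
  apply NNPP; intro N.
  apply (compactness_list 2 (-K, (-K, tt)) (K, (K, tt)) (fun t => mkposreal _ (Hp t))).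
  intros [l Hl]; apply N.
  exists (map (fun t => (fst t, fst (snd t))) l); intros [x y] Hz.
  destruct (Hl (x, (y, tt))) as [t [Ht [_ Hc]]].
  { assert (A := Rle_trans _ _ _ (fst_le_Cmod (x, y)) Hz).
    assert (B := Rle_trans _ _ _ (snd_le_Cmod (x, y)) Hz).
    simpl in *; apply Rabs_le_between in A; apply Rabs_le_between in B; repeat split; lra. }
  exists (fst t, fst (snd t)); split; [now apply (in_map (fun t => (fst t, fst (snd t))))|].
  destruct t as [t1 [t2 []]]; simpl in *; destruct Hc as [H1 [H2 _]].
  eapply Rle_lt_trans; [apply Cmod_le_sum|]; simpl; unfold Rminus in *; lra.
Qed.
(** Monotonicity in the first argument lets finitely many local bounds be replaced by their
    maximum. *)
Lemma near_compact (P : R -> C -> Prop) K :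
  (forall M M' w, M <= M' -> P M w -> P M' w) ->
  (forall z, exists M, near z (P M)) -> exists M, forall w, Cmod w <= K -> P M w.
Proof.
  intros Hmon Hloc.
  assert (H1 : forall z, exists d, 0 < d /\ exists M, forall w, Cmod (w - z)%C < d -> P M w).
  { intros z; destruct (Hloc z) as [M [d [Hd H]]]; exists d; split; eauto. }
  set (delta := fun z => proj1_sig (constructive_indefinite_description _ (H1 z))).
  assert (Hdelta : forall z, 0 < delta z /\ exists M, forall w, Cmod (w - z)%C < delta z -> P M w).
  { intros z; exact (proj2_sig (constructive_indefinite_description _ (H1 z))). }
  destruct (disc_cover delta K ltac:(apply Hdelta)) as [l Hl].
  assert (HM : exists M, forall t, In t l -> forall w, Cmod (w - t)%C < delta t -> P M w).
  { clear Hl; induction l as [|t l [M IH]].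
    - exists 0; intros t [].
    - destruct (Hdelta t) as [_ [M' HM']]; exists (Rmax M M'); intros s [<-|Hs] w Hw.
      + eapply Hmon; [apply Rmax_r|]; auto.
      + eapply Hmon; [apply Rmax_l|]; eauto. }
  destruct HM as [M HM]; exists M; intros w Hw; destruct (Hl w Hw) as [t [Ht Hwt]]; eauto.
Qed.
Definition LF (A : C -> Prop) : Prop :=
  forall K, exists l : list C, forall z, Cmod z <= K -> A z -> In z l.
Lemma LF_isolated (A : C -> Prop) : (forall z, pnear z (fun w => ~ A w)) -> LF A.
Proof.
  intros H K.
  set (delta := fun z => proj1_sig (constructive_indefinite_description _ (H z))).
  assert (Hd : forall z, 0 < delta z /\ forall w, w <> z -> Cmod (w - z)%C < delta z -> ~ A w).
  { intros z; exact (proj2_sig (constructive_indefinite_description _ (H z))). }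
  destruct (disc_cover delta K ltac:(apply Hd)) as [l Hl].
  exists l; intros z Hz Az; destruct (Hl z Hz) as [t [Ht Hzt]].
  destruct (excluded_middle_informative (z = t)) as [->|N]; auto.
  exfalso; exact (proj2 (Hd t) z N Hzt Az).
Qed.
Definition good (f : C -> C) (z : C) : Prop := holo_at f z /\ f z <> RtoC 0.
(* [Bd] is a locally finite set outside which all functions under consideration are holomorphic and
   nonzero; means are taken over circles that avoid it, and its points carry the counting functions. *)
Definition Mer (Bd : C -> Prop) (f : C -> C) : Prop := nz f /\ forall z, ~ Bd z -> good f z.
Lemma nz_good f z : nz f -> pnear z (good f).
Proof.
  intros H; destruct (H z) as [p Hp].
  exact (pnear_and _ _ _ (mer_df _ _ (ord_mer _ _ _ Hp)) (ord_nz _ _ _ Hp)).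
Qed.
Definition bads (l : list (C -> C)) (z : C) : Prop := exists f, In f l /\ ~ good f z.
Lemma bads_LF l : (forall f, In f l -> nz f) -> LF (bads l).
Proof.
  intros H; apply LF_isolated; intros z; induction l as [|f l IH].
  - apply pnear_all; intros w [f [[] _]].
  - generalize (pnear_and _ _ _ (IH (fun g Hg => H g (or_intror Hg))) (nz_good f z (H f (or_introl eq_refl)))).
    apply pnear_imp; intros w _ [H1 H2] [g [[<-|Hg] Hb]]; [auto|]; apply H1; exists g; auto.
Qed.
Lemma bads_Mer l f : (forall f, In f l -> nz f) -> In f l -> Mer (bads l) f.
Proof.
  intros H Hf; split; auto; intros z Hz; apply NNPP; intro N; apply Hz; exists f; auto.
Qed.
(** Radii of at least 1 keep the weights [lam] nonnegative. *)
Definition gr (Bd : C -> Prop) (r : R) : Prop := 1 <= r /\ forall z, Cmod z = r -> ~ Bd z.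
Lemma avoid_list (l : list R) a b : a < b ->
  exists a' b', a <= a' /\ a' < b' /\ b' <= b /\ forall x, In x l -> ~ (a' < x < b').
Proof.
  intros Hab; induction l as [|x l [a' [b' (H1 & H2 & H3 & H4)]]].
  - exists a, b; repeat split; try lra; intros x [].
  - destruct (Rlt_dec a' x) as [L1|L1]; [destruct (Rlt_dec x b') as [L2|L2]|].
    + exists a', x; repeat split; try lra; intros y [<-|Hy]; [lra|]; intros Hxy; apply (H4 y Hy); lra.
    + exists a', b'; repeat split; try lra; intros y [<-|Hy]; [lra|auto].
    + exists a', b'; repeat split; try lra; intros y [<-|Hy]; [lra|auto].
Qed.
Lemma gr_ex Bd a b : LF Bd -> 1 <= a -> a < b -> exists r, a < r < b /\ gr Bd r.
Proof.
  intros HL Ha Hab; destruct (HL b) as [l Hl].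
  destruct (avoid_list (map Cmod l) a b Hab) as [a' [b' (H1 & H2 & H3 & H4)]].
  exists ((a' + b') / 2); repeat split; try lra.
  intros z Hz Bz; apply (H4 (Cmod z)); [apply in_map, Hl; auto; lra|lra].
Qed.
Lemma gr_right Bd r : LF Bd -> gr Bd r -> exists r', r < r' /\ forall z, r <= Cmod z < r' -> ~ Bd z.
Proof.
  intros HL [Hr1 Hr]; destruct (HL (r + 1)) as [l Hl].
  assert (H : exists r', r < r' <= r + 1 /\ forall z, In z l -> Bd z -> ~ (r <= Cmod z < r')).
  { clear Hl; induction l as [|a l [r' [H1 H2]]].
    - exists (r + 1); split; [lra|]; intros z [].
    - destruct (classic (Bd a)) as [Ba|Na].
      + destruct (Rle_dec r (Cmod a)) as [L|L].
        * assert (Cmod a <> r) by (intro E; exact (Hr a E Ba)).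
          exists (Rmin r' (Cmod a)); split.
          { split; [apply Rmin_glb_lt; lra|eapply Rle_trans; [apply Rmin_l|lra]]. }
          intros z [<-|Hz] Bz Hc.
          { generalize (Rmin_r r' (Cmod a)); lra. }
          { apply (H2 z Hz Bz); generalize (Rmin_l r' (Cmod a)); lra. }
        * exists r'; split; auto; intros z [<-|Hz] Bz; [lra|auto].
      + exists r'; split; auto; intros z [<-|Hz] Bz; [contradiction|auto]. }
  destruct H as [r' [H1 H2]]; exists r'; split; [lra|].
  intros z Hz Bz; apply (H2 z); auto; apply Hl; auto; lra.
Qed.
Definition cdec (x y : C) : {x = y} + {x <> y} := excluded_middle_informative (x = y).
Definition pts_spec (Bd : C -> Prop) r l := NoDup l /\ forall z, In z l <-> (Cmod z < r /\ Bd z).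
(** Some enumeration without repetition; its order is immaterial because [lsum] is invariant under
    permutations. *)
Definition pts (Bd : C -> Prop) (r : R) : list C := epsilon (inhabits []) (pts_spec Bd r).
Lemma pts_ok Bd r : LF Bd -> pts_spec Bd r (pts Bd r).
Proof.
  intros HL; apply (epsilon_spec (inhabits []) (pts_spec Bd r)); destruct (HL r) as [l Hl].
  exists (nodup cdec (filter (fun z => if excluded_middle_informative (Cmod z < r /\ Bd z) then true else false) l)).
  split; [apply NoDup_nodup|]; intros z; rewrite nodup_In, filter_In.
  destruct (excluded_middle_informative (Cmod z < r /\ Bd z)) as [[H1 H2]|H]; split; try tauto.
  - intros _; split; auto; apply Hl; auto; lra.
  - intros [_ X]; discriminate.
Qed.
Definition lsum (l : list C) (F : C -> R) : R := fold_right (fun a s => F a + s) 0 l.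
Lemma lsum_le l F G : (forall a, In a l -> F a <= G a) -> lsum l F <= lsum l G.
Proof.
  intros H; induction l as [|a l IH]; simpl; [lra|].
  apply Rplus_le_compat; [apply H; now left|apply IH; intros; apply H; now right].
Qed.
Lemma lsum_ext l F G : (forall a, In a l -> F a = G a) -> lsum l F = lsum l G.
Proof. intros H; apply Rle_antisym; apply lsum_le; intros; rewrite H; auto; lra. Qed.
Lemma lsum_plus l F G : lsum l (fun a => F a + G a) = lsum l F + lsum l G.
Proof. induction l as [|a l IH]; simpl; [lra|]; rewrite IH; lra. Qed.
Lemma lsum_scal l F k : lsum l (fun a => k * F a) = k * lsum l F.
Proof. induction l as [|a l IH]; simpl; [lra|]; rewrite IH; lra. Qed.
Lemma lsum_perm l l' F : Permutation l l' -> lsum l F = lsum l' F.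
Proof. induction 1; simpl; lra. Qed.
Lemma lsum_nonneg l F : (forall a, In a l -> 0 <= F a) -> 0 <= lsum l F.
Proof. intros H; replace 0 with (lsum l (fun _ => 0)); [now apply lsum_le|]. induction l; simpl; [lra|rewrite IHl; [lra|]; intros; apply H; now right]. Qed.
Lemma lsum_filter l (b : C -> bool) F : (forall a, In a l -> b a = false -> F a = 0) ->
  lsum (filter b l) F = lsum l F.
Proof.
  intros H; induction l as [|a l IH]; simpl; auto.
  assert (IH' := IH (fun x Hx => H x (or_intror Hx))).
  destruct (b a) eqn:E; simpl; rewrite IH'; auto; rewrite (H a (or_introl eq_refl) E); lra.
Qed.
(** The weight of a point in Jensen's formula: the integral of dt/t from |a| to r, started at t = 1
    when a = 0. *)
Definition lam (r : R) (a : C) : R :=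
  if Rlt_dec (Cmod a) r then (if cdec a (RtoC 0) then ln r else ln (r / Cmod a)) else 0.
Lemma ln_nonneg x : 1 <= x -> 0 <= ln x.
Proof. intros [H|<-]; [left; rewrite <- ln_1; apply ln_increasing; lra|rewrite ln_1; lra]. Qed.
Lemma ln_le x y : 0 < x -> x <= y -> ln x <= ln y.
Proof. intros H [L| ->]; [left; now apply ln_increasing|lra]. Qed.
Lemma lam_nonneg r a : 1 <= r -> 0 <= lam r a.
Proof.
  intros Hr; unfold lam; destruct (Rlt_dec (Cmod a) r) as [L|L]; [|lra].
  destruct (cdec a (RtoC 0)) as [E|E]; apply ln_nonneg; auto.
  assert (Hp := Cmod_pos _ E); apply Rmult_le_reg_r with (Cmod a); auto.
  unfold Rdiv; rewrite Rmult_assoc, Rinv_l; lra.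
Qed.
(** The left side is the mean of ln |z - a|; only the first summand on the right depends on [r]. *)
Lemma lam_max r a : 0 < r -> ln (Rmax r (Cmod a)) = lam r a + (if cdec a (RtoC 0) then 0 else ln (Cmod a)).
Proof.
  intros Hr; unfold lam; destruct (cdec a (RtoC 0)) as [E|E].
  - rewrite E, Cmod_0, Rmax_left by lra; destruct (Rlt_dec 0 r); lra.
  - assert (Hp := Cmod_pos _ E); destruct (Rlt_dec (Cmod a) r) as [L|L].
    + rewrite Rmax_left, ln_div by lra; lra.
    + rewrite Rmax_right by lra; lra.
Qed.
(** The integrated counting function, with [d] as multiplicity; one definition serves zeros, poles,
    truncated counts and signed orders. *)
Definition Nf (Bd : C -> Prop) (r : R) (d : C -> R) : R := lsum (pts Bd r) (fun a => d a * lam r a).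
Lemma Nf_le Bd r d e : LF Bd -> 1 <= r -> (forall a, d a <= e a) -> Nf Bd r d <= Nf Bd r e.
Proof.
  intros HL Hr H; apply lsum_le; intros a _; apply Rmult_le_compat_r; auto; now apply lam_nonneg.
Qed.
Lemma Nf_plus Bd r d e : Nf Bd r (fun a => d a + e a) = Nf Bd r d + Nf Bd r e.
Proof. unfold Nf; rewrite <- lsum_plus; apply lsum_ext; intros; ring. Qed.
Lemma Nf_scal Bd r d k : Nf Bd r (fun a => k * d a) = k * Nf Bd r d.
Proof. unfold Nf; rewrite <- lsum_scal; apply lsum_ext; intros; ring. Qed.
Lemma Nf_ext Bd r d e : (forall a, d a = e a) -> Nf Bd r d = Nf Bd r e.
Proof. intros H; apply lsum_ext; intros; now rewrite H. Qed.
Lemma Nf_nonneg Bd r d : 1 <= r -> (forall a, 0 <= d a) -> 0 <= Nf Bd r d.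
Proof. intros Hr H; apply lsum_nonneg; intros; apply Rmult_le_pos; auto; now apply lam_nonneg. Qed.
(** Points beyond [r] have weight 0, so several radii can share one list of points. *)
Lemma Nf_big Bd r s d : LF Bd -> r <= s -> Nf Bd r d = lsum (pts Bd s) (fun a => d a * lam r a).
Proof.
  intros HL Hrs; unfold Nf.
  destruct (pts_ok Bd r HL) as [N1 P1]; destruct (pts_ok Bd s HL) as [N2 P2].
  set (b := fun a : C => if Rlt_dec (Cmod a) r then true else false).
  rewrite <- (lsum_filter (pts Bd s) b).
  - apply lsum_perm, NoDup_Permutation; auto; [now apply NoDup_filter|].
    intros z; rewrite filter_In, P1, P2; unfold b; destruct (Rlt_dec (Cmod z) r); intuition; try lra; discriminate.
  - intros a _; unfold b, lam; destruct (Rlt_dec (Cmod a) r); [discriminate|intros; ring].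
Qed.
Lemma rc_lnsub r a : 0 <= r -> Cmod a <> r -> rc r (fun z => ln (Cmod (z - a)%C)).
Proof.
  intros Hr Ha; apply (rc_lnmod r (fun z => z - a)%C); auto.
  - apply cc_minus; [now apply cc_id|apply cc_const].
  - intros z Hz; apply Csub_neq; intros ->; auto.
Qed.
Lemma avg_ln_sub r a : 0 < r -> Cmod a <> r -> avg r (fun z => ln (Cmod (z - a)%C)) = ln (Rmax r (Cmod a)).
Proof.
  intros Hr Ha; destruct (Rlt_dec r (Cmod a)) as [L|L].
  - rewrite (avg_lnmod (fun z => z - a)%C (Cmod a) r); [|intros z Hz|lra].
    + rewrite Rmax_right by lra; replace (0 - a)%C with (- a)%C by ring; now rewrite Cmod_opp.
    + split; [apply holo_sub_id|]; apply Csub_neq; intros ->; lra.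
  - rewrite Rmax_left by lra.
    destruct (cdec a (RtoC 0)) as [->|N].
    + rewrite (avg_ext r _ (fun _ => ln r)); [apply avg_const|lra|].
      intros z Hz; replace (z - 0)%C with z by ring; now rewrite Hz.
    + assert (Hp := Cmod_pos _ N).
      (* It has the modulus of z - a on the circle, while its zero r^2 / conj a lies outside the
         disc. *)
      set (g := fun z => (RtoC r - Cconj a * z / RtoC r)%C).
      assert (Hr0 : RtoC r <> RtoC 0) by (intro E; apply RtoC_inj in E; lra).
      rewrite (avg_ext r _ (fun z => ln (Cmod (g z)))); [|lra|].
      * rewrite (avg_lnmod g (r * r / Cmod a) r).
        -- unfold g; replace (RtoC r - Cconj a * 0 / RtoC r)%C with (RtoC r) by (field; auto).
           now rewrite Cmod_R, Rabs_pos_eq by lra.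
        -- intros z Hz; split.
           ++ apply holo_minus; [apply holo_const|]; apply holo_mult; [|apply holo_const].
              apply holo_mult; [apply holo_const|apply holo_id].
           ++ apply Csub_neq; intro E; apply (f_equal Cmod) in E.
              rewrite Cmod_div, Cmod_mult, Cmod_conj, Cmod_R, Rabs_pos_eq in E by (auto; lra).
              apply Rmult_lt_compat_l with (r := Cmod a) in Hz; auto.
              replace (Cmod a * (r * r / Cmod a)) with (r * r) in Hz by (field; lra).
              apply (f_equal (fun x => x * r)) in E; field_simplify in E; [|lra]; nra.
        -- split; auto; apply Rmult_lt_reg_r with (Cmod a); auto; unfold Rdiv.
           rewrite Rmult_assoc, Rinv_l, Rmult_1_r by lra; nra.
      * intros z Hz; f_equal.
        assert (Hz0 : z <> RtoC 0) by (apply Cmod_pos_neq; lra).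
        rewrite <- (Cmod_conj (z - a)%C), Cminus_conj, (Cconj_mult_R r z Hr Hz).
        replace (g z) with ((z * / RtoC r) * (RtoC (r * r) / z - Cconj a))%C.
        -- rewrite Cmod_mult, Cmod_mult, Cmod_inv, Hz, Cmod_R, Rabs_pos_eq by (auto; lra); field; lra.
        -- unfold g; rewrite RtoC_mult; field; auto.
Qed.
Definition prodZ (l : list C) (e : C -> Z) (z : C) : C :=
  fold_right (fun a p => (zp (z - a) (e a) * p)%C) (RtoC 1) l.
Lemma holo_zp a p z : z <> a -> holo_at (fun w => zp (w - a) p) z.
Proof.
  intros H; apply holo_df; generalize (near_neq _ _ H); apply near_imp; intros w Hw.
  eexists; apply (D_comp (fun x => zp x p) (fun x => x - a)%C);
    [apply D_minus; [apply D_id|apply D_const]|apply D_zp; now apply Csub_neq].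
Qed.
(** One point is divided out at a time; the quotient must be given its correct value at that point
    before the induction can go on. *)
Lemma disc_factor r (e : C -> Z) l : NoDup l -> forall X,
  (forall z, Cmod z < r -> ~ In z l -> good X z) -> (forall a, In a l -> ord X a (e a)) ->
  exists g, nvd g r /\ forall z, Cmod z < r -> ~ In z l -> X z = (prodZ l e z * g z)%C.
Proof.
  intros Hnd; induction Hnd as [|a l Ha Hnd IH]; intros X Hg Ho.
  - exists X; split; [intros z Hz; apply Hg; auto|intros z _ _; simpl; ring].
  - destruct (Ho a (or_introl eq_refl)) as [h [Hh [Hn Hf]]].
    set (X1 := fun w => if cdec w a then h a else (X w * / zp (w - a) (e a))%C).
    assert (E1 : forall z, z <> a -> near z (fun w => (X w * / zp (w - a) (e a))%C = X1 w)).
    { intros z Hz; generalize (near_neq _ _ Hz); apply near_imp; intros w Hw; unfold X1.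
      destruct (cdec w a); [contradiction|reflexivity]. }
    assert (Hz1 : forall z, z <> a -> holo_at (fun w => / zp (w - a) (e a))%C z /\ (/ zp (z - a) (e a))%C <> RtoC 0).
    { intros z Hz; assert (N := zp_nz _ (e a) (Csub_neq _ _ Hz)); split; [|now apply Cinv_nz].
      apply (holo_inv (fun w => zp (w - a) (e a))); auto; now apply holo_zp. }
    assert (Ea : near a (fun w => h w = X1 w)).
    { apply near_of_pnear.
      - unfold X1; destruct (cdec a a); congruence.
      - generalize (pnear_and _ _ _ (pnear_neq a) Hf); apply pnear_imp; intros w Hw [N E]; unfold X1.
        destruct (cdec w a); [contradiction|]; rewrite E; field; now apply zp_nz. }
    destruct (IH X1) as [g [Hg1 Hg2]].
    + intros z Hz Hin; destruct (cdec z a) as [->|Nz].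
      * split; [eapply holo_ext; eauto|]; rewrite <- (near_pt _ _ Ea); auto.
      * destruct (Hg z Hz) as [G1 G2]; [intros [X0|X0]; auto; congruence|].
        destruct (Hz1 z Nz) as [Z1 Z2]; split.
        -- apply (holo_ext _ _ _ (E1 z Nz)), holo_mult; auto.
        -- rewrite <- (near_pt _ _ (E1 z Nz)); now apply Cmult_neq_0.
    + intros b Hb; assert (Nb : b <> a) by (intros ->; contradiction).
      destruct (Hz1 b Nb) as [Z1 Z2].
      apply (ord_ext _ _ _ _ (near_pnear _ _ (E1 b Nb))).
      replace (e b) with (e b + 0)%Z by lia.
      apply (ord_mult X (fun w => / zp (w - a) (e a))%C); [apply Ho; now right|now apply holo_ord0].
    + exists g; split; auto; intros z Hz Hin.
      assert (Nz : z <> a) by (intros ->; apply Hin; now left).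
      assert (N := zp_nz _ (e a) (Csub_neq _ _ Nz)).
      assert (Nl : ~ In z l) by (intro; apply Hin; now right).
      specialize (Hg2 z Hz Nl); rewrite <- (near_pt _ _ (E1 z Nz)) in Hg2.
      simpl; replace (X z) with (zp (z - a) (e a) * (X z * / zp (z - a) (e a)))%C by (field; auto).
      rewrite Hg2; ring.
Qed.
Lemma Mer_rep Bd f r : LF Bd -> Mer Bd f -> gr Bd r -> exists r' g, r < r' /\ nvd g r' /\
  (forall z, r <= Cmod z < r' -> ~ Bd z) /\
  forall z, Cmod z < r' -> ~ In z (pts Bd r) -> f z = (prodZ (pts Bd r) (ordf f) z * g z)%C.
Proof.
  intros HL [Hnz Hg] Hgr; destruct (gr_right Bd r HL Hgr) as [r' [Hr' Hno]].
  destruct (pts_ok Bd r HL) as [Hnd Hp].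
  destruct (disc_factor r' (ordf f) (pts Bd r) Hnd f) as [g [G1 G2]].
  - intros z Hz Hin; apply Hg; intro B; destruct (Rlt_dec (Cmod z) r) as [L|L].
    + apply Hin, Hp; auto.
    + apply (Hno z); auto; lra.
  - intros a _; now apply nz_ordf.
  - exists r', g; auto.
Qed.
Lemma avg_lsum r l (F : C -> C -> R) : (forall a, In a l -> rc r (F a)) ->
  rc r (fun z => lsum l (fun a => F a z)) /\
  avg r (fun z => lsum l (fun a => F a z)) = lsum l (fun a => avg r (F a)).
Proof.
  induction l as [|a l IH]; intros H; simpl.
  - split; [apply rc_const|apply avg_const].
  - destruct IH as [I1 I2]; [intros; apply H; now right|].
    assert (Ha := H a (or_introl eq_refl)); split; [now apply rc_plus|].
    rewrite avg_plus, I2 by auto; reflexivity.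
Qed.
Lemma ln_zp z p : z <> RtoC 0 -> ln (Cmod (zp z p)) = IZR p * ln (Cmod z).
Proof.
  intros Hz; assert (Hp := Cmod_pos _ Hz).
  destruct (Z_frac p) as [a [b ->]]; rewrite zp_frac by auto.
  rewrite Cmod_mult, Cmod_inv, !Cmod_pow by now apply Cpow_nz.
  rewrite ln_mult, ln_Rinv, !ln_pow by (auto; try apply Rinv_0_lt_compat; now apply pow_lt).
  rewrite minus_IZR, <- !INR_IZR_INZ; ring.
Qed.
Lemma ln_prodZ l e z : ~ In z l ->
  prodZ l e z <> RtoC 0 /\ ln (Cmod (prodZ l e z)) = lsum l (fun a => IZR (e a) * ln (Cmod (z - a)%C)).
Proof.
  induction l as [|a l IH]; intros H; simpl.
  - split; [apply C1_neq0|rewrite Cmod_1; apply ln_1].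
  - destruct IH as [I1 I2]; [intro; apply H; now right|].
    assert (N : (z - a)%C <> RtoC 0) by (apply Csub_neq; intros ->; apply H; now left).
    assert (Nz := zp_nz _ (e a) N).
    split; [now apply Cmult_neq_0|].
    rewrite Cmod_mult, ln_mult, I2, ln_zp by (auto; now apply Cmod_pos); reflexivity.
Qed.
Lemma jensen_disc f l e g r' r : 0 < r < r' -> nvd g r' -> (forall a, In a l -> Cmod a <> r) ->
  (forall z, Cmod z = r -> f z = (prodZ l e z * g z)%C) ->
  avg r (fun z => ln (Cmod (f z))) = lsum l (fun a => IZR (e a) * ln (Rmax r (Cmod a))) + ln (Cmod (g 0)).
Proof.
  intros Hr Hg Hl Hf.
  assert (HF : forall a, In a l -> rc r (fun z => IZR (e a) * ln (Cmod (z - a)%C))).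
  { intros a Ha; apply rc_scal, rc_lnsub; [lra|auto]. }
  destruct (avg_lsum r l (fun a z => IZR (e a) * ln (Cmod (z - a)%C)) HF) as [A1 A2].
  assert (Cg : rc r (fun z => ln (Cmod (g z)))).
  { apply rc_lnmod; [lra| |intros; apply Hg; lra].
    apply cc_ccont; [lra|]; intros; apply holo_cont, Hg; lra. }
  rewrite (avg_ext r _ (fun z => lsum l (fun a => IZR (e a) * ln (Cmod (z - a)%C)) + ln (Cmod (g z)))); [|lra|].
  - rewrite avg_plus, A2, (avg_lnmod g r' r) by auto; f_equal.
    apply lsum_ext; intros a Ha; rewrite avg_scal, avg_ln_sub by (auto; try lra; apply rc_lnsub; auto; lra).
    reflexivity.
  - intros z Hz; destruct (ln_prodZ l e z) as [N E]; [intro X; exact (Hl z X Hz)|].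
    rewrite Hf, Cmod_mult, ln_mult, E by (auto; apply Cmod_pos; auto; apply Hg; lra); reflexivity.
Qed.
(** The constant is fixed at a reference radius r0. That it is the same at r follows by reading both
    radii off one factorisation on a larger disc. *)
Lemma jensen Bd f : LF Bd -> Mer Bd f -> exists K, forall r, gr Bd r ->
  avg r (fun z => ln (Cmod (f z))) = Nf Bd r (fun a => IZR (ordf f a)) + K.
Proof.
  intros HL HM; destruct (gr_ex Bd 1 2 HL) as [r0 [_ Hr0]]; try lra.
  exists (avg r0 (fun z => ln (Cmod (f z))) - Nf Bd r0 (fun a => IZR (ordf f a))); intros r Hr.
  assert (X : exists s, gr Bd s /\ r <= s /\ r0 <= s).
  { destruct (Rle_dec r r0); [exists r0|exists r]; repeat split; auto; try lra; try apply Hr; try apply Hr0. }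
  destruct X as [s [Hs [L1 L2]]].
  destruct (Mer_rep Bd f s HL HM Hs) as [s' [g (Q1 & Q2 & Q3 & Q4)]].
  destruct (pts_ok Bd s HL) as [_ Hp].
  assert (Y : forall t, gr Bd t -> t <= s -> avg t (fun z => ln (Cmod (f z))) = Nf Bd t (fun a => IZR (ordf f a)) +
     (lsum (pts Bd s) (fun a => IZR (ordf f a) * (if cdec a (RtoC 0) then 0 else ln (Cmod a))) + ln (Cmod (g 0)))).
  { intros t [Ht1 Ht] Hts.
    assert (Hno : forall a, In a (pts Bd s) -> Cmod a <> t).
    { intros a Ha E; apply Hp in Ha; exact (Ht a E (proj2 Ha)). }
    rewrite (jensen_disc f (pts Bd s) (ordf f) g s' t); auto; [|lra|].
    - rewrite (Nf_big Bd t s) by auto; rewrite <- Rplus_assoc; f_equal; rewrite <- lsum_plus.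
      apply lsum_ext; intros a _; rewrite lam_max by lra; ring.
    - intros z Hz; apply Q4; [lra|]; intro X; exact (Hno z X Hz). }
  rewrite (Y r Hr L1), (Y r0 Hr0 L2); ring.
Qed.

(** * The characteristic function *)

(** With ln (1 + x) instead of the positive part of ln, products remain subadditive, and ln (1 +
    1/x) = ln (1 + x) - ln x makes the effect of inversion an exact identity. *)
Definition mf (r : R) (f : C -> C) : R := avg r (fun z => ln (1 + Cmod (f z))).
Definition pol (f : C -> C) (a : C) : R := IZR (Z.max 0 (- ordf f a)).
Definition zer (f : C -> C) (a : C) : R := IZR (Z.max 0 (ordf f a)).
Definition Tf Bd (r : R) (f : C -> C) : R := mf r f + Nf Bd r (pol f).
Lemma pol_nonneg f a : 0 <= pol f a.
Proof. apply IZR_le; lia. Qed.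
Lemma zer_nonneg f a : 0 <= zer f a.
Proof. apply IZR_le; lia. Qed.
Lemma zer_pol f a : IZR (ordf f a) = zer f a - pol f a.
Proof. unfold zer, pol; rewrite <- minus_IZR; f_equal; lia. Qed.
Lemma Mer_cc Bd f r : Mer Bd f -> gr Bd r -> cc r f.
Proof.
  intros [_ H] [Hr K]; apply cc_ccont; [lra|]; intros z Hz; apply holo_cont, H, K, Hz.
Qed.
Lemma Mer_neq Bd f r z : Mer Bd f -> gr Bd r -> Cmod z = r -> f z <> RtoC 0.
Proof. intros [_ H] [Hr K] Hz; apply H, K, Hz. Qed.
Lemma rc_l1 r f : 0 <= r -> cc r f -> rc r (fun z => ln (1 + Cmod (f z))).
Proof.
  intros Hr H; apply (rc_ln r (fun z => 1 + Cmod (f z))); auto.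
  - apply (rc_plus r (fun _ => 1)); [apply rc_const | now apply rc_Cmod].
  - intros z _; generalize (Cmod_ge_0 (f z)); lra.
Qed.
Lemma l1_nonneg x : 0 <= x -> 0 <= ln (1 + x).
Proof. intros; apply ln_nonneg; lra. Qed.
Lemma mf_nonneg r f : 0 <= r -> cc r f -> 0 <= mf r f.
Proof.
  intros Hr H; unfold mf; rewrite <- (avg_const r 0).
  apply avg_le; auto; [apply rc_const|now apply rc_l1|]; intros; apply l1_nonneg, Cmod_ge_0.
Qed.
Lemma Nf_pol_nonneg Bd r f : 1 <= r -> 0 <= Nf Bd r (pol f).
Proof. intros; apply Nf_nonneg; auto; intros; apply pol_nonneg. Qed.
Lemma Tf_nonneg Bd r f : Mer Bd f -> gr Bd r -> 0 <= Tf Bd r f.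
Proof.
  intros HM Hr; assert (Hr1 := proj1 Hr); unfold Tf.
  assert (H1 := mf_nonneg r f ltac:(lra) (Mer_cc _ _ _ HM Hr)); assert (H2 := Nf_pol_nonneg Bd r f Hr1); lra.
Qed.
Lemma Mer_mult Bd f g : Mer Bd f -> Mer Bd g -> Mer Bd (fun w => f w * g w)%C.
Proof.
  intros [N1 G1] [N2 G2]; split.
  - intros z; destruct (N1 z) as [p Hp]; destruct (N2 z) as [q Hq]; exists (p + q)%Z; now apply ord_mult.
  - intros z Hz; destruct (G1 z Hz), (G2 z Hz); split; [now apply holo_mult|now apply Cmult_neq_0].
Qed.
Lemma Mer_inv Bd f : Mer Bd f -> Mer Bd (fun w => / f w)%C.
Proof.
  intros [N1 G1]; split.
  - intros z; destruct (N1 z) as [p Hp]; exists (- p)%Z; now apply ord_inv.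
  - intros z Hz; destruct (G1 z Hz); split; [now apply holo_inv|now apply Cinv_nz].
Qed.
Lemma mf_mult r f g : 0 <= r -> cc r f -> cc r g -> mf r (fun w => f w * g w)%C <= mf r f + mf r g.
Proof.
  intros Hr Hf Hg; unfold mf; rewrite <- avg_plus by now apply rc_l1.
  apply avg_le; auto; [apply rc_l1; auto; now apply cc_mult|apply rc_plus; now apply rc_l1|].
  intros z _; rewrite Cmod_mult; assert (0 <= Cmod (f z)) by apply Cmod_ge_0; assert (0 <= Cmod (g z)) by apply Cmod_ge_0.
  rewrite <- ln_mult by lra; apply ln_le; nra.
Qed.
Lemma Tf_mult Bd r f g : LF Bd -> Mer Bd f -> Mer Bd g -> gr Bd r ->
  Tf Bd r (fun w => f w * g w)%C <= Tf Bd r f + Tf Bd r g.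
Proof.
  intros HL Hf Hg Hr; assert (Hr1 := proj1 Hr); unfold Tf.
  assert (H1 := mf_mult r f g ltac:(lra) (Mer_cc _ _ _ Hf Hr) (Mer_cc _ _ _ Hg Hr)).
  assert (H2 : Nf Bd r (pol (fun w => f w * g w)%C) <= Nf Bd r (pol f) + Nf Bd r (pol g)).
  { rewrite <- Nf_plus; apply Nf_le; auto; intros a; unfold pol.
    rewrite (ordf_eq _ a _ (ord_mult f g a _ _ (nz_ordf f a (proj1 Hf)) (nz_ordf g a (proj1 Hg)))).
    rewrite <- plus_IZR; apply IZR_le; lia. }
  lra.
Qed.
Lemma avg_ln_le_mf Bd f r : Mer Bd f -> gr Bd r -> avg r (fun z => ln (Cmod (f z))) <= mf r f.
Proof.
  intros Hf Hr; assert (Hr1 := proj1 Hr); apply avg_le; [lra| | |].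
  - apply rc_lnmod; [lra|eapply Mer_cc; eauto|intros; eapply Mer_neq; eauto].
  - apply rc_l1; [lra|eapply Mer_cc; eauto].
  - intros z Hz; apply ln_le; [apply Cmod_pos; eapply Mer_neq; eauto|lra].
Qed.
Lemma mf_inv Bd f r : Mer Bd f -> gr Bd r ->
  mf r (fun w => / f w)%C = mf r f - avg r (fun z => ln (Cmod (f z))).
Proof.
  intros Hf Hr; assert (Hr1 := proj1 Hr); unfold mf.
  assert (R1 : rc r (fun z => ln (1 + Cmod (f z)))) by (apply rc_l1; [lra|eapply Mer_cc; eauto]).
  assert (R2 : rc r (fun z => ln (Cmod (f z))))
    by (apply rc_lnmod; [lra|eapply Mer_cc; eauto|intros; eapply Mer_neq; eauto]).
  rewrite (avg_ext r _ (fun z => 1 * ln (1 + Cmod (f z)) + -1 * ln (Cmod (f z)))); [|lra|].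
  - rewrite avg_lin by auto; ring.
  - intros z Hz; assert (N := Mer_neq _ _ _ _ Hf Hr Hz); assert (Hp := Cmod_pos _ N).
    rewrite Cmod_inv by auto.
    replace (1 + / Cmod (f z)) with ((1 + Cmod (f z)) / Cmod (f z)) by (field; lra).
    rewrite ln_div by lra; ring.
Qed.
(** Inverting f lowers the mean by that of ln |f|, which by Jensen's formula is N(zeros) - N(poles)
    up to a constant; the poles thus give way to the zeros. *)
Lemma Tf_inv Bd f : LF Bd -> Mer Bd f -> exists K, forall r, gr Bd r ->
  Tf Bd r (fun w => / f w)%C = Tf Bd r f + K.
Proof.
  intros HL Hf; destruct (jensen Bd f HL Hf) as [K HK]; exists (- K); intros r Hr.
  unfold Tf; rewrite (mf_inv Bd) by auto; rewrite (HK r Hr).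
  rewrite (Nf_ext Bd r (fun a => IZR (ordf f a)) (fun a => zer f a + -1 * pol f a)) by (intros; rewrite zer_pol; ring).
  rewrite Nf_plus, Nf_scal.
  rewrite (Nf_ext Bd r (pol (fun w => / f w)%C) (zer f)); [ring|].
  intros a; unfold pol, zer; rewrite (ordf_eq _ a _ (ord_inv f a _ (nz_ordf f a (proj1 Hf)))); f_equal; lia.
Qed.

(** * Mean estimates for the logarithmic derivative *)

Lemma ln_le_sub x : 0 < x -> ln x <= x - 1.
Proof. intros Hx; assert (H := exp_ineq1_le (ln x)); rewrite exp_ln in H; lra. Qed.
Lemma rc_sqrt r F : rc r F -> rc r (fun z => sqrt (F z)).
Proof.
  intros H t; apply (continuous_comp (fun s => F (circ r s)) sqrt); [apply H|apply continuous_sqrt].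
Qed.
(* S(x) = x / (x^2 + e^2)^(1/4) is bounded by sqrt|x| and S'(x) dominates (x^2 + e^2)^(-1/4) / 2;
   integrating sin^2 S'(cos - b1) + cos^2 S'(sin - b2) by parts leaves bounded terms only. *)
Definition Sq (e x : R) : R := x / sqrt (sqrt (x * x + e * e)).
Definition dSq (e x : R) : R := (x * x / 2 + e * e) / ((x * x + e * e) * sqrt (sqrt (x * x + e * e))).
Lemma Sq_pos e x : 0 < e -> 0 < x * x + e * e /\ 0 < sqrt (x * x + e * e) /\ 0 < sqrt (sqrt (x * x + e * e)).
Proof.
  intros He; assert (0 < x * x + e * e) by nra; repeat split; auto; repeat apply sqrt_lt_R0; auto.
Qed.
Lemma Sq_deriv e x : 0 < e -> is_derive (Sq e) x (dSq e x).
Proof.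
  intros He; destruct (Sq_pos e x He) as [H1 [H2 H3]].
  unfold Sq, dSq; auto_derive; [repeat split; auto; lra|].
  set (E := x * x + e * e) in *; set (r := sqrt E) in *; set (q := sqrt r) in *.
  assert (Er : E = r * r) by (unfold r; now rewrite sqrt_sqrt by lra).
  assert (Rr : r = q * q) by (unfold q; now rewrite sqrt_sqrt by lra).
  assert (Ee : e * e = r * r - x * x) by (rewrite <- Er; unfold E; ring).
  rewrite Ee, Er, Rr; field; lra.
Qed.
Lemma Sq_bound e x : 0 < e -> Rabs x <= 4 -> Rabs (Sq e x) <= 2.
Proof.
  intros He Hx; destruct (Sq_pos e x He) as [H1 [H2 H3]]; unfold Sq.
  unfold Rdiv; rewrite Rabs_mult, (Rabs_pos_eq (/ _)) by (left; now apply Rinv_0_lt_compat).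
  apply Rmult_le_reg_r with (sqrt (sqrt (x * x + e * e))); auto.
  rewrite Rmult_assoc, Rinv_l, Rmult_1_r by lra.
  assert (B : Rabs x <= sqrt (x * x + e * e)).
  { rewrite <- (sqrt_Rsqr (Rabs x)) by apply Rabs_pos; apply sqrt_le_1_alt; rewrite <- Rsqr_abs; unfold Rsqr; nra. }
  set (r := sqrt (x * x + e * e)) in *; set (q := sqrt r) in *.
  assert (Rr : r = q * q) by (unfold q; now rewrite sqrt_sqrt by lra).
  assert (P := Rabs_pos x).
  destruct (Rle_dec (Rabs x) (2 * q)); auto; nra.
Qed.
Lemma dSq_lower e x t : 0 < e -> e <= t -> Rabs x <= t -> sqrt (/ t) <= 4 * dSq e x.
Proof.
  intros He Het Hxt; destruct (Sq_pos e x He) as [H1 [H2 H3]]; unfold dSq.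
  assert (Hx2 : x * x <= t * t) by (assert (Q := Rsqr_le_abs_1 x t); rewrite (Rabs_pos_eq t) in Q by lra; apply Q; auto).
  set (E := x * x + e * e) in *.
  assert (HE : E <= 4 * (t * t)) by (unfold E; nra).
  assert (Hr : sqrt E <= 2 * t).
  { rewrite <- (sqrt_Rsqr (2 * t)) by lra; apply sqrt_le_1_alt; unfold Rsqr; nra. }
  assert (Hq : sqrt (sqrt E) <= 2 * sqrt t).
  { replace (2 * sqrt t) with (sqrt (4 * t)).
    - apply sqrt_le_1_alt; lra.
    - rewrite sqrt_mult by lra; f_equal; replace 4 with (2 * 2) by ring; apply sqrt_square; lra. }
  assert (Ht : 0 < sqrt t) by (apply sqrt_lt_R0; lra).
  rewrite sqrt_inv.
  apply Rle_trans with (2 * / sqrt (sqrt E)).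
  - apply Rmult_le_reg_r with (sqrt t * sqrt (sqrt E)); [now apply Rmult_lt_0_compat|].
    replace (/ sqrt t * (sqrt t * sqrt (sqrt E))) with (sqrt (sqrt E)) by (field; lra).
    replace (2 * / sqrt (sqrt E) * (sqrt t * sqrt (sqrt E))) with (2 * sqrt t) by (field; lra); auto.
  - replace (4 * ((x * x / 2 + e * e) / (E * sqrt (sqrt E)))) with
      ((2 * (x * x + 2 * (e * e)) / E) * / sqrt (sqrt E)) by (field; lra).
    apply Rmult_le_compat_r; [left; now apply Rinv_0_lt_compat|].
    apply Rmult_le_reg_r with E; auto; unfold Rdiv; rewrite Rmult_assoc, Rinv_l by lra; unfold E; nra.
Qed.
Lemma dSq_cont e (u : R -> R) t : 0 < e -> continuous u t -> continuous (fun s => dSq e (u s)) t.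
Proof.
  intros He Hu; apply (continuous_comp u (dSq e)); auto.
  apply (ex_derive_continuous (K := R_AbsRing) (V := R_NormedModule)).
  destruct (Sq_pos e (u t) He) as [H1 [H2 H3]].
  unfold dSq; auto_derive; repeat split; auto; try lra; apply Rgt_not_eq; now apply Rmult_lt_0_compat.
Qed.
(** The bound does not depend on the distance of [a] from the circle, which is what allows poles
    arbitrarily close to it. *)
Lemma avg_sqrt_inv r a : 0 < r -> Cmod a <> r -> Cmod a <= 2 * r ->
  avg r (fun z => sqrt (r / Cmod (z - a)%C)) <= 16.
Proof.
  intros Hr Ha Ha2; destruct a as [a1 a2].
  set (b1 := a1 / r); set (b2 := a2 / r).
  (* The relative distance of [a] from the circle regularises the square root; it is at most |z - a|
     / r on the circle, as [dSq_lower] requires. *)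
  set (e := Rabs (Cmod (a1, a2) - r) / r).
  assert (He : 0 < e) by (unfold e; apply Rdiv_lt_0_compat; auto; apply Rabs_pos_lt; lra).
  assert (Hb : Rabs b1 <= 2 /\ Rabs b2 <= 2).
  { assert (F1 := fst_le_Cmod (a1, a2)); assert (F2 := snd_le_Cmod (a1, a2)); simpl in F1, F2.
    unfold b1, b2, Rdiv; rewrite !Rabs_mult, (Rabs_pos_eq (/ r)) by (left; now apply Rinv_0_lt_compat).
    split; apply Rmult_le_reg_r with r; auto; rewrite Rmult_assoc, Rinv_l by lra; lra. }
  destruct Hb as [Hb1 Hb2].
  set (t := fun th => Cmod (circ r th - (a1, a2))%C / r).
  assert (Ht : forall th, e <= t th /\ Rabs (cos th - b1) <= t th /\ Rabs (sin th - b2) <= t th).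
  { intros th; unfold t; repeat split.
    - unfold e, Rdiv; apply Rmult_le_compat_r; [left; now apply Rinv_0_lt_compat|].
      assert (Hm : Cmod (circ r th) = r) by (apply Cmod_circ; lra).
      apply Rabs_le; assert (T1 := Cmod_tri_sub (circ r th) (a1, a2)).
      assert (T2 := Cmod_tri_sub (a1, a2) (circ r th)); rewrite (Cmod_sym (a1, a2)) in T2; lra.
    - replace (cos th - b1) with ((r * cos th - a1) / r) by (unfold b1; field; lra).
      unfold Rdiv; rewrite Rabs_mult, (Rabs_pos_eq (/ r)) by (left; now apply Rinv_0_lt_compat).
      apply Rmult_le_compat_r; [left; now apply Rinv_0_lt_compat|].
      apply (fst_le_Cmod (circ r th - (a1, a2))%C).
    - replace (sin th - b2) with ((r * sin th - a2) / r) by (unfold b2; field; lra).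
      unfold Rdiv; rewrite Rabs_mult, (Rabs_pos_eq (/ r)) by (left; now apply Rinv_0_lt_compat).
      apply Rmult_le_compat_r; [left; now apply Rinv_0_lt_compat|].
      apply (snd_le_Cmod (circ r th - (a1, a2))%C). }
  set (Phi := fun th => - sin th * Sq e (cos th - b1) + cos th * Sq e (sin th - b2)).
  set (dPhi := fun th => sin th * sin th * dSq e (cos th - b1) - cos th * Sq e (cos th - b1) +
     (cos th * cos th * dSq e (sin th - b2) - sin th * Sq e (sin th - b2))).
  assert (DP : forall th : R, is_derive Phi th (dPhi th)).
  { intros th; unfold Phi.
    assert (S1 := Sq_deriv e (cos th - b1) He); assert (S2 := Sq_deriv e (sin th - b2) He).
    auto_derive.
    - repeat split; eexists; eassumption.
    - assert (U1 : Derive (fun x : R => Sq e x) (cos th + - b1) = dSq e (cos th - b1)) by (apply is_derive_unique; exact S1).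
      assert (U2 : Derive (fun x : R => Sq e x) (sin th + - b2) = dSq e (sin th - b2)) by (apply is_derive_unique; exact S2).
      rewrite U1, U2; unfold dPhi, Rminus; ring. }
  assert (CS : forall (u : R -> R) (th : R), continuous u th -> continuous (fun s => Sq e (u s)) th).
  { intros u th Hu; apply (continuous_comp u (Sq e)); auto.
    apply (ex_derive_continuous (K := R_AbsRing) (V := R_NormedModule)); eexists; apply Sq_deriv; auto. }
  assert (Cc1 : forall th : R, continuous (fun s => cos s - b1) th).
  { intros th; apply (ex_derive_continuous (K := R_AbsRing) (V := R_NormedModule)); auto_derive; auto. }
  assert (Cs1 : forall th : R, continuous (fun s => sin s - b2) th).
  { intros th; apply (ex_derive_continuous (K := R_AbsRing) (V := R_NormedModule)); auto_derive; auto. }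
  assert (Ccos : forall th : R, continuous cos th).
  { intros th; apply (ex_derive_continuous (K := R_AbsRing) (V := R_NormedModule)); auto_derive; auto. }
  assert (Csin : forall th : R, continuous sin th).
  { intros th; apply (ex_derive_continuous (K := R_AbsRing) (V := R_NormedModule)); auto_derive; auto. }
  assert (CP : forall th : R, continuous dPhi th).
  { intros th; unfold dPhi.
    assert (M : forall u v : R -> R, continuous u th -> continuous v th -> continuous (fun s => u s * v s) th)
      by (intros; now apply (continuous_mult (K := R_AbsRing))).
    assert (Y1 := M _ _ (M _ _ (Csin th) (Csin th)) (dSq_cont e (fun s => cos s - b1) th He (Cc1 th))).
    assert (Y2 := M _ _ (Ccos th) (CS _ _ (Cc1 th))).
    assert (Y3 := M _ _ (M _ _ (Ccos th) (Ccos th)) (dSq_cont e (fun s => sin s - b2) th He (Cs1 th))).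
    assert (Y4 := M _ _ (Csin th) (CS _ _ (Cs1 th))).
    exact (continuous_plus (V := R_NormedModule) _ _ _ (continuous_minus (V := R_NormedModule) _ _ _ Y1 Y2)
      (continuous_minus (V := R_NormedModule) _ _ _ Y3 Y4)). }
  assert (I0 : RInt dPhi 0 (2 * PI) = 0).
  { rewrite (RInt_FTC Phi dPhi) by (auto; generalize twoPI_pos; lra).
    unfold Phi; rewrite cos_2PI, sin_2PI, cos_0, sin_0.
    match goal with |- ?a = ?b => change (@eq R a b) end; ring. }
  assert (Hpi := twoPI_pos).
  assert (E1 : ex_RInt dPhi 0 (2 * PI)) by (apply ex_RInt_c; auto; lra).
  assert (E2 : ex_RInt (fun _ => 1) 0 (2 * PI)) by (apply ex_RInt_c; [lra|intros; apply continuous_const]).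
  (* The term [dPhi] integrates to 0 by periodicity; 16 is 4 times the bound 2 + 2 on the two terms
     without derivative. *)
  assert (I1 : RInt (fun th => 4 * dPhi th + 16 * 1) 0 (2 * PI) = 16 * (2 * PI)).
  { rewrite (RInt_lin dPhi (fun _ => 1)), I0 by auto.
    assert (E0 : RInt (fun _ => 1) 0 (2 * PI) = (2 * PI - 0) * 1) by exact (RInt_const (V := R_CompleteNormedModule) 0 (2 * PI) 1).
    rewrite E0; match goal with |- ?a = ?b => change (@eq R a b) end; ring. }
  unfold avg; apply Rmult_le_reg_r with (2 * PI); auto.
  unfold Rdiv; rewrite Rmult_assoc, Rinv_l, Rmult_1_r by lra.
  rewrite <- I1; apply RInt_le; [lra| | |].
  - apply (ex_circ r (fun z => sqrt (r / Cmod (z - (a1, a2))%C))).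
    apply (rc_sqrt r (fun z => r / Cmod (z - (a1, a2))%C)).
    apply (rc_mult r (fun _ => r)); [apply rc_const|].
    apply (rc_comp r (fun z => Cmod (z - (a1, a2))%C) Rinv); [|intros z Hz|lra].
    + apply rc_Cmod, cc_minus; [apply cc_id; lra|apply cc_const].
    + apply continuous_Rinv, Rgt_not_eq, Cmod_pos, Csub_neq; intros ->; auto.
  - apply ex_RInt_c; [lra|]; intros th _.
    apply (continuous_plus (V := R_NormedModule)); [|apply continuous_const].
    apply (continuous_mult (K := R_AbsRing)); [apply continuous_const|auto].
  - intros th _; destruct (Ht th) as [T1 [T2 T3]].
    change (sqrt (r / Cmod (circ r th - (a1, a2))%C) <= 4 * dPhi th + 16 * 1).
    replace (r / Cmod (circ r th - (a1, a2))%C) with (/ t th).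
    2:{ unfold t; field; split; [|lra]. apply Rgt_not_eq.
        assert (0 < t th) by lra; unfold t in *.
        apply Rmult_lt_reg_r with (/ r); [now apply Rinv_0_lt_compat|]; unfold Rdiv in *; lra. }
    assert (L1 := dSq_lower e (cos th - b1) (t th) He T1 T2).
    assert (L2 := dSq_lower e (sin th - b2) (t th) He T1 T3).
    assert (Bc := COS_bound th); assert (Bs := SIN_bound th).
    assert (B1 : Rabs (Sq e (cos th - b1)) <= 2).
    { apply Sq_bound; auto; eapply Rle_trans; [apply Rabs_triang|]; rewrite Rabs_Ropp.
      assert (Rabs (cos th) <= 1) by (apply Rabs_le; lra); lra. }
    assert (B2 : Rabs (Sq e (sin th - b2)) <= 2).
    { apply Sq_bound; auto; eapply Rle_trans; [apply Rabs_triang|]; rewrite Rabs_Ropp.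
      assert (Rabs (sin th) <= 1) by (apply Rabs_le; lra); lra. }
    apply Rabs_le_between in B1; apply Rabs_le_between in B2.
    assert (P := sin2_cos2 th); unfold Rsqr in P.
    unfold dPhi; set (S1 := Sq e (cos th - b1)) in *; set (S2 := Sq e (sin th - b2)) in *.
    set (d1 := dSq e (cos th - b1)) in *; set (d2 := dSq e (sin th - b2)) in *.
    set (v := sqrt (/ t th)) in *; set (c := cos th) in *; set (s := sin th) in *.
    assert (s * s * v <= s * s * (4 * d1)) by (apply Rmult_le_compat_l; nra).
    assert (c * c * v <= c * c * (4 * d2)) by (apply Rmult_le_compat_l; nra).
    assert (Rabs (c * S1) <= 2).
    { rewrite Rabs_mult; assert (Rabs c <= 1) by (apply Rabs_le; lra); assert (Rabs S1 <= 2) by (apply Rabs_le; lra).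
      assert (0 <= Rabs c) by apply Rabs_pos; assert (0 <= Rabs S1) by apply Rabs_pos; nra. }
    assert (Rabs (s * S2) <= 2).
    { rewrite Rabs_mult; assert (Rabs s <= 1) by (apply Rabs_le; lra); assert (Rabs S2 <= 2) by (apply Rabs_le; lra).
      assert (0 <= Rabs s) by apply Rabs_pos; assert (0 <= Rabs S2) by apply Rabs_pos; nra. }
    apply Rabs_le_between in H1; apply Rabs_le_between in H2.
    replace v with (s * s * v + c * c * v) by (rewrite <- Rmult_plus_distr_r, P; ring).
    lra.
Qed.
Lemma prodZ_D l e z : ~ In z l -> exists s, D (prodZ l e) z (prodZ l e z * s)%C /\
  Cmod s <= lsum l (fun a => Rabs (IZR (e a)) * / Cmod (z - a)%C).
Proof.
  induction l as [|a l IH]; intros H.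
  - exists (RtoC 0); split; [|simpl; rewrite Cmod_0; lra].
    eapply D_eq; [apply (D_const (RtoC 1))|simpl; ring].
  - destruct IH as [s [S1 S2]]; [intro; apply H; now right|].
    assert (N : (z - a)%C <> RtoC 0) by (apply Csub_neq; intros ->; apply H; now left).
    exists (RtoC (IZR (e a)) * / (z - a) + s)%C; split.
    + eapply D_eq; [apply (D_mult (fun w => zp (w - a) (e a)) (prodZ l e)); [|exact S1];
        apply (D_comp (fun x => zp x (e a)) (fun x => x - a)%C);
        [apply D_minus; [apply D_id|apply D_const]|now apply D_zp]|].
      simpl; assert (E : zp (z - a) (e a) = (zp (z - a) (e a - 1) * (z - a))%C).
      { rewrite <- (zp_1 (z - a)) at 3; rewrite <- zp_add by auto; f_equal; lia. }
      rewrite E; field; auto.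
    + eapply Rle_trans; [apply Cmod_triangle|]; simpl; apply Rplus_le_compat; auto.
      rewrite Cmod_mult, Cmod_R, Cmod_inv by auto; lra.
Qed.
Lemma logd_prodZ f l e g z : ~ In z l -> near z (fun w => f w = (prodZ l e w * g w)%C) -> good g z ->
  Cmod (logd f z) <= lsum l (fun a => Rabs (IZR (e a)) * / Cmod (z - a)%C) + Cmod (logd g z).
Proof.
  intros Hz Hf [G1 G2]; destruct (prodZ_D l e z Hz) as [s [S1 S2]].
  assert (Df : D f z (prodZ l e z * s * g z + prodZ l e z * Cderive g z)%C).
  { apply (D_ext _ _ _ _ (near_eq_sym _ _ _ Hf)); apply D_mult; auto; now apply holo_D. }
  destruct (ln_prodZ l e z Hz) as [Np _].
  unfold logd at 1; rewrite (Cderive_D _ _ _ Df), (near_pt _ _ Hf).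
  replace ((prodZ l e z * s * g z + prodZ l e z * Cderive g z) / (prodZ l e z * g z))%C with (s + logd g z)%C
    by (unfold logd; field; auto).
  eapply Rle_trans; [apply Cmod_triangle|]; lra.
Qed.
(** Concavity of ln: the tangent at the mean dominates. *)
Lemma avg_ln_ln r F : 0 <= r -> rc r F -> (forall z, Cmod z = r -> 0 <= F z) ->
  avg r (fun z => ln (1 + F z)) <= ln (1 + avg r F).
Proof.
  intros Hr HF Hp; set (s := avg r F).
  assert (Hs : 0 <= s) by (unfold s; rewrite <- (avg_const r 0); apply avg_le; auto; apply rc_const).
  assert (R1 : rc r (fun z => 1 + F z)) by (apply rc_plus; auto; apply rc_const).
  rewrite <- (Rplus_0_r (ln (1 + s))).
  replace (ln (1 + s) + 0) with (avg r (fun z => (ln (1 + s) - s / (1 + s)) + / (1 + s) * F z)).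
  - apply avg_le; auto.
    + apply (rc_ln r (fun z => 1 + F z)); auto; intros z Hz; specialize (Hp z Hz); lra.
    + apply rc_plus; [apply rc_const|now apply rc_scal].
    + intros z Hz; specialize (Hp z Hz).
      assert (L := ln_le_sub ((1 + F z) / (1 + s)) ltac:(apply Rdiv_lt_0_compat; lra)).
      rewrite ln_div in L by lra.
      replace ((1 + F z) / (1 + s) - 1) with (- (s / (1 + s)) + / (1 + s) * F z) in L by (field; lra).
      lra.
  - rewrite avg_plus, avg_const, avg_scal by (auto; try apply rc_const; now apply rc_scal).
    fold s; field; lra.
Qed.
Lemma sqrt_sum_le a b : 0 <= a -> 0 <= b -> a * a + b <= (a + sqrt b) * (a + sqrt b).
Proof. intros Ha Hb; assert (S := sqrt_sqrt b Hb); assert (P := sqrt_pos b); nra. Qed.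
Lemma IZR_abs_sq n : Rabs (IZR n) <= Rabs (IZR n) * Rabs (IZR n).
Proof.
  rewrite <- abs_IZR, <- mult_IZR; apply IZR_le; assert (0 <= Z.abs n)%Z by lia; nia.
Qed.
(** The inverse distances 1/t have no mean bounded independently of the points, but their square
    roots do. A sum of squares is at most the square of the sum, so the logarithm of the left side
    is twice that of a sum of roots. *)
Lemma sqrt_lsum_bound rho l (e : C -> Z) (t : C -> R) y : 1 <= rho -> (forall a, In a l -> 0 < t a) -> 0 <= y ->
  1 + (lsum l (fun a => Rabs (IZR (e a)) * / t a) + y) <=
  (1 + (lsum l (fun a => Rabs (IZR (e a)) * sqrt (rho / t a)) + sqrt (rho * y))) *
  (1 + (lsum l (fun a => Rabs (IZR (e a)) * sqrt (rho / t a)) + sqrt (rho * y))).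
Proof.
  intros Hr Ht Hy.
  assert (X : 0 <= lsum l (fun a => Rabs (IZR (e a)) * sqrt (rho / t a)) /\
    1 + lsum l (fun a => Rabs (IZR (e a)) * / t a) <=
    (1 + lsum l (fun a => Rabs (IZR (e a)) * sqrt (rho / t a))) * (1 + lsum l (fun a => Rabs (IZR (e a)) * sqrt (rho / t a)))).
  { induction l as [|a l IH]; simpl; [lra|].
    destruct IH as [I0 I1]; [intros; apply Ht; now right|].
    assert (Ha := Ht a (or_introl eq_refl)).
    assert (Hi : 0 < / t a) by now apply Rinv_0_lt_compat.
    assert (Hq : 0 <= rho / t a) by (unfold Rdiv; nra).
    assert (S := sqrt_sqrt _ Hq); assert (P := sqrt_pos (rho / t a)).
    assert (E := IZR_abs_sq (e a)); assert (E0 := Rabs_pos (IZR (e a))).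
    set (k := Rabs (IZR (e a))) in *; set (u := sqrt (rho / t a)) in *.
    set (A := lsum l (fun a0 => Rabs (IZR (e a0)) * / t a0)) in *.
    set (B := lsum l (fun a0 => Rabs (IZR (e a0)) * sqrt (rho / t a0))) in *.
    assert (Hku : 0 <= k * u) by (apply Rmult_le_pos; auto).
    split; [lra|].
    assert (k * / t a <= k * (u * u)) by (apply Rmult_le_compat_l; auto; rewrite S; unfold Rdiv; nra).
    (* Orders are integers, so |e| <= |e|^2. *)
    assert (k * (u * u) <= k * k * (u * u)) by (apply Rmult_le_compat_r; auto; nra).
    assert (0 <= k * u) by now apply Rmult_le_pos.
    replace (k * k * (u * u)) with ((k * u) * (k * u)) in * by ring.
    set (ku := k * u) in *; nra. }
  destruct X as [X0 X1].
  set (A := lsum l (fun a0 => Rabs (IZR (e a0)) * / t a0)) in *.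
  set (B := lsum l (fun a0 => Rabs (IZR (e a0)) * sqrt (rho / t a0))) in *.
  assert (S := sqrt_sum_le (1 + B) (rho * y) ltac:(lra) ltac:(nra)).
  replace (1 + (B + sqrt (rho * y))) with (1 + B + sqrt (rho * y)) by ring.
  nra.
Qed.

(** * Logarithmic derivatives *)

Lemma lsum_pts Bd r s F : LF Bd -> r <= s -> (forall a, ~ Cmod a < r -> F a = 0) ->
  lsum (pts Bd r) F = lsum (pts Bd s) F.
Proof.
  intros HL Hrs HF.
  destruct (pts_ok Bd r HL) as [N1 P1]; destruct (pts_ok Bd s HL) as [N2 P2].
  set (b := fun a : C => if Rlt_dec (Cmod a) r then true else false).
  rewrite <- (lsum_filter (pts Bd s) b).
  - apply lsum_perm, NoDup_Permutation; auto; [now apply NoDup_filter|].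
    intros z; rewrite filter_In, P1, P2; unfold b; destruct (Rlt_dec (Cmod z) r); intuition; try lra; discriminate.
  - intros a _; unfold b; destruct (Rlt_dec (Cmod a) r); [discriminate|intros; auto].
Qed.
Lemma fmt_inv Bd f : LF Bd -> Mer Bd f -> exists K, 0 <= K /\ forall r, gr Bd r ->
  Nf Bd r (zer f) <= Tf Bd r f + K /\ mf r (fun w => / f w)%C <= Tf Bd r f + K.
Proof.
  intros HL Hf; destruct (Tf_inv Bd f HL Hf) as [K HK]; exists (Rabs K); split; [apply Rabs_pos|].
  intros r Hr; specialize (HK r Hr); assert (Hr1 := proj1 Hr).
  assert (E : Nf Bd r (pol (fun w => / f w)%C) = Nf Bd r (zer f)).
  { apply Nf_ext; intros a; unfold pol, zer.
    rewrite (ordf_eq _ a _ (ord_inv f a _ (nz_ordf f a (proj1 Hf)))); f_equal; lia. }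
  unfold Tf at 1 in HK; rewrite E in HK.
  assert (A := mf_nonneg r _ ltac:(lra) (Mer_cc _ _ _ (Mer_inv _ _ Hf) Hr)).
  assert (B := Nf_nonneg Bd r (zer f) Hr1 (zer_nonneg f)).
  assert (C0 := Rle_abs K); split; lra.
Qed.
Lemma abs_ln_le x : 0 < x -> Rabs (ln x) <= ln (1 + x) + ln (1 + / x).
Proof.
  intros Hx; assert (Hi := Rinv_0_lt_compat _ Hx).
  assert (E : ln (1 + / x) = ln (1 + x) - ln x).
  { replace (1 + / x) with ((1 + x) / x) by (field; lra); rewrite ln_div by lra; ring. }
  assert (A := l1_nonneg x ltac:(lra)); assert (B := l1_nonneg (/ x) ltac:(lra)).
  assert (ln x <= ln (1 + x)) by (apply ln_le; lra).
  apply Rabs_le; lra.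
Qed.
(** Points of modulus below R1 have weight at least ln (R2 / R1) at radius R2. *)
Lemma count_bound Bd f R1 R2 : LF Bd -> Mer Bd f -> 1 <= R1 -> R1 <= R2 -> 
  lsum (pts Bd R1) (fun a => Rabs (IZR (ordf f a))) * ln (R2 / R1) <= Nf Bd R2 (zer f) + Nf Bd R2 (pol f).
Proof.
  intros HL Hf H1 H2.
  set (F := fun a => if Rlt_dec (Cmod a) R1 then Rabs (IZR (ordf f a)) else 0).
  assert (E : lsum (pts Bd R1) (fun a => Rabs (IZR (ordf f a))) = lsum (pts Bd R2) F).
  { rewrite <- (lsum_pts Bd R1 R2 F HL H2).
    - apply lsum_ext; intros a Ha; apply (pts_ok Bd R1 HL) in Ha; unfold F.
      destruct (Rlt_dec (Cmod a) R1); [auto|tauto].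
    - intros a Ha; unfold F; destruct (Rlt_dec (Cmod a) R1); [contradiction|auto]. }
  rewrite E, Rmult_comm, <- lsum_scal, <- Nf_plus; apply lsum_le; intros a _.
  assert (A : zer f a + pol f a = Rabs (IZR (ordf f a))).
  { unfold zer, pol; rewrite <- plus_IZR, <- abs_IZR; f_equal; lia. }
  rewrite A; unfold F; destruct (Rlt_dec (Cmod a) R1) as [L|L].
  - rewrite Rmult_comm; apply Rmult_le_compat_l; [apply Rabs_pos|].
    unfold lam; destruct (Rlt_dec (Cmod a) R2); [|lra].
    assert (Hq : 0 < R2 / R1) by (apply Rdiv_lt_0_compat; lra).
    destruct (cdec a (RtoC 0)) as [Z|Z]; apply ln_le; auto.
    + apply Rmult_le_reg_r with R1; [lra|]; unfold Rdiv; rewrite Rmult_assoc, Rinv_l; nra.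
    + unfold Rdiv; apply Rmult_le_compat_l; [lra|]; apply Rinv_le_contravar; [now apply Cmod_pos|lra].
  - rewrite Rmult_0_r; apply Rmult_le_pos; [apply Rabs_pos|apply lam_nonneg; lra].
Qed.
Lemma lsum_mult_r l F k : lsum l (fun a => F a * k) = lsum l F * k.
Proof. rewrite (Rmult_comm (lsum l F)), <- lsum_scal; apply lsum_ext; intros; ring. Qed.
Lemma lsum_minus l F G : lsum l (fun a => F a - G a) = lsum l F - lsum l G.
Proof. induction l as [|a l IH]; simpl; [lra|]; rewrite IH; lra. Qed.
Lemma Rabs_lsum l F : Rabs (lsum l F) <= lsum l (fun a => Rabs (F a)).
Proof.
  induction l as [|a l IH]; simpl; [rewrite Rabs_R0; lra|].
  eapply Rle_trans; [apply Rabs_triang|lra].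
Qed.
Lemma mean_abs_ln_g Bd f r g r' : LF Bd -> Mer Bd f -> gr Bd r -> r < r' -> nvd g r' ->
  (forall z, Cmod z < r' -> ~ In z (pts Bd r) -> f z = (prodZ (pts Bd r) (ordf f) z * g z)%C) ->
  exists k, avg r (fun x => Rabs (ln (Cmod (g x)) - k)) <=
    mf r f + mf r (fun w => / f w)%C + 2 * ln 3 * lsum (pts Bd r) (fun a => Rabs (IZR (ordf f a))).
Proof.
  intros HL Hf Hr Hrr Hg Hfac; assert (Hr1 := proj1 Hr).
  set (l := pts Bd r) in *; set (e := ordf f) in *.
  assert (Hin : forall a, In a l -> Cmod a < r).
  { intros a Ha; apply (pts_ok Bd r HL) in Ha; tauto. }
  (* This normalisation replaces each ln |z - a| by a function of mean 0 on the circle. *)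
  exists (- lsum l (fun a => IZR (e a) * ln r)).
  set (h := fun a z => ln (Cmod (z - a)%C) - ln r).
  assert (Rh : forall a, In a l -> rc r (h a)).
  { intros a Ha t; specialize (Hin a Ha).
    apply (continuous_minus (V := R_NormedModule)); [|apply continuous_const].
    apply (rc_lnsub r a); lra. }
  assert (Rah : forall a, In a l -> rc r (fun z => Rabs (h a z))).
  { intros a Ha; apply (rc_comp r (h a) Rabs); [auto|intros; apply continuous_Rabs|lra]. }
  assert (Ravg : forall a, In a l -> avg r (fun z => Rabs (h a z)) <= 2 * ln 3).
  { intros a Ha; specialize (Hin a Ha).
    assert (E : avg r (h a) = 0).
    { unfold h; rewrite (avg_ext r _ (fun z => ln (Cmod (z - a)%C) + - ln r)); [|lra|intros; ring].
      rewrite avg_plus, avg_const, avg_ln_sub, Rmax_left by (try apply rc_lnsub; try apply rc_const; lra); ring. }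
    (* Since h <= ln 3 on the circle, |h| <= 2 ln 3 - h, and h has mean 0. *)
    replace (2 * ln 3) with (2 * ln 3 + -1 * avg r (h a)) by (rewrite E; ring).
    rewrite <- (avg_const r (2 * ln 3)), <- avg_scal, <- avg_plus by (auto; try apply rc_const; apply rc_scal; auto).
    apply avg_le; [lra|auto|apply rc_plus; [apply rc_const|apply rc_scal; auto]|].
    intros z Hz.
    assert (Hl3 : 0 < ln 3) by (rewrite <- ln_1; apply ln_increasing; lra).
    assert (Hh : h a z <= ln 3).
    { unfold h; rewrite <- ln_div by (try lra; apply Cmod_pos, Csub_neq; intros ->; lra).
      apply ln_le.
      - apply Rdiv_lt_0_compat; [apply Cmod_pos, Csub_neq; intros ->; lra|lra].
      - apply Rmult_le_reg_r with r; [lra|]; unfold Rdiv; rewrite Rmult_assoc, Rinv_l by lra.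
        assert (T := Cmod_tri_minus z a); lra. }
    apply Rabs_le; lra. }
  assert (Rf : rc r (fun z => Rabs (ln (Cmod (f z))))).
  { apply (rc_comp r (fun z => ln (Cmod (f z))) Rabs); [|intros; apply continuous_Rabs|lra].
    apply rc_lnmod; [lra|eapply Mer_cc; eauto|intros; eapply Mer_neq; eauto]. }
  assert (Ref : forall a, In a l -> rc r (fun z => Rabs (IZR (e a)) * Rabs (h a z))) by (intros; apply rc_scal; auto).
  destruct (avg_lsum r l (fun a z => Rabs (IZR (e a)) * Rabs (h a z)) Ref) as [S1 S2].
  apply Rle_trans with (avg r (fun z => Rabs (ln (Cmod (f z))) + lsum l (fun a => Rabs (IZR (e a)) * Rabs (h a z)))).
  - apply avg_le; [lra| |now apply rc_plus|].
    + apply (rc_comp r (fun x => ln (Cmod (g x)) - - lsum l (fun a => IZR (e a) * ln r)) Rabs); [|intros; apply continuous_Rabs|lra].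
      intros t; apply (continuous_minus (V := R_NormedModule)); [|apply continuous_const].
      apply (rc_lnmod r g); [lra| |intros; apply Hg; lra].
      apply cc_ccont; [lra|]; intros; apply holo_cont, Hg; lra.
    + intros z Hz.
      assert (Nl : ~ In z l) by (intro X; specialize (Hin z X); lra).
      destruct (ln_prodZ l e z Nl) as [N E].
      assert (G0 : g z <> RtoC 0) by (apply Hg; lra).
      rewrite (Hfac z ltac:(lra) Nl), Cmod_mult, ln_mult, E by (apply Cmod_pos; auto).
      set (s1 := lsum l (fun a => IZR (e a) * ln (Cmod (z - a)%C))).
      set (s2 := lsum l (fun a => IZR (e a) * ln r)).
      assert (Es : s1 - s2 = lsum l (fun a => IZR (e a) * h a z)).
      { unfold s1, s2, h; rewrite <- lsum_minus; apply lsum_ext; intros; ring. }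
      assert (B : Rabs (s1 - s2) <= lsum l (fun a => Rabs (IZR (e a)) * Rabs (h a z))).
      { rewrite Es; eapply Rle_trans; [apply Rabs_lsum|]; right; apply lsum_ext; intros; apply Rabs_mult. }
      replace (ln (Cmod (g z)) - - s2) with ((s1 + ln (Cmod (g z))) + - (s1 - s2)) by ring.
      eapply Rle_trans; [apply Rabs_triang|]; rewrite Rabs_Ropp; lra.
  - rewrite avg_plus, S2 by auto; apply Rplus_le_compat.
    + assert (Cf1 := Mer_cc _ _ _ Hf Hr); assert (Cf2 := Mer_cc _ _ _ (Mer_inv _ _ Hf) Hr).
      unfold mf; rewrite <- avg_plus by (apply rc_l1; [lra|assumption]).
      apply avg_le; [lra|auto| |].
      * apply rc_plus; apply rc_l1; try lra; assumption.
      * intros z Hz; assert (N := Mer_neq _ _ _ _ Hf Hr Hz); rewrite Cmod_inv by auto.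
        apply abs_ln_le; now apply Cmod_pos.
    + rewrite Rmult_comm, <- lsum_mult_r; apply lsum_le; intros a Ha.
      rewrite avg_scal by auto; apply Rmult_le_compat_l; [apply Rabs_pos|auto].
Qed.
Lemma ln_prod3 c B q : 0 < c -> 0 < B -> 0 < q -> ln (c * B * (q * q * q)) = ln c + ln B + 3 * ln q.
Proof.
  intros; rewrite !ln_mult by (auto; repeat apply Rmult_lt_0_compat; auto); ring.
Qed.
Lemma ld_arith k B q n A Y2 : 0 <= k -> 1 <= B -> 1 <= q -> 0 <= n -> n <= q * (2 * B + k) ->
  0 <= A -> A <= 2 * B + k + 2 * ln 3 * n -> 0 <= Y2 -> Y2 <= q * q * A ->
  1 + (16 * n + sqrt Y2) <= (2 + (2 + k) * (17 + 2 * ln 3)) * B * (q * q * q).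
Proof.
  intros Hk HB Hq Hn0 Hn HA0 HA HY0 HY.
  assert (L3 : 0 < ln 3) by (rewrite <- ln_1; apply ln_increasing; lra).
  assert (Hs : sqrt Y2 <= 1 + Y2).
  { assert (S := sqrt_sqrt _ HY0); assert (P := sqrt_pos Y2); nra. }
  set (c := 2 + k) in *.
  assert (H1 : 2 * B + k <= c * B) by (unfold c; nra).
  assert (H2 : n <= q * (c * B)) by (eapply Rle_trans; [exact Hn|]; apply Rmult_le_compat_l; lra).
  assert (HcB : 1 <= c * B) by (unfold c; nra).
  set (m := c * B) in *.
  assert (H3 : A <= q * m * (1 + 2 * ln 3)).
  { eapply Rle_trans; [exact HA|].
    assert (2 * ln 3 * n <= 2 * ln 3 * (q * m)) by (apply Rmult_le_compat_l; lra).
    assert (m <= q * m) by nra. nra. }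
  assert (Hq2 : 1 <= q * q) by nra.
  assert (Hq3 : q <= q * q * q) by nra.
  assert (H4 : Y2 <= q * q * q * m * (1 + 2 * ln 3)).
  { eapply Rle_trans; [exact HY|]; replace (q * q * q * m * (1 + 2 * ln 3)) with (q * q * (q * m * (1 + 2 * ln 3))) by ring.
    apply Rmult_le_compat_l; lra. }
  assert (H5 : q * m <= q * q * q * m) by (apply Rmult_le_compat_r; lra).
  assert (H6 : 2 <= 2 * B * (q * q * q)) by nra.
  replace ((2 + c * (17 + 2 * ln 3)) * B * (q * q * q)) with
    (2 * B * (q * q * q) + 16 * (q * q * q * m) + q * q * q * m * (1 + 2 * ln 3)) by (unfold m; ring).
  lra.
Qed.
(** With f = prodZ times g on the disc of radius R1, f'/f is a sum of terms e(a) / (z - a) plus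
    g'/g. The sum is averaged through square roots, g'/g is bounded pointwise by [logd_bound], and
    the larger radius R2 bounds the number of terms. *)
Lemma LD_core Bd f : LF Bd -> Mer Bd f -> exists c, 1 <= c /\
  forall rho R1 R2 del B, gr Bd rho -> gr Bd R1 -> gr Bd R2 -> 0 < del -> rho + del <= R1 ->
  R1 + del <= R2 -> R2 <= 2 * rho -> 1 <= B -> Tf Bd R1 f <= B -> Tf Bd R2 f <= B ->
  avg rho (fun z => ln (1 + Cmod (logd f z))) <= 2 * (ln c + ln B + 3 * ln (2 * rho / del)).
Proof.
  intros HL Hf; destruct (fmt_inv Bd f HL Hf) as [k [Hk HK]].
  assert (L3 : 0 < ln 3) by (rewrite <- ln_1; apply ln_increasing; lra).
  exists (2 + (2 + k) * (17 + 2 * ln 3)); split; [nra|].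
  intros rho R1 R2 del B Hrho HR1 HR2 Hdel E1 E2 E3 HB T1 T2.
  assert (G1 := proj1 Hrho).
  destruct (HK R1 HR1) as [_ K1]; destruct (HK R2 HR2) as [K2 _].
  destruct (Mer_rep Bd f R1 HL Hf HR1) as [r' [g (Q1 & Q2 & Q3 & Q4)]].
  destruct (mean_abs_ln_g Bd f R1 g r' HL Hf HR1 Q1 Q2 Q4) as [kap Hkap].
  set (l := pts Bd R1) in *.
  set (n := lsum l (fun a => Rabs (IZR (ordf f a)))) in *.
  set (A := avg R1 (fun x => Rabs (ln (Cmod (g x)) - kap))) in *.
  (* Every loss is a power of [q]: ln (R2 / R1) >= 1/q for counting points, and rho |g'/g| is at
     most q^2 times a mean. *)
  set (q := 2 * rho / del).
  assert (Hq : 1 <= q).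
  { unfold q; apply Rmult_le_reg_r with del; auto; unfold Rdiv; rewrite Rmult_assoc, Rinv_l; lra. }
  assert (Hqd : q * del = 2 * rho) by (unfold q; field; lra).
  assert (Hn0 : 0 <= n) by (apply lsum_nonneg; intros; apply Rabs_pos).
  assert (Hn : n <= q * (2 * B + k)).
  { assert (Cb := count_bound Bd f R1 R2 HL Hf (proj1 HR1) ltac:(lra)); fold l n in Cb.
    assert (NP : Nf Bd R2 (pol f) <= B).
    { unfold Tf in T2; assert (X := mf_nonneg R2 f ltac:(lra) (Mer_cc _ _ _ Hf HR2)); lra. }
    assert (Lq : / q <= ln (R2 / R1)).
    { assert (X := ln_le_sub (R1 / R2) ltac:(apply Rdiv_lt_0_compat; lra)).
      rewrite ln_div in X |- * by lra.
      assert (/ q <= (R2 - R1) / R2).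
      { apply Rmult_le_reg_r with (q * R2); [nra|].
        replace (/ q * (q * R2)) with R2 by (field; lra).
        replace ((R2 - R1) / R2 * (q * R2)) with (q * (R2 - R1)) by (field; lra).
        assert (q * del <= q * (R2 - R1)) by (apply Rmult_le_compat_l; lra); lra. }
      replace ((R2 - R1) / R2) with (1 - R1 / R2) in H by (field; lra); lra. }
    assert (n * / q <= 2 * B + k).
    { apply Rle_trans with (n * ln (R2 / R1)); [apply Rmult_le_compat_l; auto|lra]. }
    apply Rmult_le_reg_r with (/ q); [apply Rinv_0_lt_compat; lra|].
    replace (q * (2 * B + k) * / q) with (2 * B + k) by (field; lra); auto. }
  assert (NP1 : mf R1 f <= B).
  { unfold Tf in T1; assert (X := Nf_pol_nonneg Bd R1 f (proj1 HR1)); lra. }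
  assert (HA : A <= 2 * B + k + 2 * ln 3 * n) by lra.
  assert (Rg : rc R1 (fun x => Rabs (ln (Cmod (g x)) - kap))).
  { apply (rc_comp R1 (fun x => ln (Cmod (g x)) - kap) Rabs); [|intros; apply continuous_Rabs|lra].
    intros t; apply (continuous_minus (V := R_NormedModule)); [|apply continuous_const].
    apply (rc_lnmod R1 g); [lra| |intros; apply Q2; lra].
    apply cc_ccont; [lra|]; intros; apply holo_cont, Q2; lra. }
  assert (HA0 : 0 <= A).
  { unfold A; rewrite <- (avg_const R1 0); apply avg_le; [lra|apply rc_const|auto|]; intros; apply Rabs_pos. }
  (* The bound of [logd_bound], with R1 <= 2 rho and R1 - rho >= del. *)
  set (Y := 4 * rho / (del * del) * A).
  assert (HY0 : 0 <= Y).
  { unfold Y; apply Rmult_le_pos; auto; apply Rmult_le_pos; [lra|]; left; apply Rinv_0_lt_compat; nra. }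
  assert (HYb : forall z, Cmod z = rho -> Cmod (logd g z) <= Y).
  { intros z Hz; eapply Rle_trans; [apply (logd_bound g r' R1 z kap Q2); lra|].
    fold A; unfold Y; apply Rmult_le_compat_r; auto; unfold Rdiv; apply Rmult_le_compat; try lra.
    - left; apply Rinv_0_lt_compat; rewrite Hz; nra.
    - apply Rinv_le_contravar; [nra|]; rewrite Hz; apply Rmult_le_compat; lra. }
  assert (HrY : rho * Y = q * q * A) by (unfold Y, q; field; lra).
  assert (Hl : forall a, In a l -> Cmod a < R1 /\ Cmod a <> rho).
  { intros a Ha; apply (pts_ok Bd R1 HL) in Ha; split; [tauto|]; intro E; exact (proj2 Hrho a E (proj2 Ha)). }
  set (S := fun z => lsum l (fun a => Rabs (IZR (ordf f a)) * sqrt (rho / Cmod (z - a)%C)) + sqrt (rho * Y)).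
  assert (Rs : forall a, In a l -> rc rho (fun z => sqrt (rho / Cmod (z - a)%C))).
  { intros a Ha; destruct (Hl a Ha) as [_ Na].
    apply (rc_sqrt rho (fun z => rho / Cmod (z - a)%C)), (rc_mult rho (fun _ => rho)); [apply rc_const|].
    apply (rc_comp rho (fun z => Cmod (z - a)%C) Rinv); [|intros z Hz|lra].
    + apply rc_Cmod, cc_minus; [apply cc_id; lra|apply cc_const].
    + apply continuous_Rinv, Rgt_not_eq, Cmod_pos, Csub_neq; intros ->; auto. }
  assert (Rs2 : forall a, In a l -> rc rho (fun z => Rabs (IZR (ordf f a)) * sqrt (rho / Cmod (z - a)%C)))
    by (intros; apply rc_scal; auto).
  destruct (avg_lsum rho l (fun a z => Rabs (IZR (ordf f a)) * sqrt (rho / Cmod (z - a)%C)) Rs2) as [S1 S2].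
  assert (RS : rc rho S) by (apply rc_plus; [exact S1|apply rc_const]).
  assert (Sp : forall z, 0 <= S z).
  { intros z; unfold S; assert (P := sqrt_pos (rho * Y)).
    assert (0 <= lsum l (fun a => Rabs (IZR (ordf f a)) * sqrt (rho / Cmod (z - a)%C))); [|lra].
    apply lsum_nonneg; intros; apply Rmult_le_pos; [apply Rabs_pos|apply sqrt_pos]. }
  assert (RlS : rc rho (fun z => ln (1 + S z))).
  { apply (rc_ln rho (fun z => 1 + S z)); [lra|apply rc_plus; auto; apply rc_const|]; intros z _; specialize (Sp z); lra. }
  apply Rle_trans with (avg rho (fun z => 2 * ln (1 + S z))).
  - apply avg_le; [lra| |now apply rc_scal|].
    + apply rc_l1; [lra|]; apply cc_ccont; [lra|]; intros z Hz.
      destruct (proj2 Hf z (proj2 Hrho z Hz)) as [F1 F2].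
      apply holo_cont, holo_div; auto; now apply holo_Cderive.
    + intros z Hz; specialize (Sp z).
      assert (Nl : ~ In z l) by (intro X; exact (proj2 (Hl z X) Hz)).
      assert (Fe : near z (fun w => f w = (prodZ l (ordf f) w * g w)%C)).
      { assert (Zr : Cmod z < R1) by lra.
        assert (X : near z (fun w => ~ In w l)).
        { clear - Nl; induction l as [|a l IH]; [apply near_all; auto|].
          assert (z <> a) by (intros ->; apply Nl; now left).
          generalize (near_and _ _ _ (IH ltac:(intro; apply Nl; now right)) (near_neq _ _ H)); apply near_imp.
          intros w [W1 W2] [->|W]; auto. }
        generalize (near_and _ _ _ X (near_lt _ _ Zr)); apply near_imp; intros w [W1 W2]; apply Q4; auto; lra. }
      assert (LB := logd_prodZ f l (ordf f) g z Nl Fe (Q2 z ltac:(lra))).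
      specialize (HYb z Hz).
      assert (SB := sqrt_lsum_bound rho l (ordf f) (fun a => Cmod (z - a)%C) Y G1
        ltac:(intros a Ha; apply Cmod_pos, Csub_neq; intros ->; auto) HY0).
      fold (S z) in SB.
      replace (2 * ln (1 + S z)) with (ln ((1 + S z) * (1 + S z))) by (rewrite ln_mult; lra).
      apply ln_le; [generalize (Cmod_ge_0 (logd f z)); lra|].
      eapply Rle_trans; [|exact SB]; lra.
  - rewrite avg_scal by auto; apply Rmult_le_compat_l; [lra|].
    eapply Rle_trans; [apply avg_ln_ln; [lra|auto|intros; apply Sp]|].
    rewrite <- ln_prod3 by (try lra; nra).
    apply ln_le.
    + assert (0 <= avg rho S); [|lra]. rewrite <- (avg_const rho 0); apply avg_le; [lra|apply rc_const|auto|intros; apply Sp].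
    + fold q; eapply Rle_trans; [|apply (ld_arith k B q n A (rho * Y)); auto; try lra; try nra].
      unfold S; rewrite avg_plus, S2, avg_const by (auto; apply rc_const).
      apply Rplus_le_compat_l, Rplus_le_compat_r.
      unfold n; rewrite Rmult_comm, <- lsum_mult_r; apply lsum_le; intros a Ha.
      rewrite avg_scal by auto; apply Rmult_le_compat_l; [apply Rabs_pos|].
      destruct (Hl a Ha); apply avg_sqrt_inv; lra.
Qed.

(** * Exceptional radii *)

(** [B] bounds [T0] at all good radii up to [R1], so that monotonicity of [T0] never has to be
    shown. *)
Definition adm Bd (T0 : R -> R) rho R1 B : Prop :=
  gr Bd rho /\ rho < R1 /\ R1 <= 2 * rho /\ 1 <= B /\ forall s, gr Bd s -> s <= R1 -> T0 s <= B.
(* The class of functions of growth controlled by [T0] at a slightly larger radius; unlike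
   [T f <= C T0] it is visibly stable under differentiation. *)
Definition dom Bd T0 f : Prop := exists C, 0 <= C /\ forall rho R1 B, adm Bd T0 rho R1 B ->
  Tf Bd rho f <= C * (B + ln (R1 / (R1 - rho))).
Definition LD Bd T0 f : Prop := exists C, 0 <= C /\ forall rho R1 B, adm Bd T0 rho R1 B ->
  avg rho (fun z => ln (1 + Cmod (logd f z))) <= C * (1 + ln B + ln (R1 / (R1 - rho))).
Lemma adm_ln Bd T0 rho R1 B : adm Bd T0 rho R1 B -> 0 <= ln (R1 / (R1 - rho)) /\ 0 <= ln B <= B.
Proof.
  intros [[H1 _] [H2 [H3 [H4 _]]]]; split; [|split].
  - apply ln_nonneg; apply Rmult_le_reg_r with (R1 - rho); [lra|]; unfold Rdiv.
    rewrite Rmult_assoc, Rinv_l by lra; lra.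
  - now apply ln_nonneg.
  - assert (X := ln_le_sub B ltac:(lra)); lra.
Qed.
Lemma dom_mult Bd T0 f g : LF Bd -> Mer Bd f -> Mer Bd g -> dom Bd T0 f -> dom Bd T0 g ->
  dom Bd T0 (fun w => f w * g w)%C.
Proof.
  intros HL Hf Hg [C1 [P1 H1]] [C2 [P2 H2]]; exists (C1 + C2); split; [lra|].
  intros rho R1 B HA; specialize (H1 _ _ _ HA); specialize (H2 _ _ _ HA).
  eapply Rle_trans; [apply Tf_mult; auto; apply HA|lra].
Qed.
Lemma dom_inv Bd T0 f : LF Bd -> Mer Bd f -> dom Bd T0 f -> dom Bd T0 (fun w => / f w)%C.
Proof.
  intros HL Hf [C1 [P1 H1]]; destruct (Tf_inv Bd f HL Hf) as [K HK].
  exists (C1 + Rabs K); split; [generalize (Rabs_pos K); lra|].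
  intros rho R1 B HA; specialize (H1 _ _ _ HA); rewrite HK by apply HA.
  destruct (adm_ln _ _ _ _ _ HA); destruct HA as [_ [_ [_ [HB _]]]].
  assert (A1 := Rle_abs K); assert (A2 := Rabs_pos K); nra.
Qed.
Lemma dom_base Bd T0 f c d : 0 <= c -> 0 <= d -> (forall r, gr Bd r -> Tf Bd r f <= c * T0 r + d) -> dom Bd T0 f.
Proof.
  intros Hc Hd H; exists (c + d); split; [lra|]; intros rho R1 B HA.
  destruct (adm_ln _ _ _ _ _ HA) as [L _]; destruct HA as [H1 [H2 [H3 [HB HT]]]].
  eapply Rle_trans; [apply H; auto|]; assert (X := HT rho H1 ltac:(lra)).
  assert (c * T0 rho <= c * B) by now apply Rmult_le_compat_l.
  assert (d <= d * B) by nra.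
  assert (0 <= (c + d) * ln (R1 / (R1 - rho))) by (apply Rmult_le_pos; lra). lra.
Qed.
Lemma adm_between Bd T0 rho R1 B s : adm Bd T0 rho R1 B -> gr Bd s -> rho < s < R1 -> adm Bd T0 s R1 B.
Proof. intros [H1 [H2 [H3 [H4 H5]]]] Hs Hss; repeat split; auto; try lra; apply Hs. Qed.
(** The domination of f loses a logarithm of the gap, but T enters [LD_core] only under a logarithm,
    so the loss stays of the same kind. *)
Lemma LD_of_dom Bd T0 f : LF Bd -> Mer Bd f -> dom Bd T0 f -> LD Bd T0 f.
Proof.
  intros HL Hf [C [HC HD]]; destruct (LD_core Bd f HL Hf) as [c [Hc Hcore]].
  assert (L2 : 0 < ln 2) by (rewrite <- ln_1; apply ln_increasing; lra).
  assert (L4 : 0 < ln 4) by (rewrite <- ln_1; apply ln_increasing; lra).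
  assert (Lc : 0 <= ln c) by now apply ln_nonneg.
  assert (LC : 0 <= ln (C + 1)) by (apply ln_nonneg; lra).
  exists (2 * (ln c + ln (C + 1) + 4 * (ln 4 + 1) + 3 * ln 2 + 1)); split; [nra|].
  intros rho R1 B HA; destruct (adm_ln _ _ _ _ _ HA) as [La [Lb _]].
  assert (HA' := HA); destruct HA' as [H1 [H2 [H3 [HB _]]]].
  assert (Hr1 := proj1 H1).
  (* Two good radii are inserted at mutual distance at least [del]; the last quarter of the gap is
     kept for the domination hypothesis at these radii. *)
  set (del := (R1 - rho) / 4); assert (Hdel : 0 < del) by (unfold del; lra).
  destruct (gr_ex Bd (rho + del) (rho + 1.5 * del) HL) as [s [Hs Gs]]; try lra.
  destruct (gr_ex Bd (rho + 2.5 * del) (rho + 3 * del) HL) as [s2 [Hs2 Gs2]]; try lra.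
  assert (Hd4 : R1 = rho + 4 * del) by (unfold del; field).
  set (Lq := ln (R1 / del)).
  assert (EL : Lq = ln 4 + ln (R1 / (R1 - rho))).
  { unfold Lq, del; rewrite <- ln_mult; [f_equal; field; lra|lra|apply Rdiv_lt_0_compat; lra]. }
  set (B1 := (C + 1) * (B + Lq)).
  assert (HT : forall x, gr Bd x -> rho < x -> x <= rho + 3 * del -> Tf Bd x f <= B1).
  { intros x Gx Hx1 Hx2; assert (HAx := adm_between _ _ _ _ _ x HA Gx ltac:(lra)).
    eapply Rle_trans; [apply (HD x R1 B HAx)|]; unfold B1.
    destruct (adm_ln _ _ _ _ _ HAx) as [Lx _].
    assert (ln (R1 / (R1 - x)) <= Lq).
    { unfold Lq; apply ln_le; [apply Rdiv_lt_0_compat; lra|].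
      unfold Rdiv; apply Rmult_le_compat_l; [lra|]; apply Rinv_le_contravar; lra. }
    apply Rmult_le_compat; lra. }
  assert (HB1 : 1 <= B1) by (unfold B1; nra).
  assert (Hres := Hcore rho s s2 del B1 H1 Gs Gs2 Hdel ltac:(lra) ltac:(lra) ltac:(lra) HB1
    (HT s Gs ltac:(lra) ltac:(lra)) (HT s2 Gs2 ltac:(lra) ltac:(lra))).
  eapply Rle_trans; [exact Hres|].
  assert (E1 : ln B1 <= ln (C + 1) + ln B + Lq).
  { unfold B1; rewrite ln_mult by lra.
    assert (ln (B + Lq) <= ln (B * (1 + Lq))) by (apply ln_le; nra).
    rewrite ln_mult in H by lra.
    assert (X := ln_le_sub (1 + Lq) ltac:(lra)); lra. }
  assert (E2 : ln (2 * rho / del) <= ln 2 + Lq).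
  { unfold Lq; rewrite <- ln_mult by (try lra; apply Rdiv_lt_0_compat; lra).
    apply ln_le; [apply Rdiv_lt_0_compat; lra|].
    replace (2 * (R1 / del)) with (2 * R1 / del) by (field; lra).
    unfold Rdiv; apply Rmult_le_compat_r; [left; now apply Rinv_0_lt_compat|lra]. }
  set (La' := ln (R1 / (R1 - rho))) in *.
  set (k1 := ln c) in *; set (k2 := ln (C + 1)) in *; set (k3 := ln 4) in *; set (k4 := ln 2) in *; set (k5 := ln B) in *.
  assert (k1 + ln B1 + 3 * ln (2 * rho / del) <= k1 + k2 + k5 + 4 * (k3 + La') + 3 * k4) by lra.
  assert (0 <= (k1 + k2 + 4 * k3 + 3 * k4) * (k5 + La')) by (apply Rmult_le_pos; lra).
  nra.
Qed.
(** A pole of order p becomes one of order p + 1 <= 2 p, and no new poles arise. *)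
Lemma pol_deriv Bd f a : Mer Bd f -> nz (Cderive f) -> pol (Cderive f) a <= 2 * pol f a.
Proof.
  intros Hf Hd; assert (O := nz_ordf f a (proj1 Hf)); assert (O' := nz_ordf _ a Hd).
  unfold pol; rewrite <- mult_IZR; apply IZR_le.
  destruct (Z.eq_dec (ordf f a) 0) as [E|E].
  - rewrite E in O; assert (X := ord_deriv0 _ _ _ O O'); lia.
  - rewrite (ordf_eq _ _ _ (ord_deriv _ _ _ O E)); lia.
Qed.
Lemma rc_l1_logd Bd f r : Mer Bd f -> gr Bd r -> rc r (fun z => ln (1 + Cmod (logd f z))).
Proof.
  intros Hf Hr; apply rc_l1; [destruct Hr; lra|]; apply cc_ccont; [destruct Hr; lra|]; intros z Hz.
  destruct (proj2 Hf z (proj2 Hr z Hz)) as [F1 F2].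
  apply holo_cont, holo_div; auto; now apply holo_Cderive.
Qed.
Lemma dom_deriv Bd T0 f : LF Bd -> Mer Bd f -> Mer Bd (Cderive f) -> dom Bd T0 f -> dom Bd T0 (Cderive f).
Proof.
  intros HL Hf Hd HD; destruct (LD_of_dom _ _ _ HL Hf HD) as [C1 [P1 H1]]; destruct HD as [C [P H]].
  exists (2 * C + 2 * C1); split; [lra|]; intros rho R1 B HA.
  specialize (H1 _ _ _ HA); specialize (H _ _ _ HA).
  destruct (adm_ln _ _ _ _ _ HA) as [La [Lb Lb2]]; assert (HB : 1 <= B) by apply HA.
  assert (Gr := proj1 HA); assert (Hr1 := proj1 Gr).
  assert (M : mf rho (Cderive f) <= mf rho f + avg rho (fun z => ln (1 + Cmod (logd f z)))).
  { assert (Rf : rc rho (fun z => ln (1 + Cmod (f z)))) by (apply rc_l1; [lra|eapply Mer_cc; eauto]).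
    assert (Rl := rc_l1_logd Bd f rho Hf Gr).
    unfold mf; rewrite <- avg_plus by assumption.
    apply avg_le; [lra|apply rc_l1; [lra|eapply Mer_cc; eauto]| |].
    - now apply rc_plus.
    - intros z Hz; assert (N := Mer_neq _ _ _ _ Hf Gr Hz).
      assert (Cmod (Cderive f z) = Cmod (f z) * Cmod (logd f z)).
      { rewrite <- Cmod_mult; f_equal; unfold logd; field; auto. }
      rewrite <- ln_mult by (generalize (Cmod_ge_0 (f z)); generalize (Cmod_ge_0 (logd f z)); lra).
      apply ln_le; [generalize (Cmod_ge_0 (Cderive f z)); lra|].
      assert (0 <= Cmod (f z)) by apply Cmod_ge_0; assert (0 <= Cmod (logd f z)) by apply Cmod_ge_0; nra. }
  assert (N : Nf Bd rho (pol (Cderive f)) <= 2 * Nf Bd rho (pol f)).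
  { rewrite <- Nf_scal; apply Nf_le; auto; intros; eapply pol_deriv; eauto; apply Hd. }
  assert (N0 := mf_nonneg rho f ltac:(lra) (Mer_cc _ _ _ Hf Gr)).
  unfold Tf in *; set (La' := ln (R1 / (R1 - rho))) in *.
  assert (C1 * (1 + ln B + La') <= 2 * C1 * (B + La')).
  { replace (2 * C1 * (B + La')) with (C1 * (2 * (B + La'))) by ring; apply Rmult_le_compat_l; lra. }
  nra.
Qed.
(** The radii supplied by Borel's growth lemma. With R1 = r (1 + 1 / T0 r) the ratio R1 / (R1 - r)
    is T0 r + 1, so every error term becomes a logarithm of [T0 r]. *)
Definition brl Bd (T0 : R -> R) r : Prop :=
  gr Bd r /\ 1 <= T0 r /\ forall s, gr Bd s -> s <= r * (1 + / T0 r) -> T0 s <= 4 * T0 r.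
(* Otherwise T0 would blow up along a sequence of radii growing by summable proportions. *)
Lemma borel Bd T0 : (forall X, exists M, forall r, gr Bd r -> r <= X -> T0 r <= M) ->
  (forall M, exists r, gr Bd r /\ M <= T0 r) -> forall M, exists r, brl Bd T0 r /\ M <= T0 r.
Proof.
  intros Hloc Hunb M0; apply NNPP; intro N.
  set (M := Rmax M0 1); assert (HM1 : 1 <= M) by apply Rmax_r; assert (HM0 : M0 <= M) by apply Rmax_l.
  assert (step : forall r, gr Bd r -> M <= T0 r -> exists s, gr Bd s /\ s <= r * (1 + / T0 r) /\ 4 * T0 r < T0 s).
  { intros r Hr HT; apply NNPP; intro N2; apply N; exists r; split; [|lra].
    repeat split; try apply Hr; try lra; intros s Hs Hsr; apply Rnot_lt_le; intro; apply N2; eauto. }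
  destruct (Hunb M) as [r0 [G0 T00]].
  set (nxt := fun r => epsilon (inhabits r) (fun s => gr Bd s /\ s <= r * (1 + / T0 r) /\ 4 * T0 r < T0 s)).
  set (sq := fix sq n := match n with O => r0 | S n => nxt (sq n) end).
  assert (Hr0 : 1 <= r0) by apply G0.
  (* As 1 + x <= exp x and 1 / T0 <= 4^(-n) <= 2^(-n), the radii stay below r0 e^2 while [T0] grows
     at least like 4^n. *)
  assert (Inv : forall n, gr Bd (sq n) /\ M <= T0 (sq n) /\ 4 ^ n <= T0 (sq n) /\ sq n <= r0 * exp (2 - 2 * (/ 2) ^ n)).
  { induction n as [|n [I1 [I2 [I3 I4]]]].
    - simpl; repeat split; try apply G0; try lra. replace (2 - 2 * 1) with 0 by ring; rewrite exp_0; lra.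
    - assert (E := epsilon_spec (inhabits (sq n)) _ (step _ I1 I2)); fold (nxt (sq n)) in E.
      change (sq (S n)) with (nxt (sq n)); destruct E as [E1 [E2 E3]].
      assert (P4 : 0 < 4 ^ n) by (apply pow_lt; lra).
      repeat split; try apply E1; try lra; [simpl; lra|].
      eapply Rle_trans; [exact E2|].
      assert (Hi : / T0 (sq n) <= / 4 ^ n) by (apply Rinv_le_contravar; lra).
      assert (Hp : / 4 ^ n <= (/ 2) ^ n).
      { rewrite pow_inv; apply Rinv_le_contravar; [apply pow_lt; lra|apply pow_incr; lra]. }
      assert (Hx := exp_ineq1_le ((/ 2) ^ n)).
      replace (2 - 2 * (/ 2) ^ S n) with ((2 - 2 * (/ 2) ^ n) + (/ 2) ^ n) by (simpl; field).
      rewrite exp_plus, <- Rmult_assoc; apply Rmult_le_compat; try lra; [destruct I1; lra|].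
      assert (0 < / T0 (sq n)) by (apply Rinv_0_lt_compat; lra); lra. }
  destruct (Hloc (r0 * exp 2)) as [X HX].
  destruct (Pow_x_infinity 4 ltac:(rewrite Rabs_pos_eq; lra) (X + 1)) as [n Hn].
  specialize (Hn n (le_n n)); rewrite Rabs_pos_eq in Hn by (apply pow_le; lra).
  destruct (Inv n) as [I1 [I2 [I3 I4]]].
  assert (T0 (sq n) <= X); [|lra].
  apply HX; auto; eapply Rle_trans; [exact I4|]; apply Rmult_le_compat_l; [lra|].
  assert (0 < (/ 2) ^ n) by (apply pow_lt; lra).
  left; apply exp_increasing; lra.
Qed.
Lemma LD_brl Bd T0 f : LD Bd T0 f -> exists C, 0 <= C /\ forall r, brl Bd T0 r ->
  avg r (fun z => ln (1 + Cmod (logd f z))) <= C * (1 + ln (T0 r)).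
Proof.
  intros [C [HC H]].
  assert (L4 : 0 < ln 4) by (rewrite <- ln_1; apply ln_increasing; lra).
  exists (C * (2 + 2 * ln 4)); split; [apply Rmult_le_pos; lra|].
  intros r [Gr [H1 Hs]]; assert (Hr1 := proj1 Gr).
  assert (Hi : 0 < / T0 r <= 1).
  { split; [apply Rinv_0_lt_compat; lra|rewrite <- Rinv_1; apply Rinv_le_contravar; lra]. }
  assert (HA : adm Bd T0 r (r * (1 + / T0 r)) (4 * T0 r)) by (repeat split; try apply Gr; auto; nra).
  eapply Rle_trans; [apply (H _ _ _ HA)|]; rewrite Rmult_assoc; apply Rmult_le_compat_l; auto.
  rewrite ln_mult by lra.
  replace (r * (1 + / T0 r) / (r * (1 + / T0 r) - r)) with (T0 r + 1) by (field; nra).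
  assert (LT : 0 <= ln (T0 r)) by now apply ln_nonneg.
  assert (ln (T0 r + 1) <= ln (4 * T0 r)) by (apply ln_le; lra).
  rewrite ln_mult in H0 by lra; nra.
Qed.
(** From ln T <= 2 sqrt T the assumed inequality bounds sqrt T by [A], against the unboundedness of
    T. *)
Lemma growth_absurd Bd T0 kap C : (forall M, exists r, brl Bd T0 r /\ M <= T0 r) -> 0 < kap ->
  ~ (forall r, brl Bd T0 r -> kap * T0 r <= C * (1 + ln (T0 r))).
Proof.
  intros HU Hk H.
  set (A := 3 * Rabs C / kap).
  assert (HA : 0 <= A) by (unfold A; apply Rmult_le_pos; [generalize (Rabs_pos C); lra|left; now apply Rinv_0_lt_compat]).
  destruct (HU (A * A + 1)) as [r [Hr HM]]; specialize (H r Hr).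
  assert (H1 : 1 <= T0 r) by apply Hr.
  set (x := T0 r) in *; set (s := sqrt x).
  assert (Hs : s * s = x) by (unfold s; apply sqrt_sqrt; lra).
  assert (Hs1 : 1 <= s) by (unfold s; rewrite <- sqrt_1; apply sqrt_le_1_alt; lra).
  assert (Hln : ln x <= 2 * s).
  { rewrite <- Hs, ln_mult by lra; assert (X := ln_le_sub s ltac:(lra)); lra. }
  assert (L0 : 0 <= ln x) by now apply ln_nonneg.
  assert (HC : C * (1 + ln x) <= Rabs C * (3 * s)).
  { apply Rle_trans with (Rabs C * (1 + ln x)); [apply Rmult_le_compat_r; [lra|apply Rle_abs]|].
    apply Rmult_le_compat_l; [apply Rabs_pos|lra]. }
  assert (HsA : s <= A).
  { unfold A; apply Rmult_le_reg_r with kap; auto; unfold Rdiv; rewrite Rmult_assoc, Rinv_l, Rmult_1_r by lra.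
    apply Rmult_le_reg_r with s; [lra|]; nra. }
  nra.
Qed.

(** * Local boundedness and unboundedness of the characteristic *)

Lemma lam_mono r s a : 1 <= r -> r <= s -> lam r a <= lam s a.
Proof.
  intros Hr Hs; assert (X := lam_nonneg s a ltac:(lra)); unfold lam in *.
  destruct (Rlt_dec (Cmod a) r) as [L|L]; [|exact X].
  destruct (Rlt_dec (Cmod a) s); [|lra].
  destruct (cdec a (RtoC 0)) as [Z|Z]; apply ln_le; try lra.
  - apply Rdiv_lt_0_compat; [lra|now apply Cmod_pos].
  - unfold Rdiv; apply Rmult_le_compat_r; auto; left; apply Rinv_0_lt_compat; now apply Cmod_pos.
Qed.
Lemma nvd_bound g r s : nvd g r -> s < r -> exists M, 0 <= M /\ forall z, Cmod z <= s -> Cmod (g z) <= M.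
Proof.
  intros Hg Hs.
  destruct (near_compact (fun M w => Cmod w <= s -> Cmod (g w) <= M) s) as [M HM].
  - intros M M' w HMM H Hw; specialize (H Hw); lra.
  - intros z; destruct (Rlt_dec (Cmod z) r) as [L|L].
    + exists (Cmod (g z) + 1); generalize (holo_cont _ _ (proj1 (Hg z L)) 1 Rlt_0_1); apply near_imp.
      intros w Hw _; assert (T := Cmod_tri_sub (g w) (g z)); lra.
    + exists 0; exists (r - s); split; [lra|]; intros w Hw Hws.
      assert (T := Cmod_tri_sub z w); rewrite Cmod_sym in T; lra.
  - exists (Rmax 0 M); split; [apply Rmax_l|]; intros z Hz; eapply Rle_trans; [apply (HM z Hz Hz)|apply Rmax_r].
Qed.
Lemma ln1_pow x n : 0 <= x -> ln (1 + x ^ n) <= INR n * ln (1 + x) + ln 2.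
Proof.
  intros Hx; assert (P : 1 <= (1 + x) ^ n) by (apply pow_R1_Rle; lra).
  assert (Q : x ^ n <= (1 + x) ^ n) by (apply pow_incr; lra).
  replace (INR n * ln (1 + x)) with (ln ((1 + x) ^ n)) by (apply ln_pow; lra).
  rewrite <- ln_mult by lra; apply ln_le; [assert (Q2 := pow_le x n Hx); lra|lra].
Qed.
Lemma ln1_zp w p : w <> RtoC 0 -> ln (1 + Cmod (zp w p)) <=
  Rabs (IZR p) * (2 * ln (1 + Cmod w) - ln (Cmod w)) + ln 2.
Proof.
  intros Hw; assert (Hp := Cmod_pos _ Hw).
  assert (A := l1_nonneg (Cmod w) ltac:(lra)).
  assert (E : ln (1 + / Cmod w) = ln (1 + Cmod w) - ln (Cmod w)).
  { replace (1 + / Cmod w) with ((1 + Cmod w) / Cmod w) by (field; lra); rewrite ln_div by lra; ring. }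
  assert (Hi : 0 < / Cmod w) by now apply Rinv_0_lt_compat.
  assert (Bq := l1_nonneg (/ Cmod w) ltac:(lra)).
  destruct (Z.le_gt_cases 0 p) as [L|L].
  - rewrite <- (Z2Nat.id p L) at 1; rewrite zp_nat, Cmod_pow.
    eapply Rle_trans; [apply ln1_pow; lra|].
    rewrite Rabs_pos_eq by (apply IZR_le; lia).
    rewrite <- (Z2Nat.id p L) at 2; rewrite <- INR_IZR_INZ.
    assert (0 <= INR (Z.to_nat p)) by apply pos_INR; nra.
  - replace p with (- - p)%Z at 1 by lia; rewrite zp_opp by auto.
    rewrite <- (Z2Nat.id (- p)) by lia; rewrite zp_nat, Cmod_inv, Cmod_pow by now apply Cpow_nz.
    rewrite <- pow_inv.
    eapply Rle_trans; [apply ln1_pow; lra|].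
    rewrite Rabs_left1, <- opp_IZR by (apply IZR_le; lia).
    rewrite <- (Z2Nat.id (- p)) at 2 by lia; rewrite <- INR_IZR_INZ.
    assert (0 <= INR (Z.to_nat (- p))) by apply pos_INR; nra.
Qed.
Lemma ln1_prodZ l e z : ~ In z l -> ln (1 + Cmod (prodZ l e z)) <=
  lsum l (fun a => (Rabs (IZR (e a)) * (2 * ln (1 + Cmod (z - a)%C) - ln (Cmod (z - a)%C)) + ln 2)) + ln 2.
Proof.
  induction l as [|a l IH]; intros H.
  - simpl; rewrite Cmod_1; replace (1 + 1) with 2 by ring; lra.
  - assert (N : (z - a)%C <> RtoC 0) by (apply Csub_neq; intros ->; apply H; now left).
    specialize (IH ltac:(intro; apply H; now right)).
    simpl; rewrite Cmod_mult; assert (X := ln1_zp (z - a)%C (e a) N).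
    assert (P1 := Cmod_ge_0 (zp (z - a) (e a))); assert (P2 := Cmod_ge_0 (prodZ l e z)).
    apply Rle_trans with (ln (1 + Cmod (zp (z - a) (e a))) + ln (1 + Cmod (prodZ l e z))); [|lra].
    rewrite <- ln_mult by lra; apply ln_le; nra.
Qed.
(** Good circles may pass arbitrarily close to poles, so no pointwise bound exists. The mean of -ln
    |z - a| is -ln max(r, |a|) <= 0, which disposes of the singular part. *)
Lemma Tf_locbdd Bd f : LF Bd -> Mer Bd f -> forall X, exists M, forall r, gr Bd r -> r <= X -> Tf Bd r f <= M.
Proof.
  intros HL Hf X; set (X1 := Rmax X 1).
  assert (HX1 : 1 <= X1) by apply Rmax_r; assert (HX : X <= X1) by apply Rmax_l.
  destruct (gr_ex Bd X1 (X1 + 1) HL HX1 ltac:(lra)) as [s [Hs Gs]].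
  destruct (Mer_rep Bd f s HL Hf Gs) as [r' [g (Q1 & Q2 & Q3 & Q4)]].
  destruct (nvd_bound g r' s Q2 Q1) as [Mg [Mg0 HMg]].
  set (l := pts Bd s) in *.
  assert (Hin : forall a, In a l -> Cmod a < s /\ Bd a) by (intros a Ha; now apply (pts_ok Bd s HL)).
  set (cst := fun a => Rabs (IZR (ordf f a)) * (2 * ln (1 + 2 * s)) + ln 2).
  exists (lsum l cst + ln 2 + ln (1 + Mg) + Nf Bd s (pol f)); intros r Gr HrX.
  assert (Hr1 := proj1 Gr); unfold Tf; apply Rplus_le_compat.
  - assert (Hne : forall a, In a l -> Cmod a <> r).
    { intros a Ha E; exact (proj2 Gr a E (proj2 (Hin a Ha))). }
    set (F := fun a z => Rabs (IZR (ordf f a)) * (-1 * ln (Cmod (z - a)%C)) + cst a).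
    assert (R0 : forall a, In a l -> rc r (fun z => -1 * ln (Cmod (z - a)%C))).
    { intros a Ha; apply rc_scal, rc_lnsub; [lra|now apply Hne]. }
    assert (RF : forall a, In a l -> rc r (F a)).
    { intros a Ha; apply rc_plus; [apply rc_scal; auto|apply rc_const]. }
    destruct (avg_lsum r l F RF) as [A1 A2].
    apply Rle_trans with (avg r (fun z => lsum l (fun a => F a z) + (ln 2 + ln (1 + Mg)))).
    + apply avg_le; [lra|apply rc_l1; [lra|eapply Mer_cc; eauto]|apply rc_plus; [exact A1|apply rc_const]|].
      intros z Hz; assert (Nl : ~ In z l) by (intro Y; exact (Hne z Y Hz)).
      rewrite (Q4 z ltac:(lra) Nl), Cmod_mult.
      assert (P1 := Cmod_ge_0 (prodZ l (ordf f) z)); assert (P2 := Cmod_ge_0 (g z)).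
      assert (Gz := HMg z ltac:(lra)).
      apply Rle_trans with (ln (1 + Cmod (prodZ l (ordf f) z)) + ln (1 + Mg)).
      * rewrite <- ln_mult by lra; apply ln_le; nra.
      * assert (Y := ln1_prodZ l (ordf f) z Nl).
        assert (lsum l (fun a => (Rabs (IZR (ordf f a)) * (2 * ln (1 + Cmod (z - a)%C) - ln (Cmod (z - a)%C)) + ln 2)) <= lsum l (fun a => F a z)); [|lra].
        apply lsum_le; intros a Ha; unfold F, cst.
        assert (ln (1 + Cmod (z - a)%C) <= ln (1 + 2 * s)).
        { apply ln_le; [generalize (Cmod_ge_0 (z - a)%C); lra|]; assert (T := Cmod_tri_minus z a).
          destruct (Hin a Ha); lra. }
        assert (0 <= Rabs (IZR (ordf f a))) by apply Rabs_pos; nra.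
    + rewrite avg_plus, avg_const, A2 by (auto; apply rc_const).
      assert (lsum l (fun a => avg r (F a)) <= lsum l cst); [|lra].
      apply lsum_le; intros a Ha; unfold F.
      assert (Rl := rc_lnsub r a ltac:(lra) (Hne a Ha)).
      rewrite avg_plus; [|apply rc_scal, R0, Ha|apply rc_const].
      rewrite avg_const, (avg_scal r (fun z => -1 * ln (Cmod (z - a)%C))) by (apply R0, Ha).
      rewrite avg_scal, avg_ln_sub by (assumption || lra || now apply Hne).
      assert (0 <= ln (Rmax r (Cmod a))) by (apply ln_nonneg; eapply Rle_trans; [|apply Rmax_l]; lra).
      assert (0 <= Rabs (IZR (ordf f a))) by apply Rabs_pos; nra.
  - rewrite (Nf_big Bd r s) by (auto; lra); apply lsum_le; intros a _.
    apply Rmult_le_compat_l; [apply pol_nonneg|apply lam_mono; lra].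
Qed.
Lemma lam_unbdd Bd a : LF Bd -> forall M, exists r, gr Bd r /\ M <= lam r a.
Proof.
  intros HL M.
  set (c := Cmod a + 1); assert (Hc : 1 <= c) by (unfold c; generalize (Cmod_ge_0 a); lra).
  set (x := c * exp (Rabs M)).
  assert (Hx : c <= x).
  { unfold x; assert (X := exp_ineq1_le (Rabs M)); assert (Y := Rabs_pos M); nra. }
  destruct (gr_ex Bd x (x + 1) HL ltac:(lra) ltac:(lra)) as [r [Hr Gr]].
  exists r; split; auto; unfold lam.
  assert (He : 0 < exp (Rabs M)) by apply exp_pos.
  destruct (Rlt_dec (Cmod a) r) as [L|L]; [|unfold c in Hx; lra].
  assert (E : forall y, exp (Rabs M) <= y -> M <= ln y).
  { intros y Hy; apply Rle_trans with (Rabs M); [apply Rle_abs|].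
    rewrite <- (ln_exp (Rabs M)); apply ln_le; auto. }
  destruct (cdec a (RtoC 0)) as [Z|Z]; apply E.
  - assert (exp (Rabs M) <= x) by (unfold x; nra); lra.
  - apply Rmult_le_reg_r with (Cmod a); [now apply Cmod_pos|].
    unfold Rdiv; rewrite Rmult_assoc, Rinv_l, Rmult_1_r by (apply Rgt_not_eq; now apply Cmod_pos).
    assert (exp (Rabs M) * Cmod a <= x) by (unfold x, c; nra); lra.
Qed.
Lemma Nf_point Bd r d a : LF Bd -> 1 <= r -> (forall b, 0 <= d b) -> Bd a -> 1 <= d a -> lam r a <= Nf Bd r d.
Proof.
  intros HL Hr Hd Ba Ha; unfold Nf.
  destruct (Rlt_dec (Cmod a) r) as [L|L].
  - assert (Hin : In a (pts Bd r)) by (apply (pts_ok Bd r HL); auto).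
    revert Hin; induction (pts Bd r) as [|b l IH]; intros []; simpl.
    + subst b; assert (0 <= lsum l (fun x => d x * lam r x)).
      { apply lsum_nonneg; intros; apply Rmult_le_pos; auto; now apply lam_nonneg. }
      assert (X := lam_nonneg r a Hr); nra.
    + assert (0 <= d b * lam r b) by (apply Rmult_le_pos; auto; now apply lam_nonneg).
      specialize (IH H); lra.
  - assert (X := Nf_nonneg Bd r d Hr Hd); unfold Nf in X.
    assert (E : lam r a = 0) by (unfold lam; destruct (Rlt_dec (Cmod a) r); [contradiction|auto]).
    rewrite E; exact X.
Qed.

(** * Composition with polynomials and the second main theorem *)

(** The value of [u] at [z] after repairing a removable singularity, since the actual value may be
    junk. *)
Definition fin (u : C -> C) (z a : C) : Prop :=
  exists g, holo_at g z /\ g z = a /\ pnear z (fun w => u w = g w).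
Lemma holo_fin u z : holo_at u z -> fin u z (u z).
Proof. intros H; exists u; repeat split; auto; now apply pnear_all. Qed.
Lemma mer_cases u z : mer_at u z -> (exists p, (1 <= p)%Z /\ ord u z (- p)) \/ exists a, fin u z a.
Proof.
  intros H; destruct (mer_dich u z H) as [Z|[p Hp]].
  - right; exists (RtoC 0), (fun _ => RtoC 0); repeat split; auto; apply holo_const.
  - destruct (Z.le_gt_cases 0 p) as [L|L].
    + right; destruct Hp as [g [G1 [G2 G3]]].
      exists ((z - z) ^ Z.to_nat p * g z)%C, (fun w => (w - z) ^ Z.to_nat p * g w)%C; repeat split.
      * apply holo_mult; auto; apply holo_pow, holo_sub_id.
      * revert G3; apply pnear_imp; intros w _ ->; rewrite <- zp_nat, Z2Nat.id by lia; reflexivity.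
    + left; exists (- p)%Z; split; [lia|]; now rewrite Z.opp_involutive.
Qed.
Lemma fin_ord_nonneg u z a p : fin u z a -> ord u z p -> (0 <= p)%Z.
Proof.
  intros [g [G1 [G2 G3]]] H; apply (holo_ord_nonneg g z); auto; revert H; now apply ord_ext.
Qed.
Lemma fin_sub_ord u z a p : fin u z a -> ord (fun w => u w - a)%C z p -> (1 <= p)%Z.
Proof.
  intros [g [G1 [G2 G3]]] H; apply (holo_ord_zero (fun w => g w - a)%C z).
  - apply holo_minus; auto; apply holo_const.
  - revert H; apply ord_ext; revert G3; apply pnear_imp; intros w _ ->; reflexivity.
  - rewrite G2; ring.
Qed.
Definition nc (u : C -> C) : Prop := mero u /\ forall a, nz (fun w => u w - a)%C.
Lemma nc_nz u : nc u -> nz u.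
Proof.
  intros [_ H] z; destruct (H (RtoC 0) z) as [p Hp]; exists p; revert Hp; apply ord_ext, pnear_all; intros; ring.
Qed.
Lemma nc_intro u : mero u -> (forall a, ~ forall z, lz (fun w => u w - a)%C z) -> nc u.
Proof.
  intros Hm H; split; auto; intros a; apply mero_nz.
  - intros z; apply mer_minus; auto; apply mer_const.
  - apply NNPP; intro N; apply (H a); intros z; apply NNPP; intro N2; apply N; now exists z.
Qed.
Lemma pow_zp x p h n : x <> RtoC 0 -> ((zp x p * h) ^ n)%C = (zp x (Z.of_nat n * p) * h ^ n)%C.
Proof. intros; now rewrite Cpow_mult_l, zp_mul. Qed.
(** Orders multiply under composition; this and [comp_pole_ord] compute every order of F(u) in the
    sequel. *)
Lemma comp_fin_ord u z a p F n : fin u z a -> ord (fun w => u w - a)%C z p -> ord F a (Z.of_nat n) ->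
  ord (fun w => F (u w)) z (Z.of_nat n * p).
Proof.
  intros [g [G1 [G2 G3]]] Hp [f [F1 [F2 F3]]].
  assert (Nz := ord_nz _ _ _ Hp); destruct Hp as [h [H1 [H2 H3]]].
  rewrite <- G2 in F1, F2, F3.
  exists (fun w => h w ^ n * f (g w))%C; repeat split.
  - apply holo_mult; [now apply holo_pow|now apply holo_comp].
  - apply Cmult_neq_0; [now apply Cpow_nz|auto].
  - destruct F3 as [e [He K]].
    generalize (pnear_and _ _ _ (pnear_and _ _ _ (pnear_neq z) H3) (pnear_and _ _ _ Nz (pnear_and _ _ _ G3
      (near_pnear _ _ (holo_cont _ _ G1 e He))))); apply pnear_imp.
    intros w _ [[N E1] [E2 [E3 E4]]].
    rewrite E3 in E1, E2 |- *; rewrite G2 in K, E4.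
    rewrite (K (g w)); auto.
    + rewrite zp_nat, E1, pow_zp by auto; ring.
    + intro X; apply E2; rewrite X; ring.
Qed.
(* Stands for polynomials of degree [q]: behaviour at infinity is encoded by [F w = w^q r(1/w)]
   with [r] entire and [r 0 <> 0], so that no coefficients are needed. *)
Definition plike (q : nat) (F : C -> C) : Prop :=
  (forall w, holo_at F w) /\ exists r, (forall t, holo_at r t) /\ r 0 <> RtoC 0 /\
  forall w, w <> RtoC 0 -> F w = (w ^ q * r (/ w))%C.
Lemma plike_large q F : plike q F -> exists c K, 0 < c /\ 1 <= K /\ forall w, K <= Cmod w -> c * Cmod w ^ q <= Cmod (F w).
Proof.
  intros [_ [r [R1 [R2 R3]]]]; assert (Hp := Cmod_pos _ R2).
  destruct (holo_cont _ _ (R1 (RtoC 0)) (Cmod (r 0) / 2) ltac:(lra)) as [d [Hd K]].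
  exists (Cmod (r 0) / 2), (2 / d + 1); repeat split; [lra| |].
  { assert (0 < 2 / d) by (apply Rdiv_lt_0_compat; lra); lra. }
  intros w Hw; assert (H2d : 0 < 2 / d) by (apply Rdiv_lt_0_compat; lra).
  assert (Hw0 : w <> RtoC 0) by (apply Cmod_pos_neq; lra).
  rewrite R3, Cmod_mult, Cmod_pow by auto; rewrite Rmult_comm.
  apply Rmult_le_compat_l; [apply pow_le, Cmod_ge_0|].
  assert (Cmod (r (/ w)%C - r 0)%C < Cmod (r 0) / 2).
  { apply K; replace (/ w - 0)%C with (/ w)%C by ring; rewrite Cmod_inv by auto.
    apply Rle_lt_trans with (d / 2); [|lra].
    replace (d / 2) with (/ (2 / d)) by (field; lra); apply Rinv_le_contravar; lra. }
  assert (T := Cmod_tri_sub (r 0) (r (/ w)%C)); rewrite Cmod_sym in T; lra.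
Qed.
Lemma entire_mero F : (forall w, holo_at F w) -> mero F.
Proof. intros H z; now apply holo_mer. Qed.
Lemma plike_nlz q F : plike q F -> forall a, ~ lz F a.
Proof.
  intros H a Hz; destruct (plike_large q F H) as [c [K [Hc [HK HL]]]].
  assert (Z := ident F a (RtoC (K + 1)) (entire_mero F (proj1 H)) Hz).
  destruct (pnear_ex _ _ 1 Rlt_0_1 Z) as [w [_ [W1 W2]]].
  assert (T := Cmod_tri_sub (RtoC (K + 1)) w); rewrite Cmod_R, Rabs_pos_eq, Cmod_sym in T by lra.
  specialize (HL w ltac:(lra)); rewrite W2, Cmod_0 in HL.
  assert (0 < Cmod w ^ q) by (apply pow_lt; lra); nra.
Qed.
Lemma plike_ord q F a : plike q F -> exists n, ord F a (Z.of_nat n) /\ (F a = RtoC 0 -> (1 <= n)%nat) /\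
  (F a <> RtoC 0 -> n = 0%nat).
Proof.
  intros H; destruct (holo_ord_nat F a (proj1 H a) (plike_nlz q F H a)) as [n [O Z]].
  exists n; repeat split; auto; intros N.
  assert (X := ord_unique _ _ _ _ O (holo_ord0 F a (proj1 H a) N)); lia.
Qed.
Lemma comp_pole_ord u z p q F : ord u z (- p) -> (1 <= p)%Z -> plike q F ->
  ord (fun w => F (u w)) z (- (Z.of_nat q * p)).
Proof.
  intros Hu Hp [_ [r [R1 [R2 R3]]]].
  assert (Nz := ord_nz _ _ _ Hu).
  assert (Hi := ord_inv _ _ _ Hu); rewrite Z.opp_involutive in Hi.
  destruct Hi as [h [H1 [H2 H3]]].
  (* The function 1/u with its singularity at [z] filled by the value 0, so that r(1/u) is
     holomorphic there. *)
  set (t := fun w => ((w - z) ^ Z.to_nat p * h w)%C).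
  assert (Ht : holo_at t z) by (apply holo_mult; auto; apply holo_pow, holo_sub_id).
  assert (Ht0 : t z = RtoC 0).
  { unfold t; replace (Z.to_nat p) with (S (pred (Z.to_nat p))) by lia; rewrite Cpow_S; ring. }
  assert (O : ord (fun w => u w ^ q * r (t w))%C z (Z.of_nat q * - p + 0)).
  { apply (ord_mult (fun w => u w ^ q)%C (fun w => r (t w))); [now apply ord_pow|].
    apply holo_ord0; [now apply holo_comp|now rewrite Ht0]. }
  replace (- (Z.of_nat q * p))%Z with (Z.of_nat q * - p + 0)%Z by lia.
  revert O; apply ord_ext; generalize (pnear_and _ _ _ Nz H3); apply pnear_imp.
  intros w _ [N E]; rewrite R3, E by auto; do 2 f_equal; unfold t.
  rewrite <- zp_nat, Z2Nat.id by lia; reflexivity.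
Qed.
Lemma nc_cases u z : nc u ->
  (exists p, (1 <= p)%Z /\ ord u z (- p)) \/
  (exists a p, fin u z a /\ (1 <= p)%Z /\ ord (fun w => u w - a)%C z p).
Proof.
  intros [Hm H]; destruct (mer_cases u z (Hm z)) as [P|[a Ha]]; auto.
  right; destruct (H a z) as [p Hp]; exists a, p; repeat split; auto; eapply fin_sub_ord; eauto.
Qed.
Lemma comp_nz u q F : nc u -> plike q F -> nz (fun w => F (u w)).
Proof.
  intros Hu HF z; destruct (nc_cases u z Hu) as [[p [P1 P2]]|[a [p [A1 [A2 A3]]]]].
  - eexists; eapply comp_pole_ord; eauto.
  - destruct (plike_ord q F a HF) as [n [O _]]; eexists; eapply comp_fin_ord; eauto.
Qed.
Lemma nc_deriv_nz u : nc u -> nz (Cderive u).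
Proof.
  intros Hu; apply mero_nz; [intros z; apply mer_Cderive, Hu|].
  exists (RtoC 0); intro Z; destruct (df_lz_minus u _ (proj1 Hu _) Z) as [a Ha].
  destruct (proj2 Hu a (RtoC 0)) as [p Hp]; exact (ord_not_lz _ _ _ Hp Ha).
Qed.
Lemma ord_deriv_sub u z a p : mer_at u z -> ord (fun w => u w - a)%C z p -> (1 <= p)%Z -> ord (Cderive u) z (p - 1).
Proof.
  intros Hm Ho Hp; generalize (ord_deriv _ _ _ Ho ltac:(lia)); apply ord_ext.
  generalize (mer_df _ _ Hm); apply pnear_imp; intros w _ Hw.
  apply Cderive_D; eapply D_eq; [apply D_minus; [now apply holo_D|apply D_const]|ring].
Qed.
Lemma entire_bound g s : (forall z, holo_at g z) -> exists M, 0 < M /\ forall z, Cmod z <= s -> Cmod (g z) <= M.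
Proof.
  intros Hg; destruct (near_compact (fun M w => Cmod (g w) <= M) s) as [M HM].
  - intros M M' w L H; lra.
  - intros z; exists (Cmod (g z) + 1); generalize (holo_cont _ _ (Hg z) 1 Rlt_0_1); apply near_imp.
    intros w Hw; assert (T := Cmod_tri_sub (g w) (g z)); lra.
  - exists (Rmax 1 M); split; [eapply Rlt_le_trans; [|apply Rmax_l]; lra|].
    intros z Hz; eapply Rle_trans; [apply HM; auto|apply Rmax_r].
Qed.
Lemma plike_upper q F : plike q F -> exists M, 0 < M /\ forall w, Cmod (F w) <= M * (1 + Cmod w) ^ q.
Proof.
  intros [H1 [r [R1 [R2 R3]]]].
  destruct (entire_bound F 1 H1) as [M1 [P1 B1]]; destruct (entire_bound r 1 R1) as [M2 [P2 B2]].
  exists (M1 + M2); split; [lra|]; intros w.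
  assert (Hw := Cmod_ge_0 w).
  assert (P : 1 <= (1 + Cmod w) ^ q) by (apply pow_R1_Rle; lra).
  destruct (Rle_dec (Cmod w) 1) as [L|L].
  - specialize (B1 w L); nra.
  - assert (Hw0 : w <> RtoC 0) by (apply Cmod_pos_neq; lra).
    rewrite R3, Cmod_mult, Cmod_pow by auto.
    assert (Cmod (r (/ w)%C) <= M2).
    { apply B2; rewrite Cmod_inv, <- Rinv_1 by auto; apply Rinv_le_contravar; lra. }
    assert (Cmod w ^ q <= (1 + Cmod w) ^ q) by (apply pow_incr; lra).
    assert (0 <= Cmod w ^ q) by (apply pow_le; lra).
    assert (0 <= Cmod (r (/ w)%C)) by apply Cmod_ge_0.
    apply Rle_trans with ((1 + Cmod w) ^ q * M2); [apply Rmult_le_compat; auto|nra].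
Qed.
Lemma plike_lower q F : plike q F -> exists M, 0 < M /\ forall w, (1 + Cmod w) ^ q <= M * (1 + Cmod (F w)).
Proof.
  intros H; destruct (plike_large q F H) as [c [K [Hc [HK HL]]]].
  exists ((1 + K) ^ q + 2 ^ q / c); split.
  { assert (0 < (1 + K) ^ q) by (apply pow_lt; lra).
    assert (0 < 2 ^ q / c) by (apply Rdiv_lt_0_compat; auto; apply pow_lt; lra); lra. }
  intros w; assert (Hw := Cmod_ge_0 w); assert (HF := Cmod_ge_0 (F w)).
  assert (P1 : 0 < (1 + K) ^ q) by (apply pow_lt; lra).
  assert (P2 : 0 < 2 ^ q / c) by (apply Rdiv_lt_0_compat; auto; apply pow_lt; lra).
  destruct (Rle_dec K (Cmod w)) as [L|L].
  - specialize (HL w L).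
    assert ((1 + Cmod w) ^ q <= 2 ^ q * Cmod w ^ q) by (rewrite <- Rpow_mult_distr; apply pow_incr; lra).
    assert (2 ^ q * Cmod w ^ q = 2 ^ q / c * (c * Cmod w ^ q)) by (field; lra).
    assert (2 ^ q / c * (c * Cmod w ^ q) <= 2 ^ q / c * Cmod (F w)) by (apply Rmult_le_compat_l; lra).
    nra.
  - assert ((1 + Cmod w) ^ q <= (1 + K) ^ q) by (apply pow_incr; lra); nra.
Qed.
Lemma pol_comp u q F a : nc u -> plike q F -> pol (fun w => F (u w)) a = INR q * pol u a.
Proof.
  intros Hu HF; unfold pol; destruct (nc_cases u a Hu) as [[p [P1 P2]]|[b [p [A1 [A2 A3]]]]].
  - rewrite (ordf_eq _ _ _ P2), (ordf_eq _ _ _ (comp_pole_ord u a p q F P2 P1 HF)).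
    rewrite INR_IZR_INZ, <- mult_IZR; f_equal; lia.
  - destruct (plike_ord q F b HF) as [n [O _]].
    rewrite (ordf_eq _ _ _ (comp_fin_ord _ _ _ _ _ _ A1 A3 O)).
    assert (X := fin_ord_nonneg _ _ _ _ A1 (nz_ordf u a (nc_nz u Hu))).
    replace (Z.max 0 (- ordf u a)) with 0%Z by lia.
    replace (Z.max 0 (- (Z.of_nat n * p))) with 0%Z by nia; ring.
Qed.
(** T(F(u)) = q T(u) + O(1): the pole counts agree exactly, and 1 + |F(w)| is comparable with (1 +
    |w|)^q on the whole plane. *)
Lemma Tf_comp Bd u q F : LF Bd -> nc u -> Mer Bd u -> plike q F -> Mer Bd (fun w => F (u w)) ->
  exists K, 0 <= K /\ forall r, gr Bd r ->
    Tf Bd r (fun w => F (u w)) <= INR q * Tf Bd r u + K /\ INR q * Tf Bd r u <= Tf Bd r (fun w => F (u w)) + K.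
Proof.
  intros HL Hu Hm HF HmF.
  destruct (plike_upper q F HF) as [M1 [P1 B1]]; destruct (plike_lower q F HF) as [M2 [P2 B2]].
  exists (ln (1 + M1) + Rabs (ln M2)).
  assert (L1 := l1_nonneg M1 ltac:(lra)); assert (L2 := Rabs_pos (ln M2)); split; [lra|].
  intros r Gr; assert (Hr1 := proj1 Gr).
  assert (R1 : rc r (fun z => ln (1 + Cmod (u z)))) by (apply rc_l1; [lra|eapply Mer_cc; eauto]).
  assert (R2 : rc r (fun z => ln (1 + Cmod (F (u z))))) by (apply (rc_l1 r (fun w => F (u w))); [lra|eapply Mer_cc; eauto]).
  assert (EN : Nf Bd r (pol (fun w => F (u w))) = INR q * Nf Bd r (pol u)).
  { rewrite <- Nf_scal; apply Nf_ext; intros; now apply pol_comp. }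
  assert (E : forall z, INR q * ln (1 + Cmod (u z)) = ln ((1 + Cmod (u z)) ^ q)).
  { intros z; symmetry; apply ln_pow; generalize (Cmod_ge_0 (u z)); lra. }
  unfold Tf; rewrite EN; unfold mf; split.
  - assert (avg r (fun z => ln (1 + Cmod (F (u z)))) <= avg r (fun z => INR q * ln (1 + Cmod (u z)) + ln (1 + M1))).
    { apply avg_le; [lra|auto|apply rc_plus; [now apply rc_scal|apply rc_const]|].
      intros z _; rewrite E; specialize (B1 (u z)).
      assert (Q : 1 <= (1 + Cmod (u z)) ^ q) by (apply pow_R1_Rle; generalize (Cmod_ge_0 (u z)); lra).
      rewrite <- ln_mult by lra; apply ln_le; [generalize (Cmod_ge_0 (F (u z))); lra|nra]. }
    rewrite avg_plus, avg_scal, avg_const in H by (auto; try apply rc_const; now apply rc_scal); lra.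
  - assert (avg r (fun z => INR q * ln (1 + Cmod (u z))) <= avg r (fun z => ln (1 + Cmod (F (u z))) + ln M2)).
    { apply avg_le; [lra|now apply rc_scal|apply rc_plus; [auto|apply rc_const]|].
      intros z _; rewrite E; specialize (B2 (u z)).
      assert (Q : 1 <= (1 + Cmod (u z)) ^ q) by (apply pow_R1_Rle; generalize (Cmod_ge_0 (u z)); lra).
      assert (Q2 := Cmod_ge_0 (F (u z))).
      rewrite <- ln_mult by lra; apply ln_le; lra. }
    rewrite avg_plus, avg_scal, avg_const in H by (auto; try apply rc_const).
    assert (X := Rle_abs (ln M2)); lra.
Qed.
Lemma zer_comp_bound Bd u q F : LF Bd -> nc u -> Mer Bd u -> plike q F -> Mer Bd (fun w => F (u w)) ->
  exists K, 0 <= K /\ forall r, gr Bd r -> Nf Bd r (zer (fun w => F (u w))) <= INR q * Tf Bd r u + K.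
Proof.
  intros HL Hu Hm HF HmF; destruct (Tf_comp Bd u q F HL Hu Hm HF HmF) as [K [HK0 HK]].
  destruct (fmt_inv Bd _ HL HmF) as [K2 [HK2 H2]]; exists (K + K2); split; [lra|]; intros r Gr.
  destruct (HK r Gr); destruct (H2 r Gr); lra.
Qed.
Lemma dom_le Bd T0 f g c d : 0 <= c -> 0 <= d -> (forall r, gr Bd r -> Tf Bd r g <= c * Tf Bd r f + d) ->
  dom Bd T0 f -> dom Bd T0 g.
Proof.
  intros Hc Hd H [C [HC HD]]; exists (c * C + d); split; [nra|]; intros rho R1 B HA.
  eapply Rle_trans; [apply H, HA|]; specialize (HD _ _ _ HA).
  destruct (adm_ln _ _ _ _ _ HA) as [L _]; assert (HB : 1 <= B) by apply HA.
  set (La := ln (R1 / (R1 - rho))) in *.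
  assert (c * Tf Bd rho f <= c * (C * (B + La))) by now apply Rmult_le_compat_l.
  nra.
Qed.
(* [R1] is the derivative of [F]; [E] compensates the multiple roots of [F], so that [u' E(u) / F(u)] has
   at most simple poles over them. *)
Definition ramif (R1 E F : C -> C) : Prop :=
  forall w, F w = RtoC 0 -> exists t t', ord R1 w t /\ ord E w t' /\ (t <= t')%Z.
Lemma zp_le x p q : 0 < Cmod x -> Cmod x <= 1 -> (p <= q)%Z -> Cmod (zp x q) <= Cmod (zp x p).
Proof.
  intros H0 H1 Hpq; assert (Hx : x <> RtoC 0) by now apply Cmod_pos_neq.
  replace q with (p + Z.of_nat (Z.to_nat (q - p)))%Z by lia.
  rewrite zp_add, zp_nat, Cmod_mult, Cmod_pow by auto.
  assert (Cmod x ^ Z.to_nat (q - p) <= 1).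
  { rewrite <- (pow1 (Z.to_nat (q - p))); apply pow_incr; lra. }
  assert (0 <= Cmod (zp x p)) by apply Cmod_ge_0; nra.
Qed.
(** Near a root of F, E vanishes at least as fast as F', so F' dominates; near any other point |F|
    is bounded below. *)
Lemma smt_local q e F E R1 : plike q F -> plike e E -> ramif R1 E F -> (forall w, D F w (R1 w)) ->
  forall w0, exists A, near w0 (fun w => F w <> RtoC 0 -> Cmod (E w) <= A * (Cmod (F w) + Cmod (R1 w))).
Proof.
  intros HF HE Hram HD w0.
  destruct (classic (F w0 = RtoC 0)) as [Z|N].
  - destruct (Hram w0 Z) as [t [t' [[h [H1 [H2 H3]]] [[k [K1 [K2 K3]]] Htt]]]].
    assert (Hp := Cmod_pos _ H2).
    exists ((Cmod (k w0) + 1) * 2 / Cmod (h w0)); apply near_of_pnear; [intros X; contradiction|].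
    generalize (pnear_and _ _ _ (pnear_and _ _ _ H3 K3) (pnear_and _ _ _ (pnear_neq w0)
      (near_pnear _ _ (near_and _ _ _ (near_ball w0 1 w0 ltac:(rewrite Cmod_self; lra))
       (near_and _ _ _ (holo_cont _ _ H1 (Cmod (h w0) / 2) ltac:(lra)) (holo_cont _ _ K1 1 Rlt_0_1)))))).
    apply pnear_imp; intros w _ [[E1 E2] [E3 [E4 [E5 E6]]]] _.
    assert (Q : Cmod (E w) <= (Cmod (k w0) + 1) * 2 / Cmod (h w0) * Cmod (R1 w)).
    { rewrite E1, E2, !Cmod_mult.
      assert (X := zp_le (w - w0)%C t t' (Cmod_pos _ E3) ltac:(lra) Htt).
      assert (T1 := Cmod_tri_sub (h w0) (h w)); rewrite Cmod_sym in T1.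
      assert (T2 := Cmod_tri_sub (k w) (k w0)).
      assert (Z1 := Cmod_ge_0 (zp (w - w0) t')); assert (Z2 := Cmod_ge_0 (k w)).
      apply Rle_trans with (Cmod (zp (w - w0) t) * (Cmod (k w0) + 1)); [apply Rmult_le_compat; lra|].
      assert (Z3 := Cmod_ge_0 (zp (w - w0) t)); assert (Z4 := Cmod_ge_0 (k w0)).
      replace ((Cmod (k w0) + 1) * 2 / Cmod (h w0) * (Cmod (zp (w - w0) t) * Cmod (h w))) with
        (Cmod (zp (w - w0) t) * ((Cmod (k w0) + 1) * (2 * Cmod (h w) / Cmod (h w0)))) by (field; lra).
      apply Rmult_le_compat_l; auto.
      assert (1 <= 2 * Cmod (h w) / Cmod (h w0)).
      { apply Rmult_le_reg_r with (Cmod (h w0)); auto; unfold Rdiv; rewrite Rmult_assoc, Rinv_l by lra; lra. }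
      nra. }
    eapply Rle_trans; [exact Q|]; apply Rmult_le_compat_l; [|generalize (Cmod_ge_0 (F w)); lra].
    unfold Rdiv; apply Rmult_le_pos; [generalize (Cmod_ge_0 (k w0)); lra|left; now apply Rinv_0_lt_compat].
  - assert (Hp := Cmod_pos _ N).
    exists ((Cmod (E w0) + 1) * 2 / Cmod (F w0)).
    generalize (near_and _ _ _ (holo_cont _ _ (proj1 HF w0) (Cmod (F w0) / 2) ltac:(lra))
      (holo_cont _ _ (proj1 HE w0) 1 Rlt_0_1)); apply near_imp; intros w [E1 E2] _.
    assert (T1 := Cmod_tri_sub (F w0) (F w)); rewrite Cmod_sym in T1.
    assert (T2 := Cmod_tri_sub (E w) (E w0)).
    assert (Z4 := Cmod_ge_0 (E w0)); assert (Z5 := Cmod_ge_0 (R1 w)).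
    apply Rle_trans with ((Cmod (E w0) + 1) * 2 / Cmod (F w0) * (Cmod (F w0) / 2)).
    + replace ((Cmod (E w0) + 1) * 2 / Cmod (F w0) * (Cmod (F w0) / 2)) with (Cmod (E w0) + 1) by (field; lra); lra.
    + apply Rmult_le_compat_l; [|lra].
      unfold Rdiv; apply Rmult_le_pos; [lra|left; now apply Rinv_0_lt_compat].
Qed.
(** For large w both sides grow like |w|^(q-1) thanks to F(w)/w alone. On |w| <= K the local bounds
    are uniform by compactness, and there |F| <= K |F/w|. *)
Lemma smt_algebra q e F E R1 : plike q F -> plike e E -> ramif R1 E F -> (forall w, D F w (R1 w)) ->
  (e + 1 <= q)%nat ->
  exists A, 0 < A /\ forall w, w <> RtoC 0 -> F w <> RtoC 0 ->
    Cmod (E w) * (1 + Cmod w) ^ (q - e - 1) <= A * (Cmod (F w) / Cmod w + Cmod (R1 w)).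
Proof.
  intros HF HE Hram HD Hqe; set (k := (q - e - 1)%nat).
  destruct (plike_large q F HF) as [c [K [Hc [HK HL]]]].
  destruct (plike_upper e E HE) as [M [HM BM]].
  destruct (near_compact (fun A w => F w <> RtoC 0 -> Cmod (E w) <= A * (Cmod (F w) + Cmod (R1 w))) K) as [A0 HA0].
  - intros A A' w HAA H N; eapply Rle_trans; [apply H; auto|]; apply Rmult_le_compat_r; auto.
    generalize (Cmod_ge_0 (F w)); generalize (Cmod_ge_0 (R1 w)); lra.
  - intros z; eapply smt_local; eauto.
  - set (P := (1 + K) ^ k); assert (HP : 0 < P) by (apply pow_lt; lra).
    set (A1 := Rmax A0 0); assert (HA1 : 0 <= A1) by apply Rmax_r; assert (HA01 : A0 <= A1) by apply Rmax_l.
    set (A2 := M * 2 ^ (e + k) / c).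
    assert (HA2 : 0 < A2) by (unfold A2; apply Rdiv_lt_0_compat; auto; apply Rmult_lt_0_compat; auto; apply pow_lt; lra).
    exists (P * A1 * (K + 1) + A2); split; [assert (0 <= P * A1 * (K + 1)) by (repeat apply Rmult_le_pos; lra); lra|].
    intros w Hw0 HFw; assert (Hw := Cmod_pos _ Hw0).
    assert (Z1 := Cmod_ge_0 (F w)); assert (Z2 := Cmod_ge_0 (R1 w)); assert (Z3 := Cmod_ge_0 (E w)).
    assert (Z4 : 0 <= Cmod (F w) / Cmod w) by (apply Rmult_le_pos; auto; left; now apply Rinv_0_lt_compat).
    destruct (Rle_dec K (Cmod w)) as [L|L].
    + apply Rle_trans with (A2 * (Cmod (F w) / Cmod w)).
      * specialize (HL w L); specialize (BM w).
        apply Rle_trans with (M * (1 + Cmod w) ^ e * (1 + Cmod w) ^ k).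
        { apply Rmult_le_compat_r; auto; apply pow_le; lra. }
        rewrite Rmult_assoc, <- pow_add.
        apply Rle_trans with (M * (2 ^ (e + k) * Cmod w ^ (e + k))).
        { apply Rmult_le_compat_l; [lra|]; rewrite <- Rpow_mult_distr; apply pow_incr; lra. }
        replace q with (S (e + k)) in HL by (unfold k; lia); simpl in HL.
        replace (M * (2 ^ (e + k) * Cmod w ^ (e + k))) with (A2 * (c * (Cmod w * Cmod w ^ (e + k)) / Cmod w))
          by (unfold A2; field; lra).
        apply Rmult_le_compat_l; [lra|]; unfold Rdiv; apply Rmult_le_compat_r; auto; left; now apply Rinv_0_lt_compat.
      * assert (0 <= P * A1 * (K + 1)) by (repeat apply Rmult_le_pos; lra).
        assert (0 <= P * A1 * (K + 1) * (Cmod (F w) / Cmod w + Cmod (R1 w))) by (apply Rmult_le_pos; lra).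
        assert (0 <= A2 * Cmod (R1 w)) by (apply Rmult_le_pos; lra); lra.
    + specialize (HA0 w ltac:(lra) HFw).
      assert (Y1 : (1 + Cmod w) ^ k <= P) by (apply pow_incr; lra).
      assert (Y2 : Cmod (E w) <= A1 * (Cmod (F w) + Cmod (R1 w))).
      { eapply Rle_trans; [exact HA0|]; apply Rmult_le_compat_r; lra. }
      assert (Y3 : Cmod (F w) <= K * (Cmod (F w) / Cmod w)).
      { replace (Cmod (F w)) with (Cmod w * (Cmod (F w) / Cmod w)) at 1 by (field; lra).
        apply Rmult_le_compat_r; lra. }
      assert (Y0 : 0 <= (1 + Cmod w) ^ k) by (apply pow_le; lra).
      apply Rle_trans with (A1 * (Cmod (F w) + Cmod (R1 w)) * P); [apply Rmult_le_compat; auto|].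
      set (x := Cmod (F w) / Cmod w) in *; set (y := Cmod (R1 w)) in *.
      assert (Y4 : Cmod (F w) + y <= (K + 1) * (x + y)) by nra.
      assert (A1 * (Cmod (F w) + y) <= A1 * ((K + 1) * (x + y))) by now apply Rmult_le_compat_l.
      assert (0 <= A2 * (x + y)) by (apply Rmult_le_pos; lra).
      nra.
Qed.
(** At w = u(z) the algebraic inequality, multiplied by |u' / F(u)|, reads |X| (1 + |u|)^(q-e-1) <=
    A (|u'/u| + |F(u)'/F(u)|). Means of logarithms and Jensen's formula for X give the claim. *)
Lemma smt Bd T0 u q e F E R1 : LF Bd -> nc u -> Mer Bd u -> dom Bd T0 u ->
  plike q F -> plike e E -> ramif R1 E F -> (forall w, D F w (R1 w)) -> (e + 1 <= q)%nat ->
  Mer Bd (fun w => F (u w)) -> Mer Bd (fun w => Cderive u w * E (u w) / F (u w))%C ->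
  exists C, 0 <= C /\ forall r, brl Bd T0 r ->
    Nf Bd r (fun a => IZR (ordf (fun w => Cderive u w * E (u w) / F (u w))%C a)) + INR (q - e - 1) * mf r u
      <= C * (1 + ln (T0 r)).
Proof.
  intros HL Hu Hm Hdom HF HE Hram HD Hqe HmF HmX.
  set (X := fun w => (Cderive u w * E (u w) / F (u w))%C) in *.
  set (Fu := fun w => F (u w)) in *.
  destruct (Tf_comp Bd u q F HL Hu Hm HF HmF) as [K [HK0 HK]].
  assert (HdF : dom Bd T0 Fu).
  { apply (dom_le Bd T0 u Fu (INR q) K); auto; [apply pos_INR|]; intros r Gr; apply (HK r Gr). }
  destruct (LD_brl _ _ _ (LD_of_dom _ _ _ HL Hm Hdom)) as [C1 [P1 H1]].
  destruct (LD_brl _ _ _ (LD_of_dom _ _ _ HL HmF HdF)) as [C2 [P2 H2]].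
  destruct (smt_algebra q e F E R1 HF HE Hram HD Hqe) as [A [HA HAl]].
  destruct (jensen Bd X HL HmX) as [J HJ].
  exists (Rabs (ln A) + Rabs J + C1 + C2).
  assert (PA := Rabs_pos (ln A)); assert (PJ := Rabs_pos J); split; [lra|].
  intros r Hr; specialize (H1 r Hr); specialize (H2 r Hr).
  assert (Gr : gr Bd r) by apply Hr; assert (Hr1 := proj1 Gr); specialize (HJ r Gr).
  set (k := (q - e - 1)%nat) in *.
  assert (Ru : rc r (fun z => ln (1 + Cmod (u z)))) by (apply rc_l1; [lra|eapply Mer_cc; eauto]).
  assert (RX : rc r (fun z => ln (Cmod (X z))))
    by (apply rc_lnmod; [lra|eapply Mer_cc; eauto|intros; eapply Mer_neq; eauto]).
  assert (Rl1 := rc_l1_logd Bd u r Hm Gr); assert (Rl2 := rc_l1_logd Bd Fu r HmF Gr).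
  assert (I : avg r (fun z => ln (Cmod (X z)) + INR k * ln (1 + Cmod (u z))) <=
     avg r (fun z => (ln (1 + Cmod (logd u z)) + ln (1 + Cmod (logd Fu z))) + ln A)).
  { apply avg_le; [lra|apply rc_plus; [auto|now apply rc_scal]|apply rc_plus; [now apply rc_plus|apply rc_const]|].
    intros z Hz.
    assert (Nu := Mer_neq _ _ _ _ Hm Gr Hz); assert (NF := Mer_neq _ _ _ _ HmF Gr Hz); assert (NX := Mer_neq _ _ _ _ HmX Gr Hz).
    assert (Gu : good u z) by (apply (proj2 Hm), (proj2 Gr), Hz).
    assert (DF : Cderive Fu z = (Cderive u z * R1 (u z))%C).
    { apply Cderive_D; apply (D_comp F u); [apply holo_D, Gu|apply HD]. }
    specialize (HAl (u z) Nu NF).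
    assert (Z0 := Cmod_ge_0 (logd u z)); assert (Z1 := Cmod_ge_0 (logd Fu z)); assert (Zu := Cmod_ge_0 (u z)).
    assert (PX := Cmod_pos _ NX).
    rewrite <- ln_pow, <- !ln_mult by (try lra; try (apply pow_lt; lra); nra).
    apply ln_le; [apply Rmult_lt_0_compat; auto; apply pow_lt; lra|].
    assert (EX : Cmod (X z) * (1 + Cmod (u z)) ^ k =
      Cmod (Cderive u z) / Cmod (F (u z)) * (Cmod (E (u z)) * (1 + Cmod (u z)) ^ k)).
    { unfold X; rewrite Cmod_div, Cmod_mult by auto; field; apply Rgt_not_eq, Cmod_pos; auto. }
    assert (PF := Cmod_pos _ NF); assert (Pu := Cmod_pos _ Nu).
    assert (EL : Cmod (Cderive u z) / Cmod (F (u z)) * (Cmod (F (u z)) / Cmod (u z) + Cmod (R1 (u z))) =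
      Cmod (logd u z) + Cmod (logd Fu z)).
    { unfold logd; rewrite !Cmod_div, DF, Cmod_mult by auto; unfold Fu in *; field; lra. }
    rewrite EX.
    apply Rle_trans with (A * (Cmod (logd u z) + Cmod (logd Fu z))).
    - rewrite <- EL.
      replace (A * (Cmod (Cderive u z) / Cmod (F (u z)) * (Cmod (F (u z)) / Cmod (u z) + Cmod (R1 (u z))))) with
        (Cmod (Cderive u z) / Cmod (F (u z)) * (A * (Cmod (F (u z)) / Cmod (u z) + Cmod (R1 (u z))))) by ring.
      apply Rmult_le_compat_l; auto.
      apply Rmult_le_pos; [apply Cmod_ge_0|left; now apply Rinv_0_lt_compat].
    - rewrite Rmult_comm; apply Rmult_le_compat_r; [lra|]; nra. }
  rewrite !avg_plus, avg_scal, avg_const in I by (auto; try apply rc_const; try (now apply rc_scal); now apply rc_plus).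
  fold (mf r u) in I; rewrite HJ in I.
  assert (L0 : 0 <= ln (T0 r)) by (apply ln_nonneg, Hr).
  assert (A1 := Rle_abs (ln A)); assert (A2 := Rle_abs (- J)); rewrite Rabs_Ropp in A2.
  assert (0 <= (Rabs (ln A) + Rabs J) * ln (T0 r)) by (apply Rmult_le_pos; lra).
  lra.
Qed.
Lemma smt_ord_pole u z p q e F E : ord u z (- p) -> (1 <= p)%Z -> plike q F -> plike e E ->
  ord (fun w => Cderive u w * E (u w) / F (u w))%C z ((Z.of_nat q - Z.of_nat e - 1) * p - 1).
Proof.
  intros Hu Hp HF HE.
  assert (O := ord_div _ _ _ _ _ (ord_mult _ _ _ _ _ (ord_deriv _ _ _ Hu ltac:(lia)) (comp_pole_ord _ _ _ _ _ Hu Hp HE))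
    (comp_pole_ord _ _ _ _ _ Hu Hp HF)).
  replace ((Z.of_nat q - Z.of_nat e - 1) * p - 1)%Z with (- p - 1 + - (Z.of_nat e * p) - - (Z.of_nat q * p))%Z by ring.
  exact O.
Qed.
Lemma smt_ord_fin u z a p n t F E : mer_at u z -> fin u z a -> ord (fun w => u w - a)%C z p -> (1 <= p)%Z ->
  ord F a (Z.of_nat n) -> ord E a (Z.of_nat t) ->
  ord (fun w => Cderive u w * E (u w) / F (u w))%C z (p - 1 + (Z.of_nat t - Z.of_nat n) * p).
Proof.
  intros Hm Hfin Ho Hp HF HE.
  assert (O := ord_div _ _ _ _ _ (ord_mult _ _ _ _ _ (ord_deriv_sub _ _ _ _ Hm Ho Hp) (comp_fin_ord _ _ _ _ _ _ Hfin Ho HE))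
    (comp_fin_ord _ _ _ _ _ _ Hfin Ho HF)).
  replace (p - 1 + (Z.of_nat t - Z.of_nat n) * p)%Z with (p - 1 + Z.of_nat t * p - Z.of_nat n * p)%Z by ring.
  exact O.
Qed.
Definition ind (f : C -> C) (a : C) : R := if Z_lt_dec 0 (ordf f a) then 1 else 0.
Definition indp (f : C -> C) (a : C) : R := if Z_lt_dec (ordf f a) 0 then 1 else 0.
Lemma ord_deriv_of_zero F R1 w n : (forall x, D F x (R1 x)) -> ord F w (Z.of_nat n) -> (1 <= n)%nat ->
  ord R1 w (Z.of_nat n - 1).
Proof.
  intros HD Ho Hn; generalize (ord_deriv _ _ _ Ho ltac:(lia)); apply ord_ext, pnear_all.
  intros x; apply Cderive_D, HD.
Qed.
(** The order of u' E(u) / F(u) is (q - e - 1) p - 1 at a pole of order p, at least -1 at a zero of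
    F(u), and nonnegative elsewhere. The losses of 1 become the truncated counting functions. *)
Lemma smt_count Bd T0 u q e F E R1 : LF Bd -> nc u -> Mer Bd u -> dom Bd T0 u ->
  plike q F -> plike e E -> ramif R1 E F -> (forall w, D F w (R1 w)) -> (e + 1 <= q)%nat ->
  Mer Bd (fun w => F (u w)) -> Mer Bd (fun w => Cderive u w * E (u w) / F (u w))%C ->
  exists C, 0 <= C /\ forall r, brl Bd T0 r ->
    (INR q - INR e - 1) * Tf Bd r u <= Nf Bd r (indp u) + Nf Bd r (ind (fun w => F (u w))) + C * (1 + ln (T0 r)).
Proof.
  intros HL Hu Hm Hdom HF HE Hram HD Hqe HmF HmX.
  destruct (smt Bd T0 u q e F E R1 HL Hu Hm Hdom HF HE Hram HD Hqe HmF HmX) as [C [HC H]].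
  exists C; split; auto; intros r Hr; specialize (H r Hr).
  assert (Gr : gr Bd r) by apply Hr; assert (Hr1 := proj1 Gr).
  assert (Ek : INR (q - e - 1) = INR q - INR e - 1).
  { rewrite !minus_INR by lia; simpl; ring. }
  rewrite Ek in H; unfold Tf.
  assert (N : (INR q - INR e - 1) * Nf Bd r (pol u) <=
    Nf Bd r (indp u) + Nf Bd r (ind (fun w => F (u w))) + Nf Bd r (fun a => IZR (ordf (fun w => Cderive u w * E (u w) / F (u w))%C a))).
  { rewrite <- Nf_scal, <- !Nf_plus; apply Nf_le; auto; intros a.
    assert (Ez : INR q - INR e - 1 = IZR (Z.of_nat q - Z.of_nat e - 1)).
    { rewrite !minus_IZR, <- !INR_IZR_INZ; reflexivity. }
    rewrite Ez; unfold indp, ind, pol.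
    destruct (nc_cases u a Hu) as [[p [P1 P2]]|[b [p [A1 [A2 A3]]]]].
    - rewrite (ordf_eq _ _ _ P2), (ordf_eq _ _ _ (comp_pole_ord u a p q F P2 P1 HF)),
        (ordf_eq _ _ _ (smt_ord_pole u a p q e F E P2 P1 HF HE)).
      destruct (Z_lt_dec (- p) 0); [|lia]; destruct (Z_lt_dec 0 (- (Z.of_nat q * p))); [nia|].
      replace (Z.max 0 (- - p)) with p by lia.
      rewrite <- mult_IZR, <- !plus_IZR; apply IZR_le; lia.
    - destruct (plike_ord q F b HF) as [n [O [On _]]]; destruct (plike_ord e E b HE) as [t [Ot _]].
      assert (Hmu : mer_at u a) by apply Hu.
      rewrite (ordf_eq _ _ _ (comp_fin_ord _ _ _ _ _ _ A1 A3 O)),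
        (ordf_eq _ _ _ (smt_ord_fin u a b p n t F E Hmu A1 A3 A2 O Ot)).
      assert (X := fin_ord_nonneg _ _ _ _ A1 (nz_ordf u a (nc_nz u Hu))).
      replace (Z.max 0 (- ordf u a)) with 0%Z by lia.
      destruct (Z_lt_dec (ordf u a) 0); [lia|].
      destruct (Z_lt_dec 0 (Z.of_nat n * p)) as [L|L].
      + assert (Hn : (1 <= n)%nat) by nia.
        assert (Fb : F b = RtoC 0).
        { apply NNPP; intro N; assert (Y := ord_unique _ _ _ _ O (holo_ord0 F b (proj1 HF b) N)); lia. }
        destruct (Hram b Fb) as [t1 [t2 [Q1 [Q2 Q3]]]].
        assert (t1 = (Z.of_nat n - 1)%Z) by (eapply ord_unique; [exact Q1|eapply ord_deriv_of_zero; eauto]).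
        assert (t2 = Z.of_nat t) by (eapply ord_unique; eauto).
        rewrite <- mult_IZR, <- !plus_IZR; apply IZR_le; nia.
      + assert (n = 0%nat) by nia; subst n.
        rewrite <- mult_IZR, <- !plus_IZR; apply IZR_le; nia. }
  lra.
Qed.

(** * The polynomial P *)

(** Whatever [u] does at the origin, a pole or the value [a], this single point makes a counting
    function grow like ln r. *)
Lemma Tf_unbdd Bd u a : LF Bd -> nc u -> Mer Bd u -> Mer Bd (fun w => u w - a)%C ->
  ((ordf u (RtoC 0) < 0)%Z \/ (0 < ordf (fun w => u w - a)%C (RtoC 0))%Z) -> forall M, exists r, gr Bd r /\ M <= Tf Bd r u.
Proof.
  intros HL Hu Hm Hma [Ho|Ho] M.
  - assert (B0 : Bd 0).
    { apply NNPP; intro N; destruct (proj2 Hm _ N) as [G1 G2].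
      assert (X := ordf_eq _ _ _ (holo_ord0 u 0 G1 G2)); lia. }
    destruct (lam_unbdd Bd 0 HL M) as [r [Gr Hr]]; exists r; split; auto.
    assert (Hr1 := proj1 Gr).
    assert (P : 1 <= pol u 0) by (unfold pol; apply IZR_le; lia).
    assert (Q := Nf_point Bd r (pol u) 0 HL Hr1 (pol_nonneg u) B0 P).
    unfold Tf; assert (Z := mf_nonneg r u ltac:(lra) (Mer_cc _ _ _ Hm Gr)); lra.
  - assert (B0 : Bd 0).
    { apply NNPP; intro N; destruct (proj2 Hma _ N) as [G1 G2].
      assert (X := ordf_eq _ _ _ (holo_ord0 _ 0 G1 G2)); lia. }
    assert (HF : plike 1 (fun w => w - a)%C).
    { split; [intros w; apply holo_sub_id|]; exists (fun t => 1 - a * t)%C; repeat split.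
      - intros t; apply holo_minus; [apply holo_const|apply holo_mult; [apply holo_const|apply holo_id]].
      - replace (1 - a * 0)%C with (RtoC 1) by ring; apply C1_neq0.
      - intros w Hw; simpl; field; auto. }
    destruct (zer_comp_bound Bd u 1 (fun w => w - a)%C HL Hu Hm HF Hma) as [K [HK0 HK]].
    destruct (lam_unbdd Bd 0 HL (M + K)) as [r [Gr Hr]]; exists r; split; auto.
    assert (Hr1 := proj1 Gr).
    assert (P : 1 <= zer (fun w => u w - a)%C 0) by (unfold zer; apply IZR_le; lia).
    assert (Q := Nf_point Bd r (zer (fun w => u w - a)%C) 0 HL Hr1 (zer_nonneg _) B0 P).
    specialize (HK r Gr); simpl in HK; lra.
Qed.
Lemma unb_witness u : nc u -> exists a, (ordf u (RtoC 0) < 0)%Z \/ (0 < ordf (fun w => u w - a)%C (RtoC 0))%Z.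
Proof.
  intros Hu; destruct (nc_cases u 0 Hu) as [[p [P1 P2]]|[a [p [A1 [A2 A3]]]]].
  - exists (RtoC 0); left; rewrite (ordf_eq _ _ _ P2); lia.
  - exists a; right; rewrite (ordf_eq _ _ _ A3); lia.
Qed.
Lemma X_nz u q e F E : nc u -> plike q F -> plike e E -> nz (fun w => Cderive u w * E (u w) / F (u w))%C.
Proof.
  intros Hu HF HE z.
  destruct (nc_deriv_nz u Hu z) as [p1 O1]; destruct (comp_nz u e E Hu HE z) as [p2 O2];
  destruct (comp_nz u q F Hu HF z) as [p3 O3].
  eexists; apply (ord_div (fun w => Cderive u w * E (u w))%C (fun w => F (u w))); [|exact O3].
  now apply (ord_mult (Cderive u) (fun w => E (u w))); eauto.
Qed.
(** The list [l] holds further functions that must share the exceptional set [Bd] chosen here. *)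
Lemma smt_engine u q e F E R1 l : nc u -> plike q F -> plike e E -> ramif R1 E F ->
  (forall w, D F w (R1 w)) -> (e + 1 <= q)%nat -> (forall f, In f l -> nz f) ->
  exists Bd, LF Bd /\ Mer Bd u /\ Mer Bd (fun w => F (u w)) /\ (forall f, In f l -> Mer Bd f) /\
   (forall M, exists r, brl Bd (fun r => Tf Bd r u) r /\ M <= Tf Bd r u) /\
   exists C, 0 <= C /\ forall r, brl Bd (fun r => Tf Bd r u) r ->
    (INR q - INR e - 1) * Tf Bd r u <= Nf Bd r (indp u) + Nf Bd r (ind (fun w => F (u w))) + C * (1 + ln (Tf Bd r u)).
Proof.
  intros Hu HF HE Hram HD Hqe Hl.
  destruct (unb_witness u Hu) as [a Ha].
  set (X := fun w => (Cderive u w * E (u w) / F (u w))%C).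
  set (L := u :: (fun w => F (u w)) :: X :: (fun w => u w - a)%C :: l).
  assert (HLn : forall f, In f L -> nz f).
  { intros f [<-|[<-|[<-|[<-|Hf]]]]; auto.
    - now apply nc_nz.
    - eapply comp_nz; eauto.
    - eapply X_nz; eauto.
    - apply Hu. }
  exists (bads L).
  assert (HM : forall f, In f L -> Mer (bads L) f) by (intros; now apply bads_Mer).
  assert (HLF : LF (bads L)) by now apply bads_LF.
  assert (Mu : Mer (bads L) u) by (apply HM; simpl; auto).
  assert (MF : Mer (bads L) (fun w => F (u w))) by (apply HM; simpl; auto).
  assert (MX : Mer (bads L) X) by (apply HM; simpl; auto).
  assert (Ma : Mer (bads L) (fun w => u w - a)%C) by (apply HM; simpl; auto 6).
  split; [auto|]; split; [auto|]; split; [auto|]; split; [|split].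
  - intros f Hf; apply HM; simpl; auto 6.
  - apply borel; [now apply Tf_locbdd|now apply (Tf_unbdd _ u a)].
  - apply (smt_count (bads L) (fun r => Tf (bads L) r u) u q e F E R1); auto.
    apply (dom_base _ _ _ 1 0); try lra; intros; lra.
Qed.
(** Polynomials of degree below [q], in the encoding of [plike] but vanishing at infinity relative
    to w^q. *)
Definition low (q : nat) (S : C -> C) : Prop :=
  (forall w, holo_at S w) /\ exists s, (forall t, holo_at s t) /\ s 0 = RtoC 0 /\
  forall w, w <> RtoC 0 -> S w = (w ^ q * s (/ w))%C.
Lemma holo_mono c j z : holo_at (fun w => c * w ^ j)%C z.
Proof. apply holo_mult; [apply holo_const|apply holo_pow, holo_id]. Qed.
Lemma low_mono q c j : (j < q)%nat -> low q (fun w => c * w ^ j)%C.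
Proof.
  intros Hj; split; [intros; apply holo_mono|]; exists (fun t => c * t ^ (q - j))%C; repeat split.
  - intros; apply holo_mono.
  - replace (q - j)%nat with (S (q - j - 1)) by lia; rewrite Cpow_S; ring.
  - intros w Hw; rewrite Cpow_inv by auto; replace q with (j + (q - j))%nat at 1 by lia.
    rewrite Cpow_add_r; field; now apply Cpow_nz.
Qed.
Lemma low_plus q S1 S2 : low q S1 -> low q S2 -> low q (fun w => S1 w + S2 w)%C.
Proof.
  intros [H1 [s1 [A1 [A2 A3]]]] [H2 [s2 [B1 [B2 B3]]]]; split; [intros; now apply holo_plus|].
  exists (fun t => s1 t + s2 t)%C; repeat split.
  - intros; now apply holo_plus.
  - rewrite A2, B2; ring.
  - intros w Hw; rewrite A3, B3 by auto; ring.
Qed.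
Lemma plike_lead q k S : k <> RtoC 0 -> low q S -> plike q (fun w => k * w ^ q + S w)%C.
Proof.
  intros Hk [H1 [s1 [A1 [A2 A3]]]]; split; [intros; apply holo_plus; [apply holo_mono|auto]|].
  exists (fun t => k + s1 t)%C; repeat split.
  - intros; apply holo_plus; [apply holo_const|auto].
  - rewrite A2; replace (k + 0)%C with k by ring; auto.
  - intros w Hw; rewrite A3 by auto; ring.
Qed.
Lemma plike_ext q F G : (forall w, F w = G w) -> plike q F -> plike q G.
Proof.
  intros E [H1 [r [A1 [A2 A3]]]]; split.
  - intros w; apply (holo_ext F); auto; now apply near_all.
  - exists r; repeat split; auto; intros w Hw; rewrite <- E; auto.
Qed.
Lemma plike_mult q p F G : plike q F -> plike p G -> plike (q + p) (fun w => F w * G w)%C.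
Proof.
  intros [H1 [s1 [A1 [A2 A3]]]] [H2 [s2 [B1 [B2 B3]]]]; split; [intros; now apply holo_mult|].
  exists (fun t => s1 t * s2 t)%C; repeat split.
  - intros; now apply holo_mult.
  - now apply Cmult_neq_0.
  - intros w Hw; rewrite A3, B3, Cpow_add_r by auto; ring.
Qed.
Lemma plike_pow_sub a j : plike j (fun w => (w - a) ^ j)%C.
Proof.
  split; [intros; apply holo_pow, holo_sub_id|]; exists (fun t => (1 - a * t) ^ j)%C; repeat split.
  - intros; apply holo_pow, holo_minus; [apply holo_const|apply holo_mult; [apply holo_const|apply holo_id]].
  - apply Cpow_nz; replace (1 - a * 0)%C with (RtoC 1) by ring; apply C1_neq0.
  - intros w Hw; rewrite <- Cpow_mult_l; f_equal; field; auto.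
Qed.
Lemma plike_const1 : plike 0 (fun _ => RtoC 1).
Proof. apply (plike_ext 0 (fun w => (w - 0) ^ 0)%C); [reflexivity|apply plike_pow_sub]. Qed.
Lemma plike_id : plike 1 (fun w => w).
Proof. apply (plike_ext 1 (fun w => (w - 0) ^ 1)%C); [intros; simpl; ring|apply plike_pow_sub]. Qed.
Lemma ord_pow_sub a j : ord (fun w => (w - a) ^ j)%C a (Z.of_nat j).
Proof.
  exists (fun _ => RtoC 1); repeat split; [apply holo_const|apply C1_neq0|].
  apply pnear_all; intros w; rewrite zp_nat; ring.
Qed.
(** Multiplicities of explicit polynomials are read off their factored derivatives by this lemma. *)
Lemma ord_of_deriv F R1 w t : (forall x, D F x (R1 x)) -> F w = RtoC 0 -> ord R1 w (Z.of_nat t) ->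
  ord F w (Z.of_nat (S t)).
Proof.
  intros HD Hw HR.
  assert (HF : forall x, holo_at F x) by (intros; apply holo_df, near_all; intros; eexists; apply HD).
  assert (N : ~ lz F w).
  { intros Z; apply (ord_not_lz _ _ _ HR); apply pnear_near in Z; revert Z; apply pnear_imp.
    intros x _ Z; apply (D_unique F x); [apply HD|].
    apply (D_ext (fun _ => RtoC 0)); [now apply near_eq_sym|apply D_const]. }
  destruct (holo_ord_nat F w (HF w) N) as [n [O Hn]]; specialize (Hn Hw).
  assert (O2 := ord_deriv_of_zero F R1 w n HD O Hn).
  assert (E := ord_unique _ _ _ _ O2 HR); replace (S t) with n by lia; auto.
Qed.
Lemma D_mono c j w : D (fun x => c * x ^ j)%C w (c * (INR j * w ^ pred j)).
Proof. apply D_scal; eapply D_eq; [apply (D_pow (fun x => x) w 1 j), D_id|ring]. Qed.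
Lemma INR_neq0 j : (1 <= j)%nat -> RtoC (INR j) <> RtoC 0.
Proof. intros H E; apply RtoC_inj in E; apply (le_INR 1) in H; simpl in H; lra. Qed.
Lemma ord_root_one j a : (1 <= j)%nat -> (a ^ j)%C = RtoC 1 -> ord (fun w => w ^ j - 1)%C a 1.
Proof.
  intros Hj Ha.
  assert (Ha0 : a <> RtoC 0).
  { intros ->; replace j with (S (pred j)) in Ha by lia; rewrite Cpow_S in Ha.
    apply C1_neq0; rewrite <- Ha; ring. }
  apply (ord_of_deriv _ (fun w => INR j * w ^ pred j)%C a 0).
  - intros x; eapply D_eq; [apply D_minus; [apply (D_pow (fun x => x) x 1 j), D_id|apply D_const]|ring].
  - rewrite Ha; ring.
  - apply holo_ord0; [apply holo_mono|]; apply Cmult_neq_0; [now apply INR_neq0|now apply Cpow_nz].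
Qed.
(** Bezout: a m = 1 + b n for some naturals a and b. *)
Lemma gcd_root1 m n w : Nat.gcd m n = 1%nat -> (1 <= m)%nat -> (w ^ m)%C = RtoC 1 -> (w ^ n)%C = RtoC 1 -> w = RtoC 1.
Proof.
  intros Hg Hm Hwm Hwn.
  destruct (Nat.gcd_bezout_pos m n ltac:(lia)) as [a [b Hab]].
  rewrite Hg in Hab.
  assert (E : (w ^ (a * m))%C = (w ^ (1 + b * n))%C) by now rewrite Hab.
  rewrite Cpow_add_r, (Nat.mul_comm a), (Nat.mul_comm b), !Cpow_mult_r, Hwm, Hwn, !Cpow_1_l in E.
  simpl in E; replace w with (w * 1 * 1)%C by ring; now rewrite <- E.
Qed.
(** The coefficients of P are made for this factorisation of P'. *)
Definition Pder (n m : nat) (w : C) : C :=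
  (INR n * (w ^ (n - 2 * m - 1) * ((w ^ m - 1) * (w ^ m - 1))))%C.
(** The number b with P(w) = w^n b + c at every m-th root of unity w. *)
Definition bcst (n m : nat) : R := 1 - 2 * INR n / (INR n - INR m) + INR n / (INR n - 2 * INR m).
Lemma INR_facts n m : (1 <= m)%nat -> (2 * m < n)%nat ->
  1 <= INR m /\ 0 < INR n - 2 * INR m /\ 0 < INR n - INR m.
Proof.
  intros H1 H2; apply (le_INR 1) in H1; apply lt_INR in H2; rewrite mult_INR in H2; simpl in *; lra.
Qed.
Lemma bcst_val n m : (1 <= m)%nat -> (2 * m < n)%nat ->
  bcst n m = 2 * INR m ^ 2 / ((INR n - INR m) * (INR n - 2 * INR m)) /\ 0 < bcst n m.
Proof.
  intros H1 H2; destruct (INR_facts n m H1 H2) as [A [B D0]].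
  assert (E : bcst n m = 2 * INR m ^ 2 / ((INR n - INR m) * (INR n - 2 * INR m))) by (unfold bcst; field; lra).
  split; auto; rewrite E; apply Rdiv_lt_0_compat; [nra|now apply Rmult_lt_0_compat].
Qed.
Lemma Ppoly_plike n m c : (1 <= m)%nat -> (2 * m < n)%nat -> plike n (Ppoly n m c).
Proof.
  intros H1 H2.
  apply (plike_ext n (fun w => RtoC 1 * w ^ n + ((RtoC (- (2 * INR n / (INR n - INR m))) * w ^ (n - m) +
     RtoC (INR n / (INR n - 2 * INR m)) * w ^ (n - 2 * m)) + c * w ^ 0))%C).
  - intros w; unfold Ppoly; rewrite RtoC_opp; simpl; ring.
  - apply plike_lead; [apply C1_neq0|].
    apply (low_plus n (fun w => (RtoC (- (2 * INR n / (INR n - INR m))) * w ^ (n - m) +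
     RtoC (INR n / (INR n - 2 * INR m)) * w ^ (n - 2 * m))%C)); [|apply low_mono; lia].
    apply (low_plus n (fun w => (RtoC (- (2 * INR n / (INR n - INR m))) * w ^ (n - m))%C)); apply low_mono; lia.
Qed.
Lemma D_Ppoly n m c w : (1 <= m)%nat -> (2 * m < n)%nat -> D (Ppoly n m c) w (Pder n m w).
Proof.
  intros H1 H2; destruct (INR_facts n m H1 H2) as [A [B D0]].
  apply (D_ext (fun w => ((RtoC 1 * w ^ n + RtoC (- (2 * INR n / (INR n - INR m))) * w ^ (n - m)) +
     RtoC (INR n / (INR n - 2 * INR m)) * w ^ (n - 2 * m)) + c)%C).
  - apply near_all; intros x; unfold Ppoly; rewrite RtoC_opp; ring.
  - eapply D_eq; [apply D_plus; [apply D_plus; [apply D_plus|]|apply D_const]; apply D_mono|].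
    unfold Pder; set (j := (n - 2 * m - 1)%nat).
    replace (pred n) with (j + (m + m))%nat by (unfold j; lia).
    replace (pred (n - m)) with (j + m)%nat by (unfold j; lia).
    replace (pred (n - 2 * m)) with j by (unfold j; lia).
    rewrite !Cpow_add_r, !minus_INR, mult_INR by lia; simpl (INR 2).
    assert (N1 : RtoC (INR n - INR m) <> RtoC 0) by (intro E; apply RtoC_inj in E; lra).
    assert (N2 : RtoC (INR n - 2 * INR m) <> RtoC 0) by (intro E; apply RtoC_inj in E; lra).
    assert (E1 : (RtoC (- (2 * INR n / (INR n - INR m))) * RtoC (INR n - INR m))%C = RtoC (-2 * INR n))
      by (rewrite <- RtoC_mult; f_equal; field; lra).
    assert (E2 : (RtoC (INR n / (INR n - 2 * INR m)) * RtoC (INR n - (1 + 1) * INR m))%C = RtoC (INR n))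
      by (rewrite <- RtoC_mult; f_equal; field; lra).
    rewrite !Cmult_assoc, E1, E2, RtoC_mult; ring.
Qed.
Lemma Ppoly_0 n m c : (1 <= m)%nat -> (2 * m < n)%nat -> Ppoly n m c 0 = c.
Proof.
  intros H1 H2; unfold Ppoly.
  replace n with (S (pred n)) at 1 by lia; replace (n - m)%nat with (S (pred (n - m))) by lia.
  replace (n - 2 * m)%nat with (S (pred (n - 2 * m))) by lia; rewrite !Cpow_S; ring.
Qed.
Lemma Ppoly_root1 n m c w : (1 <= m)%nat -> (2 * m < n)%nat -> (w ^ m)%C = RtoC 1 ->
  Ppoly n m c w = (w ^ n * bcst n m + c)%C.
Proof.
  intros H1 H2 Hw; unfold Ppoly, bcst.
  assert (E1 : (w ^ (n - m))%C = (w ^ n)%C).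
  { replace n with ((n - m) + m)%nat at 2 by lia; rewrite Cpow_add_r, Hw; ring. }
  assert (E2 : (w ^ (n - 2 * m))%C = (w ^ n)%C).
  { replace n with ((n - 2 * m) + (m + m))%nat at 2 by lia; rewrite !Cpow_add_r, Hw; ring. }
  rewrite E1, E2, RtoC_plus, RtoC_minus; ring.
Qed.
(** The zeros of P' are excluded as roots: P is c at 0, and w^n b + c with |w| = 1 at m-th roots of
    unity, which vanishes only if |c| = b. *)
Lemma Ppoly_simple n m c w : (1 <= m)%nat -> (2 * m < n)%nat -> c <> RtoC 0 -> Cmod c <> bcst n m ->
  Ppoly n m c w = RtoC 0 -> w <> RtoC 0 /\ (w ^ m)%C <> RtoC 1.
Proof.
  intros H1 H2 Hc Hb Hw; split.
  - intros ->; rewrite Ppoly_0 in Hw; auto.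
  - intros E; rewrite Ppoly_root1 in Hw by auto; apply Hb.
    assert (X : c = (- (w ^ n * bcst n m))%C) by (replace c with (w ^ n * bcst n m + c - w ^ n * bcst n m)%C by ring; rewrite Hw; ring).
    assert (Mw : Cmod w = 1).
    { assert (Y : Cmod w ^ m = 1) by (rewrite <- Cmod_pow, E; apply Cmod_1).
      assert (P := Cmod_ge_0 w).
      destruct (Rtotal_order (Cmod w) 1) as [L|[L|L]]; auto; exfalso.
      - assert (Cmod w ^ m < 1); [|lra]; apply pow_lt_1_compat; [lra|lia].
      - assert (1 < Cmod w ^ m); [|lra]; apply Rlt_pow_R1; [lra|lia]. }
    destruct (bcst_val n m H1 H2) as [_ P].
    rewrite X, Cmod_opp, Cmod_mult, Cmod_pow, Mw, pow1, Cmod_R, Rabs_pos_eq; lra.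
Qed.
Lemma Pder_ord0 n m w : (1 <= n)%nat -> w <> RtoC 0 -> (w ^ m)%C <> RtoC 1 -> ord (Pder n m) w 0.
Proof.
  intros Hn Hw Hm; apply holo_ord0.
  - apply holo_mult; [apply holo_const|apply holo_mult; [apply holo_pow, holo_id|]].
    apply holo_mult; (apply holo_minus; [apply holo_pow, holo_id|apply holo_const]).
  - assert (X := Csub_neq _ _ Hm).
    apply Cmult_neq_0; [now apply INR_neq0|apply Cmult_neq_0; [now apply Cpow_nz|now apply Cmult_neq_0]].
Qed.
Lemma ord_pow_id j a : a <> RtoC 0 -> ord (fun w => w ^ j)%C a 0.
Proof. intros; apply holo_ord0; [apply holo_pow, holo_id|now apply Cpow_nz]. Qed.
Lemma Pder_ord_root n m w : (1 <= n)%nat -> (1 <= m)%nat -> (w ^ m)%C = RtoC 1 -> ord (Pder n m) w 2.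
Proof.
  intros Hn Hm Hw.
  assert (Hw0 : w <> RtoC 0).
  { intros ->; replace m with (S (pred m)) in Hw by lia; rewrite Cpow_S in Hw; apply C1_neq0; rewrite <- Hw; ring. }
  apply (ord_scal (RtoC (INR n)) _ w 2); [now apply INR_neq0|].
  apply (ord_mult (fun w => w ^ (n - 2 * m - 1))%C (fun w => (w ^ m - 1) * (w ^ m - 1))%C w 0 2); [now apply ord_pow_id|].
  apply (ord_mult _ _ w 1 1); now apply ord_root_one.
Qed.
Lemma Pder_ord_zero n m : (1 <= n)%nat -> (1 <= m)%nat -> ord (Pder n m) 0 (Z.of_nat (n - 2 * m - 1)).
Proof.
  intros Hn Hm; apply (ord_scal (RtoC (INR n)) _ 0); [now apply INR_neq0|].
  replace (Z.of_nat (n - 2 * m - 1)) with (Z.of_nat (n - 2 * m - 1) + 0)%Z by lia.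
  apply (ord_mult (fun w => w ^ (n - 2 * m - 1))%C (fun w => (w ^ m - 1) * (w ^ m - 1))%C).
  - generalize (ord_pow_sub 0 (n - 2 * m - 1)); apply ord_ext, pnear_all; intros w; f_equal; ring.
  - assert (X : forall z, holo_at (fun w => w ^ m - 1)%C z) by (intros; apply holo_minus; [apply holo_pow, holo_id|apply holo_const]).
    apply holo_ord0; [now apply holo_mult|].
    replace m with (S (pred m)) by lia; rewrite Cpow_S.
    replace ((0 * 0 ^ pred m - 1) * (0 * 0 ^ pred m - 1))%C with (RtoC 1) by ring; apply C1_neq0.
Qed.
Lemma ord_nat_of_plike e E w : plike e E -> exists t : nat, ord E w (Z.of_nat t).
Proof. intros H; destruct (plike_ord e E w H) as [t [O _]]; eauto. Qed.
(** At most one m-th root of unity is a root of P, because w^n separates them when gcd(m, n) = 1. It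
    is a triple root, so a factor of degree 2 compensates it. *)
Lemma ramif_nonzero n m c : (1 <= m)%nat -> (2 * m < n)%nat -> Nat.gcd m n = 1%nat -> c <> RtoC 0 ->
  exists e E, (e <= 2)%nat /\ plike e E /\ ramif (Pder n m) E (Ppoly n m c).
Proof.
  intros H1 H2 Hg Hc.
  assert (Hn : (1 <= n)%nat) by lia.
  assert (Z0 : forall w, Ppoly n m c w = RtoC 0 -> w <> RtoC 0).
  { intros w Hw ->; rewrite Ppoly_0 in Hw; auto. }
  destruct (classic (exists om, (om ^ m)%C = RtoC 1 /\ Ppoly n m c om = RtoC 0)) as [[om [Om Hom]]|No].
  - exists 2%nat, (fun w => (w - om) ^ 2)%C; split; [lia|]; split; [apply plike_pow_sub|].
    intros w Hw; destruct (classic ((w ^ m)%C = RtoC 1)) as [Ew|Nw].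
    + assert (w = om).
      { rewrite Ppoly_root1 in Hw, Hom by auto.
        assert (Eb : (w ^ n)%C = (om ^ n)%C).
        { assert (X : ((w ^ n - om ^ n) * bcst n m)%C = RtoC 0).
          { replace ((w ^ n - om ^ n) * bcst n m)%C with ((w ^ n * bcst n m + c) - (om ^ n * bcst n m + c))%C by ring.
            rewrite Hw, Hom; ring. }
          apply Cmult_integral in X; destruct X as [X|X]; [now apply Csub_eq|].
          apply RtoC_inj in X; destruct (bcst_val n m H1 H2); lra. }
        assert (Om0 : om <> RtoC 0) by now apply Z0; rewrite Ppoly_root1.
        apply Csub_eq.
        assert (Q : (w / om)%C = RtoC 1).
        { apply (gcd_root1 m n); auto; unfold Cdiv; rewrite Cpow_mult_l, Cpow_inv by auto.
          - rewrite Ew, Om; field; apply C1_neq0.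
          - rewrite Eb; field; now apply Cpow_nz. }
        replace w with (w / om * om)%C by (field; auto); rewrite Q; ring. }
      subst w; exists 2%Z, 2%Z; repeat split; [now apply Pder_ord_root|apply (ord_pow_sub om 2)|lia].
    + destruct (ord_nat_of_plike 2 _ w (plike_pow_sub om 2)) as [t Ot].
      exists 0%Z, (Z.of_nat t); repeat split; auto; [apply Pder_ord0; auto|lia].
  - exists 0%nat, (fun _ => RtoC 1); split; [lia|]; split; [apply plike_const1|].
    intros w Hw; exists 0%Z, 0%Z; repeat split; [|apply ord_const, C1_neq0|lia].
    apply Pder_ord0; auto; intros X; apply No; eauto.
Qed.
(** With constant term 0 the only multiple root is 0, since P is w^n b, hence nonzero, at m-th roots
    of unity. *)
Lemma ramif_zero n m : (1 <= m)%nat -> (2 * m < n)%nat ->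
  ramif (Pder n m) (fun w => w ^ (n - 2 * m - 1))%C (Ppoly n m 0).
Proof.
  intros H1 H2 w Hw.
  assert (PL : plike (n - 2 * m - 1) (fun w => w ^ (n - 2 * m - 1))%C).
  { apply (plike_ext _ (fun w => (w - 0) ^ (n - 2 * m - 1))%C); [intros; f_equal; ring|apply plike_pow_sub]. }
  destruct (classic (w = RtoC 0)) as [->|N].
  - exists (Z.of_nat (n - 2 * m - 1)), (Z.of_nat (n - 2 * m - 1)); repeat split; [apply Pder_ord_zero; lia| |lia].
    generalize (ord_pow_sub 0 (n - 2 * m - 1)); apply ord_ext, pnear_all; intros x; f_equal; ring.
  - destruct (ord_nat_of_plike _ _ w PL) as [t Ot].
    exists 0%Z, (Z.of_nat t); repeat split; auto; [|lia].
    apply Pder_ord0; auto; [lia|]; intros E; rewrite Ppoly_root1 in Hw by auto.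
    assert (X : (w ^ n * bcst n m)%C = RtoC 0) by (rewrite <- Hw; ring).
    apply Cmult_integral in X; destruct X as [X|X].
    + revert X; now apply Cpow_nz.
    + apply RtoC_inj in X; destruct (bcst_val n m H1 H2); lra.
Qed.

(** * Linear relations between 1/P(u) and 1/P(v) *)

(** All later contradictions take this form: truncated counts of poles and of zeros of F(u) below (q
    - e - 1) T. *)
Lemma smt_close u q e F E R1 l beta : nc u -> plike q F -> plike e E -> ramif R1 E F ->
  (forall w, D F w (R1 w)) -> (e + 1 <= q)%nat -> (forall f, In f l -> nz f) -> beta < INR q - INR e - 1 ->
  (forall Bd, LF Bd -> Mer Bd u -> Mer Bd (fun w => F (u w)) -> (forall f, In f l -> Mer Bd f) ->
     exists K, forall r, gr Bd r -> Nf Bd r (indp u) + Nf Bd r (ind (fun w => F (u w))) <= beta * Tf Bd r u + K) ->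
  False.
Proof.
  intros Hu HF HE Hram HD Hqe Hl Hb H.
  destruct (smt_engine u q e F E R1 l Hu HF HE Hram HD Hqe Hl) as [Bd [HL [Mu [MF [Ml [Hbr [C [HC HS]]]]]]]].
  destruct (H Bd HL Mu MF Ml) as [K HK].
  apply (growth_absurd Bd (fun r => Tf Bd r u) (INR q - INR e - 1 - beta) (C + Rabs K)); auto; [lra|].
  intros r Hr; specialize (HS r Hr); specialize (HK r (proj1 Hr)).
  assert (L0 : 0 <= ln (Tf Bd r u)) by (apply ln_nonneg, Hr).
  assert (X := Rle_abs K); assert (0 <= Rabs K * ln (Tf Bd r u)) by (apply Rmult_le_pos; auto; apply Rabs_pos).
  lra.
Qed.
Lemma indp_pol u a : indp u a <= pol u a.
Proof.
  unfold indp, pol; destruct (Z_lt_dec (ordf u a) 0); apply IZR_le; lia.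
Qed.
Lemma Nf_pol_le Bd u r : Mer Bd u -> gr Bd r -> Nf Bd r (pol u) <= Tf Bd r u.
Proof.
  intros Hm Gr; unfold Tf; assert (X := mf_nonneg r u ltac:(destruct Gr; lra) (Mer_cc _ _ _ Hm Gr)); lra.
Qed.
Lemma Nf_indp_le Bd u r : LF Bd -> Mer Bd u -> gr Bd r -> Nf Bd r (indp u) <= Tf Bd r u.
Proof.
  intros HL Hm Gr; eapply Rle_trans; [|now apply (Nf_pol_le Bd u r)].
  apply Nf_le; auto; [apply Gr|]; intros; apply indp_pol.
Qed.
(** The source of the factor 1/(k+1): poles of order at least [kp] are few when counted once. *)
Lemma indp_pol_mult u kp a : nz u -> (forall z p, ord u z (- p) -> (1 <= p)%Z -> (Z.of_nat kp <= p)%Z) ->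
  INR kp * indp u a <= pol u a.
Proof.
  intros Hn H; unfold indp, pol; destruct (Z_lt_dec (ordf u a) 0).
  - specialize (H a (- ordf u a)%Z); rewrite Z.opp_involutive in H.
    specialize (H (nz_ordf u a Hn) ltac:(lia)); rewrite INR_IZR_INZ, Rmult_1_r; apply IZR_le; lia.
  - rewrite Rmult_0_r; apply IZR_le; lia.
Qed.
Lemma ord_add_const f z p d : ord f z p -> (1 <= p)%Z -> d <> RtoC 0 -> ord (fun w => f w + d)%C z 0.
Proof.
  intros [g [G1 [G2 G3]]] Hp Hd.
  assert (E : ((z - z) ^ Z.to_nat p * g z + d)%C = d).
  { replace (Z.to_nat p) with (S (pred (Z.to_nat p))) by lia; rewrite Cpow_S; ring. }
  apply (ord_ext (fun w => (w - z) ^ Z.to_nat p * g w + d)%C).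
  - revert G3; apply pnear_imp; intros w _ ->; rewrite <- zp_nat, Z2Nat.id by lia; reflexivity.
  - apply (holo_ord0 (fun w => (w - z) ^ Z.to_nat p * g w + d)%C); [|now rewrite E].
    apply holo_plus; [apply holo_mult; [apply holo_pow, holo_sub_id|auto]|apply holo_const].
Qed.
(** The cofactor of w^(n-2m) in P - c. *)
Definition Kpoly (n m : nat) (w : C) : C :=
  (w ^ (2 * m) - RtoC (2 * INR n / (INR n - INR m)) * w ^ m + RtoC (INR n / (INR n - 2 * INR m)))%C.
Lemma Ppoly_K n m w : (2 * m < n)%nat -> Ppoly n m 0 w = (w ^ (n - 2 * m) * Kpoly n m w)%C.
Proof.
  intros H; unfold Ppoly, Kpoly.
  replace (w ^ n)%C with (w ^ (n - 2 * m) * w ^ (2 * m))%C by (rewrite <- Cpow_add_r; f_equal; lia).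
  replace (w ^ (n - m))%C with (w ^ (n - 2 * m) * w ^ m)%C by (rewrite <- Cpow_add_r; f_equal; lia).
  ring.
Qed.
Lemma Kpoly_plike n m : (1 <= m)%nat -> plike (2 * m) (Kpoly n m).
Proof.
  intros Hm; apply (plike_ext _ (fun w => RtoC 1 * w ^ (2 * m) + (RtoC (- (2 * INR n / (INR n - INR m))) * w ^ m +
     RtoC (INR n / (INR n - 2 * INR m)) * w ^ 0))%C).
  - intros w; unfold Kpoly; rewrite RtoC_opp; simpl; ring.
  - apply plike_lead; [apply C1_neq0|].
    apply (low_plus (2 * m) (fun w => (RtoC (- (2 * INR n / (INR n - INR m))) * w ^ m)%C)); apply low_mono; lia.
Qed.
Lemma Ppoly_shift n m c d w : (Ppoly n m c w - d)%C = Ppoly n m (c - d) w.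
Proof. unfold Ppoly; ring. Qed.
Lemma ind_le f a x : (forall p, ord f a p -> (1 <= p)%Z -> 1 <= x) -> 0 <= x -> nz f -> ind f a <= x.
Proof.
  intros H H0 Hn; unfold ind; destruct (Z_lt_dec 0 (ordf f a)); auto.
  apply (H (ordf f a)); [now apply nz_ordf|lia].
Qed.
Lemma zer_eq f a p : ord f a p -> (0 <= p)%Z -> zer f a = IZR p.
Proof. intros H Hp; unfold zer; rewrite (ordf_eq _ _ _ H); f_equal; lia. Qed.
(* At a zero of [P(u) - 1/B] the function [P(v)] has a pole, whose order is a multiple of [n]. *)
Lemma relation_mult n m c u v A B z s : (1 <= m)%nat -> (2 * m < n)%nat -> nc v -> A <> RtoC 0 -> B <> RtoC 0 ->
  (forall z, pnear z (fun w => Ppoly n m c (v w) = Ppoly n m c (u w) * (A + B * Ppoly n m c (v w)))%C) ->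
  ord (fun w => Ppoly n m (c - / B) (u w)) z s -> (1 <= s)%Z -> exists p, (1 <= p)%Z /\ s = (Z.of_nat n * p)%Z.
Proof.
  intros H1 H2 Hv HA HB Hrel Hs Hs1.
  assert (OU : ord (fun w => Ppoly n m c (u w)) z 0).
  { generalize (ord_add_const _ _ _ (/ B)%C Hs Hs1 (Cinv_nz _ HB)); apply ord_ext, pnear_all.
    intros w; rewrite <- Ppoly_shift; ring. }
  assert (OV : ord (fun w => Ppoly n m c (v w)) z (- s)).
  { assert (O := ord_div _ _ _ _ _ OU Hs); apply (ord_scal (- A / B)%C) in O.
    - generalize O; apply ord_ext; generalize (pnear_and _ _ _ (Hrel z) (ord_nz _ _ _ Hs)); apply pnear_imp.
      intros w _ [E N]; rewrite <- Ppoly_shift in N |- *.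
      set (x := Ppoly n m c (u w)) in *; set (y := Ppoly n m c (v w)) in *.
      assert (N2 : (B * x - 1)%C <> RtoC 0).
      { intros X; apply N; replace (x - / B)%C with ((B * x - 1) / B)%C by (field; auto); rewrite X; field; auto. }
      assert (E2 : (y * (B * x - 1))%C = (- A * x)%C).
      { replace (y * (B * x - 1))%C with (x * (A + B * y) - y - A * x)%C by ring; rewrite <- E; ring. }
      replace y with (y * (B * x - 1) / (B * x - 1))%C by (field; auto); rewrite E2; field; auto.
    - intros X; apply HA; replace A with (- (- A / B) * B)%C by (field; auto); rewrite X; ring. }
  destruct (nc_cases v z Hv) as [[p [P1 P2]]|[b [p [A1 [A2 A3]]]]].
  - exists p; split; auto; assert (X := ord_unique _ _ _ _ OV (comp_pole_ord v z p n _ P2 P1 (Ppoly_plike n m c H1 H2))); lia.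
  - destruct (plike_ord n _ b (Ppoly_plike n m c H1 H2)) as [t [O _]].
    assert (X := ord_unique _ _ _ _ OV (comp_fin_ord _ _ _ _ _ _ A1 A3 O)); nia.
Qed.
(** All zeros of F(u), F = P - 1/B, have order divisible by n, hence are few when counted once. The
    case where F has constant term 0 is separate because of its multiple root 0. *)
Lemma relation_shift n m c u v A B : (1 <= m)%nat -> (2 * m + 4 < n)%nat -> (4 * m < n)%nat -> Nat.gcd m n = 1%nat ->
  nc u -> nc v -> A <> RtoC 0 -> B <> RtoC 0 ->
  (forall z, pnear z (fun w => Ppoly n m c (v w) = Ppoly n m c (u w) * (A + B * Ppoly n m c (v w)))%C) -> False.
Proof.
  intros H1 H2 H4 Hg Hu Hv HA HB Hrel.
  assert (H2' : (2 * m < n)%nat) by lia.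
  set (F := Ppoly n m (c - / B)).
  assert (HF : plike n F) by now apply Ppoly_plike.
  assert (HnF := comp_nz u n F Hu HF).
  assert (HD : forall w, D F w (Pder n m w)) by (intros; now apply D_Ppoly).
  assert (Hmu : forall z s, ord (fun w => F (u w)) z s -> (1 <= s)%Z -> exists p, (1 <= p)%Z /\ s = (Z.of_nat n * p)%Z)
    by (intros z s; now apply (relation_mult n m c u v A B)).
  assert (Rm : INR (2 * m + 5) <= INR n) by (apply le_INR; lia).
  assert (R4 : INR (4 * m + 1) <= INR n) by (apply le_INR; lia).
  assert (R1 := le_INR 1 m H1); rewrite !plus_INR, !mult_INR in Rm, R4; simpl in Rm, R4, R1.
  destruct (classic (c - / B = RtoC 0)%C) as [Z|N].
  - unfold F in *; rewrite Z in *; clear F.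
    assert (HK := Kpoly_plike n m H1).
    assert (Hpw : plike (n - 2 * m - 1) (fun w => w ^ (n - 2 * m - 1))%C).
    { apply (plike_ext _ (fun w => (w - 0) ^ (n - 2 * m - 1))%C); [intros; f_equal; ring|apply plike_pow_sub]. }
    (* Here q - e - 1 = 2m. Poles contribute 1. A zero of u of order q with (n - 2m) q = n p has q
       >= 2 and contributes 1/2. Zeros of K(u) have order divisible by n and contribute 2m/n, which
       4m < n keeps below 1/2. *)
    apply (smt_close u n (n - 2 * m - 1) _ _ _ [fun w => Kpoly n m (u w)] (1 + / 2 + 2 * INR m / INR n) Hu HF Hpw
       (ramif_zero n m H1 H2') HD); [lia| | |].
    { intros f [<-|[]]; now apply (comp_nz u (2 * m)). }
    { rewrite !minus_INR, mult_INR by lia; simpl.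
      assert (2 * INR m / INR n < / 2); [|lra]; apply (Rmult_lt_reg_r (INR n)); [lra|].
      replace (2 * INR m / INR n * INR n) with (2 * INR m) by (field; lra); lra. }
    intros Bd HL Mu MF Ml.
    assert (MK : Mer Bd (fun w => Kpoly n m (u w))) by (apply Ml; simpl; auto).
    destruct (fmt_inv Bd u HL Mu) as [K1 [HK1 B1]].
    destruct (zer_comp_bound Bd u _ _ HL Hu Mu HK MK) as [K2 [HK2 B2]].
    exists (/ 2 * K1 + / INR n * K2); intros r Gr.
    destruct (B1 r Gr) as [B1' _]; specialize (B2 r Gr).
    assert (X := Nf_indp_le Bd u r HL Mu Gr).
    assert (Y : Nf Bd r (ind (fun w => Ppoly n m 0 (u w))) <=
      / 2 * Nf Bd r (zer u) + / INR n * Nf Bd r (zer (fun w => Kpoly n m (u w)))).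
    { rewrite <- !Nf_scal, <- Nf_plus; apply Nf_le; auto; [apply Gr|]; intros a.
      assert (P1 := zer_nonneg u a); assert (P2 := zer_nonneg (fun w => Kpoly n m (u w)) a).
      assert (P3 : 0 < / INR n) by (apply Rinv_0_lt_compat; lra).
      apply ind_le; [|nra|auto]; intros s Os Hs; destruct (Hmu a s Os Hs) as [p [Hp ->]].
      destruct (nc_cases u a Hu) as [[q [Q1 Q2]]|[b [q [A1 [A2 A3]]]]].
      { assert (Y := ord_unique _ _ _ _ Os (comp_pole_ord u a q n _ Q2 Q1 HF)); nia. }
      destruct (plike_ord _ _ b HK) as [t [Ot [Ht0 Ht1]]].
      assert (Okc := comp_fin_ord _ _ _ _ _ _ A1 A3 Ot).
      destruct (classic (b = RtoC 0)) as [Eb|Nb].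
      - subst b.
        assert (Ou : ord u a q) by (revert A3; apply ord_ext, pnear_all; intros; ring).
        assert (t = 0%nat).
        { apply Ht1; unfold Kpoly; replace (2 * m)%nat with (S (pred (2 * m))) by lia.
          replace (0 ^ m)%C with (0 * 0 ^ pred m)%C by (rewrite <- Cpow_S; f_equal; lia); rewrite Cpow_S.
          intros X0; ring_simplify in X0; apply RtoC_inj in X0.
          assert (0 < INR n / (INR n - 2 * INR m)) by (apply Rdiv_lt_0_compat; lra); lra. }
        subst t.
        assert (O3 := ord_mult _ _ _ _ _ (ord_pow _ _ _ (n - 2 * m) Ou) Okc).
        assert (E3 : (Z.of_nat n * p = Z.of_nat (n - 2 * m) * q + Z.of_nat 0 * q)%Z).
        { eapply ord_unique; [exact Os|]; generalize O3; apply ord_ext, pnear_all; intros w; now rewrite Ppoly_K. }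
        rewrite (zer_eq _ _ _ Ou) by lia.
        assert (2 <= q)%Z by nia; apply IZR_le in H; nra.
      - assert (Op : ord (fun w => u w ^ (n - 2 * m))%C a 0).
        { replace 0%Z with (Z.of_nat 0 * q)%Z by lia.
          apply (comp_fin_ord u a b q (fun w => w ^ (n - 2 * m))%C 0); auto; now apply ord_pow_id. }
        assert (O3 := ord_mult _ _ _ _ _ Op Okc).
        assert (E3 : (Z.of_nat n * p = 0 + Z.of_nat t * q)%Z).
        { eapply ord_unique; [exact Os|]; generalize O3; apply ord_ext, pnear_all; intros w; now rewrite Ppoly_K. }
        rewrite (zer_eq _ _ _ Okc), <- (Z.add_0_l (Z.of_nat t * q)), <- E3 by lia.
        rewrite mult_IZR, <- INR_IZR_INZ.
        replace (/ INR n * (INR n * IZR p)) with (IZR p) by (field; lra).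
        apply IZR_le in Hp; lra. }
    assert (P3 : 0 < / INR n) by (apply Rinv_0_lt_compat; lra).
    rewrite mult_INR in B2; simpl (INR 2) in B2.
    assert (/ INR n * Nf Bd r (zer (fun w => Kpoly n m (u w))) <= / INR n * ((1 + 1) * INR m * Tf Bd r u + K2))
      by (apply Rmult_le_compat_l; lra).
    unfold Rdiv; lra.
  - destruct (ramif_nonzero n m _ H1 H2' Hg N) as [e [E [He [HE Hram]]]].
    assert (Re := le_INR _ _ He); simpl in Re.
    (* Poles contribute 1, and so do the zeros of F(u), whose order is at least n; against them
       stands q - e - 1 >= n - 3. *)
    apply (smt_close u n e F E _ [] 2 Hu HF HE Hram HD); [lia|intros f []|lra|].
    intros Bd HL Mu MF _; destruct (zer_comp_bound Bd u n F HL Hu Mu HF MF) as [K [HK HB2]].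
    exists (/ INR n * K); intros r Gr; specialize (HB2 r Gr).
    assert (X := Nf_indp_le Bd u r HL Mu Gr).
    assert (P3 : 0 < / INR n) by (apply Rinv_0_lt_compat; lra).
    assert (Y : Nf Bd r (ind (fun w => F (u w))) <= / INR n * Nf Bd r (zer (fun w => F (u w)))).
    { rewrite <- Nf_scal; apply Nf_le; auto; [apply Gr|]; intros a.
      assert (P1 := zer_nonneg (fun w => F (u w)) a).
      apply ind_le; [|nra|auto]; intros s Os Hs; destruct (Hmu a s Os Hs) as [p [Hp ->]].
      rewrite (zer_eq _ _ _ Os), mult_IZR, <- INR_IZR_INZ by nia.
      replace (/ INR n * (INR n * IZR p)) with (IZR p) by (field; lra).
      apply IZR_le in Hp; lra. }
    assert (/ INR n * Nf Bd r (zer (fun w => F (u w))) <= / INR n * (INR n * Tf Bd r u + K))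
      by (apply Rmult_le_compat_l; lra).
    replace (/ INR n * (INR n * Tf Bd r u + K)) with (Tf Bd r u + / INR n * K) in H by (field; lra); lra.
Qed.

(** * Proportional polynomials P(v) = A P(u) *)

Lemma holo_pnear_eq f g z : holo_at f z -> holo_at g z -> pnear z (fun w => f w = g w) -> f z = g z.
Proof.
  intros Hf Hg H; apply Csub_eq, (ccont_pnear0 (fun w => f w - g w)%C).
  - now apply holo_cont, holo_minus.
  - revert H; apply pnear_imp; intros w _ ->; ring.
Qed.
Lemma Tf_eq Bd f g r : Mer Bd f -> Mer Bd g -> gr Bd r -> (forall z, pnear z (fun w => f w = g w)) ->
  Tf Bd r f = Tf Bd r g.
Proof.
  intros Hf Hg Gr H; unfold Tf, mf; f_equal.
  - apply avg_ext; [destruct Gr; lra|]; intros z Hz; do 3 f_equal.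
    assert (N := proj2 Gr z Hz); apply holo_pnear_eq; auto; [apply (proj2 Hf z N)|apply (proj2 Hg z N)].
  - apply Nf_ext; intros a; unfold pol; do 3 f_equal.
    symmetry; apply ordf_eq; generalize (nz_ordf f a (proj1 Hf)); now apply ord_ext.
Qed.
Lemma Tf_const Bd a : a <> RtoC 0 -> Mer Bd (fun _ => a) /\ exists K, forall r, Tf Bd r (fun _ => a) = K.
Proof.
  intros Ha; split; [split; [intros z; exists 0%Z; now apply ord_const|intros z _; split; [apply holo_const|auto]]|].
  exists (ln (1 + Cmod a)); intros r; unfold Tf, mf.
  assert (E : Nf Bd r (pol (fun _ => a)) = 0 * Nf Bd r (pol (fun _ => a))); [|rewrite avg_const, E; ring].
  rewrite <- Nf_scal; apply Nf_ext.
  intros z; unfold pol; rewrite (ordf_eq _ _ _ (ord_const a z Ha)); change (0 = 0 * 0); ring.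
Qed.
Lemma relation_scale n m c kp u v A : (1 <= m)%nat -> (2 * m + 4 < n)%nat -> Nat.gcd m n = 1%nat -> c <> RtoC 0 ->
  nc u -> nc v -> A <> RtoC 0 -> A <> RtoC 1 -> (1 <= kp)%nat -> (INR n - 2 * INR m - 4) * INR kp > 4 ->
  (forall z p, ord u z (- p) -> (1 <= p)%Z -> (Z.of_nat kp <= p)%Z) ->
  (forall z, pnear z (fun w => Ppoly n m c (v w) = A * Ppoly n m c (u w))%C) -> False.
Proof.
  intros H1 H2 Hg Hc Hu Hv HA HA1 Hkp Hnum Hpole Hrel.
  assert (H2' : (2 * m < n)%nat) by lia.
  (* P(u) = c/A exactly where P(v) = c, that is where v is 0 or a root of [Kpoly]: at most 2m + 1
     values, counted by [R2]. *)
  set (d := (/ A * c)%C); set (F := Ppoly n m (c - d)).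
  assert (HF : plike n F) by now apply Ppoly_plike.
  assert (HQ : plike n (Ppoly n m 0)) by now apply Ppoly_plike.
  assert (HP : plike n (Ppoly n m c)) by now apply Ppoly_plike.
  assert (HK := Kpoly_plike n m H1).
  set (R2 := fun w => (w * Kpoly n m w)%C).
  assert (HR2 : plike (1 + 2 * m) R2) by (apply (plike_mult 1 (2 * m) (fun w => w)); auto; apply plike_id).
  assert (HnF := comp_nz u n F Hu HF).
  assert (HD : forall w, D F w (Pder n m w)) by (intros; now apply D_Ppoly).
  assert (Ncd : (c - d)%C <> RtoC 0).
  { unfold d; intros X; apply HA1; apply Csub_eq.
    assert (Y : ((A - 1) * c)%C = RtoC 0) by (replace ((A - 1) * c)%C with (A * (c - / A * c))%C by (field; auto); rewrite X; ring).
    apply Cmult_integral in Y; destruct Y; [auto|contradiction]. }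
  destruct (ramif_nonzero n m _ H1 H2' Hg Ncd) as [e [E [He [HE Hram]]]].
  assert (Re := le_INR _ _ He); simpl in Re.
  assert (Rk := le_INR _ _ Hkp); simpl in Rk.
  assert (P3 : 0 < / INR kp) by (apply Rinv_0_lt_compat; lra).
  assert (Hb : / INR kp + (1 + 2 * INR m) < INR n - INR e - 1).
  { assert (X : 4 * / INR kp < INR n - 2 * INR m - 4).
    { apply (Rmult_lt_reg_r (INR kp)); [lra|]; replace (4 * / INR kp * INR kp) with 4 by (field; lra); lra. }
    lra. }
  apply (smt_close u n e F E _ [v; (fun w => Ppoly n m c (v w)); (fun w => Ppoly n m c (u w)); (fun w => R2 (v w))] _
    Hu HF HE Hram HD ltac:(lia)) with (2 := Hb).
  { intros f [<-|[<-|[<-|[<-|[]]]]]; [now apply nc_nz|now apply (comp_nz v n)|now apply (comp_nz u n)|now apply (comp_nz v (1 + 2 * m))]. }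
  intros Bd HL Mu MF Ml.
  assert (Mv : Mer Bd v) by (apply Ml; simpl; auto).
  assert (MV : Mer Bd (fun w => Ppoly n m c (v w))) by (apply Ml; simpl; auto).
  assert (MU : Mer Bd (fun w => Ppoly n m c (u w))) by (apply Ml; simpl; auto).
  assert (MR : Mer Bd (fun w => R2 (v w))) by (apply Ml; simpl; auto 6).
  destruct (Tf_comp Bd u n _ HL Hu Mu HP MU) as [K1 [HK1 B1]].
  destruct (Tf_comp Bd v n _ HL Hv Mv HP MV) as [K2 [HK2 B2]].
  destruct (zer_comp_bound Bd v _ _ HL Hv Mv HR2 MR) as [K3 [HK3 B3]].
  destruct (Tf_const Bd A HA) as [MA [K4 B4]].
  assert (Rn : 1 <= INR n) by (apply (le_INR 1); lia).
  exists (INR (1 + 2 * m) * (/ INR n * (K1 + K2 + K4)) + K3); intros r Gr.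
  destruct (B1 r Gr) as [B1' _]; destruct (B2 r Gr) as [_ B2']; specialize (B3 r Gr); specialize (B4 r).
  assert (T1 : Tf Bd r (fun w => Ppoly n m c (v w)) <= K4 + Tf Bd r (fun w => Ppoly n m c (u w))).
  { rewrite (Tf_eq Bd _ (fun w => A * Ppoly n m c (u w))%C r MV (Mer_mult Bd _ _ MA MU) Gr Hrel), <- B4.
    now apply (Tf_mult Bd r (fun _ => A)). }
  (* T(P(u)) and T(P(v)) are n T(u) and n T(v) up to constants, so the relation compares u with
     v. *)
  assert (T2 : Tf Bd r v <= Tf Bd r u + / INR n * (K1 + K2 + K4)).
  { apply (Rmult_le_reg_l (INR n)); [lra|]; rewrite Rmult_plus_distr_l, <- Rmult_assoc, Rinv_r by lra; lra. }
  assert (X : INR kp * Nf Bd r (indp u) <= Tf Bd r u).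
  { eapply Rle_trans; [|now apply (Nf_pol_le Bd u r)].
    rewrite <- Nf_scal; apply Nf_le; auto; [apply Gr|]; intros; apply indp_pol_mult; auto; now apply nc_nz. }
  assert (X' : Nf Bd r (indp u) <= / INR kp * Tf Bd r u).
  { apply (Rmult_le_reg_l (INR kp)); [lra|]; rewrite <- Rmult_assoc, Rinv_r by lra; lra. }
  assert (Y : Nf Bd r (ind (fun w => F (u w))) <= Nf Bd r (zer (fun w => R2 (v w)))).
  { apply Nf_le; auto; [apply Gr|]; intros a; apply ind_le; [|apply zer_nonneg|auto]; intros s Os Hs.
    assert (OQ : ord (fun w => Ppoly n m 0 (v w)) a s).
    { generalize (ord_scal A _ _ _ HA Os); apply ord_ext; generalize (Hrel a); apply pnear_imp; intros w _ Ew.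
      unfold F; rewrite <- Ppoly_shift; replace (RtoC 0) with (c - c)%C by ring; rewrite <- Ppoly_shift, Ew; unfold d; field; auto. }
    destruct (nc_cases v a Hv) as [[q [Q1 Q2]]|[b [q [A1 [A2 A3]]]]].
    { assert (Z := ord_unique _ _ _ _ OQ (comp_pole_ord v a q n _ Q2 Q1 HQ)); nia. }
    destruct (plike_ord _ _ b HQ) as [t [Ot [Ht0 Ht1]]].
    destruct (plike_ord _ _ b HR2) as [t2 [Ot2 [Ht20 _]]].
    assert (Z := ord_unique _ _ _ _ OQ (comp_fin_ord _ _ _ _ _ _ A1 A3 Ot)).
    assert (Qb : Ppoly n m 0 b = RtoC 0) by (apply NNPP; intro N; specialize (Ht1 N); nia).
    assert (Rb : R2 b = RtoC 0).
    { unfold R2; rewrite Ppoly_K in Qb by lia; apply Cmult_integral in Qb; destruct Qb as [Qb|Qb]; [|rewrite Qb; ring].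
      destruct (classic (b = RtoC 0)) as [->|N]; [ring|]; now apply Cpow_nz with (n := (n - 2 * m)%nat) in N. }
    specialize (Ht20 Rb).
    rewrite (zer_eq _ _ _ (comp_fin_ord _ _ _ _ _ _ A1 A3 Ot2)) by nia; apply IZR_le; nia. }
  assert (INR (1 + 2 * m) * Tf Bd r v <= INR (1 + 2 * m) * (Tf Bd r u + / INR n * (K1 + K2 + K4)))
    by (apply Rmult_le_compat_l; [apply pos_INR|lra]).
  assert (EI : INR (1 + 2 * m) = 1 + 2 * INR m) by (rewrite plus_INR, mult_INR; simpl; ring).
  rewrite EI in *; lra.
Qed.
(* Up to a constant, the discriminant in [v^m] of [Q(h v) = Q(v)]; it equals
   [m^2 (z^N - 1)^2 - N^2 z^(n-2m) (z^m - 1)^2]. *)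
Definition psi (n m : nat) (z : C) : C :=
  let N := (n - m)%nat in
  (INR m * INR m * z ^ (2 * N) - INR N * INR N * z ^ n + 2 * INR n * INR (n - 2 * m) * z ^ N
   - INR N * INR N * z ^ (n - 2 * m) + INR m * INR m)%C.
(** Derivatives with powers of z stripped off: [psi1] comes from psi', and [psi2], up to a constant
    factor, from the derivative of [psi1]. *)
Definition psi2 (n m : nat) (z : C) : C := (INR m * z ^ (n - m) - INR (n - m) * z ^ m + INR (n - 2 * m))%C.
Definition psi1 (n m : nat) (z : C) : C :=
  let N := (n - m)%nat in
  (2 * INR N * INR m * INR m * z ^ n - INR N * INR N * INR n * z ^ (2 * m)
   + 2 * INR n * INR (n - 2 * m) * INR N * z ^ m - INR N * INR N * INR (n - 2 * m))%C.
Definition dpsi (n m : nat) (z : C) : C := (z ^ (n - 2 * m - 1) * psi1 n m z)%C.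
Lemma RtoC_INR_minus n m : (m <= n)%nat -> RtoC (INR (n - m)) = (INR n - INR m)%C.
Proof. intros; rewrite minus_INR, RtoC_minus by auto; reflexivity. Qed.
Lemma psi_plike n m : (1 <= m)%nat -> (2 * m < n)%nat -> plike (2 * (n - m)) (psi n m).
Proof.
  intros H1 H2; set (N := (n - m)%nat).
  apply (plike_ext _ (fun z => (INR m * INR m) * z ^ (2 * N) + ((- (INR N * INR N)) * z ^ n + ((2 * INR n * INR (n - 2 * m)) * z ^ N
   + ((- (INR N * INR N)) * z ^ (n - 2 * m) + (INR m * INR m) * z ^ 0))))%C).
  - intros z; unfold psi; fold N; simpl (z ^ 0)%C; ring.
  - apply plike_lead; [apply Cmult_neq_0; now apply INR_neq0|].
    apply low_plus; [apply low_mono; lia|].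
    apply (low_plus _ (fun z => (2 * INR n * INR (n - 2 * m)) * z ^ N)%C); [apply low_mono; lia|].
    apply (low_plus _ (fun z => (- (INR N * INR N)) * z ^ (n - 2 * m))%C); apply low_mono; lia.
Qed.
Lemma D_psi n m z : (1 <= m)%nat -> (2 * m < n)%nat -> D (psi n m) z (dpsi n m z).
Proof.
  intros H1 H2; set (N := (n - m)%nat).
  apply (D_ext (fun z => (((INR m * INR m) * z ^ (2 * N) + (- (INR N * INR N)) * z ^ n) + ((2 * INR n * INR (n - 2 * m)) * z ^ N
   + (- (INR N * INR N)) * z ^ (n - 2 * m))) + (INR m * INR m))%C).
  - apply near_all; intros w; unfold psi; fold N; ring.
  - eapply D_eq; [apply D_plus; [apply D_plus; apply D_plus; apply D_mono|apply D_const]|].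
    unfold dpsi, psi1; fold N; set (j := (n - 2 * m - 1)%nat).
    replace (pred (2 * N)) with (j + n)%nat by lia; replace (pred n) with (j + 2 * m)%nat by lia.
    replace (pred N) with (j + m)%nat by lia; replace (pred (n - 2 * m)) with j by lia.
    rewrite !Cpow_add_r; replace (INR (2 * N)) with (2 * INR N) by (rewrite mult_INR; simpl; ring).
    rewrite RtoC_mult; ring.
Qed.
Lemma D_psi1 n m z : (1 <= m)%nat -> (2 * m < n)%nat ->
  D (psi1 n m) z (2 * INR m * INR n * INR (n - m) * (z ^ (m - 1) * psi2 n m z)).
Proof.
  intros H1 H2; set (N := (n - m)%nat).
  apply (D_ext (fun z => (((2 * INR N * INR m * INR m) * z ^ n + (- (INR N * INR N * INR n)) * z ^ (2 * m))
   + (2 * INR n * INR (n - 2 * m) * INR N) * z ^ m) + (- (INR N * INR N * INR (n - 2 * m))))%C).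
  - apply near_all; intros w; unfold psi1; fold N; ring.
  - eapply D_eq; [apply D_plus; [apply D_plus; [apply D_plus; apply D_mono|apply D_mono]|apply D_const]|].
    unfold psi2; fold N; set (j := (m - 1)%nat).
    replace (pred n) with (j + N)%nat by lia; replace (pred (2 * m)) with (j + m)%nat by lia.
    replace (pred m) with j by lia.
    rewrite !Cpow_add_r; replace (INR (2 * m)) with (2 * INR m) by (rewrite mult_INR; simpl; ring).
    rewrite RtoC_mult; ring.
Qed.
Lemma D_psi2 n m z : (1 <= m)%nat -> (2 * m < n)%nat ->
  D (psi2 n m) z (INR m * INR (n - m) * (z ^ (m - 1) * (z ^ (n - 2 * m) - 1))).
Proof.
  intros H1 H2; set (N := (n - m)%nat).
  apply (D_ext (fun z => (INR m * z ^ N + (- INR N) * z ^ m) + INR (n - 2 * m))%C).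
  - apply near_all; intros w; unfold psi2; fold N; ring.
  - eapply D_eq; [apply D_plus; [apply D_plus; apply D_mono|apply D_const]|].
    replace (pred N) with ((m - 1) + (n - 2 * m))%nat by lia; replace (pred m) with (m - 1)%nat by lia.
    rewrite !Cpow_add_r; ring.
Qed.
(** The derivative of [psi2] has a simple zero at 1, and [psi2] and [psi1] vanish there, so the
    orders climb from 1 to 2 to 3. *)
Lemma dpsi_ord1 n m : (1 <= m)%nat -> (2 * m < n)%nat -> ord (dpsi n m) 1 3.
Proof.
  intros H1 H2.
  assert (N2 : RtoC 2 <> RtoC 0) by (intro E; apply RtoC_inj in E; lra).
  assert (O2 : ord (psi2 n m) 1 2).
  { apply (ord_of_deriv _ _ 1 1 (fun z => D_psi2 n m z H1 H2)).
    - unfold psi2; rewrite !Cpow_1_l, !RtoC_INR_minus, mult_INR, RtoC_mult by lia; simpl; rewrite RtoC_plus; ring.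
    - apply ord_scal; [apply Cmult_neq_0; apply INR_neq0; lia|].
      apply (ord_mult (fun z => z ^ (m - 1))%C _ 1 0 1); [apply ord_pow_id, C1_neq0|].
      apply ord_root_one; [lia|apply Cpow_1_l]. }
  apply (ord_mult (fun z => z ^ (n - 2 * m - 1))%C _ 1 0 3); [apply ord_pow_id, C1_neq0|].
  apply (ord_of_deriv _ _ 1 2 (fun z => D_psi1 n m z H1 H2)).
  - unfold psi1; rewrite !Cpow_1_l, !RtoC_INR_minus, mult_INR, RtoC_mult by lia; simpl.
    replace (RtoC 2) with (RtoC (1 + 1)) by (f_equal; ring); rewrite RtoC_plus; ring.
  - apply ord_scal; [repeat apply Cmult_neq_0; auto; apply INR_neq0; lia|].
    apply (ord_mult (fun z => z ^ (m - 1))%C _ 1 0 2); [apply ord_pow_id, C1_neq0|auto].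
Qed.
(* With [p = w^N], [q = w^m] and [psi(w) = psi'(w) = 0] the two hypotheses are [m^2 (p-1)^2 q = N^2 p (q-1)^2] and
   [m (p^2-1) q = N p (q^2-1)]; squaring the latter and dividing gives [p = q] or [p q = 1]. *)
Lemma psi_system (m N : R) (p q : C) : 0 < m < N -> p <> RtoC 0 -> q <> RtoC 0 ->
  (m * m * ((p - 1) * (p - 1)) * q = N * N * (p * ((q - 1) * (q - 1))))%C ->
  (m * (p * p - 1) * q = N * (p * (q * q - 1)))%C -> p = RtoC 1 /\ q = RtoC 1.
Proof.
  intros Hm Hp Hq E1 E2.
  assert (Nm : RtoC m <> RtoC 0) by (intro E; apply RtoC_inj in E; lra).
  assert (NN : RtoC N <> RtoC 0) by (intro E; apply RtoC_inj in E; lra).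
  assert (N2 : RtoC 2 <> RtoC 0) by (intro E; apply RtoC_inj in E; lra).
  assert (ND : forall x y : R, x <> y -> (RtoC x - RtoC y)%C <> RtoC 0)
    by (intros x y Hxy E; apply Hxy, RtoC_inj, Csub_eq; auto).
  destruct (classic (q = RtoC 1)) as [->|Nq].
  { split; auto; apply Csub_eq.
    assert (X : (m * m * ((p - 1) * (p - 1)))%C = RtoC 0) by (replace (m * m * ((p - 1) * (p - 1)))%C with (m * m * ((p - 1) * (p - 1)) * 1)%C by ring; rewrite E1; ring).
    apply Cmult_integral in X; destruct X as [X|X]; [apply Cmult_integral in X; tauto|].
    apply Cmult_integral in X; tauto. }
  exfalso.
  assert (Np : p <> RtoC 1).
  { intros ->; assert (X : (N * N * ((q - 1) * (q - 1)))%C = RtoC 0) by (replace (N * N * ((q - 1) * (q - 1)))%C with (N * N * (1 * ((q - 1) * (q - 1))))%C by ring; rewrite <- E1; ring).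
    apply Cmult_integral in X; destruct X as [X|X]; [apply Cmult_integral in X; tauto|].
    apply Cmult_integral in X; destruct X as [X|X]; apply Nq, Csub_eq, X. }
  assert (X1 : (m * m * ((p - 1) * (p - 1)) * (p * ((q - 1) * (q - 1))) * ((p - q) * (p * q - 1)) = 0)%C).
  { assert (S2 : ((m * (p * p - 1) * q) * (m * (p * p - 1) * q) = (N * (p * (q * q - 1))) * (N * (p * (q * q - 1))))%C) by now rewrite E2.
    replace (m * m * ((p - 1) * (p - 1)) * (p * ((q - 1) * (q - 1))) * ((p - q) * (p * q - 1)))%C with
     (((q - 1) * (q - 1) * p / q) * ((m * (p * p - 1) * q) * (m * (p * p - 1) * q))
      - (m * m * ((p - 1) * (p - 1)) * q) * ((q * q - 1) * (q * q - 1) * p * p / q))%C by (field; auto).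
    rewrite S2, E1; field; auto. }
  assert (Y1 := Csub_neq _ _ Np); assert (Y2 := Csub_neq _ _ Nq).
  assert (X2 : ((p - q) * (p * q - 1) = 0)%C).
  { apply Cmult_integral in X1; destruct X1 as [X1|X1]; auto; exfalso; revert X1.
    apply Cmult_neq_0; [apply Cmult_neq_0; apply Cmult_neq_0; auto; apply Cmult_neq_0; auto|].
    apply Cmult_neq_0; auto; now apply Cmult_neq_0. }
  assert (Q1 : forall s : C, (s * (q * q - 1))%C = RtoC 0 -> s <> RtoC 0 -> q = (- (1))%C).
  { intros s Hs Ns; apply Cmult_integral in Hs; destruct Hs as [Hs|Hs]; [contradiction|].
    assert (Z : ((q - 1) * (q + 1))%C = RtoC 0) by (rewrite <- Hs; ring).
    apply Cmult_integral in Z; destruct Z as [Z|Z]; [contradiction|].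
    apply Csub_eq; rewrite <- Z; ring. }
  apply Cmult_integral in X2; destruct X2 as [X2|X2].
  - apply Csub_eq in X2; subst p.
    assert (q = (- (1))%C).
    { apply (Q1 ((m - N) * q)%C); [|apply Cmult_neq_0; auto; apply ND; lra].
      replace ((m - N) * q * (q * q - 1))%C with (m * (q * q - 1) * q - N * (q * (q * q - 1)))%C by ring; rewrite E2; ring. }
    subst q; assert (Z : ((m * m - N * N) * 4)%C = RtoC 0).
    { replace ((m * m - N * N) * 4)%C with (N * N * (- (1) * ((- (1) - 1) * (- (1) - 1))) - m * m * ((- (1) - 1) * (- (1) - 1)) * - (1))%C by ring.
      rewrite E1; ring. }
    rewrite <- !RtoC_mult, <- RtoC_minus, <- RtoC_mult in Z; apply RtoC_inj in Z; nra.
  - assert (Ep : p = (/ q)%C) by (replace p with ((p * q - 1 + 1) / q)%C by (field; auto); rewrite X2; field; auto).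
    assert (q = (- (1))%C).
    { apply (Q1 ((m + N) / q)%C).
      - rewrite Ep in E2; replace ((m + N) / q * (q * q - 1))%C with (N * (/ q * (q * q - 1)) - m * (/ q * / q - 1) * q)%C by (field; auto).
        rewrite E2; ring.
      - apply Cmult_neq_0; [|now apply Cinv_nz]; rewrite <- RtoC_plus; intro E; apply RtoC_inj in E; lra. }
    assert (Ep' : p = (- (1))%C).
    { rewrite Ep, H; field; intro E; rewrite <- RtoC_opp in E; apply RtoC_inj in E; lra. }
    rewrite Ep', H in E1; assert (Z : ((m * m - N * N) * 4)%C = RtoC 0).
    { replace ((m * m - N * N) * 4)%C with (N * N * (- (1) * ((- (1) - 1) * (- (1) - 1))) - m * m * ((- (1) - 1) * (- (1) - 1)) * - (1))%C by ring.
      rewrite E1; ring. }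
    rewrite <- !RtoC_mult, <- RtoC_minus, <- RtoC_mult in Z; apply RtoC_inj in Z; nra.
Qed.
(** A multiple zero w satisfies w^N = w^m = 1 by [psi_system], hence w = 1. So the quadruple zero at
    1 is the only multiple one and costs degree 3. *)
Lemma psi_ramif n m : (1 <= m)%nat -> (2 * m < n)%nat -> Nat.gcd m n = 1%nat ->
  ramif (dpsi n m) (fun w => (w - 1) ^ 3)%C (psi n m).
Proof.
  intros H1 H2 Hg w Hw; destruct (classic (w = RtoC 1)) as [->|N1].
  { exists 3%Z, 3%Z; repeat split; [now apply dpsi_ord1|apply (ord_pow_sub 1 3)|lia]. }
  destruct (ord_nat_of_plike 3 _ w (plike_pow_sub 1 3)) as [t Ot].
  exists 0%Z, (Z.of_nat t); repeat split; auto; [|lia].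
  assert (HP : plike (2 * (n - m)) (psi n m)) by now apply psi_plike.
  set (N := (n - m)%nat) in *.
  assert (Hw0 : w <> RtoC 0).
  { intros ->; unfold psi in Hw; fold N in Hw.
    replace (2 * N)%nat with (S (pred (2 * N))) in Hw by lia; replace (0 ^ N)%C with (0 * 0 ^ pred N)%C in Hw by (rewrite <- Cpow_S; f_equal; lia).
    replace (0 ^ n)%C with (0 * 0 ^ pred n)%C in Hw by (rewrite <- Cpow_S; f_equal; lia).
    replace (0 ^ (n - 2 * m))%C with (0 * 0 ^ pred (n - 2 * m))%C in Hw by (rewrite <- Cpow_S; f_equal; lia).
    rewrite Cpow_S in Hw; ring_simplify in Hw.
    assert (X : (INR m * INR m)%C = RtoC 0) by (rewrite <- Hw; ring).
    revert X; apply Cmult_neq_0; now apply INR_neq0. }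
  apply holo_ord0.
  { apply (holo_mult (fun z => z ^ (n - 2 * m - 1))%C); [apply holo_pow, holo_id|].
    apply holo_df, near_all; intros x; eexists; now apply D_psi1. }
  apply Cmult_neq_0; [now apply Cpow_nz|]; intros Hw1; apply N1.
  set (p := (w ^ N)%C); set (q := (w ^ m)%C).
  assert (Hp : p <> RtoC 0) by now apply Cpow_nz.
  assert (Hq : q <> RtoC 0) by now apply Cpow_nz.
  assert (En : (w ^ n)%C = (p * q)%C) by (unfold p, q; rewrite <- Cpow_add_r; f_equal; lia).
  assert (E2N : (w ^ (2 * N))%C = (p * p)%C) by (unfold p; rewrite <- Cpow_add_r; f_equal; lia).
  assert (E2m : (w ^ (2 * m))%C = (q * q)%C) by (unfold q; rewrite <- Cpow_add_r; f_equal; lia).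
  assert (Enm : (w ^ (n - 2 * m))%C = (p / q)%C).
  { replace p with (w ^ (n - 2 * m) * q)%C by (unfold p, q; rewrite <- Cpow_add_r; f_equal; lia); field; auto. }
  assert (EN : RtoC (INR n) = (INR N + INR m)%C) by (rewrite <- RtoC_plus, <- plus_INR; do 2 f_equal; lia).
  assert (EM : RtoC (INR (n - 2 * m)) = (INR N - INR m)%C) by (rewrite <- RtoC_minus, <- minus_INR by lia; do 2 f_equal; lia).
  unfold psi in Hw; unfold psi1 in Hw1; fold N in Hw, Hw1; fold p q in Hw, Hw1.
  rewrite En, E2m, EN, EM in Hw1; rewrite En, E2N, Enm, EN, EM in Hw; fold p in Hw; fold q in Hw1.
  assert (RN : 0 < INR m < INR N) by (split; [apply (lt_INR 0); lia|apply lt_INR; lia]).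
  assert (NN : RtoC (INR N) <> RtoC 0) by (intro E; apply RtoC_inj in E; lra).
  assert (Nm : RtoC (INR m) <> RtoC 0) by (intro E; apply RtoC_inj in E; lra).
  destruct (psi_system (INR m) (INR N) p q RN Hp Hq) as [P1 P2].
  - apply Csub_eq; rewrite <- (Cmult_0_l q), <- Hw; field; auto.
  - apply Csub_eq.
    assert (X : (INR N * INR m * (INR m * (p * p - 1) * q - INR N * (p * (q * q - 1))))%C = RtoC 0).
    { match type of Hw1 with ?b = _ => match type of Hw with ?a = _ =>
        transitivity (p * b - INR N * q * a)%C; [field; auto|rewrite Hw, Hw1; ring] end end. }
    apply Cmult_integral in X; destruct X as [X|X]; auto.
    exfalso; revert X; now apply Cmult_neq_0.
  - apply (gcd_root1 m n); auto; rewrite En, P1, P2; ring.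
Qed.

(** Completing the square: (2 a y + b)^2 = b^2 - 4 a c for the quadratic equation satisfied by y =
    v^m, with x2, xN, xn the powers h^(n-2m), h^(n-m), h^n. *)
Lemma quadratic_discriminant (m N x2 xN xn y : C) : N <> RtoC 0 -> (N - m)%C <> RtoC 0 -> (xn * x2 = xN * xN)%C ->
  ((xn - 1) * (y * y) - (1 + 1) * (N + m) / N * (xN - 1) * y + (N + m) / (N - m) * (x2 - 1) = 0)%C ->
  (((1 + 1) * (xn - 1) * y - (1 + 1) * (N + m) / N * (xN - 1)) * ((1 + 1) * (xn - 1) * y - (1 + 1) * (N + m) / N * (xN - 1))
  = (- ((1 + 1) * (1 + 1) * (N + m)) / (N * N * (N - m))) *
    (m * m * (xN * xN) - N * N * xn + (1 + 1) * (N + m) * (N - m) * xN - N * N * x2 + m * m))%C.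
Proof.
  intros HN HM E1 E2.
  match type of E2 with ?e = _ => match goal with |- ?a = ?b =>
    transitivity (b + (1 + 1) * (1 + 1) * (xn - 1) * e
       - (1 + 1) * (1 + 1) * (N + m) / (N - m) * (xn * x2 - xN * xN))%C; [field; auto|rewrite E2, E1; ring] end end.
Qed.
Lemma coef1 n m : (1 <= m)%nat -> (2 * m < n)%nat ->
  RtoC (2 * INR n / (INR n - INR m)) = ((1 + 1) * (INR (n - m) + INR m) / INR (n - m))%C /\
  RtoC (INR n / (INR n - 2 * INR m)) = ((INR (n - m) + INR m) / (INR (n - m) - INR m))%C.
Proof.
  intros H1 H2; destruct (INR_facts n m H1 H2) as [A [B D0]].
  rewrite <- !RtoC_plus, <- RtoC_minus, <- RtoC_mult, <- !RtoC_div, minus_INR by (rewrite ?minus_INR by lia; lra || lia).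
  split; f_equal; field; lra.
Qed.
Lemma ord_sq_even f g z s : mer_at f z -> pnear z (fun w => g w = f w * f w)%C -> ord g z s -> (1 <= s)%Z -> (2 <= s)%Z.
Proof.
  intros Hf E Hs H1; destruct (mer_dich f z Hf) as [Z|[p Hp]].
  - exfalso; apply (ord_not_lz _ _ _ Hs); generalize (pnear_and _ _ _ Z E); apply pnear_imp.
    intros w _ [E1 E2]; rewrite E2, E1; ring.
  - assert (s = (p + p)%Z); [|lia]; eapply ord_unique; [exact Hs|].
    generalize (ord_mult _ _ _ _ _ Hp Hp); apply ord_ext; revert E; apply pnear_imp; intros w _ ->; reflexivity.
Qed.
(** If u = a v, the equation is a polynomial identity in the nonconstant v, so its coefficients
    vanish: a^n = a^(n-m) = 1, whence a^m = 1 and a = 1. *)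
Lemma ratio_const n m u v a z : (1 <= m)%nat -> (2 * m + 4 < n)%nat -> Nat.gcd m n = 1%nat -> nc u -> nc v ->
  (forall z, pnear z (fun w => Ppoly n m 0 (u w) = Ppoly n m 0 (v w))) -> lz (fun w => u w / v w - a)%C z -> lz (fun w => u w - v w)%C z.
Proof.
  intros H1 H2 Hg Hu Hv Hrel Ha.
  assert (Eu : pnear z (fun w => u w = a * v w)%C).
  { destruct (nc_nz v Hv z) as [p Hp]; generalize (pnear_and _ _ _ Ha (ord_nz _ _ _ Hp)); apply pnear_imp.
    intros w _ [E N]; apply Csub_eq in E; rewrite <- E; field; auto. }
  set (al := RtoC (2 * INR n / (INR n - INR m))); set (be := RtoC (INR n / (INR n - 2 * INR m))).
  set (F := fun w => ((a ^ n - 1) * w ^ n + ((- al * (a ^ (n - m) - 1)) * w ^ (n - m) + (be * (a ^ (n - 2 * m) - 1)) * w ^ (n - 2 * m)))%C).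
  assert (ZF : lz (fun w => F (v w)) z).
  { generalize (pnear_and _ _ _ Eu (Hrel z)); apply pnear_imp; intros w _ [E R].
    rewrite E in R; unfold Ppoly in R; fold al be in R; rewrite !Cpow_mult_l in R; unfold F.
    match type of R with ?x = ?y => transitivity (x - y)%C; [ring|rewrite R; ring] end. }
  assert (NF : forall q, plike q F -> False).
  { intros q HF; destruct (comp_nz v q F Hv HF z) as [p Hp]; exact (ord_not_lz _ _ _ Hp ZF). }
  destruct (INR_facts n m H1 ltac:(lia)) as [A [B D0]].
  assert (Nal : (- al)%C <> RtoC 0).
  { unfold al; rewrite <- RtoC_opp; intros E; apply RtoC_inj in E.
    assert (0 < 2 * INR n / (INR n - INR m)) by (apply Rdiv_lt_0_compat; lra); lra. }
  assert (En : (a ^ n)%C = RtoC 1).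
  { apply NNPP; intro N; apply (NF n), plike_lead; [now apply Csub_neq|].
    apply (low_plus n (fun w => (- al * (a ^ (n - m) - 1)) * w ^ (n - m))%C); apply low_mono; lia. }
  assert (EN : (a ^ (n - m))%C = RtoC 1).
  { apply NNPP; intro N; apply (NF (n - m)%nat).
    apply (plike_ext _ (fun w => (- al * (a ^ (n - m) - 1)) * w ^ (n - m) + (be * (a ^ (n - 2 * m) - 1)) * w ^ (n - 2 * m))%C).
    - intros w; unfold F; rewrite En; ring.
    - apply plike_lead; [apply Cmult_neq_0; auto; now apply Csub_neq|apply low_mono; lia]. }
  assert (Em : (a ^ m)%C = RtoC 1).
  { replace n with ((n - m) + m)%nat in En by lia; rewrite Cpow_add_r, EN in En; rewrite <- En; ring. }
  assert (a = RtoC 1) by now apply (gcd_root1 m n).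
  revert Eu; apply pnear_imp; intros w _ ->; subst a; ring.
Qed.
Lemma relation_same n m u v z : (1 <= m)%nat -> (2 * m + 4 < n)%nat -> Nat.gcd m n = 1%nat -> nc u -> nc v ->
  (forall z, pnear z (fun w => Ppoly n m 0 (u w) = Ppoly n m 0 (v w))) -> lz (fun w => u w - v w)%C z.
Proof.
  intros H1 H2 Hg Hu Hv Hrel.
  assert (H2' : (2 * m < n)%nat) by lia.
  set (h := fun w => (u w / v w)%C).
  assert (Hh : nz h).
  { intros x; destruct (nc_nz u Hu x) as [p Hp]; destruct (nc_nz v Hv x) as [q Hq]; eexists; eapply ord_div; eauto. }
  destruct (classic (exists a, forall x, lz (fun w => h w - a)%C x)) as [[a Ha]|Nc]; [apply (ratio_const n m u v a), Ha; auto|].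
  exfalso; assert (Hnc : nc h) by (apply nc_intro; [now apply nz_mero|]; intros a Ha; apply Nc; eauto).
  assert (HE : plike 3 (fun w => (w - 1) ^ 3)%C) by apply plike_pow_sub.
  assert (RN : INR 6 <= INR (n - m)) by (apply le_INR; lia); simpl in RN.
  assert (Hpsi := psi_plike n m H1 H2').
  (* The zeros of psi(h) have order at least 2, so they contribute n - m, and the poles 1; q - e - 1
     = 2 (n - m) - 4 is larger because n - m >= 6. *)
  apply (smt_close h (2 * (n - m)) 3 (psi n m) _ _ [] (1 + INR (n - m)) Hnc Hpsi HE
    (psi_ramif n m H1 H2' Hg) (fun w => D_psi n m w H1 H2')); [lia|intros f []|rewrite mult_INR; simpl; lra|].
  intros Bd HL Mh MF _.
  destruct (zer_comp_bound Bd h _ _ HL Hnc Mh Hpsi MF) as [K [HK B]].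
  exists (/ 2 * K); intros r Gr; specialize (B r Gr).
  assert (X := Nf_indp_le Bd h r HL Mh Gr).
  assert (Y : Nf Bd r (ind (fun w => psi n m (h w))) <= / 2 * Nf Bd r (zer (fun w => psi n m (h w)))).
  { rewrite <- Nf_scal; apply Nf_le; auto; [apply Gr|]; intros a.
    assert (P := zer_nonneg (fun w => psi n m (h w)) a).
    apply ind_le; [|lra|apply MF]; intros s Os Hs.
    rewrite (zer_eq _ _ _ Os) by lia.
    set (al := ((1 + 1) * (INR (n - m) + INR m) / INR (n - m))%C).
    set (L := fun w => ((1 + 1) * (h w ^ n - 1) * v w ^ m - al * (h w ^ (n - m) - 1))%C).
    set (ka := (- ((1 + 1) * (1 + 1) * (INR (n - m) + INR m)) / (INR (n - m) * INR (n - m) * (INR (n - m) - INR m)))%C).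
    assert (NN : RtoC (INR (n - m)) <> RtoC 0) by (apply INR_neq0; lia).
    assert (NM : (INR (n - m) - INR m)%C <> RtoC 0).
    { rewrite <- RtoC_minus, <- minus_INR by lia; apply INR_neq0; lia. }
    assert (NS : (INR (n - m) + INR m)%C <> RtoC 0).
    { rewrite <- RtoC_plus, <- plus_INR; apply INR_neq0; lia. }
    assert (N2 : (1 + 1)%C <> RtoC 0) by (rewrite <- RtoC_plus; intro E; apply RtoC_inj in E; lra).
    assert (Nka : ka <> RtoC 0).
    { unfold ka; intros E; apply (Cmult_neq_0 _ _ (Cmult_neq_0 _ _ N2 N2) NS).
      match type of E with ?k = _ => transitivity (- k * (INR (n - m) * INR (n - m) * (INR (n - m) - INR m)))%C; [field; auto|rewrite E; ring] end. }
    assert (OK := ord_scal ka _ _ _ Nka Os).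
    assert (2 <= s)%Z; [|apply IZR_le in H; lra].
    apply (ord_sq_even L _ a s) with (3 := OK); auto.
    - apply (mer_minus (fun w => (1 + 1) * (h w ^ n - 1) * v w ^ m)%C (fun w => al * (h w ^ (n - m) - 1))%C).
      + apply (mer_mult (fun w => (1 + 1) * (h w ^ n - 1))%C (fun w => v w ^ m)%C); [|apply mer_pow, Hv].
        apply (mer_scal (1 + 1)), mer_minus; [apply mer_pow, Hnc|apply mer_const].
      + apply mer_scal, mer_minus; [apply mer_pow, Hnc|apply mer_const].
    - destruct (nc_nz v Hv a) as [p Hp].
      generalize (pnear_and _ _ _ (Hrel a) (ord_nz _ _ _ Hp)); apply pnear_imp; intros w _ [R N]; symmetry.
      destruct (coef1 n m H1 H2') as [C1 C2].
      assert (Eu : u w = (h w * v w)%C) by (unfold h; field; auto).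
      assert (ps : psi n m (h w) = (INR m * INR m * (h w ^ (n - m) * h w ^ (n - m)) - INR (n - m) * INR (n - m) * h w ^ n +
        (1 + 1) * (INR (n - m) + INR m) * (INR (n - m) - INR m) * h w ^ (n - m) - INR (n - m) * INR (n - m) * h w ^ (n - 2 * m) + INR m * INR m)%C).
      { unfold psi; replace (h w ^ (2 * (n - m)))%C with (h w ^ (n - m) * h w ^ (n - m))%C by (rewrite <- Cpow_add_r; f_equal; lia).
        replace (RtoC (INR n)) with (INR (n - m) + INR m)%C by (rewrite <- RtoC_plus, <- plus_INR; do 2 f_equal; lia).
        replace (RtoC (INR (n - 2 * m))) with (INR (n - m) - INR m)%C by (rewrite <- RtoC_minus, <- minus_INR by lia; do 2 f_equal; lia).
        replace (RtoC 2) with (RtoC (1 + 1)) by (f_equal; ring); rewrite RtoC_plus; ring. }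
      rewrite ps; apply (quadratic_discriminant (INR m) (INR (n - m)) (h w ^ (n - 2 * m)) (h w ^ (n - m)) (h w ^ n) (v w ^ m)); auto.
      { rewrite <- !Cpow_add_r; f_equal; lia. }
      rewrite Eu in R; unfold Ppoly in R; rewrite !Cpow_mult_l, C1, C2 in R.
      assert (NP : (v w ^ (n - 2 * m))%C <> RtoC 0) by now apply Cpow_nz.
      replace (v w ^ n)%C with (v w ^ (n - 2 * m) * (v w ^ m * v w ^ m))%C in R by (rewrite <- !Cpow_add_r; f_equal; lia).
      replace (v w ^ (n - m))%C with (v w ^ (n - 2 * m) * v w ^ m)%C in R by (rewrite <- !Cpow_add_r; f_equal; lia).
      match type of R with ?x = ?y => match goal with |- ?g = _ =>
        transitivity ((x - y) / v w ^ (n - 2 * m))%C; [field; auto|rewrite R; field; auto] end end. }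
  rewrite mult_INR in B; simpl (INR 2) in B; lra.
Qed.
Lemma relation_equal n m c kp u v A B : (1 <= m)%nat -> (2 * m + 4 < n)%nat -> (4 * m < n)%nat -> Nat.gcd m n = 1%nat ->
  c <> RtoC 0 -> nc u -> nc v -> A <> RtoC 0 -> (1 <= kp)%nat -> (INR n - 2 * INR m - 4) * INR kp > 4 ->
  (forall z p, ord u z (- p) -> (1 <= p)%Z -> (Z.of_nat kp <= p)%Z) ->
  (forall z, pnear z (fun w => Ppoly n m c (v w) = Ppoly n m c (u w) * (A + B * Ppoly n m c (v w)))%C) ->
  forall z, lz (fun w => u w - v w)%C z.
Proof.
  intros H1 H2 H4 Hg Hc Hu Hv HA Hkp Hnum Hpole Hrel.
  destruct (classic (B = RtoC 0)) as [->|HB]; [|exfalso; now apply (relation_shift n m c u v A B)].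
  destruct (classic (A = RtoC 1)) as [->|HA1].
  - intros z0; apply (relation_same n m); auto; intros z; generalize (Hrel z); apply pnear_imp; intros w _ E.
    replace (RtoC 0) with (c - c)%C by ring; rewrite <- !Ppoly_shift, E; ring.
  - exfalso; apply (relation_scale n m c kp u v A); auto.
    intros z; generalize (Hrel z); apply pnear_imp; intros w _ ->; ring.
Qed.

(** * Local behaviour of the auxiliary functions *)

(** The roots of P together with 0 and the m-th roots of unity, where P' can vanish. All its roots
    are simple, so the second main theorem applies with E = 1. *)
Definition Rpoly (n m : nat) (c w : C) : C := (Ppoly n m c w * (w * (w ^ m - 1)))%C.
(** The function u' E(u) / F(u) of [smt] for F = R and E = 1; the factor 1 keeps that shape. *)
Definition Xf (n m : nat) (c : C) (u : C -> C) (w : C) : C := (Cderive u w * 1 / Rpoly n m c (u w))%C.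
Definition DU (n m : nat) (c : C) (u : C -> C) : C -> C := Cderive (fun w => / Ppoly n m c (u w))%C.
Definition Om (m : nat) (u : C -> C) (w : C) : C := (u w ^ m - 1)%C.
Lemma root1_plike m : (1 <= m)%nat -> plike m (fun w => w ^ m - 1)%C.
Proof.
  intros Hm; apply (plike_ext _ (fun w => RtoC 1 * w ^ m + (- (1)) * w ^ 0)%C); [intros w; simpl; ring|].
  apply plike_lead; [apply C1_neq0|apply low_mono; lia].
Qed.
Lemma Rpoly_plike n m c : (1 <= m)%nat -> (2 * m < n)%nat -> plike (n + (1 + m)) (Rpoly n m c).
Proof.
  intros H1 H2; apply (plike_mult n (1 + m) _ (fun w => w * (w ^ m - 1))%C); [now apply Ppoly_plike|].
  apply (plike_mult 1 m (fun w => w)); [apply plike_id|now apply root1_plike].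
Qed.
Lemma Ppoly_ord1 n m c a : (1 <= m)%nat -> (2 * m < n)%nat -> c <> RtoC 0 -> Cmod c <> bcst n m ->
  Ppoly n m c a = RtoC 0 -> ord (Ppoly n m c) a (Z.of_nat 1).
Proof.
  intros H1 H2 Hc Hb Ha; destruct (Ppoly_simple n m c a H1 H2 Hc Hb Ha).
  apply (ord_of_deriv _ (Pder n m) a 0); auto; [intros; now apply D_Ppoly|apply Pder_ord0; auto; lia].
Qed.
Lemma Rpoly_ord n m c a p q r : ord (Ppoly n m c) a p -> ord (fun w => w) a q -> ord (fun w => w ^ m - 1)%C a r ->
  ord (Rpoly n m c) a (p + (q + r)).
Proof.
  intros H1 H2 H3; apply (ord_mult (Ppoly n m c) (fun w => w * (w ^ m - 1))%C); auto.
  now apply (ord_mult (fun w => w)).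
Qed.
Lemma root1_ord0 m a : (a ^ m)%C <> RtoC 1 -> ord (fun w => w ^ m - 1)%C a 0.
Proof.
  intros H; apply holo_ord0; [apply holo_minus; [apply holo_pow, holo_id|apply holo_const]|now apply Csub_neq].
Qed.
Lemma pow0_neq1 m : (1 <= m)%nat -> (0 ^ m)%C <> RtoC 1.
Proof.
  intros Hm; replace m with (S (pred m)) by lia; rewrite Cpow_S; intros X; apply C1_neq0; rewrite <- X; ring.
Qed.
Lemma ord_id_sub a : ord (fun w => w - a)%C a 1.
Proof. generalize (ord_pow_sub a 1); apply ord_ext, pnear_all; intros; simpl; ring. Qed.
Lemma Rpoly_cases n m c a : (1 <= m)%nat -> (2 * m < n)%nat -> c <> RtoC 0 -> Cmod c <> bcst n m ->
  (Ppoly n m c a = RtoC 0 /\ a <> RtoC 0 /\ (a ^ m)%C <> RtoC 1 /\ ord (Rpoly n m c) a (Z.of_nat 1)) \/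
  (Ppoly n m c a <> RtoC 0 /\ (a = RtoC 0 \/ (a <> RtoC 0 /\ (a ^ m)%C = RtoC 1)) /\ ord (Rpoly n m c) a (Z.of_nat 1)) \/
  (Ppoly n m c a <> RtoC 0 /\ a <> RtoC 0 /\ (a ^ m)%C <> RtoC 1 /\ ord (Rpoly n m c) a (Z.of_nat 0)).
Proof.
  intros H1 H2 Hc Hb.
  assert (HP : holo_at (Ppoly n m c) a) by apply (Ppoly_plike n m c H1 H2).
  destruct (classic (Ppoly n m c a = RtoC 0)) as [Z|N].
  - left; destruct (Ppoly_simple n m c a H1 H2 Hc Hb Z) as [A1 A2]; repeat split; auto.
    apply (Rpoly_ord n m c a 1 0 0); [now apply Ppoly_ord1|apply holo_ord0; [apply holo_id|auto]|now apply root1_ord0].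
  - right; assert (O := holo_ord0 _ _ HP N).
    destruct (classic (a = RtoC 0)) as [->|Na].
    + left; repeat split; auto; apply (Rpoly_ord n m c 0 0 1 0); auto.
      * generalize (ord_id_sub 0); apply ord_ext, pnear_all; intros; ring.
      * now apply root1_ord0, pow0_neq1.
    + assert (Oa : ord (fun w => w) a 0) by (apply holo_ord0; [apply holo_id|auto]).
      destruct (classic ((a ^ m)%C = RtoC 1)) as [E|Ne]; [left|right]; repeat split; auto.
      * apply (Rpoly_ord n m c a 0 0 1); auto; now apply ord_root_one.
      * apply (Rpoly_ord n m c a 0 0 0); auto; now apply root1_ord0.
Qed.
Definition dRpoly (n m : nat) (c w : C) : C :=
  (Pder n m w * (w * (w ^ m - 1)) + Ppoly n m c w * (1 * (w ^ m - 1) + w * (INR m * w ^ pred m)))%C.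
Lemma D_Rpoly n m c w : (1 <= m)%nat -> (2 * m < n)%nat -> D (Rpoly n m c) w (dRpoly n m c w).
Proof.
  intros H1 H2; apply (D_mult (Ppoly n m c) (fun w => w * (w ^ m - 1))%C); [now apply D_Ppoly|].
  apply (D_mult (fun w => w) (fun w => w ^ m - 1)%C w 1 (INR m * w ^ pred m)); [apply D_id|].
  eapply D_eq; [apply D_minus; [apply (D_pow (fun x => x) w 1 m), D_id|apply D_const]|ring].
Qed.
Lemma Rpoly_ramif n m c : (1 <= m)%nat -> (2 * m < n)%nat -> c <> RtoC 0 -> Cmod c <> bcst n m ->
  ramif (dRpoly n m c) (fun _ => RtoC 1) (Rpoly n m c).
Proof.
  intros H1 H2 Hc Hb w Hw; exists 0%Z, 0%Z; split; [|split; [apply ord_const, C1_neq0|lia]].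
  assert (HR := Rpoly_plike n m c H1 H2).
  assert (O : ord (Rpoly n m c) w (Z.of_nat 1)).
  { destruct (Rpoly_cases n m c w H1 H2 Hc Hb) as [[_ [_ [_ O]]]|[[_ [_ O]]|[_ [_ [_ O]]]]]; auto.
    assert (X := holo_ord_zero _ _ _ (proj1 HR w) O Hw); lia. }
  apply (ord_deriv_of_zero (Rpoly n m c) (dRpoly n m c) w 1); auto; intros; now apply D_Rpoly.
Qed.
(* Three kinds of points: zeros of [P(u)]; points where [u] is 0, infinity or an [m]-th root of unity;
   the remaining ones. Since [P' = n w^(n-2m-1) (w^m - 1)^2], only the second kind ramifies. *)
Definition profS n m c u z p := (1 <= p)%Z /\ ord (fun w => Ppoly n m c (u w)) z p /\
  INR (n + m) * pol u z - IZR (ordf (Xf n m c u) z) = 1 /\ IZR (ordf (logd u) z) = IZR p - 1.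
Definition profE n m c u z := (ordf (fun w => Ppoly n m c (u w)) z <= 0)%Z /\
  INR (n + m) * pol u z - IZR (ordf (Xf n m c u) z) = 1 /\
  - (indp u z + ind u z) <= IZR (ordf (logd u) z) /\ 1 <= indp u z + ind u z + ind (Om m u) z.
Definition profG n m c u z p := (1 <= p)%Z /\ (ordf (fun w => Ppoly n m c (u w)) z <= 0)%Z /\
  INR (n + m) * pol u z - IZR (ordf (Xf n m c u) z) = 1 - IZR p /\ IZR (ordf (logd u) z) = IZR p - 1 /\
  ord (DU n m c u) z (p - 1).
Lemma ind_0_1 f a : 0 <= ind f a <= 1.
Proof. unfold ind; destruct (Z_lt_dec 0 (ordf f a)); lra. Qed.
Lemma indp_0_1 f a : 0 <= indp f a <= 1.
Proof. unfold indp; destruct (Z_lt_dec (ordf f a) 0); lra. Qed.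
Lemma ind_one f a p : ord f a p -> (1 <= p)%Z -> ind f a = 1.
Proof. intros H Hp; unfold ind; rewrite (ordf_eq _ _ _ H); destruct (Z_lt_dec 0 p); [auto|lia]. Qed.
Lemma pol_fin f a p : ord f a p -> (0 <= p)%Z -> pol f a = 0.
Proof. intros H Hp; unfold pol; rewrite (ordf_eq _ _ _ H); apply IZR_eq; lia. Qed.
Lemma profile n m c u z : (1 <= m)%nat -> (2 * m < n)%nat -> c <> RtoC 0 -> Cmod c <> bcst n m -> nc u ->
  (exists p, profS n m c u z p) \/ profE n m c u z \/ exists p, profG n m c u z p.
Proof.
  intros H1 H2 Hc Hb Hu.
  assert (HP := Ppoly_plike n m c H1 H2); assert (HR := Rpoly_plike n m c H1 H2).
  assert (HE := plike_const1); assert (Hm : mer_at u z) by apply Hu.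
  assert (I1 := indp_0_1 u z); assert (I2 := ind_0_1 u z); assert (I3 := ind_0_1 (Om m u) z).
  destruct (nc_cases u z Hu) as [[p [P1 P2]]|[a [p [A1 [A2 A3]]]]].
  { right; left.
    (* For R one has q - e - 1 = n + m, so a pole of order p gives [Xf] the order (n + m) p - 1. *)
    assert (OX := smt_ord_pole u z p _ _ _ _ P2 P1 HR HE).
    assert (OY : ord (logd u) z (- p - 1 - - p)) by (apply ord_div; auto; apply ord_deriv; auto; lia).
    assert (Ip : indp u z = 1) by (unfold indp; rewrite (ordf_eq _ _ _ P2); destruct (Z_lt_dec (- p) 0); [auto|lia]).
    split; [rewrite (ordf_eq _ _ _ (comp_pole_ord u z p n _ P2 P1 HP)); nia|].
    split; [|split; [|lra]].
    - unfold Xf; rewrite (ordf_eq _ _ _ OX); unfold pol; rewrite (ordf_eq _ _ _ P2).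
      replace (Z.max 0 (- - p)) with p by lia.
      rewrite INR_IZR_INZ, <- mult_IZR, <- minus_IZR; apply IZR_eq; lia.
    - rewrite (ordf_eq _ _ _ OY), Ip; replace (- p - 1 - - p)%Z with (-1)%Z by lia; lra. }
  assert (Dv := ord_deriv_sub u z a p Hm A3 A2).
  assert (OE : ord (fun _ => RtoC 1) a (Z.of_nat 0)) by apply ord_const, C1_neq0.
  assert (Pz : pol u z = 0).
  { apply (pol_fin u z (ordf u z)); [apply nz_ordf; now apply nc_nz|].
    apply (fin_ord_nonneg u z a); auto; apply nz_ordf; now apply nc_nz. }
  assert (Y0 : a <> RtoC 0 -> ord (logd u) z (p - 1) /\ ordf u z = 0%Z).
  { intros Na; assert (O : ord u z (Z.of_nat 0 * p)).
    { apply (comp_fin_ord u z a p (fun w => w) 0); auto; apply holo_ord0; [apply holo_id|auto]. }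
    split; [|now rewrite (ordf_eq _ _ _ O)].
    replace (p - 1)%Z with (p - 1 - Z.of_nat 0 * p)%Z by lia; now apply ord_div. }
  destruct (Rpoly_cases n m c a H1 H2 Hc Hb) as [[Pa [Na [Nm O]]]|[[Pa [Sp O]]|[Pa [Na [Nm O]]]]].
  - left; exists p; destruct (Y0 Na) as [OY _].
    assert (OU := comp_fin_ord _ _ _ _ _ _ A1 A3 (Ppoly_ord1 n m c a H1 H2 Hc Hb Pa)).
    assert (OX := smt_ord_fin u z a p 1 0 _ _ Hm A1 A3 A2 O OE).
    split; auto; split; [replace p with (Z.of_nat 1 * p)%Z by lia; exact OU|]; split.
    + unfold Xf; rewrite (ordf_eq _ _ _ OX), Pz.
      replace (p - 1 + (Z.of_nat 0 - Z.of_nat 1) * p)%Z with (-1)%Z by lia; ring.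
    + rewrite (ordf_eq _ _ _ OY), minus_IZR; ring.
  - right; left.
    assert (OU := comp_fin_ord _ _ _ _ _ 0 A1 A3 (holo_ord0 _ a (proj1 HP a) Pa)).
    assert (OX := smt_ord_fin u z a p 1 0 _ _ Hm A1 A3 A2 O OE).
    split; [rewrite (ordf_eq _ _ _ OU); lia|]; split; [|].
    + unfold Xf; rewrite (ordf_eq _ _ _ OX), Pz.
      replace (p - 1 + (Z.of_nat 0 - Z.of_nat 1) * p)%Z with (-1)%Z by lia; ring.
    + destruct Sp as [->|[Na Em]].
      * assert (Ou : ord u z p) by (revert A3; apply ord_ext, pnear_all; intros; ring).
        rewrite (ind_one u z p Ou A2).
        assert (OY : ord (logd u) z (p - 1 - p)) by now apply ord_div.
        rewrite (ordf_eq _ _ _ OY); replace (p - 1 - p)%Z with (-1)%Z by lia; lra.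
      * destruct (Y0 Na) as [OY _]; rewrite (ordf_eq _ _ _ OY), minus_IZR.
        assert (Oo : ord (Om m u) z (Z.of_nat 1 * p)) by (apply (comp_fin_ord u z a p (fun w => w ^ m - 1)%C 1); auto; now apply ord_root_one).
        rewrite (ind_one _ _ _ Oo) by lia; apply IZR_le in A2; lra.
  - right; right; exists p; destruct (Y0 Na) as [OY _].
    assert (OU := comp_fin_ord _ _ _ _ _ 0 A1 A3 (holo_ord0 _ a (proj1 HP a) Pa)).
    assert (OX := smt_ord_fin u z a p 0 0 _ _ Hm A1 A3 A2 O OE).
    split; auto; split; [rewrite (ordf_eq _ _ _ OU); lia|]; split; [|split].
    + unfold Xf; rewrite (ordf_eq _ _ _ OX), Pz.
      replace (p - 1 + (Z.of_nat 0 - Z.of_nat 0) * p)%Z with (p - 1)%Z by lia; rewrite minus_IZR; ring.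
    + rewrite (ordf_eq _ _ _ OY), minus_IZR; ring.
    (* P - P(a) has a simple zero at [a], so 1/P(u) takes the finite value 1/b with multiplicity
       exactly p. *)
    + set (b := Ppoly n m c a) in *.
      assert (O1 : ord (fun w => Ppoly n m c w - b)%C a (Z.of_nat 1)).
      { apply (ord_of_deriv _ (Pder n m) a 0); [|unfold b; ring|apply Pder_ord0; auto; lia].
        intros x; eapply D_eq; [apply D_minus; [now apply D_Ppoly|apply D_const]|ring]. }
      assert (O2 := comp_fin_ord _ _ _ _ _ _ A1 A3 O1).
      assert (O3 := ord_scal (- / b)%C _ _ _ ltac:(intros X; apply (Cinv_nz b Pa); replace (/ b)%C with (- - / b)%C by ring; rewrite X; ring) (ord_div _ _ _ _ _ O2 OU)).
      apply (ord_deriv_sub (fun w => / Ppoly n m c (u w))%C z (/ b)%C p).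
      * apply mer_inv; eapply ord_mer; exact OU.
      * replace p with (Z.of_nat 1 * p - Z.of_nat 0 * p)%Z by lia.
        revert O3; apply ord_ext; generalize (ord_nz _ _ _ OU); apply pnear_imp; intros w _ N; field; auto.
      * auto.
Qed.
Lemma DU_S n m c u z p : ord (fun w => Ppoly n m c (u w)) z p -> (1 <= p)%Z -> ord (DU n m c u) z (- p - 1).
Proof. intros H Hp; apply ord_deriv; [now apply ord_inv|lia]. Qed.
(** A derivative has no residue. For the double pole of (1/f)' this says that the cofactor [e] has
    vanishing derivative at z. *)
Lemma Cderive_simple_pole f z g : holo_at g z -> g z <> RtoC 0 -> pnear z (fun w => f w = (w - z) * g w)%C ->
  exists e, holo_at e z /\ e z <> RtoC 0 /\ D e z 0 /\
    pnear z (fun w => Cderive (fun x => / f x)%C w = zp (w - z) (-2) * e w)%C.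
Proof.
  intros G1 G2 G3; set (j := fun w => (/ g w)%C).
  assert (Hj : holo_at j z) by now apply holo_inv.
  assert (Hj' := holo_Cderive j z Hj).
  assert (E1 : RtoC (IZR (-1)) = (- (1))%C) by (rewrite <- RtoC_opp; f_equal; ring).
  exists (fun w => (RtoC (IZR (-1)) * j w + (w - z) * Cderive j w)%C); split; [|split; [|split]].
  - apply holo_plus; [apply holo_mult; [apply holo_const|auto]|apply holo_mult; [apply holo_sub_id|auto]].
  - replace (RtoC (IZR (-1)) * j z + (z - z) * Cderive j z)%C with (- j z)%C by (rewrite E1; ring).
    intros X; apply (Cinv_nz _ G2); fold (j z); replace (j z) with (- - j z)%C by ring; rewrite X; ring.
  - eapply D_eq; [apply D_plus; [apply D_scal, holo_D, Hj|apply D_mult; [apply D_minus; [apply D_id|apply D_const]|apply holo_D, Hj']]|].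
    rewrite E1; ring.
  - assert (E : pnear z (fun w => (/ f w)%C = (zp (w - z) (-1) * j w)%C)).
    { generalize (pnear_and _ _ _ G3 (pnear_and _ _ _ (pnear_neq z) (near_pnear _ _ (ccont_near_neq g z (holo_cont _ _ G1) G2)))).
      apply pnear_imp; intros w _ [E [N1 N2]].
      change (-1)%Z with (- (1))%Z; rewrite zp_opp, zp_1 by auto; unfold j; rewrite E; field; auto. }
    generalize (pnear_deriv _ _ _ _ Hj E); apply pnear_imp; intros w _ [_ X]; exact X.
Qed.
(** The double poles cancel and leave W = e1 / e2 with W(z) <> 0 and W'(z) = 0, because both
    cofactors are stationary at z. *)
Lemma H_ord_simple f1 f2 z : ord f1 z 1 -> ord f2 z 1 ->
  nz (Cderive (fun w => Cderive (fun x => / f1 x) w / Cderive (fun x => / f2 x) w)%C) ->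
  (1 <= ordf (logd (fun w => Cderive (fun x => / f1 x) w / Cderive (fun x => / f2 x) w)%C) z)%Z.
Proof.
  intros [g1 [A1 [A2 A3]]] [g2 [B1 [B2 B3]]] Hn; set (W := fun w => (Cderive (fun x => / f1 x) w / Cderive (fun x => / f2 x) w)%C) in *.
  assert (A3' : pnear z (fun w => f1 w = (w - z) * g1 w)%C) by (revert A3; apply pnear_imp; intros w _ ->; now rewrite zp_1).
  assert (B3' : pnear z (fun w => f2 w = (w - z) * g2 w)%C) by (revert B3; apply pnear_imp; intros w _ ->; now rewrite zp_1).
  destruct (Cderive_simple_pole f1 z g1 A1 A2 A3') as [e1 [P1 [P2 [P3 P4]]]].
  destruct (Cderive_simple_pole f2 z g2 B1 B2 B3') as [e2 [Q1 [Q2 [Q3 Q4]]]].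
  assert (Hq : holo_at (fun w => e1 w / e2 w)%C z) by now apply holo_div.
  assert (E : pnear z (fun w => (e1 w / e2 w)%C = W w)).
  { generalize (pnear_and _ _ _ (pnear_and _ _ _ P4 Q4) (pnear_and _ _ _ (pnear_neq z) (near_pnear _ _ (ccont_near_neq e2 z (holo_cont _ _ Q1) Q2)))).
    apply pnear_imp; intros w _ [[E1 E2] [N1 N2]]; unfold W; rewrite E1, E2; field; split; auto; now apply zp_nz. }
  assert (OW : ord W z 0).
  { generalize (holo_ord0 _ z Hq (Cmult_neq_0 _ _ P2 (Cinv_nz _ Q2))); now apply ord_ext. }
  assert (E' : pnear z (fun w => Cderive W w = Cderive (fun w => e1 w / e2 w)%C w)).
  { generalize (pnear_and _ _ _ (pnear_near _ _ E) (near_pnear _ _ (holo_near _ _ Hq))); apply pnear_imp.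
    intros w _ [E1 E2]; apply Cderive_ext; auto; exists (Cderive (fun w => e1 w / e2 w)%C w); now apply holo_D. }
  destruct (Hn z) as [d Hd].
  assert (D1 : ord (Cderive (fun w => e1 w / e2 w)%C) z d) by (revert Hd; now apply ord_ext).
  assert (X : (1 <= d)%Z).
  { apply (holo_ord_zero _ _ _ (holo_Cderive _ _ Hq) D1), Cderive_D.
    eapply D_eq; [apply D_div; eauto|]; field; auto. }
  rewrite (ordf_eq (logd W) z (d - 0)); [lia|now apply ord_div].
Qed.
Lemma logd_ord_ge W z : nz W -> nz (Cderive W) -> (-1 <= ordf (logd W) z)%Z /\ (ordf W z = 0%Z -> (0 <= ordf (logd W) z)%Z).
Proof.
  intros H1 H2; assert (O := nz_ordf W z H1); destruct (H2 z) as [d Od].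
  rewrite (ordf_eq (logd W) z (d - ordf W z)) by now apply ord_div.
  destruct (Z.eq_dec (ordf W z) 0) as [E|N].
  - rewrite E in *; assert (X := ord_deriv0 _ _ _ O Od); lia.
  - assert (X := ord_unique _ _ _ _ Od (ord_deriv _ _ _ O N)); lia.
Qed.

(** * The counting inequality *)

(* What sharing with weight [l] says about the multiplicities at a common zero, for [j = min (l+1) 3];
   [theta] is the multiple of the counting function of [u'/u] used for that weight. *)
Definition wshare (j p p' : Z) : Prop := p = p' \/ ((j <= p)%Z /\ (j <= p')%Z).
Definition wcase (j : Z) (theta : R) : Prop :=
  j = 3%Z /\ theta = 0 \/ j = 2%Z /\ theta = / 4 \/ j = 1%Z /\ theta = 3 / 2.
Definition Wf (n m : nat) (c : C) (u v : C -> C) (w : C) : C := (DU n m c u w / DU n m c v w)%C.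
(** After moving the orders of the two [Xf] to the left, a zero of U or V and a point of the second
    kind each demand 1, and one of the third kind 1 - p. The cases check that the remaining terms
    pay, with H = W'/W contributing at least -1. *)
Lemma local_inequality n m c u v z j theta : (1 <= m)%nat -> (2 * m < n)%nat -> c <> RtoC 0 -> Cmod c <> bcst n m ->
  nc u -> nc v -> wcase j theta ->
  (forall p, (1 <= p)%Z -> ord (fun w => Ppoly n m c (u w)) z p ->
     exists p', (1 <= p')%Z /\ ord (fun w => Ppoly n m c (v w)) z p' /\ wshare j p p') ->
  (forall p, (1 <= p)%Z -> ord (fun w => Ppoly n m c (v w)) z p -> (0 < ordf (fun w => Ppoly n m c (u w)) z)%Z) ->
  nz (DU n m c u) -> nz (DU n m c v) -> nz (Cderive (Wf n m c u v)) ->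
  INR (n + m) * pol u z + INR (n + m) * pol v z
   <= (IZR (ordf (Xf n m c u) z) + IZR (ordf (Xf n m c v) z)) + (IZR (ordf (logd (Wf n m c u v)) z)
     + theta * (IZR (ordf (logd u) z) + IZR (ordf (logd v) z)))
   + (/ 2 * (zer (fun w => Ppoly n m c (u w)) z + zer (fun w => Ppoly n m c (v w)) z)
     + ((2 + theta) * ((indp u z + ind u z) + (indp v z + ind v z)) + 2 * (ind (Om m u) z + ind (Om m v) z))).
Proof.
  intros H1 H2 Hc Hb Hu Hv Hw Hsh1 Hsh2 Du Dv DW.
  assert (NW : nz (Wf n m c u v)).
  { intros x; destruct (Du x) as [p Hp]; destruct (Dv x) as [q Hq]; eexists; eapply ord_div; eauto. }
  destruct (logd_ord_ge _ z NW DW) as [Hm1 H0].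
  assert (W0 : forall d, ord (DU n m c u) z d -> ord (DU n m c v) z d -> (0 <= ordf (logd (Wf n m c u v)) z)%Z).
  { intros d O1 O2; apply H0; apply ordf_eq; rewrite <- (Z.sub_diag d); now apply ord_div. }
  assert (Th : 0 <= theta <= 3 / 2) by (destruct Hw as [[_ ->]|[[_ ->]|[_ ->]]]; lra).
  assert (I1 := indp_0_1 u z); assert (I2 := ind_0_1 u z); assert (I3 := ind_0_1 (Om m u) z).
  assert (J1 := indp_0_1 v z); assert (J2 := ind_0_1 v z); assert (J3 := ind_0_1 (Om m v) z).
  assert (Z1 := zer_nonneg (fun w => Ppoly n m c (u w)) z); assert (Z2 := zer_nonneg (fun w => Ppoly n m c (v w)) z).
  set (h := ordf (logd (Wf n m c u v)) z) in *.
  assert (Hm1' := IZR_le _ _ Hm1).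
  assert (Q1 : 0 <= theta * (indp u z + ind u z)) by (apply Rmult_le_pos; lra).
  assert (Q2 : 0 <= theta * (indp v z + ind v z)) by (apply Rmult_le_pos; lra).
  destruct (profile n m c u z H1 H2 Hc Hb Hu) as [[p [P1 [P2 [P3 P4]]]]|Pu].
  - destruct (Hsh1 p P1 P2) as [p' [P1' [P2' Hpp]]].
    destruct (profile n m c v z H1 H2 Hc Hb Hv) as [[q [Q1' [Q2' [Q3 Q4]]]]|[[E _]|[q [_ [E _]]]]].
    2, 3: exfalso; rewrite (ordf_eq _ _ _ P2') in E; lia.
    assert (q = p') by (eapply ord_unique; eauto); subst q.
    assert (Zu := zer_eq _ _ _ P2 ltac:(lia)); assert (Zv := zer_eq _ _ _ P2' ltac:(lia)).
    assert (Q1r := IZR_le _ _ P1); assert (Q1r' := IZR_le _ _ P1').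
    destruct (Z.eq_dec p p') as [<-|Npp].
    + assert (W1 := W0 _ (DU_S n m c u z p P2 P1) (DU_S n m c v z p P2' P1)); apply IZR_le in W1.
      destruct (Z.eq_dec p 1) as [->|Np].
      (* A common simple zero demands 2: H gives 1 and the zeros of U and V give 1/2 each. *)
      * assert (X : (1 <= h)%Z) by (apply (H_ord_simple _ _ z P2 P2'), DW).
        apply IZR_le in X; nra.
      * assert (X : (2 <= p)%Z) by lia; apply IZR_le in X; nra.
    + destruct Hpp as [?|[G1 G2]]; [contradiction|].
      (* Unequal multiplicities are both at least j, hence the sum. With H >= -1 the demand is theta
         (p + p' - 2) + (p + p')/2 >= 3, which theta = 0, 1/4, 3/2 meet for j = 3, 2, 1. *)
      assert (S : (2 * j + 1 <= p + p')%Z) by lia; apply IZR_le in S; rewrite !plus_IZR, mult_IZR in S.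
      assert (theta * (IZR p - 1 + (IZR p' - 1)) + / 2 * (IZR p + IZR p') >= 3).
      { destruct Hw as [[-> ->]|[[-> ->]|[-> ->]]]; lra. }
      rewrite P4, Q4, Zu, Zv; lra.
  - assert (Nu : (ordf (fun w => Ppoly n m c (u w)) z <= 0)%Z) by (destruct Pu as [[E _]|[q [_ [E _]]]]; auto).
    destruct (profile n m c v z H1 H2 Hc Hb Hv) as [[q [Q1' [Q2' _]]]|Pv]; [specialize (Hsh2 q Q1' Q2'); lia|].
    (* A point of the second kind demands 1 and is paid 2, which also covers a pole of H. If both
       are of the third kind, H can have a pole only for p <> q, and then p + q >= 3. *)
    destruct Pu as [[_ [A1 [A2 A3]]]|[p [B1 [_ [B2 [B3 B4]]]]]]; destruct Pv as [[_ [C1 [C2 C3]]]|[q [D1 [_ [D2 [D3 D4]]]]]].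
    + assert (theta * - (indp u z + ind u z) <= theta * IZR (ordf (logd u) z)) by (apply Rmult_le_compat_l; lra).
      assert (theta * - (indp v z + ind v z) <= theta * IZR (ordf (logd v) z)) by (apply Rmult_le_compat_l; lra).
      lra.
    + apply IZR_le in D1.
      assert (theta * - (indp u z + ind u z) <= theta * IZR (ordf (logd u) z)) by (apply Rmult_le_compat_l; lra).
      assert (0 <= theta * IZR (ordf (logd v) z)) by (apply Rmult_le_pos; lra).
      lra.
    + apply IZR_le in B1.
      assert (theta * - (indp v z + ind v z) <= theta * IZR (ordf (logd v) z)) by (apply Rmult_le_compat_l; lra).
      assert (0 <= theta * IZR (ordf (logd u) z)) by (apply Rmult_le_pos; lra).
      lra.
    + assert (0 <= theta * IZR (ordf (logd u) z)) by (apply Rmult_le_pos; apply IZR_le in B1; lra).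
      assert (0 <= theta * IZR (ordf (logd v) z)) by (apply Rmult_le_pos; apply IZR_le in D1; lra).
      destruct (Z.eq_dec p q) as [<-|Npq].
      * assert (W1 := W0 _ B4 D4); apply IZR_le in W1; apply IZR_le in B1; lra.
      * assert (S : (3 <= p + q)%Z) by lia; apply IZR_le in S; rewrite plus_IZR in S; lra.
Qed.
(** By Jensen's formula the orders of f'/f sum to the mean of ln |f'/f| up to a constant, which the
    logarithmic derivative estimate bounds. *)
Lemma Nf_logd Bd T0 f : LF Bd -> Mer Bd f -> Mer Bd (logd f) -> dom Bd T0 f ->
  exists C, 0 <= C /\ forall r, brl Bd T0 r -> Nf Bd r (fun a => IZR (ordf (logd f) a)) <= C * (1 + ln (T0 r)).
Proof.
  intros HL Hm Hl Hd.
  destruct (LD_brl _ _ _ (LD_of_dom _ _ _ HL Hm Hd)) as [C1 [P1 B1]].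
  destruct (jensen Bd _ HL Hl) as [J HJ].
  exists (C1 + Rabs J); assert (PJ := Rabs_pos J); split; [lra|]; intros r Hr.
  specialize (B1 r Hr); specialize (HJ r (proj1 Hr)).
  assert (X := avg_ln_le_mf Bd _ r Hl (proj1 Hr)); unfold mf in X.
  assert (L0 : 0 <= ln (T0 r)) by (apply ln_nonneg, Hr).
  assert (Y := Rle_abs (- J)); rewrite Rabs_Ropp in Y.
  assert (0 <= Rabs J * ln (T0 r)) by (apply Rmult_le_pos; lra); lra.
Qed.
(** If 1/P(u) were a constant a <> 0, then P - 1/a would vanish at the nonconstant u. *)
Lemma DU_nz n m c u : (1 <= m)%nat -> (2 * m < n)%nat -> nc u -> nz (DU n m c u).
Proof.
  intros H1 H2 Hu.
  assert (HU : nz (fun w => Ppoly n m c (u w))) by (apply (comp_nz u n); auto; now apply Ppoly_plike).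
  assert (HI : mero (fun w => / Ppoly n m c (u w))%C) by (intros z; apply mer_inv; now apply nz_mero).
  apply mero_nz; [intros z; now apply mer_Cderive|].
  exists (RtoC 0); intro Z; destruct (df_lz_minus _ _ (HI _) Z) as [a Ha].
  destruct (HU (RtoC 0)) as [p Hp].
  destruct (classic (a = RtoC 0)) as [->|Na].
  - apply (ord_not_lz _ _ _ (ord_inv _ _ _ Hp)); revert Ha; apply pnear_imp; intros w _ E; rewrite <- E; ring.
  - destruct (comp_nz u n _ Hu (Ppoly_plike n m (c - / a) H1 H2) (RtoC 0)) as [q Hq].
    apply (ord_not_lz _ _ _ Hq); generalize (pnear_and _ _ _ Ha (ord_nz _ _ _ Hp)); apply pnear_imp; intros w _ [E N].
    rewrite <- Ppoly_shift; apply Csub_eq in E; rewrite <- E; field; auto.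
Qed.
Lemma Nf_mult_bound Bd r f kp T : LF Bd -> 1 <= r -> nz f -> (1 <= kp)%nat ->
  (forall z p, ord f z (- p) -> (1 <= p)%Z -> (Z.of_nat kp <= p)%Z) -> Nf Bd r (pol f) <= T ->
  Nf Bd r (indp f) <= / INR kp * T.
Proof.
  intros HL Hr Hn Hk H HT; apply le_INR in Hk; simpl in Hk.
  apply (Rmult_le_reg_l (INR kp)); [lra|]; rewrite <- Rmult_assoc, Rinv_r, Rmult_1_l by lra.
  eapply Rle_trans; [|exact HT]; rewrite <- Nf_scal; apply Nf_le; auto; intros; now apply indp_pol_mult.
Qed.
Lemma ind_zer f a : ind f a <= zer f a.
Proof. unfold ind, zer; destruct (Z_lt_dec 0 (ordf f a)); apply IZR_le; lia. Qed.
Lemma Nf_ind_zer Bd r f T : LF Bd -> 1 <= r -> Nf Bd r (zer f) <= T -> Nf Bd r (ind f) <= T.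
Proof. intros HL Hr H; eapply Rle_trans; [|exact H]; apply Nf_le; auto; intros; apply ind_zer. Qed.
Lemma counting_bounds Bd T0 n m c kp u : LF Bd -> (1 <= m)%nat -> (2 * m < n)%nat -> c <> RtoC 0 -> Cmod c <> bcst n m ->
  (1 <= kp)%nat -> nc u -> (forall z p, ord u z (- p) -> (1 <= p)%Z -> (Z.of_nat kp <= p)%Z) ->
  Mer Bd u -> Mer Bd (fun w => Ppoly n m c (u w)) -> Mer Bd (fun w => Rpoly n m c (u w)) -> Mer Bd (Xf n m c u) ->
  Mer Bd (Om m u) -> Mer Bd (logd u) -> dom Bd T0 u ->
  exists C, 0 <= C /\ forall r, brl Bd T0 r ->
    Nf Bd r (fun a => IZR (ordf (Xf n m c u) a)) + INR (n + m) * mf r u <= C * (1 + ln (T0 r)) /\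
    Nf Bd r (fun a => IZR (ordf (logd u) a)) <= C * (1 + ln (T0 r)) /\
    Nf Bd r (zer (fun w => Ppoly n m c (u w))) <= INR n * Tf Bd r u + C /\
    Nf Bd r (indp u) <= / INR kp * Tf Bd r u /\
    Nf Bd r (ind u) <= Tf Bd r u + C /\ Nf Bd r (ind (Om m u)) <= INR m * Tf Bd r u + C.
Proof.
  intros HL H1 H2 Hc Hb Hk Hu Hpole Mu MU MR MX MO ML Hd.
  assert (HP := Ppoly_plike n m c H1 H2); assert (HR := Rpoly_plike n m c H1 H2).
  destruct (smt Bd T0 u _ 0 _ _ _ HL Hu Mu Hd HR plike_const1 (Rpoly_ramif n m c H1 H2 Hc Hb)
    (fun w => D_Rpoly n m c w H1 H2) ltac:(lia) MR MX) as [C1 [P1 B1]].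
  destruct (Nf_logd Bd T0 u HL Mu ML Hd) as [C2 [P2 B2]].
  destruct (zer_comp_bound Bd u n _ HL Hu Mu HP MU) as [C3 [P3 B3]].
  destruct (fmt_inv Bd u HL Mu) as [C4 [P4 B4]].
  destruct (zer_comp_bound Bd u m _ HL Hu Mu (root1_plike m H1) MO) as [C5 [P5 B5]].
  exists (C1 + C2 + C3 + C4 + C5); split; [lra|]; intros r Hr.
  assert (Gr : gr Bd r) by apply Hr; assert (Hr1 := proj1 Gr).
  specialize (B1 r Hr); specialize (B2 r Hr); specialize (B3 r Gr); destruct (B4 r Gr) as [B4' _]; specialize (B5 r Gr).
  assert (L0 : 0 <= ln (T0 r)) by (apply ln_nonneg, Hr).
  replace (n + (1 + m) - 0 - 1)%nat with (n + m)%nat in B1 by lia.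
  split; [|split; [|split; [lra|split; [|split]]]].
  - eapply Rle_trans; [exact B1|apply Rmult_le_compat_r; lra].
  - eapply Rle_trans; [exact B2|apply Rmult_le_compat_r; lra].
  - apply Nf_mult_bound; auto; [apply Mu|now apply Nf_pol_le].
  - apply Nf_ind_zer; auto; lra.
  - apply Nf_ind_zer; auto; change (Om m u) with (fun w => u w ^ m - 1)%C; lra.
Qed.
Lemma dom_DU Bd T0 n m c u : LF Bd -> (1 <= m)%nat -> (2 * m < n)%nat -> nc u -> Mer Bd u ->
  Mer Bd (fun w => Ppoly n m c (u w)) -> Mer Bd (DU n m c u) -> dom Bd T0 u -> dom Bd T0 (DU n m c u).
Proof.
  intros HL H1 H2 Hu Mu MU MD Hd; assert (HP := Ppoly_plike n m c H1 H2).
  destruct (Tf_comp Bd u n _ HL Hu Mu HP MU) as [K [HK B]].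
  apply (dom_deriv Bd T0 (fun w => / Ppoly n m c (u w))%C); auto; [now apply (Mer_inv Bd (fun w => Ppoly n m c (u w)))|].
  apply (dom_inv Bd T0 (fun w => Ppoly n m c (u w))); auto.
  apply (dom_le Bd T0 u _ (INR n) K); auto; [apply pos_INR|]; intros r Gr; apply (B r Gr).
Qed.
Lemma logd_nz f : nz f -> nz (Cderive f) -> nz (logd f).
Proof. intros H1 H2 z; destruct (H1 z) as [p Hp]; destruct (H2 z) as [q Hq]; eexists; eapply ord_div; eauto. Qed.
Lemma nonconstant_quotient_absurd n m c kp j theta u v : (1 <= m)%nat -> (2 * m < n)%nat ->
  c <> RtoC 0 -> Cmod c <> bcst n m -> nc u -> nc v -> (1 <= kp)%nat -> wcase j theta ->
  2 * INR m + (4 + 2 * theta) * (1 + / INR kp) < INR n ->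
  (forall z p, ord u z (- p) -> (1 <= p)%Z -> (Z.of_nat kp <= p)%Z) ->
  (forall z p, ord v z (- p) -> (1 <= p)%Z -> (Z.of_nat kp <= p)%Z) ->
  (forall z p, (1 <= p)%Z -> ord (fun w => Ppoly n m c (u w)) z p ->
     exists p', (1 <= p')%Z /\ ord (fun w => Ppoly n m c (v w)) z p' /\ wshare j p p') ->
  (forall z p, (1 <= p)%Z -> ord (fun w => Ppoly n m c (v w)) z p -> (0 < ordf (fun w => Ppoly n m c (u w)) z)%Z) ->
  nz (Cderive (Wf n m c u v)) -> False.
Proof.
  intros H1 H2 Hc Hb Hu Hv Hk Hw Hnum Pu Pv Hsh1 Hsh2 DW.
  destruct (unb_witness u Hu) as [a Ha].
  assert (HP := Ppoly_plike n m c H1 H2); assert (HR := Rpoly_plike n m c H1 H2); assert (HO := root1_plike m H1).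
  assert (Du := DU_nz n m c u H1 H2 Hu); assert (Dv := DU_nz n m c v H1 H2 Hv).
  assert (NW : nz (Wf n m c u v)).
  { intros x; destruct (Du x) as [p Hp]; destruct (Dv x) as [q Hq]; eexists; eapply ord_div; eauto. }
  set (fam := fun w : C -> C => [w; (fun z => Ppoly n m c (w z)); (fun z => Rpoly n m c (w z)); Xf n m c w; Om m w; logd w; DU n m c w]).
  assert (Hfam : forall w, nc w -> forall f, In f (fam w) -> nz f).
  { intros w Hw' f [<-|[<-|[<-|[<-|[<-|[<-|[<-|[]]]]]]]].
    - now apply nc_nz.
    - now apply (comp_nz w n).
    - eapply comp_nz; eauto.
    - apply (X_nz w _ 0 _ _ Hw' HR plike_const1).
    - now apply (comp_nz w m _ Hw' HO).
    - apply logd_nz; [now apply nc_nz|now apply nc_deriv_nz].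
    - now apply DU_nz. }
  set (l := (fun w => u w - a)%C :: Wf n m c u v :: logd (Wf n m c u v) :: fam u ++ fam v).
  assert (Hl : forall f, In f l -> nz f).
  { intros f [<-|[<-|[<-|Hf]]]; [apply Hu|auto|now apply logd_nz|].
    apply in_app_or in Hf; destruct Hf; [now apply (Hfam u)|now apply (Hfam v)]. }
  set (Bd := bads l); assert (HL : LF Bd) by now apply bads_LF.
  assert (HM : forall f, In f l -> Mer Bd f) by (intros; now apply bads_Mer).
  assert (HMu : forall f, In f (fam u) -> Mer Bd f) by (intros f Hf; apply HM; do 3 right; apply in_or_app; auto).
  assert (HMv : forall f, In f (fam v) -> Mer Bd f) by (intros f Hf; apply HM; do 3 right; apply in_or_app; auto).
  assert (Mu : Mer Bd u) by (apply HMu; simpl; auto).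
  assert (Mv : Mer Bd v) by (apply HMv; simpl; auto).
  assert (MU : Mer Bd (fun w => Ppoly n m c (u w))) by (apply HMu; simpl; auto).
  assert (MV : Mer Bd (fun w => Ppoly n m c (v w))) by (apply HMv; simpl; auto).
  assert (MDu : Mer Bd (DU n m c u)) by (apply HMu; simpl; auto 9).
  assert (MDv : Mer Bd (DU n m c v)) by (apply HMv; simpl; auto 9).
  (* One comparison function for both, so that the same radii serve u and v. *)
  set (T0 := fun r => Tf Bd r u + Tf Bd r v).
  assert (Hdu : dom Bd T0 u).
  { apply (dom_base Bd T0 u 1 0); try lra; intros r Gr; unfold T0.
    assert (X := Tf_nonneg Bd r v Mv Gr); lra. }
  assert (Hdv : dom Bd T0 v).
  { apply (dom_base Bd T0 v 1 0); try lra; intros r Gr; unfold T0.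
    assert (X := Tf_nonneg Bd r u Mu Gr); lra. }
  assert (HdW : dom Bd T0 (Wf n m c u v)).
  { apply (dom_mult Bd T0 (DU n m c u) (fun w => / DU n m c v w)%C); auto; [now apply Mer_inv|now apply dom_DU|].
    apply dom_inv; auto; now apply dom_DU. }
  destruct (counting_bounds Bd T0 n m c kp u) as [Cu [PCu Bu]]; auto; try (apply HMu; simpl; auto 9).
  destruct (counting_bounds Bd T0 n m c kp v) as [Cv [PCv Bv]]; auto; try (apply HMv; simpl; auto 9).
  destruct (Nf_logd Bd T0 (Wf n m c u v)) as [CH [PCH BH]]; auto; try (apply HM; simpl; auto).
  assert (Th : 0 <= theta <= 3 / 2) by (destruct Hw as [[_ ->]|[[_ ->]|[_ ->]]]; lra).
  (* What is left of n + m after the zeros of U and V take n/2, the m-th roots of unity 2m, and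
     zeros and poles of u and v (2 + theta)(1 + 1/kp). The error constant is a generous total. *)
  apply (growth_absurd Bd T0 (INR n / 2 - INR m - (2 + theta) * (1 + / INR kp)) (20 * (Cu + Cv) + CH)).
  - apply borel.
    + intros X; destruct (Tf_locbdd Bd u HL Mu X) as [M1 B1]; destruct (Tf_locbdd Bd v HL Mv X) as [M2 B2].
      exists (M1 + M2); intros r Gr Hr; specialize (B1 r Gr Hr); specialize (B2 r Gr Hr); unfold T0; lra.
    + intros M; destruct (Tf_unbdd Bd u a HL Hu Mu ltac:(apply HM; simpl; auto) Ha M) as [r [Gr Hr]].
      exists r; split; auto; assert (X := Tf_nonneg Bd r v Mv Gr); unfold T0; lra.
  - lra.
  - intros r Hr; destruct (Bu r Hr) as [U1 [U2 [U3 [U4 [U5 U6]]]]]; destruct (Bv r Hr) as [V1 [V2 [V3 [V4 [V5 V6]]]]].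
    specialize (BH r Hr).
    assert (Gr : gr Bd r) by apply Hr; assert (Hr1 := proj1 Gr).
    assert (L0 : 0 <= ln (T0 r)) by (apply ln_nonneg, Hr).
    assert (INE : INR (n + m) * Nf Bd r (pol u) + INR (n + m) * Nf Bd r (pol v) <=
      (Nf Bd r (fun a => IZR (ordf (Xf n m c u) a)) + Nf Bd r (fun a => IZR (ordf (Xf n m c v) a))) +
      (Nf Bd r (fun a => IZR (ordf (logd (Wf n m c u v)) a)) +
       theta * (Nf Bd r (fun a => IZR (ordf (logd u) a)) + Nf Bd r (fun a => IZR (ordf (logd v) a)))) +
      (/ 2 * (Nf Bd r (zer (fun w => Ppoly n m c (u w))) + Nf Bd r (zer (fun w => Ppoly n m c (v w)))) +
       ((2 + theta) * ((Nf Bd r (indp u) + Nf Bd r (ind u)) + (Nf Bd r (indp v) + Nf Bd r (ind v))) +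
        2 * (Nf Bd r (ind (Om m u)) + Nf Bd r (ind (Om m v)))))).
    { repeat (rewrite <- Nf_plus || rewrite <- Nf_scal); apply Nf_le; auto; intros z.
      assert (X := local_inequality n m c u v z j theta H1 H2 Hc Hb Hu Hv Hw (Hsh1 z) (Hsh2 z) Du Dv DW).
      exact X. }
    assert (EI : INR (n + m) = INR n + INR m) by apply plus_INR.
    rewrite EI in *; set (L := 1 + ln (T0 r)) in *; set (k := / INR kp) in *.
    unfold T0; set (Tu := Tf Bd r u) in *; set (Tv := Tf Bd r v) in *.
    assert (ETu : Tu = mf r u + Nf Bd r (pol u)) by reflexivity.
    assert (ETv : Tv = mf r v + Nf Bd r (pol v)) by reflexivity.
    assert (E1 : theta * (Nf Bd r (fun a => IZR (ordf (logd u) a)) + Nf Bd r (fun a => IZR (ordf (logd v) a))) <=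
      3 / 2 * ((Cu + Cv) * L)).
    { apply Rle_trans with (theta * ((Cu + Cv) * L)); [apply Rmult_le_compat_l; lra|].
      apply Rmult_le_compat_r; [|lra]; apply Rmult_le_pos; unfold L; lra. }
    assert (E2 : (2 + theta) * ((Nf Bd r (indp u) + Nf Bd r (ind u)) + (Nf Bd r (indp v) + Nf Bd r (ind v))) <=
      (2 + theta) * ((1 + k) * (Tu + Tv)) + 7 / 2 * (Cu + Cv)).
    { apply Rle_trans with ((2 + theta) * ((1 + k) * (Tu + Tv) + (Cu + Cv))); [apply Rmult_le_compat_l; lra|].
      rewrite Rmult_plus_distr_l; apply Rplus_le_compat_l, Rmult_le_compat_r; lra. }
    assert (E3 : Cu + Cv <= (Cu + Cv) * L) by (assert (0 <= (Cu + Cv) * ln (T0 r)) by (apply Rmult_le_pos; lra); unfold L; lra).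
    replace ((INR n / 2 - INR m - (2 + theta) * (1 + k)) * (Tu + Tv)) with
      ((INR n + INR m) * (Tu + Tv) - / 2 * (INR n * Tu + INR n * Tv) - 2 * (INR m * Tu + INR m * Tv) - (2 + theta) * ((1 + k) * (Tu + Tv))) by field.
    assert (E4 : (INR n + INR m) * (Tu + Tv) = ((INR n + INR m) * mf r u + (INR n + INR m) * mf r v) +
      ((INR n + INR m) * Nf Bd r (pol u) + (INR n + INR m) * Nf Bd r (pol v))) by (rewrite ETu, ETv; ring).
    rewrite E4; lra.
Qed.
(** W = A gives (1/U)' = A (1/V)', hence 1/U = A/V + B near 0 and then near every point by the
    identity theorem. The conclusion is this relation cleared of denominators. *)
Lemma constant_quotient_relation n m c u v : (1 <= m)%nat -> (2 * m < n)%nat -> nc u -> nc v ->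
  ~ nz (Cderive (Wf n m c u v)) -> exists A B, A <> RtoC 0 /\
  forall z, pnear z (fun w => Ppoly n m c (v w) = Ppoly n m c (u w) * (A + B * Ppoly n m c (v w)))%C.
Proof.
  intros H1 H2 Hu Hv DW; assert (HP := Ppoly_plike n m c H1 H2).
  assert (Du := DU_nz n m c u H1 H2 Hu); assert (Dv := DU_nz n m c v H1 H2 Hv).
  assert (HU := comp_nz u n _ Hu HP); assert (HV := comp_nz v n _ Hv HP).
  assert (NW : nz (Wf n m c u v)).
  { intros x; destruct (Du x) as [p Hp]; destruct (Dv x) as [q Hq]; eexists; eapply ord_div; eauto. }
  assert (MW := nz_mero _ NW).
  assert (Z : lz (Cderive (Wf n m c u v)) (RtoC 0)).
  { apply NNPP; intro N; apply DW, mero_nz; [intros z; now apply mer_Cderive|eauto]. }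
  destruct (df_lz_minus _ _ (MW _) Z) as [A HA].
  set (f := fun w => (/ Ppoly n m c (u w))%C) in *; set (g := fun w => (/ Ppoly n m c (v w))%C).
  assert (Mf : mero f) by (intros z; apply mer_inv; now apply nz_mero).
  assert (Mg : mero g) by (intros z; apply mer_inv; now apply nz_mero).
  assert (E0 : lz (Cderive (fun w => f w - A * g w)%C) (RtoC 0)).
  { destruct (Dv (RtoC 0)) as [q Hq].
    generalize (pnear_and _ _ _ (pnear_and _ _ _ HA (ord_nz _ _ _ Hq)) (pnear_and _ _ _ (mer_df f _ (Mf (RtoC 0))) (mer_df g _ (Mg (RtoC 0))))).
    apply pnear_imp; intros w _ [[E N] [F1 F2]]; apply Cderive_D.
    eapply D_eq; [apply D_minus; [now apply holo_D|apply D_scal; now apply holo_D]|].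
    apply Csub_eq in E; rewrite <- E; unfold Wf.
    change (Cderive f w) with (DU n m c u w); change (Cderive g w) with (DU n m c v w); field; auto. }
  destruct (df_lz_minus (fun w => f w - A * g w)%C (RtoC 0)) as [B HB]; auto.
  { apply mer_minus; [apply Mf|apply mer_scal, Mg]. }
  exists A, B; split.
  - intros ->; destruct (NW (RtoC 0)) as [p Hp]; apply (ord_not_lz _ _ _ Hp).
    revert HA; apply pnear_imp; intros w _ E; rewrite <- E; ring.
  - intros z; assert (HBz : lz (fun w => f w - A * g w - B)%C z).
    { apply (ident _ (RtoC 0)); auto; intros x; apply mer_minus; [apply mer_minus; [apply Mf|apply mer_scal, Mg]|apply mer_const]. }
    destruct (HU z) as [p Hp]; destruct (HV z) as [q Hq].
    generalize (pnear_and _ _ _ HBz (pnear_and _ _ _ (ord_nz _ _ _ Hp) (ord_nz _ _ _ Hq))); apply pnear_imp.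
    intros w _ [E [N1 N2]]; apply Csub_eq in E; rewrite <- E; unfold f, g; field; auto.
Qed.
Lemma shared_roots_equal n m c kp j theta u v : (1 <= m)%nat -> (4 * m < n)%nat -> Nat.gcd m n = 1%nat ->
  c <> RtoC 0 -> Cmod c <> bcst n m -> nc u -> nc v -> (1 <= kp)%nat -> wcase j theta ->
  2 * INR m + (4 + 2 * theta) * (1 + / INR kp) < INR n ->
  (forall z p, ord u z (- p) -> (1 <= p)%Z -> (Z.of_nat kp <= p)%Z) ->
  (forall z p, ord v z (- p) -> (1 <= p)%Z -> (Z.of_nat kp <= p)%Z) ->
  (forall z p, (1 <= p)%Z -> ord (fun w => Ppoly n m c (u w)) z p ->
     exists p', (1 <= p')%Z /\ ord (fun w => Ppoly n m c (v w)) z p' /\ wshare j p p') ->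
  (forall z p, (1 <= p)%Z -> ord (fun w => Ppoly n m c (v w)) z p -> (0 < ordf (fun w => Ppoly n m c (u w)) z)%Z) ->
  forall z, lz (fun w => u w - v w)%C z.
Proof.
  intros H1 H4 Hg Hc Hb Hu Hv Hk Hw Hnum Pu Pv Hsh1 Hsh2.
  assert (H2 : (2 * m < n)%nat) by lia.
  assert (Rk := le_INR _ _ Hk); simpl in Rk.
  assert (P3 : 0 < / INR kp) by (apply Rinv_0_lt_compat; lra).
  assert (Th : 0 <= theta <= 3 / 2) by (destruct Hw as [[_ ->]|[[_ ->]|[_ ->]]]; lra).
  assert (Hn : 2 * INR m + 4 + 4 * / INR kp < INR n) by nra.
  assert (H3 : (2 * m + 4 < n)%nat).
  { apply INR_lt; rewrite plus_INR, mult_INR; simpl; lra. }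
  destruct (classic (nz (Cderive (Wf n m c u v)))) as [N|N].
  - exfalso; now apply (nonconstant_quotient_absurd n m c kp j theta u v).
  - destruct (constant_quotient_relation n m c u v H1 H2 Hu Hv N) as [A [B [HA Hrel]]].
    apply (relation_equal n m c kp u v A B); auto.
    assert (X : 4 * / INR kp * INR kp = 4) by (field; lra).
    assert (4 * / INR kp * INR kp < (INR n - 2 * INR m - 4) * INR kp) by (apply Rmult_lt_compat_r; lra); lra.
Qed.

(** * Derivatives of meromorphic functions and shared sets *)

Definition poles_ge (k : nat) (u : C -> C) : Prop :=
  forall z, holo_at u z \/ exists p, (Z.of_nat k <= p)%Z /\ ord u z (- p).
Lemma meromorphic_poles f : meromorphic f -> poles_ge 1 f.
Proof.
  intros [E [Hiso [Hd Hp]]] z; destruct (Hiso z) as [e [He K]].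
  assert (PD : pnear z (df f)).
  { exists e; split; auto; intros w Hw Hwe; destruct (Hd w) as [l Hl]; [intros X; now apply Hw, K|].
    exists l; now apply Cis_deriv_D. }
  destruct (classic (E z)) as [Ez|Nz].
  - right; destruct (pole_ord f z PD) as [p [P1 P2]]; [|exists p; auto].
    intros M; destruct (Hp z Ez M) as [d [Hd1 Hd2]]; exists d; auto.
  - left; apply holo_df, near_of_pnear; auto.
    destruct (Hd z Nz) as [l Hl]; exists l; now apply Cis_deriv_D.
Qed.
(** Each differentiation raises the order of a pole by one, starting from at least 1. *)
Lemma Cderive_n_poles k f : meromorphic f -> poles_ge (S k) (Cderive_n k f).
Proof.
  intros Hf; induction k as [|k IH]; [now apply meromorphic_poles|]; intros z.
  change (Cderive_n (S k) f) with (Cderive (Cderive_n k f)).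
  destruct (IH z) as [H|[p [P1 P2]]]; [left; now apply holo_Cderive|].
  right; exists (p + 1)%Z; split; [lia|]; replace (- (p + 1))%Z with (- p - 1)%Z by lia; apply ord_deriv; auto; lia.
Qed.
Lemma poles_ge_nc k u : poles_ge (S k) u -> nonconstant u -> nc u.
Proof.
  intros Hp Hn; apply nc_intro.
  - intros z; destruct (Hp z) as [H|[p [_ H]]]; [now apply holo_mer|eapply ord_mer; eauto].
  - intros a Ha; apply Hn; exists a; intros z Hz.
    apply Csub_eq, (ccont_pnear0 (fun w => u w - a)%C); [|apply Ha].
    apply holo_cont, holo_minus; [auto|apply holo_const].
Qed.
Lemma poles_ge_ord k u z p : poles_ge k u -> ord u z (- p) -> (1 <= p)%Z -> (Z.of_nat k <= p)%Z.
Proof.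
  intros H O Hp; destruct (H z) as [Hz|[q [Q1 Q2]]].
  - assert (X := holo_ord_nonneg _ _ _ Hz O); lia.
  - assert (X := ord_unique _ _ _ _ O Q2); lia.
Qed.
Lemma a_point_ord u a z p : a_point_mult u a z p <->
  (1 <= p)%nat /\ holo_at u z /\ ord (fun w => u w - a)%C z (Z.of_nat p).
Proof.
  split.
  - intros [Hp [Hu [_ [g [G1 [G2 [e [He K]]]]]]]]; split; [|split]; auto.
    exists g; split; [|split]; auto; exists e; split; auto; intros w _ Hw; rewrite zp_nat; auto.
  - intros [Hp [Hu [g [G1 [G2 G3]]]]].
    assert (E : pnear z (fun w => (u w - a)%C = ((w - z) ^ p * g w)%C)) by (revert G3; apply pnear_imp; intros w _ ->; now rewrite zp_nat).
    assert (Ez : (u z - a)%C = ((z - z) ^ p * g z)%C).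
    { apply (holo_pnear_eq (fun w => u w - a)%C (fun w => (w - z) ^ p * g w)%C); auto.
      - apply holo_minus; [auto|apply holo_const].
      - apply holo_mult; [apply holo_pow, holo_sub_id|auto]. }
    split; [|split; [|split]]; auto.
    + apply Csub_eq; rewrite Ez; replace p with (S (pred p)) by lia; rewrite Cpow_S; ring.
    + exists g; split; [|split]; auto; apply near_of_pnear; auto.
Qed.
(** The roots of P are simple, so the multiplicity with which u takes a value in S is the order of
    P(u). Set sharing thus becomes a statement about orders. *)
Lemma E_pt_ord n m c u l z q : (1 <= m)%nat -> (2 * m < n)%nat -> c <> RtoC 0 -> Cmod c <> bcst n m ->
  nc u -> poles_ge 1 u ->
  (E_pt u (fun w => Ppoly n m c w = RtoC 0) l z q <->
   exists p, (1 <= p)%nat /\ ord (fun w => Ppoly n m c (u w)) z (Z.of_nat p) /\ q = weight_count l p).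
Proof.
  intros H1 H2 Hc Hb Hu Hp; assert (HP := Ppoly_plike n m c H1 H2); split.
  - intros [a [p [Ha [Hap Hq]]]]; assert (Hz : u z = a) by apply Hap.
    apply a_point_ord in Hap; destruct Hap as [Hp1 [Hz1 O]]; exists p; split; [|split]; auto.
    assert (Hf := holo_fin u z Hz1); rewrite Hz in Hf.
    assert (X := comp_fin_ord _ _ _ _ _ _ Hf O (Ppoly_ord1 n m c a H1 H2 Hc Hb Ha)).
    now rewrite Z.mul_1_l in X.
  - intros [p [Hp1 [O Hq]]]; destruct (nc_cases u z Hu) as [[t [T1 T2]]|[a [t [A1 [A2 A3]]]]].
    { assert (X := ord_unique _ _ _ _ O (comp_pole_ord u z t n _ T2 T1 HP)); nia. }
    destruct (plike_ord n _ a HP) as [s [Os [_ Os0]]].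
    assert (X := ord_unique _ _ _ _ O (comp_fin_ord _ _ _ _ _ _ A1 A3 Os)).
    assert (Pa : Ppoly n m c a = RtoC 0) by (apply NNPP; intro N; specialize (Os0 N); subst s; lia).
    assert (Y := ord_unique _ _ _ _ Os (Ppoly_ord1 n m c a H1 H2 Hc Hb Pa)).
    rewrite Y, Z.mul_1_l in X; subst t.
    exists a, p; split; [|split]; auto; apply a_point_ord; split; [|split]; auto.
    destruct (Hp z) as [Hz|[t [T1 T2]]]; auto; exfalso.
    assert (Z := fin_ord_nonneg _ _ _ _ A1 T2); lia.
Qed.
(** Equal truncations at l + 1 force equal multiplicities or both at least l + 1; infinite weight
    gives equality. *)
Lemma weight_wshare l p p' j : (weight_ge l 2 /\ j = 3%Z \/ l = Some 1%nat /\ j = 2%Z \/ l = Some 0%nat /\ j = 1%Z) ->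
  (1 <= p)%nat -> (1 <= p')%nat -> weight_count l p = weight_count l p' -> wshare j (Z.of_nat p) (Z.of_nat p').
Proof.
  intros H Hp Hp' E; unfold wshare; destruct H as [[H ->]|[[-> ->]|[-> ->]]].
  - destruct l as [l|]; simpl in *; lia.
  - unfold weight_count in E; lia.
  - unfold weight_count in E; lia.
Qed.

Theorem theorem2p1 (n m k : nat) (l : option nat) (c : C) (f g : C -> C) :
  (1 <= n)%nat -> (1 <= m)%nat -> Nat.gcd m n = 1%nat ->
  Cmod c <> 2 * INR m ^ 2 / ((INR n - INR m) * (INR n - 2 * INR m)) ->
  c <> RtoC 0 ->
  c <> RtoC (- / 2 * (1 - 2 * INR n / (INR n - INR m) + INR n / (INR n - 2 * INR m))) ->
  meromorphic f -> meromorphic g -> nonconstant f -> nonconstant g ->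
  nonconstant (Cderive_n k f) -> nonconstant (Cderive_n k g) ->
  share_set (Cderive_n k f) (Cderive_n k g) (fun z => Ppoly n m c z = RtoC 0) l ->
  (weight_ge l 2 /\
     INR n > Rmax (2 * INR m + 4 + 4 / (INR k + 1)) (4 * INR m + 1)
   \/ l = Some 1%nat /\
     INR n > Rmax (2 * INR m + 9 / 2 + (9 / 2) / (INR k + 1)) (4 * INR m + 1)
   \/ l = Some 0%nat /\
     INR n > Rmax (2 * INR m + 7 + 7 / (INR k + 1)) (4 * INR m + 1)) ->
  forall z : C, holo_at (Cderive_n k f) z -> holo_at (Cderive_n k g) z ->
    Cderive_n k f z = Cderive_n k g z.
Proof.
  intros _ Hm Hg Hb Hc _ Mf Mg _ _ Nf Ng Hsh Hl.
  assert (Pf := Cderive_n_poles k f Mf); assert (Pg := Cderive_n_poles k g Mg).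
  set (u := Cderive_n k f) in *; set (v := Cderive_n k g) in *.
  assert (Hu := poles_ge_nc k u Pf Nf); assert (Hv := poles_ge_nc k v Pg Ng).
  assert (P1 : forall w, poles_ge (S k) w -> poles_ge 1 w).
  { intros w H z; destruct (H z) as [X|[p [X Y]]]; [auto|right; exists p; split; auto; lia]. }
  assert (Rk := pos_INR k).
  (* The coefficient 4 + 2 theta is 4, 9/2 and 7 in the three cases, matching the bounds on n. *)
  assert (HK : exists j theta, (weight_ge l 2 /\ j = 3%Z \/ l = Some 1%nat /\ j = 2%Z \/ l = Some 0%nat /\ j = 1%Z) /\
    wcase j theta /\ 2 * INR m + (4 + 2 * theta) * (1 + / INR (S k)) < INR n /\ 4 * INR m + 1 < INR n).
  { rewrite S_INR; unfold wcase, Rdiv in *.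
    destruct Hl as [[L H]|[[L H]|[L H]]]; apply Rgt_lt, Rmax_Rlt in H; destruct H as [H4 H5];
      [exists 3%Z, 0|exists 2%Z, (/ 4)|exists 1%Z, (3 * / 2)]; repeat split; auto; lra. }
  destruct HK as [j [theta [Hj [Hw [Hn H4]]]]].
  assert (H4n : (4 * m < n)%nat) by (apply INR_lt; rewrite mult_INR; simpl; lra).
  assert (H2n : (2 * m < n)%nat) by lia.
  rewrite <- (proj1 (bcst_val n m Hm H2n)) in Hb.
  assert (Hshare : forall z p, (1 <= p)%Z -> ord (fun w => Ppoly n m c (u w)) z p ->
     exists p', (1 <= p')%Z /\ ord (fun w => Ppoly n m c (v w)) z p' /\ wshare j p p').
  { intros z p Hp O; rewrite <- (Z2Nat.id p) in O by lia.
    destruct (proj1 (E_pt_ord n m c v l z _ Hm H2n Hc Hb Hv (P1 _ Pg)) (proj1 (Hsh z (weight_count l (Z.to_nat p)))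
      (proj2 (E_pt_ord n m c u l z _ Hm H2n Hc Hb Hu (P1 _ Pf)) (ex_intro _ (Z.to_nat p) (conj (proj1 (Z2Nat.inj_le 1 p ltac:(lia) ltac:(lia)) Hp) (conj O eq_refl))))))
      as [p' [Q1 [Q2 Q3]]].
    exists (Z.of_nat p'); repeat split; auto; [lia|].
    rewrite <- (Z2Nat.id p) by lia; apply (weight_wshare l); auto; lia. }
  (* Equality is obtained off [z] only; continuity at a common point of holomorphy extends it to
     [z]. *)
  intros z Fz Gz; apply holo_pnear_eq; auto.
  assert (X : lz (fun w => u w - v w)%C z).
  { apply (shared_roots_equal n m c (S k) j theta u v); auto; try lia.
    - intros x p; now apply poles_ge_ord.
    - intros x p; now apply poles_ge_ord.
    - intros x p Hp O; rewrite <- (Z2Nat.id p) in O by lia.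
      destruct (proj1 (E_pt_ord n m c u l x _ Hm H2n Hc Hb Hu (P1 _ Pf)) (proj2 (Hsh x (weight_count l (Z.to_nat p)))
        (proj2 (E_pt_ord n m c v l x _ Hm H2n Hc Hb Hv (P1 _ Pg)) (ex_intro _ (Z.to_nat p) (conj (proj1 (Z2Nat.inj_le 1 p ltac:(lia) ltac:(lia)) Hp) (conj O eq_refl))))))
        as [p' [Q1 [Q2 Q3]]].
      rewrite (ordf_eq _ _ _ Q2); lia. }
  revert X; apply pnear_imp; intros w _; apply Csub_eq.
Qed.
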